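(* Let $\Gamma$ be a finite index subgroup of $\mathrm{SL}_2(\mathbb{Z})$ with $-I\in\Gamma$, let $k$ be a sufficiently large real number, and let $\nu$ be an automorphy factor of weight $k$ on $\Gamma$. Suppose $[\mathrm{SL}_2(\mathbb{Z}):\Gamma]\le C k^{1-\delta}$ for some constants $\delta>0$, $C>0$. Then for any orthonormal basis $\{f_j\}$ of $S(\Gamma,k,\nu)$ (with respect to $\langle\cdot,\cdot\rangle_\Gamma$), $$\sup_{z\in\mathbb{H}}\sum_j y^k|f_j(z)|^2\asymp\frac{[\mathrm{SL}_2(\mathbb{Z}):\Gamma]\,k^{3/2}}{\min_{\tau\in\mathrm{SL}_2(\mathbb{Z})}\eta_\tau},$$ where $z=x+iy$ and the implied constants depend at most on $\delta$ and $C$.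
   Context: For $w\in\mathbb{C}$ and $k\in\mathbb{R}$, $w^k:=\exp(k\log w)$ with principal branch $-\pi<\arg w\le\pi$. $\mathrm{SL}_2(\mathbb{Z})$ acts on $\mathbb{H}$ by Möbius transformations, $j(\gamma,z)=cz+d$. $\mu(\Gamma)=[\mathrm{SL}_2(\mathbb{Z}):\Gamma]$, $\hat\Gamma=\Gamma/\{\pm I\}$. An automorphy factor of weight $k$ on $\Gamma$ is $\nu:\Gamma\times\mathbb{H}\to\mathbb{C}$ with $\nu(\gamma,\cdot)$ holomorphic, $|\nu(\gamma,z)|=|j(\gamma,z)|^k$, $\nu(\tau\gamma,z)=\nu(\tau,\gamma z)\nu(\gamma,z)$, $\nu(-\gamma,z)=\nu(\gamma,z)$. For $\tau\in\mathrm{SL}_2(\mathbb{Z})$, $\nu^\tau$ on $\Gamma^\tau=\tau^{-1}\Gamma\tau$ is $\nu^\tau(\tau^{-1}\gamma\tau,z)=\nu(\gamma,\tau z)j(\tau,z)^k/j(\tau,\tau^{-1}\gamma\tau z)^k$. With $U=\begin{pmatrix}1&1\\0&1\end{pmatrix}$, the width $n_\tau$ of the cusp $\tau\infty$ is the least positive integer $n$ such that the stabilizer of $\tau\infty$ in $\hat\Gamma$ is generated by the image of $\tau U^n\tau^{-1}$; the cusp parameter $\kappa_\tau\in[0,1)$ satisfies $e^{2\pi i\kappa_\tau}=\nu^\tau(U^{n_\tau},z)$. $\eta_\tau=\kappa_\tau$ if $\kappa_\tau\ne0$ and $\eta_\tau=1$ if $\kappa_\tau=0$. $(f|_k\gamma)(z)=j(\gamma,z)^{-k}f(\gamma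 z)$. $S(\Gamma,k,\nu)$ is the (finite-dimensional) space of holomorphic $f$ on $\mathbb{H}$ with $f(\gamma z)=\nu(\gamma,z)f(z)$ for $\gamma\in\Gamma$ and with expansions $(f|_k\tau)(z)=\sum_{m\in\mathbb{Z},\,m+\kappa_\tau>0}\widehat{(f|_k\tau)}(m)e^{2\pi i(m+\kappa_\tau)z/n_\tau}$ for every $\tau\in\mathrm{SL}_2(\mathbb{Z})$. $\langle f,g\rangle_\Gamma=\mu(\Gamma)^{-1}\int_{\mathcal{F}_\Gamma}f\bar g\,y^k\frac{dx\,dy}{y^2}$. *)

(* Defs.v *)
From HB Require Import structures.
From mathcomp Require Import all_boot all_order all_algebra.
From mathcomp Require Import all_classical all_reals all_analysis.
From mathcomp Require Import finmap complex.

Set Implicit Arguments.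
Unset Strict Implicit.
Unset Printing Implicit Defensive.

Import Order.TTheory GRing.Theory Num.Theory.
Import numFieldNormedType.Exports.

Local Open Scope classical_set_scope.
Local Open Scope ring_scope.
Local Open Scope complex_scope.

Definition SL2Z : set 'M[int]_2 := [set g | \det g = 1].

Definition is_subgroup (G : set 'M[int]_2) : Prop :=
  [/\ G `<=` SL2Z, G 1,
      forall g h, G g -> G h -> G (g * h) &
      forall g, G g -> G g^-1].

Definition left_cosets (G : set 'M[int]_2) : set (set 'M[int]_2) :=
  (fun t => [set t * g | g in G]) @` SL2Z.

Definition finite_index (G : set 'M[int]_2) : Prop :=
  finite_set (left_cosets G).

(* [SL2Z : G], meaningful when G has finite index *)
Definition SL2Z_index (G : set 'M[int]_2) : nat :=
  (#|` fset_set (left_cosets G)|)%fset.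

Definition Umx : 'M[int]_2 := 1 + delta_mx 0 1.

(* t oo = t' oo iff t^-1 t' fixes oo, and a matrix of SL2Z fixes oo iff its
   lower left entry vanishes. *)
Definition fixes_cusp (t g : 'M[int]_2) : Prop := (t^-1 * g * t) 1 0 = 0.

(* The stabilizer of t oo in G / {+-1} is generated by the image of
   t U^n t^-1, stated upstairs for G containing -1. *)
Definition cusp_stab_generated (G : set 'M[int]_2) (t : 'M[int]_2) (n : nat) :=
  forall g, (G g /\ fixes_cusp t g) <->
    exists m : int, g = (t * Umx ^+ n * t^-1) ^ m \/
                    g = - (t * Umx ^+ n * t^-1) ^ m.

Definition is_cusp_width (G : set 'M[int]_2) (t : 'M[int]_2) (n : nat) :=
  [/\ (0 < n)%N, cusp_stab_generated G t n &
      forall m, (0 < m)%N -> cusp_stab_generated G t m -> (n <= m)%N].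

Definition cusp_width (G : set 'M[int]_2) (t : 'M[int]_2) : nat :=
  xget 0%N [set n | is_cusp_width G t n].

Section Analysis.
Variable R : realType.
Local Notation C := R[i].

Definition upper_half : set C := [set z | 0 < complex.Im z].

Definition cabs (z : C) : R := ComplexField.Normc.normc z.

Definition cexp (z : C) : C :=
  (expR (complex.Re z) * cos (complex.Im z)) +i*
  (expR (complex.Re z) * sin (complex.Im z)).

(* principal argument, in ]-pi, pi] for z != 0 *)
Definition carg (z : C) : R :=
  if 0 <= complex.Im z then acos (complex.Re z / cabs z)
  else - acos (complex.Re z / cabs z).

Definition clog (z : C) : C := ln (cabs z) +i* carg z.

Definition cpow (w : C) (k : R) : C := cexp (k%:C * clog w).

Definition jfac (g : 'M[int]_2) (z : C) : C := (g 1 0)%:~R * z + (g 1 1)%:~R.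

Definition mobius (g : 'M[int]_2) (z : C) : C :=
  ((g 0 0)%:~R * z + (g 0 1)%:~R) / jfac g z.

(* Complex differentiability: C^o is C as a normed module over itself. *)
Definition holomorphic_on_H (f : C -> C) : Prop :=
  forall z, upper_half z -> derivable (f : C^o -> C^o) z 1.

(* Only the values nu g z with g in G and z in the upper half-plane matter. *)
Definition automorphy_factor (G : set 'M[int]_2) (k : R)
    (nu : 'M[int]_2 -> C -> C) : Prop :=
  [/\ forall g, G g -> holomorphic_on_H (nu g),
      forall g z, G g -> upper_half z -> cabs (nu g z) = cabs (jfac g z) `^ k,
      forall t g z, G t -> G g -> upper_half z ->
        nu (t * g) z = nu t (mobius g z) * nu g z &
      forall g z, G g -> upper_half z -> nu (- g) z = nu g z].

(* nu^t, an automorphy factor on t^-1 G t *)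
Definition conj_factor (k : R) (nu : 'M[int]_2 -> C -> C) (t h : 'M[int]_2)
    (z : C) : C :=
  nu (t * h * t^-1) (mobius t z) * cpow (jfac t z) k
    / cpow (jfac t (mobius h z)) k.

Definition is_cusp_param (G : set 'M[int]_2) (k : R)
    (nu : 'M[int]_2 -> C -> C) (t : 'M[int]_2) (kappa : R) : Prop :=
  0 <= kappa < 1 /\
  forall z, upper_half z ->
    cexp (0 +i* (2 * pi * kappa)) =
    conj_factor k nu t (Umx ^+ cusp_width G t) z.

Definition cusp_param (G : set 'M[int]_2) (k : R)
    (nu : 'M[int]_2 -> C -> C) (t : 'M[int]_2) : R :=
  xget 0 [set kappa | is_cusp_param G k nu t kappa].

Definition eta_cusp (G : set 'M[int]_2) (k : R)
    (nu : 'M[int]_2 -> C -> C) (t : 'M[int]_2) : R :=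
  if cusp_param G k nu t == 0 then 1 else cusp_param G k nu t.

Definition slash (k : R) (f : C -> C) (g : 'M[int]_2) (z : C) : C :=
  cpow (jfac g z) (- k) * f (mobius g z).

Definition cusp_term (G : set 'M[int]_2) (k : R) (nu : 'M[int]_2 -> C -> C)
    (t : 'M[int]_2) (a : nat -> C) (z : C) (m : nat) : C :=
  let kappa := cusp_param G k nu t in
  if 0 < m%:R + kappa
  then a m * cexp ((0 +i* (2 * pi * (m%:R + kappa) / (cusp_width G t)%:R)) * z)
  else 0.

(* Since 0 <= kappa < 1, the integers m with m + kappa > 0 are natural
   numbers, so the expansion is a series over nat. *)
Definition cusp_form (G : set 'M[int]_2) (k : R) (nu : 'M[int]_2 -> C -> C)
    (f : C -> C) : Prop :=
  [/\ holomorphic_on_H f,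
      forall g z, G g -> upper_half z -> f (mobius g z) = nu g z * f z &
      forall t, SL2Z t -> exists a : nat -> C, forall z, upper_half z ->
        series (cusp_term G k nu t a z : nat -> C^o) @ \oo
          --> (slash k f t z : C^o)].

Definition area : set (measurableTypeR R * measurableTypeR R) -> \bar R :=
  (@lebesgue_measure R \x @lebesgue_measure R)%E.

Definition plane (A : set C) :
    set (measurableTypeR R * measurableTypeR R) :=
  [set p | A (p.1 +i* p.2)].

Definition fundamental_domain (G : set 'M[int]_2) (F : set C) : Prop :=
  [/\ F `<=` upper_half,
      measurable (plane F),
      forall z, upper_half z -> exists2 g, G g & F (mobius g z) &
      forall g, G g -> g <> 1 -> g <> -1 ->
        area.-negligible (plane (F `&` mobius g @` F))].

Definition plane_integral (F : set C) (h : C -> C) : C :=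
  Rintegral area (plane F) (fun p => complex.Re (h (p.1 +i* p.2))) +i*
  Rintegral area (plane F) (fun p => complex.Im (h (p.1 +i* p.2))).

(* F is a fundamental domain of G *)
Definition petersson (G : set 'M[int]_2) (F : set C) (k : R)
    (f g : C -> C) : C :=
  ((SL2Z_index G)%:R)^-1 *
  plane_integral F (fun z =>
    f z * (g z)^* * (complex.Im z `^ k / complex.Im z ^+ 2)%:C).

Definition orthonormal_basis (G : set 'M[int]_2) (F : set C) (k : R)
    (nu : 'M[int]_2 -> C -> C) (d : nat) (f : 'I_d -> C -> C) : Prop :=
  [/\ forall j, cusp_form G k nu (f j),
      forall i j, petersson G F k (f i) (f j) = (i == j)%:R &
      forall g, cusp_form G k nu g ->
        exists a : 'I_d -> C, forall z, upper_half z ->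
          g z = \sum_(j < d) a j * f j z].

Definition sup_norm (k : R) (d : nat) (f : 'I_d -> C -> C) : \bar R :=
  ereal_sup [set (\sum_(j < d) complex.Im z `^ k * cabs (f j z) ^+ 2)%:E
            | z in upper_half].

End Analysis.

(* Main.v *)
Require Import Defs.
From mathcomp Require Import all_boot all_order all_algebra.
From mathcomp Require Import all_classical all_reals all_analysis.
From mathcomp Require Import complex finmap ring lra zify.
From mathcomp Require Import measurable_realfun.

Set Implicit Arguments.
Unset Strict Implicit.
Unset Printing Implicit Defensive.

Import Order.TTheory GRing.Theory Num.Theory.
Import numFieldNormedType.Exports.

Local Open Scope classical_set_scope.
Local Open Scope ring_scope.
Local Open Scope complex_scope.

(** Upper bound. Fourier coefficients at a cusp are bounded by integrating over a
    box of relative height 1/sqrt k around Im z = y, which meets each G-orbit a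
    bounded number of times; summing them with weights 1 + A_m^2, A_m the number of
    standard deviations by which the m-th term misses its peak, gives
    y^k |f(z)|^2 <= K k^(3/2) / eta * int_F |f|^2 y^k dmu for every cusp form f.
    Applied to sum_j conj(f_j(z)) f_j this bounds the supremum.

    Lower bound. By Cauchy-Schwarz the supremum is at least y^k |P(z)|^2 / |P|^2 for
    any cusp form P. Take the Poincare series of exp(2 pi i eta z / n) at a cusp t of
    width n with eta minimal: at height y = k n / (4 pi eta) the terms with lower left
    entry 0 dominate, so y^k |P|t|^2 >= y^k exp(-k), while unfolding and Stirling's
    formula bound the norm.

    No Fourier theory of nu-automorphic functions is used: that P has an expansion at
    each cusp is obtained from discrete Fourier transforms of its values on a line. *)

(** The shape k^(3/2) / eta comes from one function. At a cusp of width n the m-th term of |f|^2 y^k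
    has size y^k exp(-t y) with t = 4 pi (m + kappa) / n; it peaks at y = k / t with relative width
    1 / sqrt k. Hence the height of the boxes, and hence the deviations A_m = (t y - k) / sqrt k.
    The resulting bound at height y has order k + sqrt k y / n. It grows up to y = n k / (4 pi eta),
    where the lowest possible frequency peaks, and has order k^(3/2) / eta there; the Poincare
    series attains this order at the same height. Complex differentiability is only pointwise and no
    contour integral is used. Second-order Taylor estimates, uniform along horizontal lines, take
    its place. For the terms of the Poincare series the error is proportional to the term itself,
    uniformly in the matrix, so the estimates pass to the sum; and they make discrete Fourier
    coefficients decay like 1 / m^2. Constant phases between automorphy factors and complex powers
    come from one principle: a holomorphic function of modulus 1 on H is constant. *)

(** * Elementary inequalities for sin, cos and exp *)

Section RealEstimates.
Variable R : realType.
Implicit Types x y : R.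

Lemma norm_sq x : `|x| ^+ 2 = x ^+ 2.
Proof. by rewrite real_normK ?num_real. Qed.

Lemma norm_sin_le x : `|sin x| <= `|x|.
Proof.
wlog x0 : x / 0 <= x.
  move=> H; case: (leP 0 x) => [|/ltW x0]; first exact: H.
  by rewrite -normrN -sinN -[leRHS]normrN; apply: H; rewrite oppr_ge0.
have [c _] : exists2 c, c \in `[0, x] & sin x - sin 0 = cos c * (x - 0).
  apply: MVT_segment => //; apply: derivable_within_continuous => c _.
  exact: derivable_sin.
rewrite sin0 !subr0 => ->; rewrite normrM ler_piMl//; exact: cos_max.
Qed.

Lemma cos_ge_quad x : 1 - x ^+ 2 / 2 <= cos x.
Proof.
have -> : cos x = 1 - 2 * sin (x / 2) ^+ 2.
  rewrite [in LHS](_ : x = (x / 2) *+ 2); last by rewrite -mulr_natr; field.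
  by rewrite cos_mulr2n cos2sin2 mulr2n; ring.
have : sin (x / 2) ^+ 2 <= (x / 2) ^+ 2.
  by rewrite -[leRHS]norm_sq -norm_sq ler_sqr ?nnegrE ?norm_sin_le.
lra.
Qed.

Lemma sin_le_id x : 0 <= x -> sin x <= x.
Proof.
move=> x0; apply: le_trans (ler_norm _) _.
by apply: le_trans (norm_sin_le x) _; rewrite ger0_norm.
Qed.

Lemma sin_ge_cubic x : 0 <= x -> x - x ^+ 3 / 6 <= sin x.
Proof.
move=> x0.
pose g := (fun x : R => sin x - x + x ^+ 3 / 6).
have dg y : is_derive y 1 g (cos y - 1 + (3 * y ^+ 2) / 6).
  rewrite /g; apply: is_derive_eq.
  by rewrite !scaler0 !scaler1 -mulr_natr /GRing.scale /=; field.
have [c _] : exists2 c, c \in `[0, x] &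
    g x - g 0 = (cos c - 1 + (3 * c ^+ 2) / 6) * (x - 0).
  apply: MVT_segment => //; apply: derivable_within_continuous => c _.
  exact: (@ex_derive _ _ _ _ _ _ _ (dg c)).
have -> : g 0 = 0 by rewrite /g sin0; ring.
rewrite !subr0 => e; have : 0 <= g x.
  by rewrite e mulr_ge0//; have := cos_ge_quad c; lra.
rewrite /g; lra.
Qed.

(** A weak form of Jordan's inequality, on a range that contains [0, pi / 2] since pi / 2 < 2. *)
Lemma sin_ge_third x : 0 <= x <= 2 -> x / 3 <= sin x.
Proof.
move=> /andP[x0 x2]; apply: le_trans (sin_ge_cubic x0).
have -> : x - x ^+ 3 / 6 = x * (1 - x ^+ 2 / 6) by field.
by rewrite ler_wpM2l//; nra.
Qed.

Lemma norm_sin_sub_le x : `|sin x - x| <= `|x| ^+ 3 / 6.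
Proof.
wlog x0 : x / 0 <= x.
  move=> H; case: (leP 0 x) => [|/ltW x0]; first exact: H.
  have := H (- x); rewrite sinN normrN -opprD normrN; apply.
  by rewrite oppr_ge0.
rewrite (ger0_norm x0) ler_norml; have := sin_ge_cubic x0.
have := sin_le_id x0; have : 0 <= x ^+ 3 by rewrite exprn_ge0.
lra.
Qed.

(** Both bounds follow from 1 + x <= exp x; taken at -x it reads exp x * (1 - x) <= 1. *)
Lemma expR_sub_le x : `|x| <= 1 / 2 -> `|expR x - 1 - x| <= 2 * x ^+ 2.
Proof.
rewrite ler_norml => /andP[h1 h2].
have := expR_ge1Dx x; have := expR_ge1Dx (- x); rewrite expRN => e1 e2.
have e3 : expR x * (1 - x) <= 1.
  have x1 : 0 < 1 - x by lra.
  by rewrite -[leRHS](mulVf (lt0r_neq0 (expR_gt0 x))) mulrC ler_wpM2r ?expR_ge0.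
rewrite ler_norml; apply/andP; split; nra.
Qed.

End RealEstimates.

(** * Modulus, exponential, logarithm and powers of complex numbers *)

Section ComplexBasics.
Variable R : realType.
Local Notation C := R[i].
Implicit Types z w : C.
Local Notation e_ t := (@cexp R (0 +i* t)).

Lemma cabsE z : cabs z = Num.sqrt (complex.Re z ^+ 2 + complex.Im z ^+ 2).
Proof. by case: z. Qed.

Lemma normCE z : `|z| = (cabs z)%:C. Proof. by []. Qed.

Lemma cabs_ge0 z : 0 <= cabs z. Proof. by rewrite cabsE sqrtr_ge0. Qed.

Lemma cabs_sqr z : cabs z ^+ 2 = complex.Re z ^+ 2 + complex.Im z ^+ 2.
Proof. by rewrite cabsE sqr_sqrtr// addr_ge0 ?sqr_ge0. Qed.

Lemma cabs0 : cabs (0 : C) = 0. Proof. exact: ComplexField.Normc.normc0. Qed.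
Lemma cabs1 : cabs (1 : C) = 1. Proof. exact: ComplexField.Normc.normc1. Qed.
Lemma cabsM z w : cabs (z * w) = cabs z * cabs w.
Proof. exact: ComplexField.Normc.normcM. Qed.
Lemma cabsV z : cabs z^-1 = (cabs z)^-1.
Proof. exact: ComplexField.Normc.normcV. Qed.
Lemma cabs_eq0 z : (cabs z == 0) = (z == 0).
Proof.
apply/eqP/eqP => [|->]; [exact: ComplexField.Normc.eq0_normc|exact: cabs0].
Qed.
Lemma cabs_gt0 z : (0 < cabs z) = (z != 0).
Proof. by rewrite lt_def cabs_ge0 andbT cabs_eq0. Qed.
Lemma cabsN z : cabs (- z) = cabs z. Proof. exact: normcN. Qed.
Lemma cabsD z w : cabs (z + w) <= cabs z + cabs w. Proof. exact: le_normcD. Qed.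
Lemma cabsB z w : cabs (z - w) <= cabs z + cabs w.
Proof. by rewrite -(cabsN w) cabsD. Qed.
Lemma cabsBC z w : cabs (z - w) = cabs (w - z). Proof. by rewrite -cabsN opprB. Qed.
Lemma cabs_lerB z w : cabs z - cabs w <= cabs (z - w).
Proof. by rewrite lerBlDr; have := cabsD (z - w) w; rewrite subrK. Qed.
Lemma cabsX z n : cabs (z ^+ n) = cabs z ^+ n.
Proof. by elim: n => [|n IH]; rewrite ?expr0 ?cabs1// !exprS cabsM IH. Qed.
Lemma cabs_sum (I : Type) (s : seq I) (P : pred I) (F : I -> C) :
  cabs (\sum_(i <- s | P i) F i) <= \sum_(i <- s | P i) cabs (F i).
Proof.
elim/big_ind2 : _ => //; first by rewrite cabs0.
by move=> a b a' b' h1 h2; apply: le_trans (cabsD _ _) _; apply: lerD.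
Qed.
Lemma cabs_real (x : R) : cabs x%:C = `|x|.
Proof. by rewrite cabsE /= expr0n /= addr0 sqrtr_sqr. Qed.
Lemma cabs_nat n : cabs (n%:R : C) = n%:R.
Proof. by rewrite -[n%:R](rmorph_nat (real_complex R)) cabs_real ger0_norm. Qed.
Lemma Re_le_cabs z : `|complex.Re z| <= cabs z.
Proof. by rewrite cabsE -sqrtr_sqr ler_wsqrtr// lerDl sqr_ge0. Qed.
Lemma Im_le_cabs z : `|complex.Im z| <= cabs z.
Proof. by rewrite cabsE -sqrtr_sqr ler_wsqrtr// lerDr sqr_ge0. Qed.
Lemma cabs_le_ReIm z : cabs z <= `|complex.Re z| + `|complex.Im z|.
Proof.
rewrite -ler_sqr ?nnegrE ?addr_ge0 ?cabs_ge0// cabs_sqr -!(norm_sq (complex.Re z)).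
rewrite -[complex.Im z ^+ 2]norm_sq sqrrD lerD2r lerDl mulrn_wge0 ?mulr_ge0//.
Qed.
Lemma cabs_conj z : cabs z^* = cabs z.
Proof. by case: z => a b; rewrite !cabsE /= sqrrN. Qed.
Lemma mul_conj z : z * z^* = (cabs z ^+ 2)%:C.
Proof. by rewrite cabs_sqr; case: z => a b; simpc; congr (_ +i* _); ring. Qed.

Lemma ReD z w : complex.Re (z + w) = complex.Re z + complex.Re w.
Proof. by case: z w => [a b] [c d]. Qed.
Lemma ImD z w : complex.Im (z + w) = complex.Im z + complex.Im w.
Proof. by case: z w => [a b] [c d]. Qed.
Lemma ReN z : complex.Re (- z) = - complex.Re z. Proof. by case: z. Qed.
Lemma ImN z : complex.Im (- z) = - complex.Im z. Proof. by case: z. Qed.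
Lemma ReM z w : complex.Re (z * w) =
  complex.Re z * complex.Re w - complex.Im z * complex.Im w.
Proof. by case: z w => [a b] [c d]. Qed.
Lemma ImM z w : complex.Im (z * w) =
  complex.Re z * complex.Im w + complex.Im z * complex.Re w.
Proof. by case: z w => [a b] [c d]. Qed.
Lemma ReZ (x : R) z : complex.Re (x%:C * z) = x * complex.Re z.
Proof. by rewrite ReM /= mul0r subr0. Qed.
Lemma ImZ (x : R) z : complex.Im (x%:C * z) = x * complex.Im z.
Proof. by rewrite ImM /= mul0r addr0. Qed.
Lemma intrCE (m : int) : (m%:~R : C) = (m%:~R : R)%:C.
Proof. by rewrite (rmorph_int (real_complex R)). Qed.
Lemma natrCE (m : nat) : (m%:R : C) = (m%:R : R)%:C.
Proof. by rewrite (rmorph_nat (real_complex R)). Qed.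
Lemma Re_sum (I : Type) (s : seq I) (P : pred I) (F : I -> C) :
  complex.Re (\sum_(i <- s | P i) F i) = \sum_(i <- s | P i) complex.Re (F i).
Proof. by apply: (big_morph _ ReD). Qed.
Lemma cexpD z w : cexp (z + w) = cexp z * cexp w.
Proof.
case: z w => [a b] [c d]; rewrite /cexp /= expRD cosD sinD; simpc.
by congr (_ +i* _); ring.
Qed.
Lemma cexp0 : cexp (0 : C) = 1.
Proof. by rewrite /cexp /= expR0 cos0 sin0 mulr1 mulr0. Qed.
Lemma cabs_cexp z : cabs (cexp z) = expR (complex.Re z).
Proof.
by rewrite cabsE /= !exprMn -mulrDr cos2Dsin2 mulr1 sqrtr_sqr ger0_norm// expR_ge0.
Qed.
Lemma cexp_neq0 z : cexp z != 0.
Proof. by rewrite -cabs_gt0 cabs_cexp expR_gt0. Qed.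
Lemma cexpN z : cexp (- z) = (cexp z)^-1.
Proof.
by apply: (mulIf (cexp_neq0 z)); rewrite -cexpD addNr cexp0 mulVf ?cexp_neq0.
Qed.
Lemma cexpB z w : cexp (z - w) = cexp z / cexp w.
Proof. by rewrite cexpD cexpN. Qed.
Lemma cexpMn z n : cexp (n%:R * z) = cexp z ^+ n.
Proof.
elim: n => [|n IH]; first by rewrite mul0r cexp0 expr0.
by rewrite -[n.+1]add1n natrD mulrDl mul1r cexpD IH add1n exprS.
Qed.

Lemma cexp_2pi_int (m : int) : e_ (2 * pi * m%:~R) = 1.
Proof.
have H (n : nat) : e_ (2 * pi * n%:R) = 1.
  have -> : (0 +i* (2 * pi * n%:R) : C) = n%:R * (0 +i* (2 * pi)).
    by rewrite natrCE; simpc; congr (_ +i* _); ring.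
  rewrite cexpMn /cexp /= expR0 !mul1r.
  by rewrite mulrC -[pi * 2]/(pi * 2%:R) mulr_natr cos2pi sin2pi expr1n.
case: m => n; first exact: H.
rewrite NegzE mulrNz mulrN.
rewrite (_ : (0 +i* - _ : C) = - (0 +i* (2 * pi * n.+1%:R))); last first.
  by simpc.
by rewrite cexpN H invr1.
Qed.

(** The real and imaginary parts of the remainder are split into products of the real remainders of
    exp, sin and cos; the constant 8 is not optimised. *)
Lemma cexp_taylor z : cabs z <= 1 / 2 ->
  cabs (cexp z - 1 - z) <= 8 * cabs z ^+ 2.
Proof.
case: z => x y h.
have hx : `|x| <= 1/2 by apply: le_trans h; exact: (Re_le_cabs (x +i* y)).
have hy : `|y| <= 1/2 by apply: le_trans h; exact: (Im_le_cabs (x +i* y)).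
have Ex := expR_sub_le hx.
have Sy := norm_sin_sub_le y.
have Cy : `|cos y - 1| <= y ^+ 2 / 2.
  by rewrite ler_norml; have := cos_ge_quad y; have := cos_le1 y; nra.
apply: (le_trans (cabs_le_ReIm _)).
rewrite cabs_sqr !ReD !ImD !ReN !ImN /= oppr0 addr0.
have E2 : expR x <= 2.
  move: Ex; rewrite ler_norml => /andP[_]; move: hx; rewrite ler_norml; nra.
have -> : expR x * cos y - 1 - x = (expR x - 1 - x) + expR x * (cos y - 1) by ring.
have -> : expR x * sin y - y = expR x * (sin y - y) + (expR x - 1 - x) * y + x * y.
  by ring.
have E0 := expR_ge0 x.
have a1 : `|expR x * (cos y - 1)| <= y ^+ 2.
  by rewrite normrM ger0_norm//; have := normr_ge0 (cos y - 1); nra.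
have a2 : `|expR x * (sin y - y)| <= y ^+ 2 / 6.
  rewrite normrM ger0_norm//.
  have : `|y| ^+ 3 / 6 <= y ^+ 2 / 12.
    by rewrite -(norm_sq y); have := normr_ge0 y; nra.
  have := normr_ge0 (sin y - y); nra.
have a3 : `|(expR x - 1 - x) * y| <= x ^+ 2.
  by rewrite normrM; have := normr_ge0 (expR x - 1 - x); have := normr_ge0 y; nra.
have a4 : `|x * y| <= (x ^+ 2 + y ^+ 2) / 2.
  rewrite normrM -(norm_sq x) -(norm_sq y).
  have := sqr_ge0 (`|x| - `|y|); nra.
apply: le_trans (lerD (ler_normD _ _) (ler_normD _ _)) _.
have := ler_normD (expR x * (sin y - y)) ((expR x - 1 - x) * y).
have := sqr_ge0 x; have := sqr_ge0 y; lra.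
Qed.

Lemma cabs_gt_Re z : complex.Im z != 0 -> -1 < complex.Re z / cabs z < 1.
Proof.
move=> h; have c0 : 0 < cabs z.
  by rewrite cabs_gt0; apply: contra_neq h => ->.
rewrite -ltr_norml normrM normfV (ger0_norm (cabs_ge0 z)) ltr_pdivrMr// mul1r.
rewrite -ltr_sqr ?nnegrE ?cabs_ge0// norm_sq cabs_sqr ltrDl.
by rewrite lt_def sqr_ge0 sqrf_eq0 h.
Qed.

Lemma clogK w : w != 0 -> cexp (clog w) = w.
Proof.
move=> w0; have c0 : 0 < cabs w by rewrite cabs_gt0.
have b : -1 <= complex.Re w / cabs w <= 1.
  rewrite -ler_norml normrM normfV (ger0_norm (cabs_ge0 w)) ler_pdivrMr// mul1r.
  exact: Re_le_cabs.
have s : sin (acos (complex.Re w / cabs w)) = `|complex.Im w| / cabs w.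
  rewrite sin_acos//.
  have -> : 1 - (complex.Re w / cabs w) ^+ 2 = (`|complex.Im w| / cabs w) ^+ 2.
    rewrite !expr_div_n norm_sq cabs_sqr.
    have : complex.Re w ^+ 2 + complex.Im w ^+ 2 != 0.
      by rewrite -cabs_sqr; apply: lt0r_neq0; rewrite exprn_gt0.
    by move=> ?; field.
  by rewrite sqrtr_sqr ger0_norm// divr_ge0 ?cabs_ge0.
rewrite /cexp /clog /= lnK ?posrE// /carg.
have c : cos (acos (complex.Re w / cabs w)) = complex.Re w / cabs w.
  by rewrite acosK// in_itv /=.
case: w w0 c0 b s c => x y w0 c0 b s c /=.
have c0' := lt0r_neq0 c0.
case: leP => y0.
  by rewrite c s /= ger0_norm//; congr (_ +i* _); field.
by rewrite cosN sinN c s /= ltr0_norm//; congr (_ +i* _); field.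
Qed.

Lemma cabs_cpow w k : w != 0 -> cabs (cpow w k) = cabs w `^ k.
Proof.
move=> w0; rewrite /cpow cabs_cexp ReZ /= /powR.
by rewrite (negbTE (lt0r_neq0 _)) ?cabs_gt0.
Qed.
Lemma cpow_neq0 w k : cpow w k != 0. Proof. exact: cexp_neq0. Qed.
Lemma cpowN w k : cpow w (- k) = (cpow w k)^-1.
Proof. by rewrite /cpow (rmorphN (real_complex R)) mulNr cexpN. Qed.
Lemma cpow1 k : cpow (1 : C) k = 1.
Proof.
rewrite /cpow; have -> : clog (1 : C) = 0.
  by rewrite /clog /carg cabs1 ln1 /= lexx divr1 acos1.
by rewrite mulr0 cexp0.
Qed.

End ComplexBasics.

(** * The action of SL2(Z) *)

Section SL2.
Implicit Types (g h t : 'M[int]_2) (l : int).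

Lemma mx2P (T : Type) (g h : 'M[T]_2) : g 0 0 = h 0 0 -> g 0 1 = h 0 1 ->
  g 1 0 = h 1 0 -> g 1 1 = h 1 1 -> g = h.
Proof.
move=> e00 e01 e10 e11; apply/matrixP => i j.
have E (u : 'I_2) : u = 0 \/ u = 1.
  by case: u => -[|[|//]] hu; [left|right]; apply/val_inj.
by case: (E i) => ->; case: (E j) => ->.
Qed.

Definition mx2 (a b c d : int) : 'M[int]_2 :=
  \matrix_(i, j) (if i == 0 then if j == 0 then a else b
                  else if j == 0 then c else d).

Lemma mx2E a b c d : [/\ mx2 a b c d 0 0 = a, mx2 a b c d 0 1 = b,
  mx2 a b c d 1 0 = c & mx2 a b c d 1 1 = d].
Proof. by rewrite /mx2 !mxE. Qed.

Lemma mul2E g h i j : (g * h) i j = g i 0 * h 0 j + g i 1 * h 1 j.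
Proof.
rewrite mxE !big_ord_recl big_ord0 addr0; congr (_ + g i _ * h _ j);
  exact/val_inj.
Qed.

Lemma SL2ZE g : SL2Z g <-> g 0 0 * g 1 1 - g 0 1 * g 1 0 = 1.
Proof.
rewrite /SL2Z /= (expand_det_row g 0) !big_ord_recl big_ord0 /cofactor.
rewrite !det_mx11 !mxE /= !(lift0, add0n, addn0, expr0, expr1, addr0).
rewrite (_ : lift 0 0 = 1 :> 'I_2); last exact/val_inj.
rewrite (_ : lift 1 0 = 0 :> 'I_2); last exact/val_inj.
by rewrite mul1r mulN1r mulrN.
Qed.

Lemma SL2Z_mx2 a b c d : a * d - b * c = 1 -> SL2Z (mx2 a b c d).
Proof. by move=> e; apply/SL2ZE; have [-> -> -> ->] := mx2E a b c d. Qed.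

Lemma SL2Z_unit g : SL2Z g -> g \is a GRing.unit.
Proof. by move=> e; rewrite unitmxE e. Qed.

Lemma SL2ZM g h : SL2Z g -> SL2Z h -> SL2Z (g * h).
Proof. by rewrite /SL2Z /= => e1 e2; rewrite -[g * h]/(g *m h) det_mulmx e1 e2 mulr1. Qed.

Lemma SL2Z1 : SL2Z 1.
Proof. exact: det1. Qed.

Lemma SL2Z_inv g : SL2Z g -> g^-1 = mx2 (g 1 1) (- g 0 1) (- g 1 0) (g 0 0).
Proof.
move=> sg; have /SL2ZE e := sg.
apply: (mulrI (SL2Z_unit sg)); rewrite divrr ?SL2Z_unit//.
have [x0 x1 x2 x3] := mx2E (g 1 1) (- g 0 1) (- g 1 0) (g 0 0).
by apply: mx2P; rewrite mul2E ?x0 ?x1 ?x2 ?x3 mxE /=;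
  [rewrite -e; ring|ring|ring|rewrite -e; ring].
Qed.

Lemma SL2ZV g : SL2Z g -> SL2Z g^-1.
Proof. by move=> sg; rewrite /SL2Z /= det_inv sg invr1. Qed.

Lemma SL2Z_row_neq0 g : SL2Z g -> (g 1 0 != 0) || (g 1 1 != 0).
Proof.
move=> /SL2ZE; case: eqP => //= ->; case: eqP => //= ->.
by rewrite !mulr0 subr0 => /eqP; rewrite eq_sym oner_eq0.
Qed.

Definition Um l : 'M[int]_2 := 1 + l *: delta_mx 0 1.

Lemma UmE l : [/\ Um l 0 0 = 1, Um l 0 1 = l, Um l 1 0 = 0 & Um l 1 1 = 1].
Proof. by rewrite /Um !mxE /= ?mulr0 ?mulr1 ?addr0 ?add0r. Qed.

Lemma SL2Z_Um l : SL2Z (Um l).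
Proof. by apply/SL2ZE; have [-> -> -> ->] := UmE l; ring. Qed.

Lemma UmD l m : Um (l + m) = Um l * Um m.
Proof.
have [a b c d] := UmE l; have [a' b' c' d'] := UmE m.
have [x y z w] := UmE (l + m).
by apply: mx2P; rewrite mul2E ?a ?b ?c ?d ?a' ?b' ?c' ?d' ?x ?y ?z ?w; ring.
Qed.

Lemma Um0 : Um 0 = 1. Proof. by rewrite /Um scale0r addr0. Qed.

Lemma UmN l : Um (- l) = (Um l)^-1.
Proof.
apply: (mulrI (SL2Z_unit (SL2Z_Um l))).
by rewrite -UmD subrr Um0 divrr// SL2Z_unit//; exact: SL2Z_Um.
Qed.

Lemma UmX l n : Um l ^+ n = Um (l * n%:Z).
Proof.
elim: n => [|n IH]; first by rewrite mulr0 Um0 expr0.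
by rewrite exprS IH -UmD; congr Um; rewrite intS mulrDr mulr1.
Qed.

Lemma UmXz l m : Um l ^ m = Um (l * m).
Proof.
case: m => n; first exact: UmX.
by rewrite NegzE -exprnN UmX -UmN mulrN.
Qed.

Lemma UmxE n : Umx ^+ n = Um n%:Z.
Proof. by rewrite (_ : Umx = Um 1) ?UmX ?mul1r// /Umx /Um scale1r. Qed.

Lemma exprz_conj t g (m : int) : SL2Z t -> SL2Z g ->
  (t * g * t^-1) ^ m = t * g ^ m * t^-1.
Proof.
move=> st sg; have ut := SL2Z_unit st; have ug := SL2Z_unit sg.
have H n : (t * g * t^-1) ^+ n = t * g ^+ n * t^-1.
  elim: n => [|n IH]; first by rewrite !expr0 mulr1 divrr.
  by rewrite !exprS IH !mulrA mulrVK.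
case: m => n; first exact: H.
have un : g ^+ n.+1 \is a GRing.unit by rewrite unitrX.
have utn : t * g ^+ n.+1 \is a GRing.unit by rewrite (unitrMr _ ut).
rewrite NegzE -!exprnN H (@invrM _ _ t^-1) ?unitrV//.
by rewrite (@invrM _ t)// invrK mulrA.
Qed.

Lemma SL2Z_fixoo g : SL2Z g -> g 1 0 = 0 -> exists l, g = Um l \/ g = - Um l.
Proof.
move=> /SL2ZE; move=> + c0; rewrite c0 mulr0 subr0 => e.
have : (g 0 0 = 1 /\ g 1 1 = 1) \/ (g 0 0 = -1 /\ g 1 1 = -1).
  move: (g 0 0) (g 1 1) e => a d e.
  have /eqP : (`|a| * `|d| = 1)%N by rewrite -abszM e.
  rewrite muln_eq1 => /andP[/eqP ha /eqP hd].
  have [a1|a1] : a = 1 \/ a = -1 by lia.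
    by left; move: e; rewrite a1 mul1r.
  by right; move: e; rewrite a1 mulN1r => <-; rewrite opprK.
have [x y z w] := UmE (g 0 1); have [x' y' z' w'] := UmE (- g 0 1).
case=> -[a d]; [exists (g 0 1); left|exists (- g 0 1); right].
  by apply: mx2P; rewrite ?x ?y ?z ?w.
by apply: mx2P; rewrite mxE ?x' ?y' ?z' ?w' ?opprK// c0 oppr0.
Qed.

(** The quotient h g^-1 has bottom row (0, 1), so it is a translation. Thus bottom rows index
    matrices up to translations on the left, both when counting in a box and in the Poincare
    series. *)
Lemma SL2Z_same_row g h : SL2Z g -> SL2Z h -> g 1 0 = h 1 0 -> g 1 1 = h 1 1 ->
  exists l, h = Um l * g.
Proof.
move=> sg sh e0 e1; have si := SL2Z_inv sg; have sgi := SL2ZV sg.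
have [x y z w] := mx2E (g 1 1) (- g 0 1) (- g 1 0) (g 0 0).
have c0 : (h * g^-1) 1 0 = 0 by rewrite mul2E si x z -e0 -e1; ring.
have d1 : (h * g^-1) 1 1 = 1.
  by rewrite mul2E si y w -e0 -e1; move/SL2ZE : sg => <-; ring.
have [l [E|E]] := SL2Z_fixoo (SL2ZM sh sgi) c0.
  by exists l; rewrite -E mulrVK// SL2Z_unit.
by move: d1; rewrite E mxE; have [_ _ _ ->] := UmE l.
Qed.

End SL2.

(** * The action on the upper half-plane and the factor j *)

Section Mobius.
Variable R : realType.
Local Notation C := R[i].
Local Notation Re := complex.Re.
Local Notation Im := complex.Im.
Implicit Types (z w : C) (g h t : 'M[int]_2).

Lemma Im_jfac g z : Im (jfac g z) = (g 1 0)%:~R * Im z.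
Proof. by rewrite /jfac ImD !intrCE ImZ /= addr0. Qed.
Lemma Re_jfac g z : Re (jfac g z) = (g 1 0)%:~R * Re z + (g 1 1)%:~R.
Proof. by rewrite /jfac ReD !intrCE ReZ /=. Qed.

Lemma cabs_jfac g z : cabs (jfac g z) ^+ 2 =
  ((g 1 0)%:~R * Re z + (g 1 1)%:~R) ^+ 2 + (g 1 0)%:~R ^+ 2 * Im z ^+ 2.
Proof. by rewrite cabs_sqr Re_jfac Im_jfac exprMn. Qed.

Lemma jfac_neq0 g z : SL2Z g -> upper_half z -> jfac g z != 0.
Proof.
move=> /SL2Z_row_neq0 sg; rewrite /upper_half /= => z0.
suff : 0 < cabs (jfac g z) ^+ 2.
  by move/lt0r_neq0; rewrite sqrf_eq0 cabs_eq0.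
rewrite cabs_jfac.
have [c0|c0] := eqVneq (g 1 0) 0.
  move: sg; rewrite c0 eqxx /= => d0.
  by rewrite !mul0r add0r expr0n mul0r addr0 lt_def sqr_ge0 sqrf_eq0 intr_eq0 d0.
rewrite ltr_wpDl ?sqr_ge0//; apply: mulr_gt0; last by rewrite exprn_gt0.
by rewrite lt_def sqr_ge0 sqrf_eq0 intr_eq0 c0.
Qed.

Lemma cabs_jfac_gt0 g z : SL2Z g -> upper_half z -> 0 < cabs (jfac g z).
Proof. by move=> *; rewrite cabs_gt0; exact: jfac_neq0. Qed.

Lemma Im_mobius g z : SL2Z g -> upper_half z ->
  Im (mobius g z) = Im z / cabs (jfac g z) ^+ 2.
Proof.
move=> sg hz; have j0 := jfac_neq0 sg hz.
have -> : mobius g z = ((g 0 0)%:~R * z + (g 0 1)%:~R) * (jfac g z)^* *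
    ((cabs (jfac g z) ^+ 2)^-1)%:C.
  rewrite /mobius -mulrA; congr (_ * _).
  apply: (mulfI j0); rewrite divff// mulrA mul_conj -(rmorphM (real_complex R)).
  by rewrite divff// expf_eq0/= cabs_eq0.
rewrite ImM /= mulr0 add0r; congr (_ * _).
rewrite ImM ReD ImD !intrCE ReZ ImZ /=.
have -> : Re (jfac g z)^* = Re (jfac g z) by case: (jfac g z).
have -> : Im (jfac g z)^* = - Im (jfac g z) by case: (jfac g z).
rewrite Re_jfac Im_jfac addr0; move/SL2ZE : sg => e.
have e' : (g 0 0)%:~R * (g 1 1)%:~R - (g 0 1)%:~R * (g 1 0)%:~R = 1 :> R.
  by rewrite -!intrM -intrB e.
transitivity (((g 0 0)%:~R * (g 1 1)%:~R - (g 0 1)%:~R * (g 1 0)%:~R) * Im z).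
  by ring.
by rewrite e' mul1r.
Qed.

Lemma mobius_upper g z : SL2Z g -> upper_half z -> upper_half (mobius g z).
Proof.
move=> sg hz; rewrite /upper_half /= Im_mobius//.
by rewrite divr_gt0// exprn_gt0// cabs_jfac_gt0.
Qed.

Lemma jfacM g h z : SL2Z g -> SL2Z h -> upper_half z ->
  jfac (g * h) z = jfac g (mobius h z) * jfac h z.
Proof.
move=> sg sh hz; have j0 := jfac_neq0 sh hz.
rewrite [jfac g _]/jfac /mobius mulrDl mulrA mulfVK// /jfac !mul2E.
by rewrite !(intrD, intrM); ring.
Qed.

Lemma mobiusM g h z : SL2Z g -> SL2Z h -> upper_half z ->
  mobius (g * h) z = mobius g (mobius h z).
Proof.
move=> sg sh hz; have j0 := jfac_neq0 sh hz.
have j1 := jfac_neq0 sg (mobius_upper sh hz).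
rewrite {1}/mobius jfacM// [RHS]/mobius [in RHS](_ : _ + _ =
  (((g * h) 0 0)%:~R * z + ((g * h) 0 1)%:~R) / jfac h z).
  by rewrite invfM mulrA mulrAC.
apply: (mulIf j0); rewrite mulfVK// {1}/mobius mulrDl mulrA mulfVK// /jfac !mul2E.
by rewrite !(intrD, intrM); ring.
Qed.

Lemma jfac1 z : jfac 1 z = 1.
Proof. by rewrite /jfac !mxE /= mul0r add0r. Qed.
Lemma mobius1 z : mobius 1 z = z.
Proof. by rewrite /mobius jfac1 !mxE /= mul1r addr0 divr1. Qed.
Lemma jfacN g z : jfac (- g) z = - jfac g z.
Proof. by rewrite /jfac !mxE !mulrNz; ring. Qed.
Lemma mobiusN g z : mobius (- g) z = mobius g z.
Proof. by rewrite /mobius jfacN invrN !mxE !mulrNz mulNr -opprD mulNr mulrN opprK. Qed.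
Lemma jfac_Um l z : jfac (Um l) z = 1.
Proof. by have [x y u v] := UmE l; rewrite /jfac u v mul0r add0r. Qed.
Lemma mobius_Um l z : mobius (Um l) z = z + l%:~R.
Proof. by have [x y u v] := UmE l; rewrite /mobius jfac_Um x y divr1 mul1r. Qed.

Lemma mobiusK g z : SL2Z g -> upper_half z -> mobius g^-1 (mobius g z) = z.
Proof.
by move=> sg hz; rewrite -(mobiusM (SL2ZV sg) sg hz) mulVr ?SL2Z_unit// mobius1.
Qed.
Lemma mobiusVK g z : SL2Z g -> upper_half z -> mobius g (mobius g^-1 z) = z.
Proof.
by move=> sg hz; rewrite -(mobiusM sg (SL2ZV sg) hz) mulrV ?SL2Z_unit// mobius1.
Qed.

(** An exact difference formula in place of the derivative 1 / j^2: it gives Taylor remainders with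
    explicit constants. *)
Lemma mobiusB g z w : SL2Z g -> upper_half z -> upper_half w ->
  mobius g w - mobius g z = (w - z) / (jfac g z * jfac g w).
Proof.
move=> sg hz hw; have jz := jfac_neq0 sg hz; have jw := jfac_neq0 sg hw.
apply: (mulIf (mulf_neq0 jz jw)); rewrite mulfVK ?mulf_neq0//.
rewrite mulrBl {1}mulrCA {1}/mobius mulfVK// mulrA {1}/mobius mulfVK//.
have : (g 0 0)%:~R * (g 1 1)%:~R - (g 0 1)%:~R * (g 1 0)%:~R = 1 :> C.
  by move/SL2ZE : sg => e; rewrite -!intrM -intrB e.
move=> e; transitivity
  (((g 0 0)%:~R * (g 1 1)%:~R - (g 0 1)%:~R * (g 1 0)%:~R) * (w - z)).
  by rewrite /jfac; ring.
by rewrite e mul1r.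
Qed.

Lemma upperDr z (x : R) : upper_half z -> upper_half (z + x%:C).
Proof. by rewrite /upper_half /= ImD /= addr0. Qed.
End Mobius.

(** * Taylor estimates uniform in the matrix *)

Section LogTaylor.
Variable R : realType.
Local Notation C := R[i].
Local Notation Re := complex.Re.
Local Notation Im := complex.Im.
Implicit Types (z w h : C) (g : 'M[int]_2).

(** The modulus of exp l confines Re l; then cos (Im l) > 0 together with |Im l| < pi gives |Im l| <
    pi / 2, so the sine confines Im l as well, excluding every other logarithm of 1 + d. The result
    is |l| <= 6 |d| <= 1 / 2, and [cexp_taylor] gives the constant 288 = 8 * 6^2. *)
Lemma clog_near (l d : C) : cexp l = 1 + d -> cabs d <= 1 / 12 ->
  `|Im l| < pi -> cabs (l - d) <= 288 * cabs d ^+ 2.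
Proof.
move=> E d12 ilpi.
have t0 := cabs_ge0 d; set t := cabs d in d12 t0 *.
have el : expR (Re l) <= 1 + t.
  by rewrite -cabs_cexp E; apply: le_trans (cabsD _ _) _; rewrite cabs1.
have eg : 1 - t <= expR (Re l).
  rewrite -cabs_cexp E; have := cabs_lerB (1 : C) (- d).
  by rewrite cabs1 cabsN opprK.
have r1 : Re l <= t by rewrite -ler_expR; apply: le_trans el _; exact: expR_ge1Dx.
have r2 : - (2 * t) <= Re l.
  rewrite -ler_expR; apply: le_trans eg; rewrite expRN.
  have e2 := expR_ge1Dx (2 * t); have e2p := expR_gt0 (2 * t).
  rewrite -[leLHS]mul1r ler_pdivrMr//; nra.
have Rd := Re_le_cabs d; have Id := Im_le_cabs d.
rewrite -/t in Rd Id.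
have [Ec Es] : expR (Re l) * cos (Im l) = 1 + Re d /\
    expR (Re l) * sin (Im l) = Im d.
  by move: E; case: (l) (d) => [a b] [x y] /= [-> ->]; rewrite add0r.
have cpos : 0 < cos (Im l).
  rewrite -(pmulr_rgt0 _ (expR_gt0 (Re l))) Ec.
  by move: Rd; rewrite ler_norml => /andP[]; lra.
have ipi : `|Im l| < pi / 2.
  have pi0 := pi_gt0 R; have n0 := normr_ge0 (Im l).
  rewrite -ltr_cos ?cos_pihalf ?cos_norm// in_itv /=; lra.
have i2 : `|Im l| <= 2 by have := pihalf_lt2 R; lra.
have il : `|Im l| <= 4 * t.
  have s3 : `|Im l| / 3 <= `|sin (Im l)|.
    apply: le_trans (@sin_ge_third _ `|Im l| _) _; first by rewrite normr_ge0.
    case: (leP 0 (Im l)) => [i0|/ltW i0]; first by rewrite (ger0_norm i0) ler_norm.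
    by rewrite (ler0_norm i0) sinN -normrN ler_norm.
  have : expR (Re l) * `|sin (Im l)| <= t.
    by rewrite -[expR _]ger0_norm ?expR_ge0// -normrM Es.
  have := normr_ge0 (sin (Im l)); nra.
have rl : `|Re l| <= 2 * t by rewrite ler_norml; lra.
have cl : cabs l <= 6 * t by apply: le_trans (cabs_le_ReIm l) _; lra.
have := @cexp_taylor _ l; rewrite E.
have -> : 1 + d - 1 - l = - (l - d) by ring.
rewrite cabsN; have cl0 := cabs_ge0 l.
by move=> /(_ ltac:(lra)) /le_trans; apply; nra.
Qed.

Lemma carg_upper w : 0 < Im w -> 0 < carg w < pi.
Proof.
move=> h; have /andP[a b] := cabs_gt_Re (lt0r_neq0 h).
by rewrite /carg (ltW h) acos_gt0 ?acos_ltpi// ?a ?b ?(ltW a) ?(ltW b).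
Qed.

Lemma carg_lower w : Im w < 0 -> - pi < carg w < 0.
Proof.
move=> h; have /andP[a b] := cabs_gt_Re (ltr0_neq0 h).
rewrite /carg leNgt h /= ltrN2 oppr_lt0.
by rewrite acos_gt0 ?acos_ltpi// ?a ?b ?(ltW a) ?(ltW b).
Qed.

(** For c <> 0 the values of [jfac g] on H stay in one open half-plane, upper or lower according to
    the sign of c. Two principal arguments then differ by less than pi, so the branch cut is never
    crossed and [clog_near] applies. For c = 0 the factor is constant. *)
Lemma cpow_jfac_shift g z h s : SL2Z g -> upper_half z -> upper_half (z + h) ->
  cabs ((g 1 0)%:~R * h / jfac g z) <= 1 / 12 :> R ->
  exists2 l : C, cpow (jfac g (z + h)) s = cpow (jfac g z) s * cexp (s%:C * l) &
    cabs (l - (g 1 0)%:~R * h / jfac g z)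
      <= 288 * cabs ((g 1 0)%:~R * h / jfac g z) ^+ 2.
Proof.
move=> sg hz hzh; set d := _ * h / _ => hd.
have j0 := jfac_neq0 sg hz; have j1 := jfac_neq0 sg hzh.
have jE : jfac g (z + h) = jfac g z * (1 + d).
  by rewrite /d mulrDr mulr1 mulrC mulfVK// /jfac; ring.
exists (clog (jfac g (z + h)) - clog (jfac g z)).
  by rewrite /cpow -cexpD; congr cexp; ring.
have [c0|c0] := eqVneq (g 1 0) 0.
  have d0 : d = 0 by rewrite /d c0 !mul0r.
  by rewrite jE d0 addr0 mulr1 subrr subrr cabs0 expr0n mulr0.
apply: clog_near => //.
  by rewrite cexpB !clogK// jE mulrC mulKf.
have Ic w : Im (clog w) = carg w by [].
rewrite ImD ImN !Ic.
have I1 := Im_jfac g z; have I2 := Im_jfac g (z + h).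
move: hz hzh; rewrite /upper_half /= => hz hzh.
have [cp|cp] : (0 < (g 1 0)%:~R :> R) \/ ((g 1 0)%:~R < 0 :> R).
  by rewrite ltr0z ltrz0; lia.
  have /carg_upper/andP[? ?] : 0 < Im (jfac g z) by rewrite I1 mulr_gt0.
  have /carg_upper/andP[? ?] : 0 < Im (jfac g (z + h)) by rewrite I2 mulr_gt0.
  by rewrite ltr_norml; lra.
have /carg_lower/andP[? ?] : Im (jfac g z) < 0 by rewrite I1 nmulr_rlt0.
have /carg_lower/andP[? ?] : Im (jfac g (z + h)) < 0 by rewrite I2 nmulr_rlt0.
by rewrite ltr_norml; lra.
Qed.

(* Bounds independent of g: |c / j| <= 1 / Im z, and |j| >= min 1 (Im z). *)
Lemma jfac_lb g z (Y : R) : SL2Z g -> 0 < Y <= 1 -> Y <= Im z ->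
  Y <= cabs (jfac g z) /\ `|(g 1 0)%:~R| * Y <= cabs (jfac g z).
Proof.
move=> sg /andP[Y0 Y1] Yz.
have H : `|(g 1 0)%:~R| * Y <= cabs (jfac g z).
  apply: le_trans (Im_le_cabs _); rewrite Im_jfac normrM.
  by rewrite ler_wpM2l// (le_trans Yz)// ler_norm.
split=> //; have [c0|c0] := eqVneq (g 1 0) 0.
  move: (SL2Z_row_neq0 sg); rewrite c0 eqxx /= => d0.
  apply: (le_trans Y1); rewrite /jfac c0 mul0r add0r intrCE cabs_real.
  by rewrite -intr_norm ler1z; lia.
apply: le_trans H; rewrite -[leLHS]mul1r ler_wpM2r ?(ltW Y0)//.
by rewrite -intr_norm ler1z; lia.
Qed.

(** For s = -k and A = 2 pi eta / n this is, up to a constant of modulus 1, a term of the slashed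
    Poincare series. *)
Definition pterm (s A : R) g z : C :=
  cpow (jfac g z) s * cexp ((0 +i* A) * mobius g z).

(** K and d do not depend on g and the error is proportional to |pterm|, so the estimate can be
    summed over all bottom rows. D is the logarithmic derivative s c / j + i A / j^2. *)
Lemma pterm_taylor (s A Y : R) : 0 < Y <= 1 ->
  exists K d : R, [/\ 0 <= K, 0 < d & forall g, SL2Z g ->
  exists D : C -> C, forall z, Y <= Im z -> cabs (D z) <= K /\
    forall h, cabs h <= d ->
    cabs (pterm s A g (z + h) - pterm s A g z - pterm s A g z * D z * h)
      <= K * cabs (pterm s A g z) * cabs h ^+ 2].
Proof.
move=> Y01; have /andP[Y0 Y1] := Y01.
pose K1 := `|s| / Y + `|A| / Y ^+ 2.
pose K2 := 288 * `|s| / Y ^+ 2 + 2 * `|A| / Y ^+ 3.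
have K10 : 0 <= K1 by rewrite addr_ge0 ?divr_ge0// ?exprn_ge0 ?ltW.
have K20 : 0 <= K2.
  by apply: addr_ge0; (apply: divr_ge0; last by rewrite exprn_ge0// ltW);
    (apply: mulr_ge0; [exact: ler0n|exact: normr_ge0]).
pose K := K1 + (8 * (K1 + K2) ^+ 2 + K2).
(* The first bound gives |c h / j| <= 1 / 12 as [cpow_jfac_shift] demands; the second gives |rho| <=
   1 / 2 for [cexp_taylor]. *)
pose d := Num.min (Y / 12) (2 * (K1 + K2 + 1))^-1.
have d0 : 0 < d.
  by rewrite lt_min divr_gt0//= invr_gt0 mulr_gt0// ltr_wpDl// addr_ge0.
exists K, d; split=> //.
  by apply: addr_ge0 => //; apply: addr_ge0 => //; apply: mulr_ge0 => //; exact: sqr_ge0.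
move=> g sg.
exists (fun z => s%:C * ((g 1 0)%:~R / jfac g z) + (0 +i* A) / jfac g z ^+ 2).
move=> z Yz.
have hz : upper_half z by rewrite /upper_half /= (lt_le_trans Y0).
have j0 := jfac_neq0 sg hz; have jp := cabs_jfac_gt0 sg hz.
have [jY jcY] := jfac_lb sg Y01 Yz.
have cA : cabs (0 +i* A : C) = `|A|.
  by rewrite cabsE /= expr0n add0r sqrtr_sqr.
have cj : cabs ((g 1 0)%:~R / jfac g z) <= Y^-1.
  rewrite cabsM cabsV intrCE cabs_real ler_pdivrMr// -ler_pdivrMl ?invr_gt0//.
  by rewrite invrK mulrC.
have ij : (cabs (jfac g z))^-1 <= Y^-1 by rewrite lef_pV2.
have Y'0 : 0 < Y^-1 by rewrite invr_gt0.
have DK1 : cabs (s%:C * ((g 1 0)%:~R / jfac g z) + (0 +i* A) / jfac g z ^+ 2) <= K1.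
  apply: le_trans (cabsD _ _) _; rewrite cabsM cabs_real; apply: lerD.
    by rewrite ler_wpM2l.
  rewrite cabsM cA cabsV cabsX ler_wpM2l// -!exprVn lerXn2r// ?nnegrE//.
    by rewrite invr_ge0 cabs_ge0.
  exact: ltW.
split.
  apply: le_trans DK1 _; rewrite lerDl; apply: addr_ge0 => //.
  by apply: mulr_ge0 => //; exact: sqr_ge0.
move=> h hd.
have h0 := cabs_ge0 h.
have hY : cabs h <= Y / 12 by apply: le_trans hd _; rewrite ge_min lexx.
have K120 : 0 < 2 * (K1 + K2 + 1) by lra.
have hK : cabs h * (2 * (K1 + K2 + 1)) <= 1.
  rewrite -ler_pdivlMr// div1r.
  by apply: le_trans hd _; rewrite ge_min lexx orbT.
have h1 : cabs h <= 1 by nra.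
have Yh : Y / 2 <= Im (z + h).
  have := Im_le_cabs h; rewrite ImD ler_norml => /andP[]; lra.
have hzh : upper_half (z + h) by rewrite /upper_half /=; lra.
have j1 := jfac_neq0 sg hzh.
have jY' : Y / 2 <= cabs (jfac g (z + h)).
  by have [] := @jfac_lb g (z + h) (Y / 2) sg _ Yh; lra.
set u := (g 1 0)%:~R * h / jfac g z.
have uE : u = (g 1 0)%:~R / jfac g z * h by rewrite /u mulrAC.
have cu : cabs u <= Y^-1 * cabs h by rewrite uE cabsM ler_wpM2r.
have cu12 : cabs u <= 1 / 12.
  by apply: le_trans cu _; rewrite ler_pdivrMl//; lra.
have [l El Bl] := cpow_jfac_shift s sg hz hzh cu12.
set v := h / (jfac g z * jfac g (z + h)).
have vE : mobius g (z + h) = mobius g z + v.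
  have -> : v = mobius g (z + h) - mobius g z.
    by rewrite mobiusB// /v addrAC subrr add0r.
  by ring.
set rho := s%:C * l + (0 +i* A) * v.
have TE : pterm s A g (z + h) = pterm s A g z * cexp rho.
  by rewrite /pterm El vE mulrDr !cexpD; ring.
set D := _ + _ in DK1 *.
have rD : cabs (rho - D * h) <= K2 * cabs h ^+ 2.
  have -> : rho - D * h = s%:C * (l - u) + (0 +i* A) * (v - h / jfac g z ^+ 2).
    by rewrite /rho /D uE; ring.
  apply: le_trans (cabsD _ _) _; rewrite !cabsM cabs_real cA [leRHS]mulrDl.
  apply: lerD.
    have -> : 288 * `|s| / Y ^+ 2 * cabs h ^+ 2 =
        `|s| * (288 * (Y^-1 * cabs h) ^+ 2) by field; rewrite lt0r_neq0.
    apply: ler_wpM2l; first exact: normr_ge0.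
    apply: le_trans Bl _; apply: ler_wpM2l; first exact: ler0n.
    apply: lerXn2r => //; rewrite nnegrE ?cabs_ge0//.
    by apply: mulr_ge0 => //; exact: ltW.
  have -> : v - h / jfac g z ^+ 2 = - (u * (h / (jfac g z * jfac g (z + h)))).
    rewrite /v /u.
    have -> : jfac g (z + h) = jfac g z + (g 1 0)%:~R * h by rewrite /jfac; ring.
    have : jfac g z + (g 1 0)%:~R * h != 0.
      by move: j1; apply: contra_neq => <-; rewrite /jfac; ring.
    by move: j0 => /[swap] ? ?; field; apply/andP.
  have -> : 2 * `|A| / Y ^+ 3 * cabs h ^+ 2 =
      `|A| * ((Y^-1 * cabs h) * (cabs h * (Y^-1 * (Y / 2)^-1))).
    by field; rewrite lt0r_neq0.
  rewrite ler_wpM2l// cabsN cabsM ler_pM ?cabs_ge0//.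
  rewrite cabsM cabsV cabsM ler_wpM2l// invfM ler_pM ?invr_ge0 ?cabs_ge0//.
  by rewrite lef_pV2 ?posrE ?divr_gt0// cabs_gt0.
have rb : cabs rho <= (K1 + K2) * cabs h.
  have -> : rho = (rho - D * h) + D * h by ring.
  apply: le_trans (cabsD _ _) _; rewrite (cabsM D) [leRHS]mulrDl [leRHS]addrC; apply: lerD.
    by apply: le_trans rD _; rewrite ler_wpM2l// expr2 -[leRHS]mul1r ler_wpM2r.
  by rewrite ler_wpM2r.
have r12 : cabs rho <= 1 / 2.
  by apply: le_trans rb _; move: hK; rewrite mulrCA mulrDr mulr1 [_ * cabs h]mulrC; lra.
have -> : pterm s A g (z + h) - pterm s A g z - pterm s A g z * D * h =
    pterm s A g z * ((cexp rho - 1 - rho) + (rho - D * h)) by rewrite TE; ring.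
rewrite cabsM mulrAC [leRHS]mulrC ler_wpM2l ?cabs_ge0//.
apply: le_trans (cabsD _ _) _.
have r0 := cabs_ge0 rho.
apply: (@le_trans _ _ (8 * ((K1 + K2) ^+ 2 * cabs h ^+ 2) + K2 * cabs h ^+ 2)).
  apply: lerD => //; apply: le_trans (cexp_taylor r12) _; rewrite ler_wpM2l//.
  rewrite -exprMn; apply: lerXn2r => //; rewrite nnegrE ?cabs_ge0//.
  by rewrite mulr_ge0// addr_ge0.
have -> : K * cabs h ^+ 2 = K1 * cabs h ^+ 2 +
    (8 * ((K1 + K2) ^+ 2 * cabs h ^+ 2) + K2 * cabs h ^+ 2) by rewrite /K; ring.
by rewrite lerDr mulr_ge0// sqr_ge0.
Qed.

End LogTaylor.

(** * Holomorphic functions and Fourier expansions *)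

Section Holomorphic.
Variable R : realType.
Local Notation C := R[i].
Local Notation Re := complex.Re.
Local Notation Im := complex.Im.
Local Notation H := (@upper_half R).
Implicit Types (z w h : C) (g : 'M[int]_2) (f : C -> C).

Lemma gt0_complexE (e : C) : 0 < e -> e = (Re e)%:C /\ 0 < Re e.
Proof. by case: e => a b; rewrite ltcE /= => /andP[/eqP -> ->]. Qed.

(** The norm of [C^o] is complex-valued; this form has real epsilon and delta and allows h = 0. *)
Lemma derivable_epsP f z : derivable (f : C^o -> C^o) z 1 <->
  exists l : C, forall e : R, 0 < e -> exists2 d : R, 0 < d &
    forall h, cabs h < d -> cabs (f (z + h) - f z - l * h) <= e * cabs h.
Proof.
split.
  move=> /cvg_ex[l /cvgrPdist_le Hl]; exists l => e e0.
  have e0' : (0 : C) < e%:C by rewrite ltcR.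
  have [d /= d0 Hd] := Hl _ e0'.
  have [dE d0'] := gt0_complexE d0.
  exists (Re d) => // h hd.
  have [->|h0] := eqVneq h 0.
    by rewrite addr0 subrr mulr0 subrr cabs0 mulr0.
  have := Hd h _ h0; rewrite /ball_ /= sub0r normrN normCE dE ltcR => /(_ hd).
  rewrite normCE lecR /GRing.scale /= mulr1 [h + z]addrC => Hh.
  have -> : f (z + h) - f z - l * h = - (h * (l - h^-1 * (f (z + h) - f z))).
    by rewrite mulrBr mulVKf//; ring.
  by rewrite cabsN cabsM mulrC ler_wpM2r ?cabs_ge0.
case=> l Hl; apply/cvg_ex; exists l; apply/cvgrPdist_le => e /gt0_complexE[-> e0].
have [d d0 Hd] := Hl _ e0.
exists d%:C => /=; first by rewrite ltcR.
move=> h; rewrite /ball_ /= sub0r normrN normCE ltcR => hd h0.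
rewrite normCE lecR /GRing.scale /= mulr1 [h + z]addrC.
have := Hd h hd; rewrite -ler_pdivrMr ?cabs_gt0//.
rewrite -cabsV -cabsM -cabsN; congr (cabs _ <= _); field.
exact: h0.
Qed.

Lemma taylor_derivable f z (l : C) (K d : R) : 0 < d ->
  (forall h, cabs h <= d -> cabs (f (z + h) - f z - l * h) <= K * cabs h ^+ 2) ->
  derivable (f : C^o -> C^o) z 1.
Proof.
move=> d0 Hf; apply/derivable_epsP; exists l => e e0.
have K1 : 0 < `|K| + 1 by rewrite ltr_wpDl.
exists (Num.min d (e / (`|K| + 1))) => [|h]; first by rewrite lt_min d0 divr_gt0.
rewrite lt_min => /andP[hd he]; apply: le_trans (Hf _ (ltW hd)) _.
rewrite expr2 mulrA ler_wpM2r ?cabs_ge0//.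
move: he; rewrite ltr_pdivlMr// => he; have := ler_norm K; have := cabs_ge0 h; nra.
Qed.

Definition holo f := forall z, H z -> derivable (f : C^o -> C^o) z 1.

Lemma holo_cst (c : C) : holo (fun=> c).
Proof. by move=> z hz; exact: derivable_cst. Qed.

Lemma holoM f1 f2 : holo f1 -> holo f2 -> holo (fun z => f1 z * f2 z).
Proof. by move=> h1 h2 z hz; apply: derivableM; [exact: h1|exact: h2]. Qed.

Lemma holoD f1 f2 : holo f1 -> holo f2 -> holo (fun z => f1 z + f2 z).
Proof. by move=> h1 h2 z hz; apply: derivableD; [exact: h1|exact: h2]. Qed.

Lemma holoV f : holo f -> (forall z, H z -> f z != 0) -> holo (fun z => (f z)^-1).
Proof. by move=> h1 h2 z hz; apply: derivableV; [exact: h2|exact: h1]. Qed.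

Lemma holo_pterm (s A : R) g : SL2Z g -> holo (pterm s A g).
Proof.
move=> sg z hz.
have Y0 : 0 < Num.min 1 (Im z) <= 1 by rewrite lt_min ltr01 /= hz ge_min lexx.
have [K [d [K0 d0 /(_ g sg)[D HD]]]] := pterm_taylor s A Y0.
have [|_ Hh] := HD z _; first by rewrite ge_min lexx orbT.
exact: taylor_derivable d0 Hh.
Qed.

Lemma holo_cpow_jfac (s : R) g : SL2Z g -> holo (fun z => cpow (jfac g z) s).
Proof.
move=> sg; have -> : (fun z => cpow (jfac g z) s) = pterm s 0 g; last exact: holo_pterm.
by apply/funext => z; rewrite /pterm mul0r cexp0 mulr1.
Qed.

Lemma holo_jfac g : holo (jfac g : C -> C).
Proof.
move=> z hz; apply: (@taylor_derivable _ _ ((g 1 0)%:~R) 0 1) => // h _.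
by rewrite (_ : _ - _ = 0) ?cabs0 ?mul0r// /jfac; ring.
Qed.

Lemma holo_mobius g : SL2Z g -> holo (mobius g : C -> C).
Proof.
move=> sg; apply: holoM; last first.
  by apply: holoV => [|z hz]; [exact: holo_jfac|exact: jfac_neq0].
move=> z hz; apply: (@taylor_derivable _ _ ((g 0 0)%:~R) 0 1) => // h _.
by rewrite (_ : _ - _ = 0) ?cabs0 ?mul0r//; ring.
Qed.

Lemma holo_comp f g : holo f -> SL2Z g -> holo (fun z => f (mobius g z)).
Proof.
move=> hf sg z hz; apply/derivable1_diffP.
apply: (@differentiable_comp _ (C^o) (C^o) (C^o) (mobius g : C^o -> C^o) (f : C^o -> C^o)).
  by apply/derivable1_diffP; exact: holo_mobius.
by apply/derivable1_diffP; apply: hf; exact: mobius_upper.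
Qed.

Lemma derive0_eps_cst (phi : R -> R) :
  (forall t : R, 0 <= t <= 1 -> forall e : R, 0 < e -> exists2 d : R, 0 < d &
    forall s : R, `|s| < d -> `|phi (t + s) - phi t| <= e * `|s|) ->
  phi 0 = phi 1.
Proof.
move=> Hp.
have D (t : R) : 0 <= t <= 1 -> is_derive t 1 (phi : R^o -> R^o) 0.
  move=> t01; have : (fun h : R => h^-1 *: ((phi \o shift t) (h *: (1 : R^o)) - phi t)) @ 0^' --> (0 : R^o).
    apply/cvgrPdist_le => e e0; have [d d0 Hd] := Hp t t01 e e0.
    exists d => //= h; rewrite /ball_ /= sub0r normrN => hd h0.
    rewrite sub0r normrN normrM normfV /GRing.scale /= mulr1 mulrC.
    by rewrite ler_pdivrMr ?normr_gt0// [h + t]addrC; exact: Hd.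
  move=> c; apply: DeriveDef; last exact: cvg_lim c.
  by apply/cvg_ex; exists 0.
have [c _] : exists2 c, c \in `[0 : R, 1] & phi 1 - phi 0 = 0 * (1 - 0).
  apply: (@MVT_segment R phi (fun=> 0)) => //.
    by move=> x; rewrite in_itv /= => /andP[a b]; apply: D; rewrite !ltW.
  apply: derivable_within_continuous => x; rewrite in_itv /= => x01.
  exact: (@ex_derive _ _ _ _ _ _ _ (D x x01)).
by rewrite mul0r => /subr0_eq.
Qed.

(** A derivative l <> 0 at z is impossible: for small s > 0, h = s f(z) / l moves f(z) to about (1 +
    s) f(z), of modulus above 1. So the derivative vanishes on H, and the mean value theorem on
    segments concludes. This identifies all constant phases below. *)
Lemma holo_unimodular_cst f : holo f -> (forall z, H z -> cabs (f z) = 1) ->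
  forall z w, H z -> H w -> f z = f w.
Proof.
move=> hf f1.
have L z : H z -> forall e : R, 0 < e -> exists2 d : R, 0 < d &
    forall h, cabs h < d -> cabs (f (z + h) - f z) <= e * cabs h.
  move=> hz; have /derivable_epsP[l Hl] := hf z hz.
  suff l0 : l = 0.
    by move=> e /Hl[d d0 Hd]; exists d => // h /Hd; rewrite l0 mul0r subr0.
  apply: contrapT => /eqP l0; have cl : 0 < cabs l by rewrite cabs_gt0.
  have cl2 : 0 < cabs l / 2 by rewrite divr_gt0.
  have [d d0 Hd] := Hl _ cl2.
  pose s := Num.min d (Im z) * cabs l / 2.
  have m0 : 0 < Num.min d (Im z) by rewrite lt_min d0.
  have s0 : 0 < s by rewrite divr_gt0// mulr_gt0.
  pose h := s%:C * f z / l.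
  have ch : cabs h = Num.min d (Im z) / 2.
    rewrite /h !cabsM cabsV f1// cabs_real ger0_norm ?ltW// /s.
    by field; exact: lt0r_neq0.
  have hd : cabs h < d.
    rewrite ch; apply: (@lt_le_trans _ _ (Num.min d (Im z))); last by rewrite ge_min lexx.
    by rewrite ltr_pdivrMr//; lra.
  have hzh : H (z + h).
    have : cabs h < Im z.
      rewrite ch; apply: (@lt_le_trans _ _ (Num.min d (Im z))); last by rewrite ge_min lexx orbT.
      by rewrite ltr_pdivrMr//; lra.
    by have := Im_le_cabs h; rewrite /upper_half /= ImD ler_norml => /andP[]; lra.
  have := Hd h hd; rewrite ch (_ : l * h = s%:C * f z); last first.
    by rewrite /h mulrC mulfVK.
  have : cabs (f z + s%:C * f z) <= cabs (f (z + h)) +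
      cabs (f (z + h) - f z - s%:C * f z).
    rewrite [X in X <= _](_ : _ = cabs (f (z + h) - (f (z + h) - f z - s%:C * f z))).
      exact: cabsB.
    by congr cabs; ring.
  have -> : cabs (f z + s%:C * f z) = 1 + s.
    rewrite -{1}[f z]mul1r -mulrDl cabsM f1// mulr1.
    have -> : 1 + s%:C = (1 + s)%:C by rewrite (rmorphD (real_complex R)).
    rewrite cabs_real.
    by rewrite ger0_norm// addr_ge0// ltW.
  by rewrite f1// /s => h1 h2; have := le_trans h1 (lerD (lexx _) h2); nra.
move=> z w hz hw.
have Hseg (t : R) : 0 <= t <= 1 -> H (z + t%:C * (w - z)).
  move: hz hw; rewrite /upper_half /= ImD ImZ ImD ImN => hz hw /andP[t0 t1]; nra.
have K (t : R) : 0 <= t <= 1 -> forall e : R, 0 < e -> exists2 d : R, 0 < d &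
    forall s : R, `|s| < d -> cabs (f (z + (t + s)%:C * (w - z)) -
      f (z + t%:C * (w - z))) <= e * `|s|.
  move=> t01 e e0.
  have W0 : 0 < cabs (w - z) + 1 by rewrite ltr_wpDl ?cabs_ge0.
  have [d d0 Hd] := L _ (Hseg t t01) (e / (cabs (w - z) + 1)) (divr_gt0 e0 W0).
  exists (d / (cabs (w - z) + 1)) => [|s]; first by rewrite divr_gt0.
  rewrite ltr_pdivlMr// => sd.
  have -> : z + (t + s)%:C * (w - z) = z + t%:C * (w - z) + s%:C * (w - z).
    by rewrite (rmorphD (real_complex R)); ring.
  have cs : cabs (s%:C * (w - z)) = `|s| * cabs (w - z) by rewrite cabsM cabs_real.
  have s0 := normr_ge0 s; have wz0 := cabs_ge0 (w - z).
  apply: le_trans (Hd _ _) _; first by rewrite cs; nra.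
  rewrite cs (_ : _ * _ = e * `|s| * (cabs (w - z) / (cabs (w - z) + 1))); last by ring.
  rewrite ler_piMr ?mulr_ge0 ?(ltW e0)// ler_pdivrMr// mul1r; lra.
have E0 : f (z + 0%:C * (w - z)) = f z by rewrite mul0r addr0.
have E1 : f (z + 1%:C * (w - z)) = f w by rewrite mul1r addrC subrK.
rewrite -E0 -E1.
have eqRI (a b : C) : Re a = Re b -> Im a = Im b -> a = b.
  by case: a b => [a a'] [b b'] /= -> ->.
apply: eqRI.
  apply: (@derive0_eps_cst (fun t => Re (f (z + t%:C * (w - z))))).
  move=> t t01 e e0; have [d d0 Hd] := K t t01 e e0; exists d => // s /Hd.
  by apply: le_trans; rewrite -ReN -ReD Re_le_cabs.
apply: (@derive0_eps_cst (fun t => Im (f (z + t%:C * (w - z))))).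
move=> t t01 e e0; have [d d0 Hd] := K t t01 e e0; exists d => // s /Hd.
by apply: le_trans; rewrite -ImN -ImD Im_le_cabs.
Qed.

End Holomorphic.

(** * Averages over equispaced points of a horizontal period *)

Section Averages.
Variable R : realType.
Local Notation C := R[i].
Local Notation Re := complex.Re.
Local Notation Im := complex.Im.
Local Notation H := (@upper_half R).
Implicit Types (z w h : C) (f p : C -> C).

(** Holomorphy made quantitative: the constants hold along entire horizontal lines, hence at all
    sample points at once, and the property passes to products. *)
Definition taylor_on (Y1 Y2 : R) f := exists K d : R, exists D : C -> C,
  [/\ 0 <= K, 0 < d, d <= 1 & forall z, Y1 <= Im z <= Y2 ->
   [/\ cabs (f z) <= K, cabs (D z) <= K &
     forall h, cabs h <= d -> cabs (f (z + h) - f z - D z * h) <= K * cabs h ^+ 2]].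

Lemma taylor_onM Y1 Y2 f1 f2 : taylor_on Y1 Y2 f1 -> taylor_on Y1 Y2 f2 ->
  taylor_on Y1 Y2 (fun z => f1 z * f2 z).
Proof.
move=> [K1 [d1 [D1 [K10 d10 d11 H1]]]] [K2 [d2 [D2 [K20 d20 d21 H2]]]].
have KK : 0 <= K1 * K2 by rewrite mulr_ge0.
exists (6 * (K1 * K2)), (Num.min d1 d2), (fun z => D1 z * f2 z + f1 z * D2 z).
split.
- by rewrite mulr_ge0.
- by rewrite lt_min d10.
- by rewrite ge_min d11.
move=> z hz; have [a1 b1 c1] := H1 z hz; have [a2 b2 c2] := H2 z hz.
split.
- by rewrite cabsM; apply: le_trans (ler_pM _ _ a1 a2) _; rewrite ?cabs_ge0//; lra.
- apply: le_trans (cabsD _ _) _; rewrite !cabsM.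
  have := ler_pM (cabs_ge0 _) (cabs_ge0 _) b1 a2.
  have := ler_pM (cabs_ge0 _) (cabs_ge0 _) a1 b2; lra.
move=> h; rewrite le_min => /andP[hd1 hd2].
have {}c1 := c1 h hd1; have {}c2 := c2 h hd2.
have h0 := cabs_ge0 h; have h1 : cabs h <= 1 by apply: le_trans d11.
have hh : cabs h ^+ 2 <= cabs h by rewrite expr2 ler_piMr.
have e2 : cabs (f2 (z + h) - f2 z) <= 2 * K2 * cabs h.
  have -> : f2 (z + h) - f2 z = (f2 (z + h) - f2 z - D2 z * h) + D2 z * h by ring.
  apply: le_trans (cabsD _ _) _; rewrite cabsM.
  have : K2 * cabs h ^+ 2 <= K2 * cabs h by rewrite ler_wpM2l.
  have : cabs (D2 z) * cabs h <= K2 * cabs h by rewrite ler_wpM2r.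
  lra.
have f2h : cabs (f2 (z + h)) <= 3 * K2.
  have -> : f2 (z + h) = (f2 (z + h) - f2 z) + f2 z by ring.
  apply: le_trans (cabsD _ _) _.
  have : 2 * K2 * cabs h <= 2 * K2 by rewrite ler_piMr// mulr_ge0.
  lra.
have -> : f1 (z + h) * f2 (z + h) - f1 z * f2 z -
    (D1 z * f2 z + f1 z * D2 z) * h =
    (f1 (z + h) - f1 z - D1 z * h) * f2 (z + h) +
    f1 z * (f2 (z + h) - f2 z - D2 z * h) + D1 z * h * (f2 (z + h) - f2 z) by ring.
apply: le_trans (cabsD _ _) _.
have := cabsD ((f1 (z + h) - f1 z - D1 z * h) * f2 (z + h))
  (f1 z * (f2 (z + h) - f2 z - D2 z * h)).
rewrite !cabsM.
have := ler_pM (cabs_ge0 _) (cabs_ge0 _) c1 f2h.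
have := ler_pM (cabs_ge0 _) (cabs_ge0 _) a1 c2.
have b1' : cabs (D1 z) * cabs h <= K1 * cabs h by rewrite ler_wpM2r.
have b0 : 0 <= cabs (D1 z) * cabs h by rewrite mulr_ge0 ?cabs_ge0.
have := ler_pM b0 (cabs_ge0 _) b1' e2.
lra.
Qed.

Lemma taylor_on_cexp Y1 Y2 (b : R) : 0 < Y1 ->
  taylor_on Y1 Y2 (fun z => cexp ((0 +i* b) * z)).
Proof.
move=> Y10; pose B := 0 +i* b : C.
have cB : cabs B = `|b| by rewrite cabsE /= expr0n add0r sqrtr_sqr.
have b0 := normr_ge0 b.
pose S := expR (`|b| * `|Y2|); have S0 : 0 < S by exact: expR_gt0.
have b1 : 0 < 2 * (`|b| + 1) by rewrite mulr_gt0// ltr_wpDl.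
exists (S * (1 + `|b| + 8 * `|b| ^+ 2)), (Num.min 1 (2 * (`|b| + 1))^-1),
  (fun z => cexp (B * z) * B); split.
- by rewrite mulr_ge0 ?(ltW S0)// !addr_ge0// mulr_ge0// exprn_ge0.
- by rewrite lt_min ltr01 invr_gt0.
- by rewrite ge_min lexx.
move=> z /andP[z1 z2].
have cz : cabs (cexp (B * z)) <= S.
  rewrite cabs_cexp ler_expR ReM /= mul0r sub0r -mulNr.
  apply: le_trans (ler_norm _) _; rewrite normrM normrN ler_wpM2l//.
  by rewrite !ger0_norm//; lra.
have q0 := sqr_ge0 `|b|.
split.
- by apply: le_trans cz _; rewrite ler_peMr ?(ltW S0)//; lra.
- rewrite cabsM cB; apply: le_trans (ler_pM (cabs_ge0 _) b0 cz (lexx _)) _.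
  by rewrite ler_wpM2l ?(ltW S0)//; lra.
move=> h; rewrite le_min => /andP[_ hd].
have h0 := cabs_ge0 h.
have hb : cabs (B * h) <= 1 / 2.
  rewrite cabsM cB; move: hd; rewrite -div1r ler_pdivlMr//.
  have := mulr_ge0 b0 h0; lra.
have -> : cexp (B * (z + h)) - cexp (B * z) - cexp (B * z) * B * h =
   cexp (B * z) * (cexp (B * h) - 1 - B * h) by rewrite mulrDr cexpD; ring.
rewrite cabsM; apply: le_trans (ler_pM (cabs_ge0 _) (cabs_ge0 _) cz (cexp_taylor hb)) _.
rewrite cabsM cB exprMn -mulrA ler_wpM2l ?(ltW S0)// mulrA ler_wpM2r ?sqr_ge0//.
lra.
Qed.

Variable n : nat.
Hypothesis n0 : (0 < n)%N.
Let nR : 0 < n%:R :> R. Proof. by rewrite ltr0n. Qed.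

Definition avg f (N : nat) z : C :=
  N%:R^-1 * \sum_(0 <= j < N) f (z + (j%:R * (n%:R / N%:R))%:C).

Definition periodic_on_H f := forall z, H z -> f (z + n%:R%:C) = f z.

Lemma avg_bound f N z (B : R) : 0 <= B ->
  (forall x : R, cabs (f (z + x%:C)) <= B) -> cabs (avg f N z) <= B.
Proof.
move=> B0 Hf; rewrite /avg cabsM cabsV cabs_nat.
case: N => [|N]; first by rewrite invr0 mul0r.
rewrite ler_pdivrMl ?ltr0n//; apply: le_trans (cabs_sum _ _ _) _.
apply: (@le_trans _ _ (\sum_(0 <= j < N.+1) B)); first exact: ler_sum.
by rewrite sumr_const_nat subn0 mulr_natl.
Qed.

(** By periodicity the increments of f between consecutive sample points add up to 0, and their
    Taylor expansions then show that the mean of the derivative D is O(1 / N). A shift by h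
    therefore changes the average by O(|h| / N + |h|^2) only. *)
Lemma avg_shift f Y1 Y2 : 0 < Y1 -> periodic_on_H f -> taylor_on Y1 Y2 f ->
  exists2 K, 0 <= K & exists2 d, 0 < d & forall N z h, (0 < N)%N ->
   n%:R / N%:R <= d -> cabs h <= d -> Y1 <= Im z <= Y2 ->
   cabs (avg f N (z + h) - avg f N z) <= K * n%:R * cabs h / N%:R + K * cabs h ^+ 2.
Proof.
move=> Y10 pf [K [d [D [K0 d0 d1 Hf]]]]; exists K => //; exists d => // N z h N0 Nd hd hz.
have NR : 0 < N%:R :> R by rewrite ltr0n.
pose de := n%:R / N%:R : R; have de0 : 0 < de by rewrite divr_gt0.
pose zj (j : nat) := z + (j%:R * de)%:C.
have Imz j : Im (zj j) = Im z by rewrite ImD /= addr0.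
have Hj j : Y1 <= Im (zj j) <= Y2 by rewrite Imz.
have zz : H z by rewrite /upper_half /=; case/andP: hz => *; lra.
have tel : \sum_(0 <= j < N) (f (zj j.+1) - f (zj j)) = 0.
  rewrite telescope_sumr// /zj mul0r addr0 (_ : N%:R * de = n%:R) ?pf ?subrr//.
  by rewrite /de mulrCA divff ?mulr1// gt_eqF.
have zS j : zj j.+1 = zj j + de%:C.
  by rewrite /zj -addrA -(rmorphD (real_complex R)) -[j.+1]addn1 natrD mulrDl mul1r.
have cde : cabs de%:C = de by rewrite cabs_real ger0_norm// ltW.
have SD : cabs (\sum_(0 <= j < N) D (zj j)) <= N%:R * K * de.
  have : cabs (\sum_(0 <= j < N) D (zj j) * de%:C) <= N%:R * (K * de ^+ 2).
    have -> : \sum_(0 <= j < N) D (zj j) * de%:C =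
        - \sum_(0 <= j < N) (f (zj j.+1) - f (zj j) - D (zj j) * de%:C).
      by rewrite sumrB tel sub0r opprK.
    rewrite cabsN; apply: le_trans (cabs_sum _ _ _) _.
    apply: (@le_trans _ _ (\sum_(0 <= j < N) K * de ^+ 2)).
      apply: ler_sum => j _; rewrite zS.
      by have [_ _ /(_ de%:C)] := Hf _ (Hj j); rewrite cde; apply.
    by rewrite sumr_const_nat subn0 mulr_natl.
  rewrite -mulr_suml cabsM cde; rewrite -ler_pdivlMr// => /le_trans; apply.
  have E (x y t : R) : t != 0 -> x * (y * t ^+ 2) / t = x * y * t.
    by move=> ?; field.
  by rewrite E ?gt_eqF.
have -> : avg f N (z + h) - avg f N z =
  N%:R^-1 * (\sum_(0 <= j < N) (f (zj j + h) - f (zj j) - D (zj j) * h)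
    + (\sum_(0 <= j < N) D (zj j)) * h).
  rewrite /avg -mulrBr; congr (_ * _); rewrite mulr_suml -big_split -sumrB /=.
  apply: eq_big_nat => j _; by rewrite subrK /zj addrAC.
rewrite cabsM cabsV cabs_nat ler_pdivrMl//.
apply: le_trans (cabsD _ _) _; rewrite cabsM addrC.
have E : N%:R * (K * n%:R * cabs h / N%:R + K * cabs h ^+ 2) =
  N%:R * K * de * cabs h + N%:R * (K * cabs h ^+ 2).
  by rewrite /de; field; rewrite gt_eqF.
rewrite E; apply: lerD; first by rewrite ler_wpM2r ?cabs_ge0.
apply: le_trans (cabs_sum _ _ _) _.
apply: (@le_trans _ _ (\sum_(0 <= j < N) K * cabs h ^+ 2)).
  by apply: ler_sum => j _; have [_ _] := Hf _ (Hj j); apply.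
by rewrite sumr_const_nat subn0 mulr_natl.
Qed.

Lemma avg_double f N z : (0 < N)%N -> avg f (N + N) z =
  2^-1 * (avg f N z + avg f N (z + (n%:R / (N + N)%:R)%:C)).
Proof.
move=> N0; have NR : N%:R != 0 :> R by rewrite pnatr_eq0 -lt0n.
have NC : N%:R != 0 :> C by rewrite pnatr_eq0 -lt0n.
have S (F : nat -> C) M : \sum_(0 <= j < M + M) F j =
   \sum_(0 <= j < M) F (j + j)%N + \sum_(0 <= j < M) F (j + j).+1.
  elim: M => [|M IH]; first by rewrite !big_geq// addr0.
  rewrite addSn addnS !big_nat_recr//= IH; ring.
rewrite /avg S -mulrDr mulrA; congr (_ * _).
  by rewrite natrD -invfM; congr _^-1; ring.
congr (_ + _); apply: eq_big_nat => j _; congr (f _); rewrite natrD.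
  by congr (_ + _%:C); rewrite natrD; field; rewrite NR -mulr2n mulrn_eq0.
rewrite -addrA -(rmorphD (real_complex R)); congr (_ + _%:C).
by rewrite -natr1 natrD; field; rewrite NR -mulr2n mulrn_eq0.
Qed.

Lemma geometric_cauchy (u : nat -> C) (c : R) (s0 : nat) : 0 <= c ->
  (forall s, (s0 <= s)%N -> cabs (u s.+1 - u s) <= c / 2 ^+ s) ->
  exists a, forall e : R, 0 < e -> exists s1, forall s, (s1 <= s)%N ->
    cabs (u s - a) <= e.
Proof.
move=> c0 Hu.
have HR (v : nat -> R) : (forall s, (s0 <= s)%N -> `|v s.+1 - v s| <= c / 2 ^+ s) ->
    exists a : R, forall e, 0 < e -> exists s1, forall s, (s1 <= s)%N -> `|v s - a| <= e.
  move=> Hv.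
  have cv : cvgn v.
    pose w := fun s => v (s + s0)%N.
    suff cw : cvgn w by apply/cvg_ex; exists (limn w); rewrite -(cvg_shiftn s0); exact: cw.
    rewrite (_ : w = (fun s => w 0%N + series (telescope w) s)); last first.
      by apply/funext => s; exact: eq_sum_telescope.
    apply: is_cvgD; first exact: is_cvg_cst.
    apply: normed_cvg.
    apply: (@series_le_cvg _ _ (geometric (c / 2 ^+ s0) (1 / 2))).
    - by move=> s /=.
    - by move=> s /=; rewrite mulr_ge0// ?exprn_ge0// divr_ge0// exprn_ge0.
    - move=> s /=; rewrite /telescope /= /w addSn.
      apply: le_trans (Hv _ (leq_addl _ _)) _.
      by rewrite div1r exprVn exprD invfM mulrA mulrAC.
    apply: is_cvg_geometric_series; rewrite ger0_norm; lra.
  exists (limn v) => e e0; move/cvgrPdist_le : cv => /(_ e e0)[s1 _ Hs].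
  by exists s1 => s /Hs; rewrite distrC.
have [a Ha] := HR (fun s => Re (u s)) (fun s hs => le_trans
  (eq_ind _ (fun x => `|x| <= _) (Re_le_cabs _) _ (eq_trans (ReD _ _) (congr1 _ (ReN _))))
  (Hu s hs)).
have [b Hb] := HR (fun s => Im (u s)) (fun s hs => le_trans
  (eq_ind _ (fun x => `|x| <= _) (Im_le_cabs _) _ (eq_trans (ImD _ _) (congr1 _ (ImN _))))
  (Hu s hs)).
exists (a +i* b) => e e0; have e20 : 0 < e / 2 by rewrite divr_gt0.
have [s1 H1] := Ha _ e20; have [s2 H2] := Hb _ e20.
exists (maxn s1 s2) => s; rewrite geq_max => /andP[hs1 hs2].
apply: le_trans (cabs_le_ReIm _) _; rewrite ReD ImD ReN ImN /=.
by have := H1 s hs1; have := H2 s hs2; lra.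
Qed.

(** The path from z to w is cut into N steps, each of which costs O(1 / N^2) by [avg_shift]. In the
    limit the average depends on neither the point nor its height, which is what Cauchy's theorem
    would give. *)
Lemma avg_path f Y1 Y2 : 0 < Y1 -> periodic_on_H f -> taylor_on Y1 Y2 f ->
  forall z w, Y1 <= Im z <= Y2 -> Y1 <= Im w <= Y2 -> exists2 K, 0 <= K &
  exists N0, forall N, (N0 <= N)%N -> (0 < N)%N ->
    cabs (avg f N w - avg f N z) <= K / N%:R.
Proof.
move=> Y10 pf tf z w hz hw; have [K K0 [d d0 Hs]] := avg_shift Y10 pf tf.
have c0 := cabs_ge0 (w - z).
exists (K * n%:R * cabs (w - z) + K * cabs (w - z) ^+ 2).
  by rewrite addr_ge0// !mulr_ge0// ?exprn_ge0.
have [N0 HN0] : exists N0 : nat, (n%:R + cabs (w - z)) / d <= N0%:R.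
  exists (Num.truncn ((n%:R + cabs (w - z)) / d)).+1.
  by rewrite ltW// truncnS_gt.
exists N0 => N hN N1; have NR : 0 < N%:R :> R by rewrite ltr0n.
have Nd : n%:R + cabs (w - z) <= d * N%:R.
  rewrite mulrC -ler_pdivrMr//; apply: le_trans HN0 _; by rewrite ler_nat.
pose h := (N%:R^-1)%:C * (w - z).
have ch : cabs h = cabs (w - z) / N%:R.
  by rewrite cabsM cabs_real ger0_norm ?invr_ge0 ?ltW// mulrC.
pose zi (i : nat) := z + (i%:R)%:C * h.
have zS i : zi i.+1 = zi i + h.
  by rewrite /zi -addn1 natrD (rmorphD (real_complex R)); ring.
have Im_zi i : (i <= N)%N -> Y1 <= Im (zi i) <= Y2.
  move=> iN; rewrite /zi /h mulrA -(rmorphM (real_complex R)) ImD ImZ ImD ImN.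
  have t0 : 0 <= i%:R / N%:R :> R by rewrite divr_ge0// ltW.
  have t1 : i%:R / N%:R <= 1 :> R by rewrite ler_pdivrMr// mul1r ler_nat.
  move: hz hw => /andP[? ?] /andP[? ?]; apply/andP; split; nra.
have -> : avg f N w - avg f N z = \sum_(0 <= i < N) (avg f N (zi i.+1) - avg f N (zi i)).
  rewrite telescope_sumr// /zi mul0r addr0 /h mulrA -(rmorphM (real_complex R)).
  by rewrite divff ?gt_eqF// mul1r [z + (w - z)]addrC subrK.
apply: le_trans (cabs_sum _ _ _) _.
apply: (@le_trans _ _ (\sum_(0 <= i < N) (K * n%:R * cabs h / N%:R + K * cabs h ^+ 2))).
  rewrite big_nat [leRHS]big_nat; apply: ler_sum => i /andP[_ iN]; rewrite zS.
  apply: Hs => //; last by apply: Im_zi; exact: ltnW.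
    by rewrite ler_pdivrMr//; lra.
  rewrite ch ler_pdivrMr//; have : 0 <= n%:R :> R by [].
  lra.
rewrite sumr_const_nat subn0 -mulr_natl ch le_eqVlt; apply/orP; left; apply/eqP.
by field; rewrite gt_eqF.
Qed.

(** Doubling N averages the old average with its shift by n / (2 N), a change of O(1 / N^2) by
    [avg_shift]. So the averages along powers of 2 converge at the point i, and [avg_path] carries
    the limit to every z. *)
Lemma avg_lim f : periodic_on_H f ->
  (forall Y1 Y2, 0 < Y1 -> Y1 <= Y2 -> taylor_on Y1 Y2 f) ->
  exists a : C, forall z, H z -> forall e : R, 0 < e ->
    exists s1, forall s, (s1 <= s)%N -> cabs (avg f (2 ^ s) z - a) <= e.
Proof.
move=> pf tf.
have two_s s : (0 < 2 ^ s)%N by rewrite expn_gt0.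
have [a Ha] : exists a, forall e : R, 0 < e -> exists s1, forall s, (s1 <= s)%N ->
    cabs (avg f (2 ^ s) 'i - a) <= e.
  have [K K0 [d d0 Hs]] := avg_shift ltr01 pf (tf 1 1 ltr01 (lexx _)).
  have [s0 Hs0] : exists s0 : nat, n%:R / d <= s0%:R.
    exists (Num.truncn (n%:R / d)).+1.
    by rewrite ltW// truncnS_gt.
  apply: (@geometric_cauchy (fun s => avg f (2 ^ s) 'i) (K * n%:R ^+ 2) s0).
    by rewrite mulr_ge0// exprn_ge0.
  move=> s hs /=; set N := (2 ^ s)%N.
  have NE : N%:R = 2 ^+ s :> R by rewrite /N natrX.
  have NR : 0 < N%:R :> R by rewrite ltr0n two_s.
  have N1 : 1 <= N%:R :> R by rewrite ler1n two_s.
  have N2 : (N + N)%:R = 2 * N%:R :> R by rewrite natrD; ring.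
  have -> : (2 ^ s.+1)%N = (N + N)%N by rewrite expnS mul2n addnn.
  rewrite avg_double ?two_s//.
  set A := avg f N 'i; set B := avg f N _.
  have -> : 2^-1 * (A + B) - A = 2^-1 * (B - A) by field.
  have dN : n%:R / N%:R <= d.
    rewrite ler_pdivrMr// mulrC -ler_pdivrMr//; apply: le_trans Hs0 _.
    rewrite ler_nat; apply: leq_trans hs _; exact/ltnW/ltn_expl.
  have hd0 : 0 <= n%:R / (N + N)%:R :> R by rewrite divr_ge0.
  have hdE : n%:R / (N + N)%:R = n%:R / N%:R / 2 :> R.
    by rewrite N2; field; rewrite gt_eqF.
  have chd : cabs (n%:R / (N + N)%:R)%:C = n%:R / N%:R / 2 :> R.
    by rewrite cabs_real ger0_norm// hdE.
  rewrite cabsM cabsV cabs_nat ler_pdivrMl//.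
  have := Hs N 'i (n%:R / (N + N)%:R)%:C (two_s s) dN.
  rewrite -/A -/B chd => /(_ _ _)/le_trans; apply.
  - by have : 0 <= n%:R / N%:R :> R by [rewrite divr_ge0]; lra.
  - by rewrite /= lexx.
  have -> : K * n%:R * (n%:R / N%:R / 2) / N%:R + K * (n%:R / N%:R / 2) ^+ 2 =
     (3 / 4) * ((K * n%:R ^+ 2 / N%:R) * N%:R^-1) by field; rewrite gt_eqF.
  rewrite -NE; have q0 : 0 <= K * n%:R ^+ 2 / N%:R.
    by rewrite divr_ge0 ?mulr_ge0 ?exprn_ge0// ltW.
  have : K * n%:R ^+ 2 / N%:R * N%:R^-1 <= K * n%:R ^+ 2 / N%:R.
    by rewrite ler_piMr// invf_le1.
  lra.
exists a => z hz e e0.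
have hz' : 0 < Im z by [].
pose Y1 := Num.min 1 (Im z); pose Y2 := Num.max 1 (Im z).
have Y10 : 0 < Y1 by rewrite lt_min ltr01.
have Y12 : Y1 <= Y2 by rewrite ge_min le_max lexx.
have [K K0 [N0 HN]] := @avg_path f Y1 Y2 Y10 pf (tf _ _ Y10 Y12) 'i z
  ltac:(by rewrite /= /Y1 /Y2 ge_min le_max lexx)
  ltac:(by rewrite /= /Y1 /Y2 ge_min le_max lexx !orbT).
have e2 : 0 < e / 2 by rewrite divr_gt0.
have [s1 Hs1] := Ha _ e2.
exists (maxn s1 (maxn N0 (Num.truncn (K / (e / 2))).+1)) => s.
rewrite !geq_max => /andP[h1 /andP[h2 h3]].
have -> : avg f (2 ^ s) z - a =
   (avg f (2 ^ s) z - avg f (2 ^ s) 'i) + (avg f (2 ^ s) 'i - a) by ring.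
apply: le_trans (cabsD _ _) _.
have sl : (s <= 2 ^ s)%N by exact/ltnW/ltn_expl.
have := HN (2 ^ s)%N (leq_trans h2 sl) (two_s s).
have : K / (2 ^ s)%:R <= e / 2.
  rewrite ler_pdivrMr ?ltr0n ?two_s// mulrC -ler_pdivrMr//.
  apply: (@le_trans _ _ ((Num.truncn (K / (e / 2))).+1)%:R).
    by rewrite ltW// truncnS_gt.
  by rewrite ler_nat (leq_trans h3).
have := Hs1 s h1; lra.
Qed.

End Averages.

(** * Fourier expansion of a quasi-periodic function that decays at infinity *)

Section Fourier.
Variable R : realType.
Local Notation C := R[i].
Local Notation Re := complex.Re.
Local Notation Im := complex.Im.
Local Notation H := (@upper_half R).
Local Notation e_ t := (@cexp R (0 +i* t)).
Implicit Types (z w h : C) (f p : C -> C).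

Lemma e_D (s t : R) : e_ (s + t) = e_ s * e_ t.
Proof. by rewrite -cexpD; congr cexp; simpc. Qed.
Lemma e_N (t : R) : e_ (- t) = (e_ t)^-1.
Proof. by rewrite -cexpN; congr cexp; simpc. Qed.
Lemma e_X (t : R) (m : nat) : e_ (m%:R * t) = e_ t ^+ m.
Proof. by rewrite -cexpMn; congr cexp; rewrite natrCE; simpc. Qed.
Lemma cabs_e (t : R) : cabs (e_ t) = 1.
Proof. by rewrite cabs_cexp /= expR0. Qed.

Lemma cabs_e_sub1 (t : R) : cabs (e_ t - 1) = 2 * `|sin (t / 2)|.
Proof.
apply/eqP; rewrite -(@eqrXn2 _ 2) ?cabs_ge0 ?mulr_ge0//; apply/eqP.
rewrite cabs_sqr exprMn norm_sq ReD ImD ReN ImN /= expR0 !mul1r oppr0 addr0.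
pose u := t / 2; have tE : t = u *+ 2 by rewrite /u -mulr_natr; field.
have -> : cos t = 1 - 2 * sin u ^+ 2.
  by rewrite tE cos_mulr2n cos2sin2 mulr2n; ring.
have -> : sin t = 2 * (cos u * sin u) by rewrite tE sin_mulr2n mulr2n; ring.
rewrite -/u !exprMn cos2sin2; ring.
Qed.

Lemma cabs_e_sub1_ge (t : R) : `|t| <= pi -> `|t| / 3 <= cabs (e_ t - 1).
Proof.
move=> ht; rewrite cabs_e_sub1.
have h2 : `|t / 2| <= 2.
  by rewrite normrM (@ger0_norm _ (2^-1 : R))//; have := pihalf_lt2 R; lra.
have : `|t / 2| / 3 <= `|sin (t / 2)|.
  apply: le_trans (@sin_ge_third _ `|t / 2| _) _; first by rewrite normr_ge0.
  case: (leP 0 (t / 2)) => [i0|/ltW i0]; first by rewrite (ger0_norm i0) ler_norm.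
  by rewrite (ler0_norm i0) sinN -normrN ler_norm.
by rewrite normrM (@ger0_norm _ (2^-1 : R))//; lra.
Qed.

Lemma e_neq1 (t : R) : 0 < t < 2 * pi -> e_ t != 1.
Proof.
move=> /andP[t0 t1]; rewrite -subr_eq0 -cabs_eq0 cabs_e_sub1 mulf_neq0//.
rewrite normr_eq0 gt_eqF// sin_gt0_pi//; lra.
Qed.

Variables (n : nat) (kappa : R) (g : C -> C).
Hypothesis n0 : (0 < n)%N.
Hypothesis kappa01 : 0 <= kappa < 1.
Hypothesis gper : forall z, H z -> g (z + n%:R%:C) = e_ (2 * pi * kappa) * g z.
Hypothesis gtay : forall Y1 Y2, 0 < Y1 -> Y1 <= Y2 -> taylor_on Y1 Y2 g.
Hypothesis gdecay : forall e : R, 0 < e -> exists Y : R, forall z, Y <= Im z ->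
  cabs (g z) <= e.

Let nR : 0 < n%:R :> R. Proof. by rewrite ltr0n. Qed.
Let b (m : int) : R := 2 * pi * (m%:~R + kappa) / n%:R.
Let em (m : int) z := cexp ((0 +i* b m) * z).
(** Removing the m-th exponential leaves an n-periodic function; the limit of its averages is the
    m-th Fourier coefficient of g. *)
Let pm (m : int) z := g z * cexp ((0 +i* - b m) * z).

Let pm_per m : periodic_on_H n (pm m).
Proof.
move=> z hz; rewrite /pm gper// [(_ +i* _) * (z + _)]mulrDr cexpD.
have -> : (0 +i* - b m) * n%:R%:C = 0 +i* (- (2 * pi * kappa) - 2 * pi * m%:~R) :> C.
  by simpc; congr (_ +i* _); rewrite /b; field; rewrite gt_eqF.
rewrite e_D !e_N cexp_2pi_int invr1 mulr1.
have E0 : e_ (2 * pi * kappa) != 0 by exact: cexp_neq0.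
by rewrite -mulrA mulrCA [_ * (_ / _)]mulrC divfK// mulrC; apply: (mulfI E0); field.
Qed.

Let pm_tay m Y1 Y2 : 0 < Y1 -> Y1 <= Y2 -> taylor_on Y1 Y2 (pm m).
Proof. by move=> h1 h2; apply: taylor_onM; [exact: gtay|exact: taylor_on_cexp]. Qed.

Let em_pm m z : em m z * pm m z = g z.
Proof.
rewrite /em /pm mulrCA -cexpD (_ : (0 +i* - b m : C) = - (0 +i* b m)).
  by rewrite mulNr subrr cexp0 mulr1.
by simpc.
Qed.

Let coefE m : exists a : C, forall z, H z -> forall e : R, 0 < e ->
    exists s1, forall s, (s1 <= s)%N -> cabs (avg n (pm m) (2 ^ s) z - a) <= e.
Proof. by apply: (avg_lim n0 (@pm_per m)) => Y1 Y2; exact: pm_tay. Qed.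

Let coef m : C := projT1 (cid (coefE m)).
Let coefP m z : H z -> forall e : R, 0 < e ->
    exists s1, forall s, (s1 <= s)%N -> cabs (avg n (pm m) (2 ^ s) z - coef m) <= e.
Proof. by rewrite /coef; case: cid => a Ha; exact: Ha. Qed.

(** The limit of the averages is the same at every height, and for a nonpositive frequency |pm m| <=
    |g|, which is small high up. *)
Let coef0 m : m%:~R + kappa <= 0 -> coef m = 0.
Proof.
move=> mk; apply/eqP; rewrite -cabs_eq0 eq_le cabs_ge0 andbT.
apply/ler_addgt0Pr => e e0; rewrite add0r.
have e2 : 0 < e / 2 by rewrite divr_gt0.
have [Y HY] := gdecay e2.
pose z : C := 0 +i* (Num.max 1 Y).
have hz : H z by rewrite /upper_half /= lt_max ltr01.
have [s Hs] := coefP m hz e2.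
have := Hs s (leqnn s).
have A : cabs (avg n (pm m) (2 ^ s) z) <= e / 2.
  apply: avg_bound; first exact: ltW.
  move=> x; rewrite /pm cabsM cabs_cexp ReM /= mul0r sub0r addr0 mulNr opprK.
  rewrite -[leRHS]mulr1; apply: ler_pM; rewrite ?cabs_ge0 ?expR_ge0//.
    by apply: HY; rewrite /= addr0 le_max lexx orbT.
  rewrite expR_le1 mulr_le0_ge0 ?le_max ?ler01//.
  apply: mulr_le0_ge0; last by rewrite invr_ge0 ltW.
  by apply: mulr_ge0_le0 => //; rewrite mulr_ge0// pi_ge0.
have := cabs_lerB (coef m) (avg n (pm m) (2 ^ s) z).
by rewrite cabsBC; lra.
Qed.

Section AtPoint.
Variable z : C.
Hypothesis hz : H z.

(** [hh m N] is the m-th coefficient of the discrete Fourier transform of length N of the samples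
    [q N j]. These are the values of g on the horizontal line through z, made periodic by a phase.
    For fixed m it tends, along powers of 2, to the m-th term of the expansion at z. *)
Let hh (m : int) (N : nat) : C := em m z * avg n (pm m) N z.
Let q (N j : nat) : C := em 0 z * pm 0 (z + (j%:R * (n%:R / N%:R))%:C).
Let w (N : nat) (m : int) : C := e_ (- (2 * pi * m%:~R / N%:R)).

Let hhE m N : (0 < N)%N ->
  hh m N = N%:R^-1 * \sum_(0 <= j < N) q N j * w N m ^+ j.
Proof.
move=> N0; have NR : N%:R != 0 :> R by rewrite pnatr_eq0 -lt0n.
rewrite /hh /avg mulrCA; congr (_ * _); rewrite mulr_sumr; apply: eq_big_nat => j _.
rewrite /q /pm /em /w -e_X.
rewrite !mulrA ![_ * g _]mulrC -!mulrA; congr (_ * _); rewrite -!cexpD; congr cexp.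
set x := (j%:R * _)%:C.
have Nb m' : (0 +i* - b m' : C) = - (0 +i* b m') by simpc.
have K : (0 +i* - b m) * x = (0 +i* - b 0) * x +
    (0 +i* (j%:R * - (2 * (pi * (m%:~R / N%:R))))) :> C.
  by rewrite /x; simpc; congr (_ +i* _); rewrite /b; field; rewrite NR gt_eqF.
by rewrite !mulrDr K !Nb; ring.
Qed.

Let wN N m : (0 < N)%N -> w N m ^+ N = 1.
Proof.
move=> N0; have NR : N%:R != 0 :> R by rewrite pnatr_eq0 -lt0n.
rewrite /w -e_X mulrN mulrCA divff// mulr1 -mulrN -mulrNz.
exact: cexp_2pi_int.
Qed.

Let qN N j : (0 < N)%N -> q N (j + N) = q N j.
Proof.
move=> N0; have NR : N%:R != 0 :> R by rewrite pnatr_eq0 -lt0n.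
rewrite /q natrD mulrDl (_ : N%:R * (n%:R / N%:R) = n%:R); last first.
  by rewrite mulrCA divff// mulr1.
rewrite (rmorphD (real_complex R)) addrA pm_per//.
exact: upperDr.
Qed.

Let q0 N : q N 0 = g z.
Proof. by rewrite /q mul0r addr0 em_pm. Qed.

(** Inversion of the discrete Fourier transform at the sample j = 0; the residues modulo 2 M are
    represented by -M, ..., M - 1. *)
Let inversion M : (0 < M)%N ->
  g z = \sum_(0 <= m < M) hh m%:Z (M + M) + \sum_(0 <= m < M) hh (- m.+1%:Z) (M + M).
Proof.
move=> M0; set N := (M + M)%N; have N0 : (0 < N)%N by rewrite addn_gt0 M0.
have NC : N%:R != 0 :> C by rewrite pnatr_eq0 -lt0n.
have NR : 0 < N%:R :> R by rewrite ltr0n.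
have wD m1 m2 : w N (m1 + m2) = w N m1 * w N m2.
  by rewrite /w -e_D; congr cexp; congr (_ +i* _); rewrite intrD; ring.
have wE (m : nat) j : w N (m%:Z - M%:Z) ^+ j = w N (- M%:Z) ^+ j * (w N 1 ^+ j) ^+ m.
  rewrite exprAC -exprMn; congr (_ ^+ _).
  rewrite [m%:Z - _]addrC wD; congr (_ * _).
  by rewrite /w -e_X; congr cexp; congr (_ +i* _); rewrite pmulrn; ring.
have -> : \sum_(0 <= m < M) hh m%:Z N + \sum_(0 <= m < M) hh (- m.+1%:Z) N =
   \sum_(0 <= m < N) hh (m%:Z - M%:Z) N.
  rewrite (@big_cat_nat _ _ _ M 0 N)//= ?leq_addr// addrC; congr (_ + _).
    rewrite -{2}[M]add0n big_addn /N addnK; apply: eq_big_nat => m _.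
    by congr (hh _ (M + M)); lia.
  rewrite big_nat_rev /= add0n; apply: eq_big_nat => m /andP[_ mM].
  by congr (hh _ N); lia.
under eq_bigr do rewrite hhE//.
rewrite -mulr_sumr exchange_big /=.
have S j : (0 < j < N)%N -> \sum_(0 <= m < N) q N j * w N (m%:Z - M%:Z) ^+ j = 0.
  move=> /andP[j0 jN]; under eq_bigr do rewrite wE.
  rewrite -!mulr_sumr; set x := w N 1 ^+ j.
  have x1 : x != 1.
    rewrite /x /w -e_X mulrN e_N invr_eq1; apply: e_neq1.
    rewrite mulr1 mulrCA -!mulrA; have pi0 := pi_gt0 R.
    have jR : 0 < j%:R :> R by rewrite ltr0n.
    have jN' : j%:R / N%:R < 1 :> R by rewrite ltr_pdivrMr// mul1r ltr_nat.
    have jN0 : 0 < j%:R / N%:R :> R by rewrite divr_gt0.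
    by rewrite !mulr_gt0//=; nra.
  have : (x - 1) * \sum_(0 <= m < N) x ^+ m = 0.
    by rewrite big_mkord -subrX1 /x -exprM mulnC exprM wN// expr1n subrr.
  move/eqP; rewrite mulf_eq0 subr_eq0 (negbTE x1) /= => /eqP ->.
  by rewrite !mulr0.
rewrite big_ltn// [X in _ + X](_ : _ = 0) ?addr0; last first.
  by rewrite big_nat big1 // => j jN; exact: S.
under eq_bigr do rewrite expr0 mulr1.
by rewrite sumr_const_nat subn0 q0 -(mulr_natl (g z)) mulKf.
Qed.

(* Summation by parts twice: the m-th discrete Fourier coefficient times
   (w - 1) ^ 2 is the mean of the second differences, of size O(1 / N ^ 2). *)
Let hh_decay : exists2 K : R, 0 <= K & exists N0, forall N (m : int),
  (N0 <= N)%N -> (0 < N)%N -> m != 0 -> (2 * `|m| <= N)%N ->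
  cabs (hh m N) <= K / `|m%:~R| ^+ 2.
Proof.
have [K [d [D [K0 d0 d1 HD]]]] := pm_tay 0 hz (lexx (Im z)).
have [N0 HN0] : exists N0 : nat, n%:R / d <= N0%:R.
  exists (Num.truncn (n%:R / d)).+1; by rewrite ltW// truncnS_gt.
exists (cabs (em 0 z) * (2 * K * n%:R ^+ 2) * 9).
  by rewrite !mulr_ge0 ?exprn_ge0 ?cabs_ge0.
exists N0 => N m hN N1 m0 mN.
have NR : 0 < N%:R :> R by rewrite ltr0n.
pose de := n%:R / N%:R : R; have de0 : 0 < de by rewrite divr_gt0.
have dd : de <= d.
  rewrite ler_pdivrMr// mulrC -ler_pdivrMr//; apply: le_trans HN0 _.
  by rewrite ler_nat.
have cde : cabs de%:C = de by rewrite cabs_real ger0_norm// ltW.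
pose F j := q N j * w N m ^+ j.
have shift (G : nat -> C) : G N = G 0%N ->
    \sum_(0 <= j < N) G j.+1 = \sum_(0 <= j < N) G j.
  move=> GN; case: N N1 GN {hN mN NR de de0 dd cde F} => // N _ GN.
  by rewrite big_nat_recr//= GN big_nat_recl//= addrC.
have S1 : \sum_(0 <= j < N) F j.+1 = \sum_(0 <= j < N) F j.
  by apply: shift; rewrite /F -{2}(add0n N) qN// wN.
have S2 : \sum_(0 <= j < N) F j.+2 = \sum_(0 <= j < N) F j.
  rewrite -S1; apply: (shift (fun j => F j.+1)).
  by rewrite /F -(add1n N) qN// exprD wN// mulr1.
have SS : (w N m - 1) ^+ 2 * \sum_(0 <= j < N) F j =
   \sum_(0 <= j < N) (q N j.+2 - 2 * q N j.+1 + q N j) * w N m ^+ j.+2.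
  rewrite (_ : (w N m - 1) ^+ 2 = 1 - 2 * w N m + w N m ^+ 2); last by ring.
  rewrite mulrDl mulrBl mul1r -{1}S2 -{1}S1 mulr_sumr mulr_sumr.
  rewrite -sumrB -big_split /=; apply: eq_bigr => j _.
  by rewrite /F !exprS; ring.
have Q2 j : cabs (q N j.+2 - 2 * q N j.+1 + q N j) <=
    cabs (em 0 z) * (2 * K * de ^+ 2).
  rewrite /q; set u := z + (j.+1%:R * (n%:R / N%:R))%:C.
  have -> : z + (j.+2%:R * (n%:R / N%:R))%:C = u + de%:C.
    by rewrite /u -addrA -(rmorphD (real_complex R)) -[j.+2]addn1 natrD mulrDl mul1r.
  have -> : z + (j%:R * (n%:R / N%:R))%:C = u + (- de%:C).
    rewrite /u -addrA -(rmorphN (real_complex R)) -(rmorphD (real_complex R)).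
    by rewrite -[j.+1]addn1 natrD mulrDl mul1r addrK.
  have hu : Im z <= Im u <= Im z by rewrite /u ImD /= addr0 lexx.
  have [_ _ Hu] := HD u hu.
  have := Hu de%:C; have := Hu (- de%:C); rewrite cabsN cde => /(_ dd) A1 /(_ dd) A2.
  have -> : em 0 z * pm 0 (u + de%:C) - 2 * (em 0 z * pm 0 u) +
      em 0 z * pm 0 (u + - de%:C) =
     em 0 z * ((pm 0 (u + de%:C) - pm 0 u - D u * de%:C) +
       (pm 0 (u + - de%:C) - pm 0 u - D u * - de%:C)) by ring.
  rewrite cabsM ler_wpM2l ?cabs_ge0//; apply: le_trans (cabsD _ _) _; lra.
have cw : cabs (w N m) = 1 by rewrite cabs_e.
have B1 : cabs (w N m - 1) ^+ 2 * cabs (\sum_(0 <= j < N) F j) <=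
    N%:R * (cabs (em 0 z) * (2 * K * de ^+ 2)).
  rewrite -cabsX -cabsM SS; apply: le_trans (cabs_sum _ _ _) _.
  apply: (@le_trans _ _ (\sum_(0 <= j < N) (cabs (em 0 z) * (2 * K * de ^+ 2)))).
    by apply: ler_sum => j _; rewrite cabsM cabsX cw expr1n mulr1.
  by rewrite sumr_const_nat subn0 [leRHS]mulr_natl.
have mpos : 0 < `|m%:~R| :> R by rewrite normr_gt0 intr_eq0.
have wm : `|m%:~R| / (N%:R) / (3 / 4) <= cabs (w N m - 1).
  have pi0 := pi_ge2 R.
  have E : `|- (2 * pi * m%:~R / N%:R)| = (2 * pi) * (`|m%:~R| / N%:R) :> R.
    rewrite normrN (_ : 2 * pi * m%:~R / N%:R = 2 * pi / N%:R * m%:~R); last by ring.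
    rewrite normrM ger0_norm; last by rewrite divr_ge0 ?mulr_ge0 ?pi_ge0 ?(ltW NR).
    by ring.
  have mN' : `|m%:~R| / N%:R <= 1 / 2 :> R.
    rewrite ler_pdivrMr//; have : (2 * `|m|)%:R <= N%:R :> R by rewrite ler_nat.
    by rewrite natrM natr_absz intr_norm; lra.
  have mN0 : 0 < `|m%:~R| / N%:R :> R by rewrite divr_gt0.
  apply: le_trans (@cabs_e_sub1_ge _ _) => //; first by rewrite E; nra.
  by rewrite E; nra.
have B2 : (`|m%:~R| / N%:R) ^+ 2 <= cabs (w N m - 1) ^+ 2.
  apply: lerXn2r; rewrite ?nnegrE ?cabs_ge0 ?divr_ge0 ?(ltW NR)//.
  apply: le_trans wm; have : 0 <= `|m%:~R| / N%:R :> R by rewrite divr_ge0 ?(ltW NR).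
  lra.
rewrite hhE// cabsM cabsV cabs_nat.
rewrite ler_pdivlMr ?exprn_gt0//.
rewrite [leLHS](_ : _ = `|m%:~R| ^+ 2 * cabs (\sum_(0 <= j < N) F j) / N%:R); last by ring.
rewrite ler_pdivrMr// [leRHS]mulrC.
have : (`|m%:~R| / N%:R) ^+ 2 * cabs (\sum_(0 <= j < N) F j) <=
   N%:R * (cabs (em 0 z) * (2 * K * de ^+ 2)).
  by apply: le_trans B1; rewrite ler_wpM2r ?cabs_ge0.
rewrite expr_div_n mulrAC ler_pdivrMr ?exprn_gt0// => /le_trans; apply.
have -> : N%:R * (cabs (em 0 z) * (2 * K * de ^+ 2)) * N%:R ^+ 2 =
   N%:R * (cabs (em 0 z) * (2 * K * n%:R ^+ 2)).
  by rewrite /de; field; rewrite gt_eqF.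
rewrite ler_wpM2l ?(ltW NR)// ler_peMr// ?mulr_ge0 ?cabs_ge0 ?exprn_ge0//; lra.
Qed.

Let coef_lim m e : 0 < e -> exists s1, forall s, (s1 <= s)%N ->
  cabs (hh m (2 ^ s) - coef m * em m z) <= e.
Proof.
move=> e0; have E0 : 0 < cabs (em m z) by rewrite cabs_gt0 cexp_neq0.
have [s1 Hs] := coefP m hz (divr_gt0 e0 E0).
exists s1 => s /Hs Hs'; rewrite /hh mulrC -mulrBl cabsM.
by rewrite -ler_pdivlMr.
Qed.

Let tail_sum (K : R) L M : 0 <= K -> (0 < L)%N -> (L <= M)%N ->
  \sum_(L <= m < M) K / m%:R ^+ 2 <= 2 * K / L%:R.
Proof.
move=> K0 L0 LM; have LR : 0 < L%:R :> R by rewrite ltr0n.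
have MR : 0 < M%:R :> R by rewrite ltr0n (leq_trans L0).
apply: (@le_trans _ _ (\sum_(L <= m < M) (2 * K / m%:R - 2 * K / m.+1%:R))).
  rewrite big_nat [leRHS]big_nat; apply: ler_sum => m /andP[Lm _].
  have m1 : 1 <= m%:R :> R by rewrite ler1n (leq_trans L0).
  have mp : 0 < m%:R :> R by lra.
  have -> : m.+1%:R = m%:R + 1 :> R by rewrite -natr1.
  rewrite -subr_ge0.
  rewrite (_ : 2 * K / m%:R - 2 * K / (m%:R + 1) - K / m%:R ^+ 2 =
     K * (m%:R - 1) / (m%:R ^+ 2 * (m%:R + 1))); last first.
    by field; rewrite !gt_eqF//; lra.
  by rewrite divr_ge0 ?mulr_ge0 ?exprn_ge0//; lra.
have -> : \sum_(L <= m < M) (2 * K / m%:R - 2 * K / m.+1%:R) =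
  2 * K / L%:R - 2 * K / M%:R.
  rewrite -[RHS]opprB -(telescope_sumr (fun m => 2 * K / m%:R) LM) -sumrN.
  by apply: eq_bigr => m _; rewrite opprB.
by rewrite lerBlDr lerDl divr_ge0 ?mulr_ge0// ltW.
Qed.

(** In [inversion] with a large power of 2, the terms of index below L in absolute value are near
    their limits, which vanish for negative indices by [coef0]. The remaining ones contribute O(1 /
    L) by [hh_decay], uniformly in N. *)
Let partial : exists2 K : R, 0 <= K & forall L, (0 < L)%N ->
  cabs (g z - \sum_(0 <= m < L) coef m%:Z * em m%:Z z) <= K / L%:R.
Proof.
have [K K0 [N0 HN]] := hh_decay.
exists (4 * K); first by rewrite mulr_ge0.
move=> L L0; apply/ler_addgt0Pr => e e0.
have LR : 0 < L%:R :> R by rewrite ltr0n.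
pose e1 := e / (2 * L%:R); have e10 : 0 < e1 by rewrite divr_gt0// mulr_gt0.
have ex (mm : int) : exists s1, forall s, (s1 <= s)%N ->
    cabs (hh mm (2 ^ s) - coef mm * em mm z) <= e1 by exact: coef_lim.
pose sf mm := projT1 (cid (ex mm)).
have sfP mm s : (sf mm <= s)%N -> cabs (hh mm (2 ^ s) - coef mm * em mm z) <= e1.
  by rewrite /sf; case: cid => s1 Hs1; exact: Hs1.
(* A sum of thresholds, used as a common upper bound for all of them. *)
pose s := (N0 + L + \sum_(0 <= m < L) (sf m%:Z + sf (- m.+1%:Z)%R))%N.
have sb m : (m < L)%N -> (sf m%:Z <= s.+1)%N /\ (sf (- m.+1%:Z)%R <= s.+1)%N.
  move=> mL.
  have : (sf m%:Z + sf (- m.+1%:Z)%R <= \sum_(0 <= m < L) (sf m%:Z + sf (- m.+1%:Z)%R))%N.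
    by rewrite big_mkord (bigD1 (Ordinal mL))//= leq_addr.
  by rewrite /s; lia.
pose M := (2 ^ s)%N.
have sM : (s < M)%N by exact: ltn_expl.
have MM : (2 ^ s.+1 = M + M)%N by rewrite expnS mul2n addnn.
have M0 : (0 < M)%N by lia.
have LM : (L <= M)%N by rewrite /s in sM; lia.
have NM : (N0 <= M + M)%N by rewrite /s in sM; lia.
rewrite (inversion M0).
rewrite (@big_cat_nat _ _ _ L 0 M (fun _ => true) (fun m => hh m%:Z (M + M)))//=.
rewrite (@big_cat_nat _ _ _ L 0 M (fun _ => true) (fun m => hh (- m.+1%:Z) (M + M)))//=.
set A1 := \sum_(0 <= i < L) hh i%:Z _; set A2 := \sum_(L <= i < M) hh i%:Z _.
set B1 := \sum_(0 <= i < L) hh (- _) _; set B2 := \sum_(L <= i < M) hh (- _) _.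
set S := \sum_(0 <= m < L) _.
have a2 : cabs A2 <= 2 * K / L%:R.
  apply: le_trans (cabs_sum _ _ _) _; apply: le_trans (tail_sum K0 L0 LM).
  rewrite big_nat [leRHS]big_nat; apply: ler_sum => m /andP[Lm mM].
  have := @HN (M + M)%N m%:Z NM.
  rewrite -[m%:Z%:~R]/(m%:R : R) normr_nat; apply; lia.
have b2 : cabs B2 <= 2 * K / L%:R.
  apply: le_trans (cabs_sum _ _ _) _; apply: le_trans (tail_sum K0 L0 LM).
  rewrite big_nat [leRHS]big_nat; apply: ler_sum => m /andP[Lm mM].
  have := @HN (M + M)%N (- m.+1%:Z) NM.
  rewrite mulrNz normrN -[m.+1%:Z%:~R]/(m.+1%:R : R) normr_nat => Hm.
  have q1 : (0 < M + M)%N by rewrite addn_gt0 M0.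
  have q2 : - m.+1%:Z != 0 by rewrite oppr_eq0.
  have q3 : (2 * `|- m.+1%:Z| <= M + M)%N.
    by rewrite abszN absz_nat mul2n -addnn leq_add.
  apply: (le_trans (Hm q1 q2 q3)).
  have m0 : (0 < m)%N by exact: leq_trans Lm.
  rewrite ler_wpM2l// lef_pV2 ?posrE ?exprn_gt0 ?ltr0n//.
  by apply: lerXn2r; rewrite ?nnegrE// ler_nat.
have a1 : cabs (A1 - S) <= e / 2.
  rewrite /A1 /S -sumrB; apply: le_trans (cabs_sum _ _ _) _.
  apply: (@le_trans _ _ (\sum_(0 <= m < L) e1)).
    rewrite big_nat [leRHS]big_nat; apply: ler_sum => m /andP[_ mL].
    by rewrite -MM; apply: sfP; have [] := sb m mL.
  by rewrite sumr_const_nat subn0 -mulr_natl /e1 le_eqVlt; apply/orP; left;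
    apply/eqP; field; rewrite gt_eqF.
have b1 : cabs B1 <= e / 2.
  rewrite /B1; apply: le_trans (cabs_sum _ _ _) _.
  apply: (@le_trans _ _ (\sum_(0 <= m < L) e1)).
    rewrite big_nat [leRHS]big_nat; apply: ler_sum => m /andP[_ mL].
    rewrite -MM; have [_ /sfP] := sb m mL.
    rewrite coef0 ?mul0r ?subr0// mulrNz -[m.+1%:Z%:~R]/(m.+1%:R).
    have : 1 <= m.+1%:R :> R by rewrite ler1n.
    by case/andP: kappa01; lra.
  by rewrite sumr_const_nat subn0 -mulr_natl /e1 le_eqVlt; apply/orP; left;
    apply/eqP; field; rewrite gt_eqF.
have -> : A1 + A2 + (B1 + B2) - S = (A1 - S) + A2 + (B1 + B2) by ring.
have := cabsD ((A1 - S) + A2) (B1 + B2); have := cabsD (A1 - S) A2.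
have := cabsD B1 B2; lra.
Qed.

Lemma fourier_expansion_at (a : nat -> C) : a = (fun m => coef m%:Z) ->
  series ((fun m => if 0 < m%:R + kappa then
     a m * cexp ((0 +i* (2 * pi * (m%:R + kappa) / n%:R)) * z) else 0) : nat -> C^o)
   @ \oo --> (g z : C^o).
Proof.
move=> ->; have [K K0 HK] := partial.
apply/cvgrPdist_le => e /gt0_complexE[-> e0].
exists (Num.truncn (K / Re e)).+1 => // L /= hL.
have L0 : (0 < L)%N by exact: leq_trans hL.
rewrite normCE lecR seriesEnat /=.
rewrite (eq_big_nat _ _ (F2 := fun m => coef m%:Z * em m%:Z z)); last first.
  move=> m _; rewrite /em /b -[m%:Z%:~R]/(m%:R : R); case: ifPn => // mk.
  by rewrite coef0 ?mul0r// leNgt.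
apply: le_trans (HK L L0) _; rewrite ler_pdivrMr ?ltr0n// mulrC -ler_pdivrMr//.
apply: le_trans (_ : (Num.truncn (K / Re e)).+1%:R <= _); first by rewrite ltW// truncnS_gt.
by rewrite ler_nat.
Qed.

End AtPoint.

Lemma fourier_expansion : exists a : nat -> C, forall z, H z ->
  series ((fun m => if 0 < m%:R + kappa then
     a m * cexp ((0 +i* (2 * pi * (m%:R + kappa) / n%:R)) * z) else 0) : nat -> C^o)
   @ \oo --> (g z : C^o).
Proof. by exists (fun m => coef m%:Z) => z hz; exact: fourier_expansion_at. Qed.

End Fourier.

Lemma seq_argmin (T : eqType) (R : realType) (F : T -> R) (s : seq T) :
  s != [::] -> exists2 r0, r0 \in s & forall r, r \in s -> F r0 <= F r.
Proof.
elim: s => // a s IH _; have [->|s0] := eqVneq s [::].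
  by exists a; [exact: mem_head|move=> r; rewrite inE => /eqP ->].
have [r0 r0s Hr0] := IH s0.
case: (leP (F a) (F r0)) => ar.
  exists a; first exact: mem_head.
  by move=> r; rewrite inE => /orP[/eqP ->|/Hr0]; [exact: lexx|exact: le_trans].
exists r0; first by rewrite inE r0s orbT.
by move=> r; rewrite inE => /orP[/eqP ->|/Hr0]; [exact: ltW|].
Qed.

(** * Cusp widths, cusp parameters *)

Section Group.
Variable G : set 'M[int]_2.
Hypothesis sG : is_subgroup G.
Hypothesis fG : finite_index G.
Hypothesis GN1 : G (- 1).
Implicit Types (g h t r : 'M[int]_2) (l : int).

Lemma G_SL2Z g : G g -> SL2Z g. Proof. by case: sG => + _ _ _; apply. Qed.
Lemma G1 : G 1. Proof. by case: sG. Qed.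
Lemma GM g h : G g -> G h -> G (g * h). Proof. by case: sG => _ _ + _; apply. Qed.
Lemma GV g : G g -> G g^-1. Proof. by case: sG => _ _ _; apply. Qed.
Lemma GN g : G g -> G (- g). Proof. by rewrite -mulN1r; exact: GM. Qed.
Lemma coset_reps : exists s : seq 'M[int]_2,
  (forall r, r \in s -> SL2Z r) /\
  forall t, SL2Z t -> exists2 r, r \in s & G (r^-1 * t).
Proof.
have /finite_seqP[S HS] := fG.
pose rep (X : set 'M[int]_2) := xget 1 [set r | SL2Z r /\ X = [set r * g | g in G]].
have repP X : X \in S -> SL2Z (rep X) /\ X = [set rep X * g | g in G].
  move=> XS; have : left_cosets G X by rewrite HS.
  case=> t st <-; rewrite /rep; case: xgetP => [r -> //|/(_ t)[]]; by split.
exists (map rep S); split.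
  by move=> r /mapP[X XS ->]; have [] := repP X XS.
move=> t st; pose X := [set t * g | g in G].
have XS : X \in S.
  have : left_cosets G X by exists t.
  by rewrite HS.
have [sr EX] := repP X XS; exists (rep X); first exact: map_f.
have : X t by exists 1; rewrite ?mulr1//; exact: G1.
by rewrite {1}EX => -[g Gg <-]; rewrite mulrA mulVr ?mul1r//; exact: SL2Z_unit.
Qed.

Lemma conj_Um t l m : SL2Z t ->
  (t * Um l * t^-1) * (t * Um m * t^-1) = t * Um (l + m) * t^-1.
Proof. by move=> /SL2Z_unit ut; rewrite UmD !mulrA mulrVK. Qed.

Lemma conj_UmV t l : SL2Z t -> (t * Um l * t^-1)^-1 = t * Um (- l) * t^-1.
Proof.
move=> st; have sU : SL2Z (t * Um l * t^-1).
  by apply: SL2ZM; [apply: SL2ZM => //; exact: SL2Z_Um|exact: SL2ZV].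
apply: (mulrI (SL2Z_unit sU)).
by rewrite mulrV ?SL2Z_unit// conj_Um// subrr Um0 mulr1 mulrV ?SL2Z_unit.
Qed.

(** Pigeonhole: among the matrices t U^i t^-1, one more than there are representatives, two lie in
    the same coset, and their quotient is in G. *)
Lemma cusp_period t : SL2Z t -> exists2 n : nat, (0 < n)%N & G (t * Um n%:Z * t^-1).
Proof.
move=> st; have [s [ss Hs]] := coset_reps.
have sx (i : nat) : SL2Z (t * Um i%:Z * t^-1).
  by apply: SL2ZM; [apply: SL2ZM => //; exact: SL2Z_Um|exact: SL2ZV].
have /choice[f Hf] : forall i : nat, exists r, r \in s /\ G (r^-1 * (t * Um i%:Z * t^-1)).
  by move=> i; have [r rs Gr] := Hs _ (sx i); exists r.
have : ~~ uniq (map f (iota 0 (size s).+1)).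
  apply/negP => u; have : (size (map f (iota 0 (size s).+1)) <= size s)%N.
    by apply: uniq_leq_size => // r /mapP[i _ ->]; have [] := Hf i.
  by rewrite size_map size_iota ltnn.
case/(uniqPn 1) => i [j []]; rewrite size_map size_iota => ij js.
rewrite !(nth_map 0%N) ?size_iota ?(ltn_trans ij)// !nth_iota ?(ltn_trans ij)// !add0n => e.
have [ris Gi] := Hf i; have [_ Gj] := Hf j; rewrite -e in Gj.
exists (j - i)%N; first by rewrite subn_gt0.
have := GM (GV Gi) Gj; have ur : (f i)^-1 \is a GRing.unit.
  by rewrite unitrV; apply: SL2Z_unit; exact: ss.
have uf : f i \is a GRing.unit by apply: SL2Z_unit; exact: ss.
have E (x y : 'M[int]_2) : SL2Z x -> ((f i)^-1 * x)^-1 * ((f i)^-1 * y) = x^-1 * y.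
  move=> sx'; rewrite (invrM ur (SL2Z_unit sx')) invrK -mulrA.
  by rewrite [f i * _]mulrA mulrV// mul1r.
by rewrite (E _ _ (sx i)) conj_UmV// conj_Um// addrC subzn// ltnW.
Qed.

(** The width is used only through this divisibility criterion. The least n > 0 with t U^n t^-1 in G
    satisfies it by division with remainder, and it generates the stabilizer because a matrix fixing
    the cusp is a conjugated translation up to sign and -1 lies in G. *)
Lemma cusp_widthP t : SL2Z t -> (0 < cusp_width G t)%N /\
  forall l, G (t * Um l * t^-1) <-> ((cusp_width G t)%:Z %| l)%Z.
Proof.
move=> st; pose P (n : nat) := `[< (0 < n)%N /\ G (t * Um n%:Z * t^-1) >].
have exP : exists n, P n.
  by have [n n0 Gn] := cusp_period st; exists n; apply/asboolP.
have [n /asboolP[n0 Gn] nmin] := ex_minnP exP.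
have Gmul m : G (t * Um (n%:Z * m) * t^-1).
  have H (q : nat) : G (t * Um (n%:Z * q%:Z) * t^-1).
    elim: q => [|q IH]; first by rewrite mulr0 Um0 mulr1 mulrV ?SL2Z_unit//; exact: G1.
    have -> : n%:Z * q.+1%:Z = n%:Z + n%:Z * q%:Z.
      by rewrite -[q.+1]add1n PoszD mulrDr mulr1.
    by rewrite -conj_Um//; exact: GM.
  case: m => q; first exact: H.
  by rewrite NegzE mulrN -conj_UmV//; apply: GV; exact: H.
have Gdiv l : G (t * Um l * t^-1) <-> (n%:Z %| l)%Z.
  split; last by move=> /dvdzP[m ->]; rewrite mulrC.
  move=> Gl; have e := divz_eq l n%:Z.
  have nz : n%:Z != 0 by rewrite -lt0n.
  have r0 := modz_ge0 l nz; have rn : (l %% n)%Z < n%:Z by exact: ltz_pmod.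
  have Gr : G (t * Um (l %% n)%Z * t^-1).
    have -> : (l %% n)%Z = l + n%:Z * - (l %/ n)%Z by rewrite {2}e; ring.
    by rewrite -conj_Um//; apply: GM.
  apply/dvdz_mod0P; move: r0 rn Gr; case: (l %% n)%Z => // q _ qn Gq.
  apply/eqP; rewrite -[_ == _]/(q == 0)%N; apply/negP => /negP q0.
  have : P q by apply/asboolP; rewrite lt0n.
  by move/nmin; rewrite leqNgt; move: qn; rewrite ltz_nat => ->.
have wn : is_cusp_width G t n.
  split=> //.
    move=> g; rewrite /fixes_cusp UmxE; split.
      move=> [Gg cg]; have sg := G_SL2Z Gg.
      have ut := SL2Z_unit st.
      have si : SL2Z (t^-1 * g * t) by apply: SL2ZM => //; apply: SL2ZM => //; exact: SL2ZV.
      have gE : g = t * (t^-1 * g * t) * t^-1 by rewrite !mulrA mulrV// mul1r mulrK.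
      have [l [E|E]] := SL2Z_fixoo si cg.
        move: gE Gg; rewrite E => -> /Gdiv/dvdzP[m ->].
        by exists m; left; rewrite exprz_conj//; [rewrite UmXz mulrC|exact: SL2Z_Um].
      move: gE Gg; rewrite E mulrN mulNr => -> /GN; rewrite opprK => /Gdiv/dvdzP[m ->].
      by exists m; right; rewrite exprz_conj//; [rewrite UmXz mulrC|exact: SL2Z_Um].
    move=> [m]; rewrite exprz_conj//; last exact: SL2Z_Um.
    have E0 : t^-1 * (t * Um n%:Z ^ m * t^-1) * t = Um (n%:Z * m).
      by rewrite UmXz !mulrA mulVr ?SL2Z_unit// mul1r mulrVK ?SL2Z_unit.
    have [_ _ c0 _] := UmE (n%:Z * m).
    have cN : (- Um (n%:Z * m)) 1 0 = 0 by rewrite mxE c0 oppr0.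
    case=> ->; rewrite ?mulrN ?mulNr E0 ?c0 ?cN; (split; last by []); last apply: GN.
      by rewrite UmXz.
    by rewrite UmXz.
  move=> m m0 Hm; apply: nmin; apply/asboolP; split=> //.
  have [_ /(_ _)[]] := Hm (t * Um m%:Z * t^-1) => //.
  by exists 1; left; rewrite expr1z UmxE.
rewrite /cusp_width; suff -> : xget 0%N [set n | is_cusp_width G t n] = n by [].
apply: (@xget_unique _ _ _ n) => // m [m0 Hm mmin].
apply/eqP; rewrite eqn_leq; case: wn => _ Hn nmin'.
by rewrite mmin// nmin'.
Qed.

Lemma cusp_width_gt0 t : SL2Z t -> (0 < cusp_width G t)%N.
Proof. by move=> /cusp_widthP[]. Qed.

Lemma cusp_width_mulG g t : G g -> SL2Z t -> cusp_width G (g * t) = cusp_width G t.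
Proof.
move=> Gg st; have sg := G_SL2Z Gg; have ug := SL2Z_unit sg; have ut := SL2Z_unit st.
have [n0 Hn] := cusp_widthP st; have [m0 Hm] := cusp_widthP (SL2ZM sg st).
have E l : G (g * t * Um l * (g * t)^-1) <-> G (t * Um l * t^-1).
  rewrite (invrM ug ut) !mulrA; split=> [H|H].
    have := GM (GM (GV Gg) H) Gg; rewrite !mulrA mulVr// mul1r mulrVK//.
  by have := GM (GM Gg H) (GV Gg); rewrite !mulrA.
apply/eqP; rewrite eqn_dvd.
have D1 : ((cusp_width G (g * t))%:Z %| (cusp_width G t)%:Z)%Z by apply/Hm/E/Hn; exact: dvdzz.
have D2 : ((cusp_width G t)%:Z %| (cusp_width G (g * t))%:Z)%Z by apply/Hn/E/Hm; exact: dvdzz.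
move: (cusp_width G _) (cusp_width G _) D1 D2 => a b; rewrite !dvdzE => D1 D2.
by apply/andP.
Qed.

(** * Automorphy factors, cusp parameters and the minimum of eta *)

Section Factor.
Variable R : realType.
Local Notation C := R[i].
Local Notation H := (@upper_half R).
Variables (k : R) (nu : 'M[int]_2 -> C -> C).
Hypothesis anu : automorphy_factor G k nu.
Implicit Types z w : C.

Lemma nu_holo g : G g -> holo (nu g). Proof. by case: anu => + _ _ _; apply. Qed.
Lemma cabs_nu g z : G g -> H z -> cabs (nu g z) = cabs (jfac g z) `^ k.
Proof. by case: anu => _ + _ _; apply. Qed.
Lemma nuM g h z : G g -> G h -> H z -> nu (g * h) z = nu g (mobius h z) * nu h z.
Proof. by case: anu => _ _ + _; apply. Qed.
Lemma nu_neq0 g z : G g -> H z -> nu g z != 0.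
Proof.
move=> Gg hz; rewrite -cabs_gt0 cabs_nu// powR_gt0// cabs_jfac_gt0//.
exact: G_SL2Z.
Qed.
Lemma nu1 z : H z -> nu 1 z = 1.
Proof.
move=> hz; have := nuM G1 G1 hz; rewrite mulr1 mobius1 => e.
by apply: (mulfI (nu_neq0 G1 hz)); rewrite mulr1.
Qed.

Lemma holo_nu_mobius g t : G g -> SL2Z t -> holo (fun z => nu g (mobius t z)).
Proof. by move=> Gg st; apply: holo_comp => //; exact: nu_holo. Qed.

Lemma cabs_conj_factor t h z : SL2Z t -> SL2Z h -> G (t * h * t^-1) -> H z ->
  cabs (conj_factor k nu t h z) = cabs (jfac h z) `^ k.
Proof.
move=> st sh Gh hz; have htz := mobius_upper st hz; have hhz := mobius_upper sh hz.
have sc := G_SL2Z Gh.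
rewrite /conj_factor !cabsM cabsV !cabs_cpow ?jfac_neq0// cabs_nu//.
have E : cabs (jfac (t * h * t^-1) (mobius t z)) * cabs (jfac t z) =
   cabs (jfac t (mobius h z)) * cabs (jfac h z).
  rewrite -!cabsM -jfacM// mulrVK ?SL2Z_unit// jfacM//.
rewrite -powRM ?cabs_ge0// E powRM ?cabs_ge0// mulrC mulKf//.
by rewrite gt_eqF// powR_gt0// cabs_jfac_gt0.
Qed.

Lemma holo_conj_factor t h : SL2Z t -> SL2Z h -> G (t * h * t^-1) ->
  holo (conj_factor k nu t h).
Proof.
move=> st sh Gh; apply: holoM; first apply: holoM.
- exact: holo_nu_mobius.
- exact: holo_cpow_jfac.
apply: holoV; last by move=> z hz; exact: cpow_neq0.
apply: (@holo_comp _ (fun z => cpow (jfac t z) k) h) => //.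
exact: holo_cpow_jfac.
Qed.

Lemma unimodular_kappa (c : C) : cabs c = 1 ->
  exists2 kap : R, 0 <= kap < 1 & cexp (0 +i* (2 * pi * kap)) = c.
Proof.
move=> c1; have c0 : c != 0 by rewrite -cabs_gt0 c1.
have E : cexp (0 +i* carg c) = c by rewrite -[RHS]clogK// /clog c1 ln1.
have pi0 := pi_gt0 R.
have b : -1 <= complex.Re c / cabs c <= 1.
  by rewrite c1 divr1 -ler_norml -c1 Re_le_cabs.
have : - pi <= carg c <= pi.
  have := acos_ge0 b; have := acos_lepi b; rewrite /carg; case: ifP => _; lra.
have A : 2 * pi * (carg c / (2 * pi)) = carg c.
  by rewrite mulrC divfK// gt_eqF//; lra.
move=> /andP[a1 a2]; case: (leP 0 (carg c)) => ca.
  exists (carg c / (2 * pi)).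
    have pi2 : 0 < 2 * pi :> R by lra.
    by apply/andP; split; [rewrite divr_ge0// ltW|rewrite ltr_pdivrMr//; lra].
  by rewrite A E.
exists (carg c / (2 * pi) + 1).
  have : carg c / (2 * pi) < 0 by rewrite pmulr_llt0// invr_gt0 mulr_gt0.
  have : - 1 / 2 <= carg c / (2 * pi) by rewrite ler_pdivlMr ?mulr_gt0//; lra.
  lra.
have -> : (0 +i* (2 * pi * (carg c / (2 * pi) + 1)) : C) =
   (0 +i* carg c) + (0 +i* (2 * pi * 1%:~R)).
  by rewrite mulrDr A; simpc.
by rewrite cexpD E cexp_2pi_int mulr1.
Qed.

Lemma width_conj t : SL2Z t -> G (t * Um (cusp_width G t)%:Z * t^-1).
Proof. by move=> st; have [_ ->] := cusp_widthP st; exact: dvdzz. Qed.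

(** A cusp parameter exists because the conjugated factor at U^n has modulus |j|^k = 1, hence is
    constant. *)
Lemma cusp_paramP t : SL2Z t -> is_cusp_param G k nu t (cusp_param G k nu t).
Proof.
move=> st; rewrite /cusp_param; apply: xgetPex.
have hi : H 'i by rewrite /upper_half /= ltr01.
have sU := SL2Z_Um (cusp_width G t)%:Z; have Gw := width_conj st.
have u z : H z -> cabs (conj_factor k nu t (Um (cusp_width G t)%:Z) z) = 1.
  by move=> hz; rewrite cabs_conj_factor// jfac_Um cabs1 powR1.
have [kap kap01 E] := unimodular_kappa (u _ hi).
exists kap; split=> // z hz; rewrite E UmxE.
exact: (holo_unimodular_cst (holo_conj_factor st sU Gw) u).
Qed.

(** Q compares the automorphy factors attached to t and to g t. It has modulus 1, hence is constant,
    and equating its values at z and at h z cancels the dependence on g. *)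
Lemma conj_factor_mulG g t z : G g -> SL2Z t -> H z ->
  conj_factor k nu (g * t) (Um (cusp_width G t)%:Z) z =
  conj_factor k nu t (Um (cusp_width G t)%:Z) z.
Proof.
move=> Gg st hz; have sg := G_SL2Z Gg; have ug := SL2Z_unit sg; have ut := SL2Z_unit st.
set h := Um _; have sh : SL2Z h by exact: SL2Z_Um.
have Gh : G (t * h * t^-1) by exact: width_conj.
pose Q z := nu g (mobius t z) * cpow (jfac t z) k / cpow (jfac (g * t) z) k.
have hQ : holo Q.
  apply: holoM; first apply: holoM.
  - exact: holo_nu_mobius.
  - exact: holo_cpow_jfac.
  apply: holoV; last by move=> w hw; exact: cpow_neq0.
  by apply: holo_cpow_jfac; exact: SL2ZM.
have Q1 w : H w -> cabs (Q w) = 1.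
  move=> hw; have sgt := SL2ZM sg st; rewrite /Q !cabsM cabsV !cabs_cpow ?jfac_neq0//.
  rewrite cabs_nu//; last exact: mobius_upper.
  rewrite -powRM ?cabs_ge0// -cabsM -jfacM// divff// gt_eqF// powR_gt0//.
  exact: cabs_jfac_gt0.
have hhz : H (mobius h z) by exact: mobius_upper.
have QE := holo_unimodular_cst hQ Q1 hhz hz.
have htz := mobius_upper st hz; have gtz := mobius_upper sg htz.
rewrite /conj_factor mobiusM//.
have -> : nu (g * t * h * (g * t)^-1) (mobius g (mobius t z)) =
    nu g (mobius t (mobius h z)) * nu (t * h * t^-1) (mobius t z) / nu g (mobius t z).
  have GX : G (g * t * h * (g * t)^-1).
    by rewrite (invrM ug ut) !mulrA; have := GM (GM Gg Gh) (GV Gg); rewrite !mulrA.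
  apply: (mulIf (nu_neq0 Gg htz)); rewrite mulfVK ?nu_neq0// -nuM//.
  rewrite (invrM ug ut) !mulrA mulrVK// -!mulrA (mulrA t) nuM//.
  by rewrite -[X in nu g X]mobiusM// ?mulrVK// ?mobiusM//; exact: G_SL2Z.
have alg (a2 c2 c4 a1 c1 c3 N : C) : a1 != 0 -> c2 != 0 -> c3 != 0 -> c4 != 0 ->
    a2 * c2 / c4 = a1 * c1 / c3 -> a2 * N / a1 * c3 / c4 = N * c1 / c2.
  move=> h1 h2 h3 h4 E; have -> : a2 = a1 * c1 / c3 * c4 / c2.
    by rewrite -E; field; rewrite h2 h4.
  by field; rewrite h1 h2 h3 h4.
by apply: alg => //; rewrite ?cpow_neq0 ?nu_neq0.
Qed.

Lemma eta_cusp_mulG g t : G g -> SL2Z t -> eta_cusp G k nu (g * t) = eta_cusp G k nu t.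
Proof.
move=> Gg st; suff E : cusp_param G k nu (g * t) = cusp_param G k nu t.
  by rewrite /eta_cusp E.
have E kap : is_cusp_param G k nu (g * t) kap <-> is_cusp_param G k nu t kap.
  rewrite /is_cusp_param cusp_width_mulG// UmxE.
  by split; case=> k01 Hk; (split; first exact: k01) => z hz;
    rewrite (Hk z hz) conj_factor_mulG.
apply: (congr1 (fun X : set R => xget 0 X)); apply/funext => kap.
by apply/propext; exact: E.
Qed.

Lemma eta_cusp_gt0 t : SL2Z t -> 0 < eta_cusp G k nu t <= 1.
Proof.
move=> st; have [/andP[k0 k1] _] := cusp_paramP st.
rewrite /eta_cusp; case: eqP => [_|/eqP kn]; first by rewrite ltr01 lexx.
by rewrite lt0r kn k0 ltW.
Qed.

(** [coset_reps] represents the cosets r G, whereas eta is invariant under multiplication by G on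
    the left; hence the minimum over the inverses of the representatives. *)
Lemma eta_cusp_min : exists2 t0, SL2Z t0 &
  forall t, SL2Z t -> eta_cusp G k nu t0 <= eta_cusp G k nu t.
Proof.
have [s [ss Hs]] := coset_reps.
have [r0 r0s Hr0] : exists2 r0, r0 \in s & forall r, r \in s ->
    eta_cusp G k nu r0^-1 <= eta_cusp G k nu r^-1.
  apply: (@seq_argmin _ R (fun r => eta_cusp G k nu r^-1)).
  by have [r rs _] := Hs _ SL2Z1; apply: contraL rs => /eqP ->.
exists r0^-1; first by apply: SL2ZV; exact: ss.
move=> t st; have [r rs Gr] := Hs _ (SL2ZV st).
have sr := ss _ rs; have ur := SL2Z_unit sr; have ut := SL2Z_unit st.
have -> : t = (r^-1 * t^-1)^-1 * r^-1.
  by rewrite invrM ?unitrV// !invrK mulrK.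
rewrite eta_cusp_mulG; [exact: Hr0|exact: GV|exact: SL2ZV].
Qed.

End Factor.
End Group.

(** * The hyperbolic measure and unfolding *)

Section Lines.
Variable R : realType.
Local Notation mu := (@lebesgue_measure R).
Local Notation RM := (measurableTypeR R).

(** By uniqueness of Lebesgue measure, which equals |a| times its push-forward as soon as they agree
    on half-open intervals. For a < 0 the preimage of such an interval is open at the other end. *)
Lemma integral_affine (a b : R) (f : R -> \bar R) : a != 0 ->
  measurable_fun [set: RM] f -> (forall x, 0 <= f x)%E ->
  (\int[mu]_x f (a * x + b)%R = (`|a|^-1)%:E * \int[mu]_x f x)%E.
Proof.
move=> a0 mf f0; pose h := fun x : R => a * x + b.
have mh : measurable_fun [set: RM] (h : RM -> RM).
  by apply: measurable_funD => //; exact: mulrl_measurable.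
have an0 : 0 < `|a| by rewrite normr_gt0.
pose nu := (measure_function_pushforward__canonical__measure_function_Measure mu mh).
pose nu' := mscale (NngNum (normr_ge0 a)) nu.
have E : forall A, measurable A -> mu A = nu' A.
  apply: lebesgue_measure_unique => X /ocitvP[->|[[u v] /= uv ->]].
    by rewrite !measure0.
  rewrite /nu' /mscale /= /pushforward.
  have [ap|an] : 0 < a \/ a < 0 by apply/orP; rewrite orbC -neq_lt.
    have -> : h @^-1` `]u, v] = `](u - b) / a, (v - b) / a]%classic.
      apply/seteqP; split=> x; rewrite /= !in_itv /= /h ltr_pdivrMr// ler_pdivlMr//;
        by move=> /andP[? ?]; apply/andP; split; lra.
    rewrite !lebesgue_measure_itv /= !lte_fin uv ltr_pM2r ?invr_gt0// ltrD2r uv.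
    by rewrite -!EFinD -EFinM gtr0_norm//; congr _%:E; field; exact: a0.
  have -> : h @^-1` `]u, v] = `[(v - b) / a, (u - b) / a[%classic.
    apply/seteqP; split=> x; rewrite /= !in_itv /= /h ler_ndivrMr// ltr_ndivlMr//;
      by move=> /andP[? ?]; apply/andP; split; lra.
  rewrite !lebesgue_measure_itv /= !lte_fin uv ltr_nM2r ?invr_lt0// ltrD2r uv.
  by rewrite -!EFinD -EFinM ltr0_norm//; congr _%:E; field; exact: a0.
have -> : (\int[mu]_x f x = \int[nu']_x f x)%E.
  by apply: eq_measure_integral => A mA _; exact: E.
rewrite ge0_integral_mscale//= muleA -EFinM mulVf ?gt_eqF// mul1e.
by rewrite (ge0_integral_pushforward mh)//= preimage_setT.
Qed.

(** The product x * |x|^(-2) is also right at 0, where both sides vanish. *)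
Lemma measurable_invR : measurable_fun [set: RM] (fun x : R => x^-1).
Proof.
have -> : (fun x : R => x^-1) = (fun x : R => x * `|x| `^ (- 2%:R)).
  apply/funext => x; rewrite powR_invn// -normrX.
  have [->|x0] := eqVneq x 0; first by rewrite invr0 mul0r.
  by rewrite ger0_norm ?sqr_ge0//; field.
apply: measurable_funM => //.
have m1 : measurable_fun [set: RM] (fun x : R => x `^ (- 2%:R)) by exact: measurable_powR.
have m2 : measurable_fun [set: RM] (fun x : R => `|x|) by exact: normr_measurable.
exact: (measurableT_comp m1 m2).
Qed.

(** A weight that vanishes for x <= 0: integrals against it over R or over the plane are integrals
    over y > 0 without restricting the domain. *)
Definition invpos (x : R) : R := if 0 < x then x^-1 else 0.

Lemma measurable_invpos : measurable_fun [set: RM] invpos.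
Proof.
apply: measurable_fun_ifT => //; last exact: measurable_invR.
exact: measurable_fun_ltr.
Qed.

Lemma invpos_ge0 x : 0 <= invpos x.
Proof. by rewrite /invpos; case: ifP => // x0; rewrite invr_ge0 ltW. Qed.

Lemma invposM (a x : R) : 0 < a -> invpos (a * x) = a^-1 * invpos x.
Proof. by move=> a0; rewrite /invpos pmulr_rgt0//; case: ifP; rewrite ?mulr0// invfM. Qed.

Lemma measurable_EFin_invpos : measurable_fun [set: RM] (fun x => (invpos x)%:E).
Proof. by apply/measurable_EFinP; exact: measurable_invpos. Qed.

(** dy / y is the Haar measure of the multiplicative group of positive reals. *)
Lemma integral_invpos_scale (a : R) (f : R -> \bar R) : 0 < a ->
  measurable_fun [set: RM] f -> (forall x, 0 <= f x)%E ->
  (\int[mu]_x (f (a * x)%R * (invpos x)%:E) = \int[mu]_x (f x * (invpos x)%:E))%E.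
Proof.
move=> a0 mf f0; pose h x := (f x * (invpos x)%:E)%E.
have mh : measurable_fun [set: RM] h.
  by apply: emeasurable_funM => //; exact: measurable_EFin_invpos.
have h0 x : (0 <= h x)%E by rewrite mule_ge0// lee_fin invpos_ge0.
have := integral_affine 0 (lt0r_neq0 a0) mh h0.
under eq_integral => x _ do rewrite addr0 /h invposM// EFinM muleCA.
rewrite ge0_integralZl//; last 3 first.
- apply: emeasurable_funM; last exact: measurable_EFin_invpos.
  by apply: (measurableT_comp mf); exact: mulrl_measurable.
- by move=> x _; rewrite mule_ge0// lee_fin invpos_ge0.
- by rewrite lee_fin invr_ge0 ltW.
rewrite gtr0_norm// => /(congr1 (fun z => a%:E * z)%E).
by rewrite !muleA -EFinM divff ?gt_eqF// !mul1e.
Qed.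

(* Compute the integral of f s * 1_(0 < r * s < 1) over r, s > 0 in both orders. *)
Lemma integral_invpos (f : R -> \bar R) :
  measurable_fun [set: RM] f -> (forall x, 0 <= f x)%E ->
  (\int[mu]_x (f (invpos x) * (invpos x)%:E) = \int[mu]_x (f x * (invpos x)%:E))%E.
Proof.
move=> mf f0; have mi := measurable_EFin_invpos.
pose g : R -> R := \1_(`]0, 1[%classic : set R).
have mg : measurable_fun [set: RM] g by exact: measurable_indic.
have mEg : measurable_fun [set: RM] (fun x => (g x)%:E) by exact/measurable_EFinP.
have g0 x : 0 <= g x by rewrite /g indicE.
have Ig : (\int[mu]_x (g x)%:E = 1)%E.
  rewrite integral_indic//= setIT lebesgue_measure_itv /= lte_fin ltr01.
  by rewrite oppr0 addr0.
pose pos (x : R) : R := if 0 < x then 1 else 0.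
have pos0 x : 0 <= pos x by rewrite /pos; case: ifP.
have mpos : measurable_fun [set: RM] pos.
  by apply: measurable_fun_ifT => //; exact: measurable_fun_ltr.
pose F (p : RM * RM) : \bar R := (f p.2 * (g (p.1 * p.2)%R * (pos p.1 * pos p.2))%:E)%E.
have mF : measurable_fun [set: (RM * RM)%type] F.
  apply: emeasurable_funM.
    by apply: (measurableT_comp mf); exact: measurable_snd.
  apply/measurable_EFinP; apply: measurable_funM.
    apply: (measurableT_comp mg); apply: measurable_funM;
      [exact: measurable_fst|exact: measurable_snd].
  apply: measurable_funM.
    by apply: (measurableT_comp mpos); exact: measurable_fst.
  by apply: (measurableT_comp mpos); exact: measurable_snd.
have F0 p : (0 <= F p)%E by rewrite mule_ge0// lee_fin !mulr_ge0.
have := @fubini_tonelli _ _ RM RM R mu mu F mF F0.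
have -> : (\int[mu]_y fubini_G mu F y = \int[mu]_x (f x * (invpos x)%:E))%E.
  apply: eq_integral => s _; rewrite /fubini_G /F /=.
  case: (ltP 0 s) => s0; last first.
    rewrite /invpos /pos ltNge s0 /= mule0.
    by apply: integral0_eq => r _; rewrite !mulr0 mule0.
  have E r : g (r * s) * (pos r * pos s) = g (s * r + 0).
    rewrite /pos s0 mulr1 addr0 (mulrC r); case: ifP; rewrite ?mulr1// mulr0.
    move=> /negbT; rewrite -leNgt => r0; rewrite /g indicE memNset//=.
    rewrite in_itv /= => /andP[]; rewrite pmulr_rgt0//; lra.
  under eq_integral do rewrite E.
  rewrite ge0_integralZl//; last 2 first.
  - apply/measurable_EFinP; apply: (measurableT_comp mg).
    by apply: measurable_funD => //; exact: mulrl_measurable.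
  - by move=> r _; rewrite lee_fin.
  congr (_ * _)%E; rewrite /invpos s0.
  rewrite (@integral_affine s 0 (fun x => (g x)%:E)) ?gt_eqF//.
  by rewrite Ig mule1 gtr0_norm.
move=> <-.
(* For fixed r > 0 the substitution s = t / r turns F(r, .) into H(r, .), in which the cutoff g
   depends on t alone. *)
pose H (p : RM * RM) : \bar R := (f (p.2 * invpos p.1)%R * (invpos p.1 * g p.2)%:E)%E.
have mH : measurable_fun [set: (RM * RM)%type] H.
  have mi1 : measurable_fun [set: (RM * RM)%type] (fun p : RM * RM => invpos p.1).
    by apply: (measurableT_comp measurable_invpos); exact: measurable_fst.
  apply: emeasurable_funM.
    apply: (measurableT_comp mf); apply: measurable_funM => //; exact: measurable_snd.
  apply/measurable_EFinP; apply: measurable_funM => //.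
  by apply: (measurableT_comp mg); exact: measurable_snd.
have H0 p : (0 <= H p)%E by rewrite mule_ge0// lee_fin mulr_ge0// invpos_ge0.
have -> : (\int[mu]_x fubini_F mu F x = \int[mu]_x fubini_F mu H x)%E.
  apply: eq_integral => r _; rewrite /fubini_F /F /H /=.
  case: (ltP 0 r) => r0; last first.
    rewrite /pos /invpos ltNge r0 /=.
    transitivity (0 : \bar R)%E; first by apply: integral0_eq => t _; rewrite mul0r mulr0 mule0.
    by apply/esym/integral0_eq => t _; rewrite mul0r mule0.
  have ir0 : r^-1 != 0 by rewrite invr_eq0 gt_eqF.
  pose K (s : R) := (f s * (g (r * s)%R * (pos r * pos s))%:E)%E.
  have mK : measurable_fun [set: RM] K.
    apply: emeasurable_funM => //; apply/measurable_EFinP; apply: measurable_funM.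
      by apply: (measurableT_comp mg); exact: mulrl_measurable.
    by apply: measurable_funM.
  have K0 s : (0 <= K s)%E by rewrite mule_ge0// lee_fin !mulr_ge0.
  have := integral_affine 0 ir0 mK K0; rewrite normfV invrK (gtr0_norm r0) => e.
  have r00 : (0 <= (r^-1)%:E :> \bar R)%E by rewrite lee_fin invr_ge0 ltW.
  have -> : (\int[mu]_y K y = (r^-1)%:E * (r%:E * \int[mu]_x K x))%E.
    by rewrite muleA -EFinM mulVf ?gt_eqF// mul1e.
  rewrite -e -ge0_integralZl//; last first.
    apply: (measurableT_comp mK); apply: measurable_funD => //; exact: mulrl_measurable.
  apply: eq_integral => t _; rewrite /K addr0 /invpos r0 [r^-1 * t]mulrC.
  rewrite [r * (t * _)]mulrCA divff ?gt_eqF// mulr1 muleCA; congr (_ * _)%E.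
  rewrite -EFinM; congr (_ * _)%:E; rewrite /pos r0 mul1r pmulr_lgt0 ?invr_gt0//.
  case: ifP; rewrite ?mulr1// => /negbT; rewrite -leNgt => t0.
  by rewrite mulr0 /g indicE memNset//= in_itv /= => /andP[]; lra.
rewrite (@fubini_tonelli _ _ RM RM R mu mu H mH H0).
have -> : (\int[mu]_y fubini_G mu H y =
    \int[mu]_t ((g t)%:E * \int[mu]_x (f (invpos x) * (invpos x)%:E)))%E.
  apply: eq_integral => t _; rewrite /fubini_G /H /=.
  have [t0|/negbTE t0] := boolP (t \in (`]0, 1[%classic : set R)); last first.
    rewrite /g indicE t0 mul0e.
    by apply: integral0_eq => x _; rewrite mulr0 mule0.
  have g1 : g t = 1 by rewrite /g indicE t0.
  rewrite g1 mul1e; have {t0 g1}tp : 0 < t by move: t0 => /set_mem /=; rewrite in_itv /= => /andP[].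
  under eq_integral do rewrite mulr1.
  pose L (x : R) := f (invpos x).
  have mL : measurable_fun [set: RM] L by apply: (measurableT_comp mf); exact: measurable_invpos.
  rewrite -(integral_invpos_scale (f := L) (a := t^-1)) ?invr_gt0//; last by move=> x; exact: f0.
  apply: eq_integral => x _; rewrite /L invposM ?invr_gt0// invrK.
  by [].
rewrite ge0_integralZr//; last 2 first.
- by move=> x _; rewrite lee_fin.
- by apply: integral_ge0 => x _; rewrite mule_ge0// lee_fin invpos_ge0.
by rewrite Ig mul1e.
Qed.

End Lines.

(** * Invariance of dx dy / y^2 on the upper half-plane *)

Section Hyp.
Variable R : realType.
Local Notation C := R[i].
Local Notation mu := (@lebesgue_measure R).
Local Notation RM := (measurableTypeR R).
Local Notation H := (@upper_half R).

Definition pmeas (f : RM * RM -> C) :=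
  measurable_fun [set: (RM * RM)%type] (fun p => complex.Re (f p)) /\
  measurable_fun [set: (RM * RM)%type] (fun p => complex.Im (f p)).

Lemma pmeas_cst (a : C) : pmeas (fun=> a).
Proof. by split; exact: measurable_cst. Qed.

Lemma pmeas_id : pmeas (fun p => p.1 +i* p.2).
Proof. by split; [exact: measurable_fst|exact: measurable_snd]. Qed.

Lemma pmeasD f g : pmeas f -> pmeas g -> pmeas (fun p => f p + g p).
Proof.
move=> [f1 f2] [g1 g2]; split.
  by under eq_fun do rewrite ReD; exact: measurable_funD.
by under eq_fun do rewrite ImD; exact: measurable_funD.
Qed.

Lemma pmeasM f g : pmeas f -> pmeas g -> pmeas (fun p => f p * g p).
Proof.
move=> [f1 f2] [g1 g2]; split.
  under eq_fun do rewrite ReM.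
  by apply: measurable_funB; exact: measurable_funM.
under eq_fun do rewrite ImM.
by apply: measurable_funD; exact: measurable_funM.
Qed.

Lemma pmeasV f : pmeas f -> pmeas (fun p => (f p)^-1).
Proof.
move=> [f1 f2].
have m : measurable_fun [set: (RM * RM)%type]
    (fun p => (complex.Re (f p) ^+ 2 + complex.Im (f p) ^+ 2)^-1).
  apply: (measurableT_comp (@measurable_invR R)).
  by apply: measurable_funD; exact: measurable_funX.
split.
  have -> : (fun p => complex.Re (f p)^-1) =
      (fun p => complex.Re (f p) * (complex.Re (f p) ^+ 2 + complex.Im (f p) ^+ 2)^-1).
    by apply/funext => p; case: (f p).
  exact: measurable_funM.
have -> : (fun p => complex.Im (f p)^-1) =
    (fun p => - (complex.Im (f p) * (complex.Re (f p) ^+ 2 + complex.Im (f p) ^+ 2)^-1)).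
  by apply/funext => p; case: (f p) => a b; rewrite /= -?mulNr.
under eq_fun do rewrite -sub0r.
by apply: measurable_funB => //; exact: measurable_funM.
Qed.

Lemma pmeas_cabs f : pmeas f -> measurable_fun [set: (RM * RM)%type] (fun p => cabs (f p)).
Proof.
move=> [f1 f2].
have -> : (fun p => cabs (f p)) =
    (fun p => Num.sqrt (complex.Re (f p) ^+ 2 + complex.Im (f p) ^+ 2)).
  by apply/funext => p; rewrite cabsE.
have ms : measurable_fun [set: RM] (Num.sqrt : RM -> RM).
  by apply: continuous_measurable_fun; exact: sqrt_continuous.
apply: (measurableT_comp ms).
by apply: measurable_funD; exact: measurable_funX.
Qed.

Definition hmeas (phi : C -> \bar R) :=
  measurable_fun [set: (RM * RM)%type] (fun p => phi (p.1 +i* p.2)).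

Lemma hmeas_comp phi (f : C -> C) : hmeas phi -> pmeas (fun p => f (p.1 +i* p.2)) ->
  hmeas (fun z => phi (f z)).
Proof.
move=> mphi [f1 f2].
have m : measurable_fun [set: (RM * RM)%type] (fun p : RM * RM =>
    (complex.Re (f (p.1 +i* p.2)) : RM, complex.Im (f (p.1 +i* p.2)) : RM)).
  exact: measurable_fun_pair.
have := measurableT_comp mphi m; apply: eq_measurable_fun => p _ /=.
by congr phi; case: (f _).
Qed.

Lemma pmeas_mobius g : pmeas (fun p => mobius g (p.1 +i* p.2)).
Proof.
have aff (a b : C) : pmeas (fun p => a * (p.1 +i* p.2) + b).
  by apply: pmeasD; [apply: pmeasM; [exact: pmeas_cst|exact: pmeas_id]|exact: pmeas_cst].
by apply: pmeasM; [exact: aff|apply: pmeasV; exact: aff].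
Qed.

Lemma hmeas_mobius phi g : hmeas phi -> hmeas (fun z => phi (mobius g z)).
Proof. by move=> m; apply: hmeas_comp => //; exact: pmeas_mobius. Qed.

(** The integral over H for the invariant measure. The weight vanishes off H, so phi may be
    arbitrary there as long as it is measurable. *)
Definition hyp (phi : C -> \bar R) : \bar R :=
  (\int[@area R]_p (phi (p.1 +i* p.2) * ((invpos p.2) ^+ 2)%:E))%E.

Lemma measurable_invpos2 :
  measurable_fun [set: (RM * RM)%type] (fun p : RM * RM => (invpos p.2 ^+ 2)%:E).
Proof.
apply/measurable_EFinP; apply: measurable_funX.
by apply: (measurableT_comp (@measurable_invpos R)); exact: measurable_snd.
Qed.

Lemma measurable_hyp phi : hmeas phi -> measurable_fun [set: (RM * RM)%type]
  (fun p : RM * RM => phi (p.1 +i* p.2) * (invpos p.2 ^+ 2)%:E)%E.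
Proof. by move=> m; apply: emeasurable_funM => //; exact: measurable_invpos2. Qed.

Lemma hyp_eq phi psi : (forall z, H z -> phi z = psi z) -> hyp phi = hyp psi.
Proof.
move=> e; apply: eq_integral => p _; rewrite /invpos.
case: ifP => y0; first by rewrite e.
by rewrite expr0n /= !mule0.
Qed.

Lemma le_hyp phi psi : hmeas phi -> hmeas psi ->
  (forall z, H z -> 0 <= phi z)%E -> (forall z, H z -> phi z <= psi z)%E ->
  (hyp phi <= hyp psi)%E.
Proof.
move=> m1 m2 p0 le.
have ww p : (0 <= (invpos p ^+ 2)%:E :> \bar R)%E by rewrite lee_fin sqr_ge0.
have w0 (p : RM * RM) : ~~ (0 < p.2) -> (invpos p.2 ^+ 2)%:E = 0%E :> \bar R.
  by move=> /negbTE h; rewrite /invpos h expr0n.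
apply: ge0_le_integral => //.
- move=> p _; case: (boolP (0 < p.2)) => h; last by rewrite w0// mule0.
  by rewrite mule_ge0// p0.
- exact: measurable_hyp.
- exact: measurable_hyp.
- move=> p _; case: (boolP (0 < p.2)) => h; last by rewrite w0// !mule0.
  by rewrite lee_wpmul2r// le.
Qed.

Lemma hypZ (a : R) phi : 0 <= a -> hmeas phi -> (forall z, 0 <= phi z)%E ->
  (hyp (fun z => a%:E * phi z) = a%:E * hyp phi)%E.
Proof.
move=> a0 m p0; rewrite /hyp -ge0_integralZl//.
- by apply: eq_integral => p _; rewrite muleA.
- exact: measurable_hyp.
- by move=> p _; rewrite mule_ge0// lee_fin sqr_ge0.
Qed.

Lemma hypD phi psi : hmeas phi -> hmeas psi ->
  (forall z, 0 <= phi z)%E -> (forall z, 0 <= psi z)%E ->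
  (hyp (fun z => phi z + psi z) = hyp phi + hyp psi)%E.
Proof.
move=> m1 m2 p0 q0.
have ww p : (0 <= (invpos p ^+ 2)%:E :> \bar R)%E by rewrite lee_fin sqr_ge0.
rewrite /hyp -ge0_integralD//.
- by apply: eq_integral => p _; rewrite ge0_muleDl.
- by move=> p _; rewrite mule_ge0.
- exact: measurable_hyp.
- by move=> p _; rewrite mule_ge0.
- exact: measurable_hyp.
Qed.

Lemma hyp_lines phi : hmeas phi -> (forall z, 0 <= phi z)%E ->
  (hyp phi = \int[mu]_y \int[mu]_x (phi (x +i* y) * ((invpos y) ^+ 2)%:E))%E.
Proof.
move=> m p0; have q0 p : (0 <= phi (p.1 +i* p.2) * (invpos p.2 ^+ 2)%:E)%E.
  by rewrite mule_ge0// lee_fin sqr_ge0.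
exact: (@fubini_tonelli2 _ _ RM RM R mu mu _ (measurable_hyp m) q0).
Qed.

Lemma hyp_translate phi (b : R) : hmeas phi -> (forall z, 0 <= phi z)%E ->
  hyp (fun z => phi (z + b%:C)) = hyp phi.
Proof.
move=> m p0.
have ww p : (0 <= (invpos p ^+ 2)%:E :> \bar R)%E by rewrite lee_fin sqr_ge0.
have mb : hmeas (fun z => phi (z + b%:C)).
  by apply: hmeas_comp => //; apply: pmeasD; [exact: pmeas_id|exact: pmeas_cst].
rewrite (hyp_lines mb (fun z => p0 _)) (hyp_lines m p0).
apply: eq_integral => y _.
pose h (x : R) := (phi (x +i* y) * (invpos y ^+ 2)%:E)%E.
have mh : measurable_fun [set: RM] h.
  have m2 : measurable_fun [set: RM] (fun x : RM => (x, y : RM)) by exact: measurable_pair2.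
  exact: (measurableT_comp (measurable_hyp m) m2).
have h0 x : (0 <= h x)%E by rewrite mule_ge0.
have := integral_affine b (oner_neq0 R) mh h0.
rewrite normr1 invr1 mul1e => <-; apply: eq_integral => x _.
by rewrite /h mul1r; congr (phi _ * _)%E; apply/eqP; rewrite eq_complex /= addr0 !eqxx.
Qed.

(** Coordinates t = x / y and y, in which dx dy / y^2 becomes dt dy / y. Dilations act on y
    alone. *)
Definition polar (phi : C -> \bar R) (p : RM * RM) : \bar R :=
  (phi ((p.1 * p.2)%R +i* p.2) * (invpos p.2)%:E)%E.

Lemma measurable_polar phi : hmeas phi -> measurable_fun [set: (RM * RM)%type] (polar phi).
Proof.
move=> m; apply: emeasurable_funM; last first.
  apply: (measurableT_comp (@measurable_EFin_invpos R)); exact: measurable_snd.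
have m' : measurable_fun [set: (RM * RM)%type] (fun p : RM * RM => (p.1 * p.2 : RM, p.2 : RM)).
  apply: measurable_fun_pair; last exact: measurable_snd.
  by apply: measurable_funM; [exact: measurable_fst|exact: measurable_snd].
exact: (measurableT_comp m m').
Qed.

(* Substitute [x = t * y] on each horizontal line. *)
Lemma hyp_polar phi : hmeas phi -> (forall z, 0 <= phi z)%E ->
  (hyp phi = \int[mu]_t \int[mu]_y polar phi (t, y))%E.
Proof.
move=> m p0.
have ww p : (0 <= (invpos p)%:E :> \bar R)%E by rewrite lee_fin invpos_ge0.
have q0 p : (0 <= polar phi p)%E by rewrite mule_ge0.
transitivity (\int[@area R]_p polar phi p)%E; last first.
  exact: (@fubini_tonelli1 _ _ RM RM R mu mu _ (measurable_polar m) q0).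
rewrite (hyp_lines m p0).
rewrite (@fubini_tonelli2 _ _ RM RM R mu mu _ (measurable_polar m) q0).
apply: eq_integral => y _; rewrite /fubini_G /polar /=.
case: (ltP 0 y) => y0; last first.
  transitivity (0 : \bar R)%E; last apply/esym.
    by apply: integral0_eq => x _; rewrite /invpos ltNge y0 /= expr0n mule0.
  by apply: integral0_eq => x _; rewrite /invpos ltNge y0 /= mule0.
pose h (x : R) := (phi (x +i* y) * (invpos y)%:E)%E.
have mh : measurable_fun [set: RM] h.
  apply: emeasurable_funM; last exact: measurable_cst.
  have m2 : measurable_fun [set: RM] (fun x : RM => (x, y : RM)) by exact: measurable_pair2.
  exact: (measurableT_comp m m2).
have h0 x : (0 <= h x)%E by rewrite mule_ge0.
have := integral_affine 0 (lt0r_neq0 y0) mh h0.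
rewrite (gtr0_norm y0).
under eq_integral do rewrite addr0 /h [y * _]mulrC.
move=> ->; rewrite -ge0_integralZl//; last by rewrite lee_fin invr_ge0 ltW.
apply: eq_integral => x _; rewrite /h [RHS]muleCA -EFinM /invpos y0; congr (_ * _)%E.
Qed.

Lemma hyp_dilate phi (a : R) : 0 < a -> hmeas phi -> (forall z, 0 <= phi z)%E ->
  hyp (fun z => phi (a%:C * z)) = hyp phi.
Proof.
move=> a0 m p0.
have ma : hmeas (fun z => phi (a%:C * z)).
  by apply: hmeas_comp => //; apply: pmeasM; [exact: pmeas_cst|exact: pmeas_id].
rewrite (hyp_polar m p0) (hyp_polar ma (fun z => p0 _)).
apply: eq_integral => t _; rewrite /polar /=.
pose h (y : R) := phi ((t * y) +i* y).
have mh : measurable_fun [set: RM] h.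
  have m' : measurable_fun [set: RM] (fun y : RM => (t * y : RM, y)).
    by apply: measurable_fun_pair => //; exact: mulrl_measurable.
  exact: (measurableT_comp m m').
rewrite -(integral_invpos_scale a0 mh); last by move=> x; exact: p0.
apply: eq_integral => y _; rewrite /h; congr (phi _ * _)%E.
by apply/eqP; rewrite eq_complex /= !mul0r subr0 addr0 mulrCA !eqxx.
Qed.

(** In the coordinates of [polar] the map z |-> -1 / z sends (t, y) to (-t, 1 / ((1 + t^2) y)): a
    reflection of t and, for each t, an inversion and a dilation of y, all preserving dt dy / y. *)
Lemma hyp_inv phi : hmeas phi -> (forall z, 0 <= phi z)%E ->
  hyp (fun z => phi (- z^-1)) = hyp phi.
Proof.
move=> m p0.
have mi : hmeas (fun z => phi (- z^-1)).
  apply: (@hmeas_comp _ (fun z => - z^-1)) => //.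
  under eq_fun do rewrite -mulN1r.
  by apply: pmeasM; [exact: pmeas_cst|apply: pmeasV; exact: pmeas_id].
rewrite (hyp_polar m p0) (hyp_polar mi (fun z => p0 _)).
pose h (t y : R) := phi ((t * y) +i* y).
have mh t : measurable_fun [set: RM] (h t).
  have m' : measurable_fun [set: RM] (fun y : RM => (t * y : RM, y)).
    by apply: measurable_fun_pair => //; exact: mulrl_measurable.
  exact: (measurableT_comp m m').
have h0 t y : (0 <= h t y)%E by exact: p0.
pose q (t : R) := (\int[mu]_y polar phi (t, y))%E.
have pp0 p : (0 <= polar phi p)%E by rewrite mule_ge0// lee_fin invpos_ge0.
have mq : measurable_fun [set: RM] q.
  exact: (@measurable_fun_fubini_tonelli_F _ _ RM RM R mu _ (measurable_polar m) pp0).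
have q0 t : (0 <= q t)%E by apply: integral_ge0 => y _; exact: pp0.
have N1 : -1 != 0 :> R by rewrite oppr_eq0 oner_eq0.
have := integral_affine 0 N1 mq q0; rewrite normrN1 invr1 mul1e => <-.
apply: eq_integral => t _; rewrite addr0 mulN1r /q /polar /=.
have s0 : 0 < (1 + t ^+ 2)^-1 by rewrite invr_gt0; have := sqr_ge0 t; lra.
rewrite -(integral_invpos_scale s0 (mh (- t)) (h0 (- t))).
rewrite -(integral_invpos (f := fun y => h (- t) ((1 + t ^+ 2)^-1 * y))); last 2 first.
- by apply: (measurableT_comp (mh (- t))); exact: mulrl_measurable.
- by move=> x; exact: h0.
apply: eq_integral => y _; case: (ltP 0 y) => y0; last first.
  by rewrite /invpos ltNge y0 /= !mule0.
congr (_ * _)%E; rewrite /h /invpos y0; congr phi.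
have y00 : y != 0 by rewrite gt_eqF.
have t0 : 1 + t ^+ 2 != 0 by rewrite gt_eqF// -invr_gt0.
have n0 : (t * y) ^+ 2 + y ^+ 2 != 0.
  have -> : (t * y) ^+ 2 + y ^+ 2 = (1 + t ^+ 2) * y ^+ 2 by ring.
  by rewrite mulf_neq0// expf_neq0.
apply/eqP; rewrite eq_complex /=; apply/andP; split; apply/eqP; field; rewrite ?y00 ?t0 ?n0//.
Qed.

(** For c <> 0, g z = a / c - 1 / (c^2 (z + d / c)): a composition of two translations, a dilation
    and an inversion. *)
Lemma hyp_mobius phi g : SL2Z g -> hmeas phi -> (forall z, 0 <= phi z)%E ->
  hyp (fun z => phi (mobius g z)) = hyp phi.
Proof.
move=> sg m p0; have [g0|g0] := eqVneq (g 1 0) 0.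
  have [l [->|->]] := SL2Z_fixoo sg g0.
    rewrite -(hyp_translate (l%:~R) m p0); apply: hyp_eq => z Hz.
    by rewrite mobius_Um intrCE.
  rewrite -(hyp_translate (l%:~R) m p0); apply: hyp_eq => z Hz.
  by rewrite mobiusN mobius_Um intrCE.
set c : R := (g 1 0)%:~R; set a : R := (g 0 0)%:~R; set d : R := (g 1 1)%:~R.
have c0 : c != 0 by rewrite intr_eq0.
pose phi1 z := phi (z + (a / c)%:C).
pose phi2 z := phi1 (- z^-1).
pose phi3 z := phi2 ((c ^+ 2)%:C * z).
have m1 : hmeas phi1.
  by apply: hmeas_comp => //; apply: pmeasD; [exact: pmeas_id|exact: pmeas_cst].
have m2 : hmeas phi2.
  apply: (@hmeas_comp _ (fun z => - z^-1)) => //.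
  under eq_fun do rewrite -mulN1r.
  by apply: pmeasM; [exact: pmeas_cst|apply: pmeasV; exact: pmeas_id].
have m3 : hmeas phi3.
  by apply: hmeas_comp => //; apply: pmeasM; [exact: pmeas_cst|exact: pmeas_id].
have c20 : 0 < c ^+ 2 by rewrite exprn_even_gt0.
rewrite -(hyp_translate (a / c) m p0) -/phi1 -(hyp_inv m1 (fun z => p0 _)) -/phi2.
rewrite -(hyp_dilate c20 m2 (fun z => p0 _)).
rewrite -/phi3 -(hyp_translate (d / c) m3 (fun z => p0 _)).
apply: hyp_eq => z Hz; rewrite /phi3 /phi2 /phi1; congr phi.
have j0 := jfac_neq0 sg Hz.
have cC : c%:C != 0 by rewrite fmorph_eq0.
have det1 : a * d - (g 0 1)%:~R * c = 1.
  by rewrite /a /d /c -!intrM -intrB; have /SL2ZE -> := sg.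
rewrite /mobius /jfac !intrCE -/a -/c -/d.
move: j0; rewrite /jfac !intrCE -/c -/d => j0.
set b : C := (_ 0 1)%:~R%:C.
have detC : a%:C * d%:C - b * c%:C = 1.
  by rewrite -[1]/(1%:C) -det1 rmorphB !rmorphM.
have E : (c ^+ 2)%:C * (z + (d / c)%:C) = c%:C * (c%:C * z + d%:C).
  have dc : c%:C * (d / c)%:C = d%:C by rewrite -rmorphM mulrCA divff// mulr1.
  by rewrite expr2 rmorphM -mulrA mulrDr dc.
have ac : (a / c)%:C * c%:C = a%:C by rewrite -rmorphM mulfVK.
rewrite E; apply: (mulIf j0); rewrite mulfVK//.
rewrite [RHS]mulrDl mulNr invfM mulfVK//; apply: (mulIf cC).
rewrite [RHS]mulrDl mulNr mulVf// [RHS]addrC mulrAC ac -detC; ring.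
Qed.

End Hyp.

(** * Sums over G and unfolding *)

Section Unfold.
Variable R : realType.
Local Notation C := R[i].
Local Notation RM := (measurableTypeR R).
Local Notation H := (@upper_half R).
Local Notation M2 := 'M[int]_2.

Definition Gterm (G : set M2) (u : M2 -> \bar R) (n : nat) : \bar R :=
  if pickle_inv n is Some g then (if `[< G g >] then u g else 0%E) else 0%E.

(* Sum over G along the enumeration of all integer matrices. *)
Definition Gsum (G : set M2) (u : M2 -> \bar R) : \bar R := (\sum_(n <oo) Gterm G u n)%E.

Lemma Gterm_ge0 G u n : (forall g, 0 <= u g)%E -> (0 <= Gterm G u n)%E.
Proof. by move=> u0; rewrite /Gterm; case: pickle_inv => // g; case: ifP. Qed.

Lemma Gsum_ge0 G u : (forall g, 0 <= u g)%E -> (0 <= Gsum G u)%E.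
Proof. by move=> u0; apply: nneseries_ge0 => n _ _; exact: Gterm_ge0. Qed.

Lemma eq_Gsum G u v : (forall g, G g -> u g = v g) -> Gsum G u = Gsum G v.
Proof.
move=> e; congr (limn _); apply/funext => N; apply: eq_bigr => n _.
by rewrite /Gterm; case: pickle_inv => // g; case: asboolP => // /e.
Qed.

Lemma le_Gsum G u v : (forall g, 0 <= u g)%E -> (forall g, G g -> u g <= v g)%E ->
  (Gsum G u <= Gsum G v)%E.
Proof.
move=> u0 e; apply: lee_nneseries => n *; first exact: Gterm_ge0.
by rewrite /Gterm; case: pickle_inv => // g; case: asboolP => // /e.
Qed.

Lemma Gsum_ge_seq G u (s : seq M2) : (forall g, 0 <= u g)%E -> uniq s ->
  (forall g, g \in s -> G g) -> (\sum_(g <- s) u g <= Gsum G u)%E.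
Proof.
move=> u0 us sG; pose N := (\max_(g <- s) choice.pickle g)%N.+1.
have -> : (\sum_(g <- s) u g = \sum_(n <- map (choice.pickle : M2 -> nat) s) Gterm G u n)%E.
  rewrite big_map; apply: eq_big_seq => g gs.
  by rewrite /Gterm pickleK_inv asboolT//; exact: sG.
have uN : uniq (map (choice.pickle : M2 -> nat) s) by rewrite map_inj_uniq//; exact: (pcan_inj pickleK).
have P : perm_eq (map (choice.pickle : M2 -> nat) s) [seq n <- iota 0 N | n \in map (choice.pickle : M2 -> nat) s].
  apply: uniq_perm => //; first by rewrite filter_uniq// iota_uniq.
  move=> n; rewrite mem_filter; case: (boolP (n \in map (choice.pickle : M2 -> nat) s)) => [/mapP[g gs ->]|//].
  rewrite andTb mem_iota add0n /= ltnS; apply/esym.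
  by rewrite (bigD1_seq g)//= leq_maxl.
rewrite (perm_big _ P) big_filter big_mkcond /=.
apply: (@le_trans _ _ (\sum_(0 <= n < N) Gterm G u n)%E).
  by rewrite /index_iota subn0; apply: lee_sum => n _; case: ifP => // _; exact: Gterm_ge0.
apply: (@nneseries_lim_ge _ (Gterm G u) xpredT 0 N) => n *; exact: Gterm_ge0.
Qed.

Lemma Gsum_ge G u g : (forall g, 0 <= u g)%E -> G g -> (u g <= Gsum G u)%E.
Proof.
move=> u0 Gg; have := @Gsum_ge_seq G u [:: g] u0 isT.
by rewrite big_seq1; apply=> h; rewrite inE => /eqP ->.
Qed.

Lemma Gsum_count G (Q : M2 -> bool) (K : nat) :
  (forall s, uniq s -> (forall g, g \in s -> G g /\ Q g) -> (size s <= K)%N) ->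
  (Gsum G (fun g => (Q g)%:R%:E) <= K%:R%:E)%E.
Proof.
move=> cK; pose u g : \bar R := (Q g)%:R%:E.
have u0 g : (0 <= u g)%E by rewrite lee_fin ler0n.
apply: lime_le; first by apply: is_cvg_nneseries => n *; exact: Gterm_ge0.
apply: nearW => N; pose q n := if pickle_inv n is Some g then `[< G g >] && Q g else false.
have -> : (\sum_(0 <= n < N) Gterm G u n = (count q (iota 0 N))%:R%:E)%E.
  rewrite /index_iota subn0; elim: (iota 0 N) => [|n s ih]; first by rewrite big_nil.
  rewrite big_cons ih /= natrD EFinD; congr (_ + _)%E; rewrite /Gterm /q /u.
  by case: pickle_inv => // g; case: asboolP => //= _; case: (Q g).
rewrite lee_fin ler_nat -size_filter.
pose s := pmap (pickle_inv : nat -> option M2) [seq n <- iota 0 N | q n].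
have pi n : n \in [seq n <- iota 0 N | q n] -> exists2 g, pickle_inv n = Some g & G g /\ Q g.
  rewrite mem_filter /q => /andP[+ _]; case E: (pickle_inv n) => [g|//] /andP[/asboolP Gg Qg].
  by exists g.
have -> : size [seq n <- iota 0 N | q n] = size s.
  rewrite size_pmap -[LHS](count_predT); apply: eq_in_count => n /pi [g e _].
  by rewrite /= e.
apply: cK; last first.
  move=> g; rewrite mem_pmap => /mapP[n /pi[h e gh]]; rewrite e => -[->]; exact: gh.
apply: (pmap_uniq (@pickle_invK _)); exact/filter_uniq/iota_uniq.
Qed.

Lemma measurable_Gsum G (d : measure_display) (T : measurableType d) (u : M2 -> T -> \bar R) :
  (forall g, G g -> measurable_fun setT (u g)) -> (forall g x, 0 <= u g x)%E ->
  measurable_fun setT (fun x => Gsum G (fun g => u g x)).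
Proof.
move=> mu u0; apply: (@ge0_emeasurable_sum _ _ _ _ (fun n x => Gterm G (u^~ x) n) xpredT).
  by move=> n x _ _; exact: Gterm_ge0.
move=> n _; rewrite /Gterm; case: pickle_inv => [g|]; last exact: measurable_cst.
by case: asboolP => [/mu//|_]; exact: measurable_cst.
Qed.

Lemma hmeas_Gsum G (u : M2 -> C -> \bar R) : (forall g, G g -> hmeas (u g)) ->
  (forall g x, 0 <= u g x)%E -> hmeas (fun z => Gsum G (fun g => u g z)).
Proof. by move=> mu u0; apply: measurable_Gsum. Qed.

Lemma hyp_Gsum G (u : M2 -> C -> \bar R) : (forall g, G g -> hmeas (u g)) ->
  (forall g x, 0 <= u g x)%E ->
  hyp (fun z : C => Gsum G (fun g => u g z)) = Gsum G (fun g => hyp (u g)).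
Proof.
move=> mu u0.
have w0 p : (0 <= ((invpos p) ^+ 2)%:E :> \bar R)%E by rewrite lee_fin sqr_ge0.
have g0 n p : (0 <= Gterm G (fun g => u g (p.1 +i* p.2)) n * (invpos p.2 ^+ 2)%:E)%E.
  by rewrite mule_ge0// Gterm_ge0.
transitivity (\int[@area R]_p
   (\sum_(n <oo) (Gterm G (fun g => u g (p.1 +i* p.2)) n * (invpos p.2 ^+ 2)%:E)))%E.
  apply: eq_integral => p _; rewrite /Gsum muleC -nneseriesZl.
    by apply: eq_eseriesr => n _; rewrite muleC.
  by move=> n _; exact: Gterm_ge0.
rewrite integral_nneseries//.
  apply: eq_eseriesr => n _; rewrite /Gterm; case: pickle_inv => [g|].
    by case: ifP => // _; apply: integral0_eq => p _; rewrite mul0e.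
  by apply: integral0_eq => p _; rewrite mul0e.
move=> n; apply: emeasurable_funM; last exact: measurable_invpos2.
rewrite /Gterm; case: pickle_inv => [g|]; last exact: measurable_cst.
by case: asboolP => [/mu//|_]; exact: measurable_cst.
Qed.

Lemma GsumZ G u (a : \bar R) : (0 <= a)%E -> (forall g, 0 <= u g)%E ->
  (a * Gsum G u = Gsum G (fun g => a * u g))%E.
Proof.
move=> a0 u0.
have E n : Gterm G (fun g => a * u g)%E n = (a * Gterm G u n)%E.
  by rewrite /Gterm; case: pickle_inv => [g|]; [case: ifP|]; rewrite ?mule0.
rewrite /Gsum; under [RHS]eq_eseriesr do rewrite E.
case: a a0 {E} => [a a0||//]; first by rewrite nneseriesZl// => n _; exact: Gterm_ge0.
(* For the factor +oo, both sides are 0 if all terms vanish and +oo otherwise. *)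
move=> _; have [/eqP z|nz] := boolP (Gsum G u == 0%E).
  have t0 n : Gterm G u n = 0%E.
    apply/eqP; rewrite eq_le Gterm_ge0// andbT -[leRHS]z.
    rewrite /Gterm; case: pickle_inv => [g|]; last exact: Gsum_ge0.
    by case: asboolP => [Gg|_]; [exact: Gsum_ge|exact: Gsum_ge0].
  rewrite -/(Gsum G u) z mule0; apply/esym.
  by under eq_eseriesr do rewrite t0 mule0; exact: eseries0.
rewrite -/(Gsum G u) gt0_mulye; last by rewrite lt0e nz Gsum_ge0.
have [n tn] : exists n, Gterm G u n != 0%E.
  apply: contrapT => /forallNP h; move/eqP: nz; apply.
  by apply: eseries0 => n _ _; apply/eqP/negPn/negP; exact: h.
apply/esym; apply: (@nneseries_pinfty _ _ xpredT n) => // [k _|].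
  by rewrite mule_ge0// Gterm_ge0.
by rewrite gt0_mulye// lt0e tn Gterm_ge0.
Qed.

Variables (G : set M2) (F : set C).
Hypotheses (sG : is_subgroup G) (fF : fundamental_domain G F).

Definition indF (z : C) : \bar R := (\1_F z)%:E.

Lemma indF_ge0 z : (0 <= indF z)%E.
Proof. by rewrite lee_fin. Qed.

Lemma hmeas_ind (A : set C) : measurable (plane A) -> hmeas (fun z => (\1_A z : R)%:E).
Proof.
move=> mA; apply/measurable_EFinP.
have -> : (fun p : RM * RM => \1_A (p.1 +i* p.2)) = (\1_(plane A) : RM * RM -> R).
  by apply/funext => p; rewrite !indicE; congr (_%:R); apply/idP/idP => /set_mem h; apply/mem_set.
exact: measurable_indic.
Qed.

Lemma hmeas_indF : hmeas indF.
Proof. by apply: hmeas_ind; have [] := fF. Qed.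

Lemma hmeasM phi psi : hmeas phi -> hmeas psi -> @hmeas R (fun z => phi z * psi z)%E.
Proof. exact: emeasurable_funM. Qed.

(** Invariance of the measure in the form of an adjunction, which moves the group element from one
    factor to the other. *)
Lemma hyp_swap (phi psi : C -> \bar R) g : SL2Z g -> hmeas phi -> hmeas psi ->
  (forall z, 0 <= phi z)%E -> (forall z, 0 <= psi z)%E ->
  hyp (fun z : C => phi z * psi (mobius g z))%E = hyp (fun z : C => phi (mobius g^-1 z) * psi z)%E.
Proof.
move=> sg m1 m2 p0 q0.
rewrite -(@hyp_mobius _ (fun z => phi (mobius g^-1 z) * psi z)%E g)//.
- by apply: hyp_eq => z Hz; rewrite mobiusK.
- by apply: hmeasM => //; exact: hmeas_mobius.
- by move=> z; rewrite mule_ge0.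
Qed.

(* Unfolding: the translates of F cover H ([unfold_le]) and overlap, up to sign,
   only in null sets ([unfold_ge]). *)
Lemma unfold_le (phi : C -> \bar R) : hmeas phi -> (forall z, 0 <= phi z)%E ->
  (hyp phi <= hyp (fun z : C => indF z * Gsum G (fun g => phi (mobius g^-1 z))))%E.
Proof.
move=> m p0; have [FH mF cov _] := fF; have mI := hmeas_indF; have I0 := indF_ge0.
have mg g : hmeas (fun z => phi (mobius g^-1 z)) by exact: hmeas_mobius.
apply: (@le_trans _ _ (hyp (fun z : C => Gsum G (fun g => phi z * indF (mobius g z))%E))).
  apply: le_hyp => //.
  - apply: hmeas_Gsum => [g _|g z]; last by rewrite mule_ge0.
    by apply: hmeasM => //; exact: hmeas_mobius.
  - move=> z Hz; have [g Gg Fg] := cov z Hz.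
    apply: (@le_trans _ _ (phi z * indF (mobius g z))%E).
      by rewrite /indF indicE mem_set// mule1.
    by apply: (@Gsum_ge _ (fun g => phi z * indF (mobius g z)))%E => // h; rewrite mule_ge0.
rewrite hyp_Gsum; last 2 first.
- by move=> g _; apply: hmeasM => //; exact: hmeas_mobius.
- by move=> g z; rewrite mule_ge0.
have -> : hyp (fun z : C => indF z * Gsum G (fun g => phi (mobius g^-1 z)))%E =
    Gsum G (fun g => hyp (fun z : C => indF z * phi (mobius g^-1 z))%E).
  rewrite -hyp_Gsum; last 2 first.
  - by move=> g _; exact: hmeasM.
  - by move=> g z; rewrite mule_ge0.
  by congr hyp; apply/funext => z; rewrite GsumZ.
apply: le_Gsum => [g|g Gg]; first by apply: integral_ge0 => p _; rewrite !mule_ge0// lee_fin sqr_ge0.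
rewrite hyp_swap//; last exact: (G_SL2Z sG).
by under [X in (hyp X <= _)%E]funext do rewrite muleC.
Qed.

Lemma hyp_eq0 (phi : C -> \bar R) (N : set (RM * RM)) : hmeas phi -> (forall z, 0 <= phi z)%E ->
  measurable N -> @area R N = 0%E ->
  (forall z, H z -> ~ N (complex.Re z, complex.Im z) -> phi z = 0%E) -> hyp phi = 0%E.
Proof.
move=> m p0 mN N0 h.
have e : hyp phi = (\int[@area R]_(p in N) (phi (p.1 +i* p.2) * ((invpos p.2) ^+ 2)%:E))%E.
  rewrite /hyp [RHS]integral_mkcond; apply: eq_integral => p _; rewrite patchE.
  case: ifPn => // /negP pN; rewrite /invpos; case: ifP => p2; last by rewrite expr0n mule0.
  by rewrite h ?mul0e//= => Np; apply: pN; apply/mem_set; case: p p2 Np => a b.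
rewrite e; apply: (null_set_integral mN) => //.
by apply: (@measurable_funTS); exact: measurable_hyp.
Qed.

Lemma unfold_ge (phi : C -> \bar R) : hmeas phi -> (forall z, 0 <= phi z)%E ->
  (hyp (fun z : C => indF z * Gsum G (fun g => phi (mobius g^-1 z))) <= 2%:R%:E * hyp phi)%E.
Proof.
move=> m p0; have [FH mF cov ovl] := fF; have mI := hmeas_indF; have I0 := indF_ge0.
have mg g : hmeas (fun z => phi (mobius g^-1 z)) by exact: hmeas_mobius.
have gS := G_SL2Z sG.
pose P h (N : set (RM * RM)) := (G h -> h <> 1 -> h <> -1 ->
  [/\ measurable N, @area R N = 0%E & plane (F `&` mobius h @` F) `<=` N]).
have /choice [N hN] : forall h : M2, exists N, P h N.
  move=> h; case: (pselect [/\ G h, h <> 1 & h <> -1]) => [[a b c]|n].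
    by have [N0 [? ? ?]] := ovl h a b c; exists N0 => *; split.
  by exists set0 => a b c; case: n.
(* [bad h] is +oo on a null set that contains the overlap of F with h F. The sum B of all its
   translates costs nothing, since the integral of phi * B is 0. With it in the majorant, the
   pointwise inequality need only be checked where phi is nonzero and no translate of z is in a bad
   set. *)
pose bad h (z : C) : \bar R := if `[< [/\ G h, h <> 1 & h <> -1] >] then
  (+oo * (\1_(N h) (complex.Re z, complex.Im z))%:E)%E else 0%E.
have mbad h : hmeas (bad h).
  rewrite /bad; case: asboolP => [[a b c]|_]; last exact: measurable_cst.
  have [mN _ _] := hN h a b c.
  apply: emeasurable_funM; first exact: measurable_cst.
  apply/measurable_EFinP; have := @measurable_indic _ _ R setT _ mN.
  by apply: eq_measurable_fun => -[].
have bad0 h z : (0 <= bad h z)%E by rewrite /bad; case: ifP => // _; rewrite mule_ge0.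
pose B z := Gsum G (fun g => Gsum G (fun h => bad h (mobius g z))).
have mB1 : forall g, hmeas (fun z => Gsum G (fun h => bad h (mobius g z))).
  by move=> g; apply: hmeas_Gsum => // h _; exact: hmeas_mobius.
have B10 g z : (0 <= Gsum G (fun h => bad h (mobius g z)))%E by exact: Gsum_ge0.
have mB : hmeas B by apply: hmeas_Gsum.
have B0 z : (0 <= B z)%E by exact: Gsum_ge0.
have hB : hyp (fun z : C => phi z * B z)%E = 0%E.
  rewrite /B; under [X in hyp X]funext do rewrite GsumZ//.
  rewrite hyp_Gsum; last 2 first.
  - by move=> g _; exact: hmeasM.
  - by move=> g z; rewrite mule_ge0.
  rewrite (@eq_Gsum _ _ (fun=> 0%E)).
    by apply: eseries0 => n *; rewrite /Gterm; case: pickle_inv => // ?; case: ifP.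
  move=> g Gg; under [X in hyp X]funext do rewrite GsumZ//.
  rewrite hyp_Gsum; last 2 first.
  - by move=> h _; apply: hmeasM => //; exact: hmeas_mobius.
  - by move=> h z; rewrite mule_ge0.
  rewrite (@eq_Gsum _ _ (fun=> 0%E)).
    by apply: eseries0 => n *; rewrite /Gterm; case: pickle_inv => // ?; case: ifP.
  move=> h Gh; rewrite (@hyp_swap phi (bad h))//; last exact: gS.
  rewrite /bad; case: asboolP => [[a b c]|_]; last first.
    by apply: integral0_eq => p _; rewrite mule0 mul0e.
  have [mN N0 _] := hN h a b c.
  have mb := mbad h; rewrite /bad asboolT// in mb.
  apply: (hyp_eq0 _ _ mN N0).
  - exact: hmeasM.
  - by move=> z; rewrite !mule_ge0.
  - by move=> z _ nN; rewrite indicE memNset// mulr0n !mule0.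
have -> : hyp (fun z : C => indF z * Gsum G (fun g => phi (mobius g^-1 z)))%E =
    hyp (fun z : C => phi z * Gsum G (fun g => indF (mobius g z)))%E.
  under [X in hyp X = _]funext do rewrite GsumZ//.
  under [X in _ = hyp X]funext do rewrite GsumZ//.
  rewrite !hyp_Gsum; last 4 first.
  - by move=> g _; apply: hmeasM => //; exact: hmeas_mobius.
  - by move=> g z; rewrite mule_ge0.
  - by move=> g _; apply: hmeasM.
  - by move=> g z; rewrite mule_ge0.
  apply: eq_Gsum => g Gg; rewrite (@hyp_swap phi indF g)//; last exact: gS.
  by congr hyp; apply/funext => z; rewrite muleC.
have m2 : @hmeas R (fun=> 2%:R%:E) by exact: measurable_cst.
apply: (@le_trans _ _ (hyp (fun z : C => 2%:R%:E * phi z + phi z * B z)%E)); last first.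
  rewrite hypD ?hB ?adde0 ?hypZ//.
  - exact: (hmeasM m2).
  - exact: hmeasM.
  - by move=> z; rewrite mule_ge0// lee_fin.
  - by move=> z; rewrite mule_ge0.
apply: le_hyp.
- apply: hmeasM => //; apply: hmeas_Gsum => // g _; exact: hmeas_mobius.
- apply: emeasurable_funD; last exact: hmeasM.
  exact: (hmeasM m2).
- by move=> z _; rewrite mule_ge0// Gsum_ge0.
move=> z Hz; have [->|phi0] := eqVneq (phi z) 0%E.
  by rewrite !mul0e mule0 adde0.
have [[g [h [Gg Gh [h1 h2] Nz]]]|good] := pselect (exists g h,
    [/\ G g, G h, h <> 1 /\ h <> -1 & N h (complex.Re (mobius g z), complex.Im (mobius g z))]).
  have bh : bad h (mobius g z) = +oo%E.
    by rewrite /bad asboolT// indicE mem_set// mule1.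
  have -> : B z = +oo%E.
    apply/eqP; rewrite -leye_eq -bh.
    apply: (le_trans (@Gsum_ge G (fun h => bad h (mobius g z)) h _ Gh)) => //.
    exact: (@Gsum_ge G (fun g => Gsum G (fun h => bad h (mobius g z))) g).
  rewrite gt0_muley; last by rewrite lt0e phi0 p0.
  by rewrite addey ?leey// -ltNye (lt_le_trans ltNy0)// mule_ge0// lee_fin.
rewrite -[leLHS]adde0; apply: leeD; last by rewrite mule_ge0.
rewrite muleC lee_wpmul2r//.
have -> : Gsum G (fun g => indF (mobius g z)) = Gsum G (fun g => (mobius g z \in F)%:R%:E).
  by apply: eq_Gsum => g _; rewrite /indF indicE.
apply: Gsum_count => -[//|g s] us gs.
(* If g z and h z are both in F, then g h^-1 has an overlap at g z, so at a good point it is 1 or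
   -1. This is the factor 2. *)
suff : {subset g :: s <= [:: g; - g]} by move=> /(uniq_leq_size us).
move=> h hs; have [Gg /set_mem Fg] := gs g (mem_head _ _).
have [Gh /set_mem Fh] := gs h hs.
rewrite !inE; apply/orP; apply: contrapT => nn; apply: good.
have gU := SL2Z_unit (gS _ Gg); have hU := SL2Z_unit (gS _ Gh).
exists g, (g * h^-1); split => //.
- by apply: (GM sG) => //; exact: (GV sG).
- split=> e; apply: nn.
    by left; rewrite -[g](divrK hU) e mul1r.
  by right; rewrite -[g](divrK hU) e mulN1r opprK.
have GK : G (g * h^-1) by apply: (GM sG) => //; exact: (GV sG).
have [] := hN (g * h^-1) GK.
- by move=> e; apply: nn; left; rewrite -[g](divrK hU) e mul1r.
- by move=> e; apply: nn; right; rewrite -[g](divrK hU) e mulN1r opprK.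
move=> _ _; apply; rewrite /plane /=.
have -> : complex.Re (mobius g z) +i* complex.Im (mobius g z) = mobius g z by case: (mobius g z).
split=> //; exists (mobius h z) => //.
by rewrite -mobiusM ?divrK//; [exact: gS|exact: gS].
Qed.

End Unfold.

(** * The upper bound *)

Section Count.
Variable R : realType.
Local Notation C := R[i].
Local Notation H := (@upper_half R).
Local Notation M2 := 'M[int]_2.

(* Outside the region Im >= 1/2, an integer translation followed by z |-> -1/z
   at least doubles the imaginary part. *)
Lemma reduction (z : C) : H z ->
  exists t w, [/\ SL2Z t, 1 / 2 <= complex.Im w & z = mobius t w].
Proof.
move=> Hz.
have step n : exists g, SL2Z g /\
    (1 / 2 <= complex.Im (mobius g z) \/ 2 ^+ n * complex.Im z <= complex.Im (mobius g z)).
  elim: n => [|n [g [sg [h|h]]]].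
  - by exists 1; split; [exact: SL2Z1|right; rewrite mobius1 expr0 mul1r].
  - by exists g; split => //; left.
  have [big|small] := lerP (1 / 2) (complex.Im (mobius g z)).
    by exists g; split => //; left.
  set w := mobius g z in h small.
  have Hw : H w by exact: mobius_upper.
  pose l := - Num.floor (complex.Re w + 1 / 2).
  pose S := mx2 0 (-1) 1 0.
  have [S00 S01 S10 S11] := mx2E 0 (-1) 1 0 : [/\ _, _, _ & _].
  have sS : SL2Z S by apply: SL2Z_mx2; rewrite mul0r mulN1r opprK add0r.
  have sU : SL2Z (Um l) by exact: SL2Z_Um.
  have HU : H (mobius (Um l) w) by exact: mobius_upper.
  exists (S * Um l * g); split; first by do 2?apply: SL2ZM.
  right; rewrite mobiusM//; last exact: SL2ZM.
  rewrite -/w mobiusM// Im_mobius// mobius_Um.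
  have -> : cabs (jfac S (w + l%:~R)) ^+ 2 = (complex.Re w + l%:~R) ^+ 2 + complex.Im w ^+ 2.
    rewrite cabs_sqr /jfac S10 S11 mul1r addr0 !ReD !ImD intrCE /= addr0.
    by [].
  rewrite ImD intrCE /= addr0.
  have [l1 l2] : -1/2 <= complex.Re w + l%:~R /\ complex.Re w + l%:~R <= 1/2.
    rewrite /l rmorphN /=; have := Num.Theory.floor_le (complex.Re w + 1 / 2).
    by have := lt_succ_floor (complex.Re w + 1 / 2); rewrite intrD; lra.
  set x := complex.Re w + l%:~R in l1 l2 *.
  have y0 : 0 < complex.Im w by exact: Hw.
  rewrite ler_pdivlMr; last by rewrite ltr_wpDl ?sqr_ge0// exprn_gt0.
  have q : x ^+ 2 + complex.Im w ^+ 2 <= 1 / 2 by nra.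
  rewrite exprS; have p0 : 0 <= 2 ^+ n * complex.Im z.
    by rewrite mulr_ge0 ?exprn_ge0//; exact: ltW.
  set P := _ * complex.Im z in h p0; rewrite -mulrA -/P; nra.
have [N hN] : exists N, 1 / 2 <= 2 ^+ N * complex.Im z.
  have y0 : 0 < complex.Im z by exact: Hz.
  exists (Num.bound (complex.Im z)^-1).
  have b : (complex.Im z)^-1 < (Num.bound (complex.Im z)^-1)%:R.
    by rewrite archi_boundP// invr_ge0 ltW.
  have c : (Num.bound (complex.Im z)^-1)%:R <= 2 ^+ (Num.bound (complex.Im z)^-1) :> R.
    by rewrite -natrX ler_nat ltnW// ltn_expl.
  have : 1 <= 2 ^+ (Num.bound (complex.Im z)^-1) * complex.Im z.
    by rewrite -ler_pdivrMr// mul1r ltW// (lt_le_trans b).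
  lra.
have [g [sg hg]] := step N.
exists g^-1, (mobius g z); split; first exact: SL2ZV.
  by case: hg => // hg; exact: le_trans hg.
by rewrite mobiusK.
Qed.

(** Since (1 + v)^2 <= 2 (1 + v^2), each term is at most (2 / h) (1 / (1 + v - h) - 1 / (1 + v)),
    and these differences telescope. *)
Lemma sum_inv_sqr_pos (h b : R) (N : nat) : 0 < h -> 0 <= b ->
  \sum_(m < N) (1 + (b + h * m%:R) ^+ 2)^-1 <= 1 + 2 / h.
Proof.
move=> h0 b0.
case: N => [|N]; first by rewrite big_ord0 addr_ge0// divr_ge0// ltW.
apply: (@le_trans _ _ (1 + 2 / h * ((1 + b)^-1 - (1 + (b + h * N%:R))^-1))).
  elim: N => [|N ih].
    rewrite big_ord1 mulr0 addr0 subrr mulr0 addr0 invf_le1; last by have := sqr_ge0 b; lra.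
    by have := sqr_ge0 b; lra.
  rewrite big_ord_recr /=; apply: (le_trans (lerD ih (lexx _))).
  have -> : h * N.+1%:R = h * N%:R + h by rewrite -natr1 mulrDr mulr1.
  have n0 : 0 <= h * N%:R by rewrite mulr_ge0// ltW.
  set u := h * N%:R in n0 *; set v := b + (u + h).
  have v0 : 0 <= v by rewrite /v; lra.
  have -> : (1 + (b + u))^-1 = (1 + v - h)^-1 by congr (_^-1); rewrite /v; ring.
  have p1 : 0 < 1 + v by lra.
  have p2 : 0 < 1 + v - h by rewrite /v; lra.
  have p3 : 0 < 1 + v ^+ 2 by have := sqr_ge0 v; lra.
  have : (1 + v ^+ 2)^-1 <= 2 / h * ((1 + v - h)^-1 - (1 + v)^-1).
    have -> : 2 / h * ((1 + v - h)^-1 - (1 + v)^-1) = 2 / ((1 + v) * (1 + v - h)).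
      by field; rewrite !gt_eqF.
    rewrite ler_pdivlMr ?mulr_gt0// mulrC ler_pdivrMr//.
    have : (1 + v) * (1 + v - h) <= (1 + v) * (1 + v) by rewrite ler_wpM2l; lra.
    have := sqr_ge0 (v - 1); nra.
  set q1 := (1 + v - h)^-1; set q2 := (1 + v)^-1; set q3 := (_ + _ ^+ 2)^-1.
  have -> : 1 + 2 / h * ((1 + b)^-1 - q2) =
    1 + 2 / h * ((1 + b)^-1 - q1) + 2 / h * (q1 - q2) by ring.
  by move=> e; rewrite lerD2l.
rewrite lerD2l -[leRHS]mulr1; apply: ler_wpM2l; first by rewrite divr_ge0// ltW.
have i1 : (1 + b)^-1 <= 1 by rewrite invf_le1; lra.
have i2 : 0 <= (1 + (b + h * N%:R))^-1.
  by rewrite invr_ge0 !addr_ge0// mulr_ge0// ltW.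
lra.
Qed.

(** A sequence of step h has O(1 + 1 / h) elements of bounded size, wherever it starts. The negative
    part telescopes like the positive one, with the mirrored potential 1 / (1 - c), until it crosses
    0. *)
Lemma sum_inv_sqr (h b : R) (N : nat) : 0 < h ->
  \sum_(m < N) (1 + (b + h * m%:R) ^+ 2)^-1 <= 2 + 4 / h.
Proof.
move=> h0; have h2 : 0 < 2 / h by rewrite divr_gt0.
have h4 : 4 / h = 2 / h + 2 / h by rewrite -mulrDl; congr (_ / _); ring.
suff K c : c < 0 -> \sum_(m < N) (1 + (c + h * m%:R) ^+ 2)^-1 <=
    1 + 2 / h + (1 + 2 / h * (1 - (1 - c)^-1)).
  have [b0|b0] := lerP 0 b; first by have := sum_inv_sqr_pos N h0 b0; lra.
  apply: (le_trans (K b b0)).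
  have : 2 / h * (1 - (1 - b)^-1) <= 2 / h * 1.
    by rewrite ler_pM2l// gerBl invr_ge0; lra.
  lra.
elim: N c => [|N ih] c c0.
  have : 0 <= 2 / h * (1 - (1 - c)^-1).
    by rewrite mulr_ge0 ?(ltW h2)// subr_ge0 invf_le1; lra.
  rewrite big_ord0; lra.
rewrite big_ord_recl mulr0 addr0.
have -> : \sum_(i < N) (1 + (c + h * (bump 0 i)%:R) ^+ 2)^-1 =
    \sum_(m < N) (1 + ((c + h) + h * m%:R) ^+ 2)^-1.
  apply: eq_bigr => i _; rewrite /bump /= natrD mulrDr mulr1 addrA.
  by [].
have p3 : 0 < 1 + c ^+ 2 by have := sqr_ge0 c; lra.
have q0 : 0 <= 2 / h * (1 - (1 - c)^-1).
  by rewrite mulr_ge0 ?(ltW h2)// subr_ge0 invf_le1; lra.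
have [d0|d0] := lerP 0 (c + h).
  have := sum_inv_sqr_pos N h0 d0.
  have : (1 + c ^+ 2)^-1 <= 1 by rewrite invf_le1//; have := sqr_ge0 c; lra.
  lra.
have := ih _ d0.
have : (1 + c ^+ 2)^-1 <= 2 / h * ((1 - (c + h))^-1 - (1 - c)^-1).
  have p1 : 0 < 1 - c by lra.
  have p2 : 0 < 1 - (c + h) by lra.
  have -> : 2 / h * ((1 - (c + h))^-1 - (1 - c)^-1) = 2 / ((1 - c) * (1 - (c + h))).
    by field; rewrite !gt_eqF.
  rewrite ler_pdivlMr ?mulr_gt0// mulrC ler_pdivrMr//.
  have : (1 - c) * (1 - (c + h)) <= (1 - c) * (1 - c) by rewrite ler_wpM2l; lra.
  have := sqr_ge0 (c + 1); nra.
set q1 := (1 - (c + h))^-1; set q2 := (1 - c)^-1; nra.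
Qed.

Variable (G : set M2).
Hypotheses (sG : is_subgroup G) (fG : finite_index G) (GN1 : G (-1)).

(** The bound is 1 / 4 although [reduction] reaches height 1 / 2: a box of relative half-height 1 /
    sqrt k <= 1 / 2 around such a point stays above 1 / 4. *)
Definition in_box (n : nat) (w : C) : bool :=
  [&& 0 <= complex.Re w, complex.Re w < n%:R & 1 / 4 <= complex.Im w].

(** The h of the proof moves one point w of the box to another. With y = Im w >= 1 / 4 and Im (h w)
    >= 1 / 4 one gets (c x + d)^2 + c^2 y^2 <= 4 y, so |c| <= 4, which leaves 9 values; for c <> 0
    then |c x + d| <= 2, which leaves 5 values of d: 45 rows in all. Equal rows force equal
    matrices: the quotient is a translation by a multiple of n, and the box is only n wide. *)
Lemma count_box t z (s : seq M2) : SL2Z t -> H z -> uniq s ->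
  (forall g, g \in s -> G g /\ in_box (cusp_width G t) (mobius (t^-1 * g) z)) ->
  (size s <= 45)%N.
Proof.
move=> st Hz us; have [n0 wid] := cusp_widthP sG fG GN1 st.
move: n0 wid; generalize (cusp_width G t) => n n0 wid hs.
case: s us hs => [//|g0 s] us hs; have gS := G_SL2Z sG.
set s' := g0 :: s in us hs *; have [G0 /and3P[_ _ im0]] := hs g0 (mem_head _ _).
have s0 := gS _ G0; have stV := SL2ZV st; have tU := SL2Z_unit st; have g0U := SL2Z_unit s0.
set w := mobius (t^-1 * g0) z in im0.
have Hw : H w by apply: mobius_upper => //; exact: SL2ZM.
pose h g : M2 := t^-1 * g * g0^-1 * t.
have sh g : g \in s' -> SL2Z (h g).
  by move=> /hs[/gS sg _]; rewrite /h; do 3?apply: SL2ZM => //; exact: SL2ZV.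
have hw g : g \in s' -> mobius (h g) w = mobius (t^-1 * g) z.
  move=> gs; have [/gS sg _] := hs g gs.
  rewrite /w -mobiusM//; [|exact: sh|exact: SL2ZM].
  by rewrite /h !mulrA -(mulrA _ t) mulrV// mulr1 divrK.
(* The least candidate for d given c; if c = 0 then d is 1 or -1, which the same five offsets
   cover. *)
pose D (c : int) : int := if c == 0 then -1 else Num.floor (- (c%:~R * complex.Re w) - 2).
pose L : seq (int * int) := [seq (c, D c + d) | c <- [:: -4; -3; -2; -1; 0; 1; 2; 3; 4], d <- [:: 0; 1; 2; 3; 4]].
pose row g := (h g 1 0, h g 1 1).
have rowL g : g \in s' -> row g \in L.
  move=> gs; have [_ /and3P[_ _]] := hs g gs; have shg := sh g gs.
  rewrite -hw// (Im_mobius shg Hw).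
  have y0 : 0 < complex.Im w by lra.
  rewrite ler_pdivlMr ?exprn_gt0 ?cabs_jfac_gt0//.
  rewrite cabs_sqr Re_jfac Im_jfac => bound.
  set c : int := h g 1 0 in bound *; set d : int := h g 1 1 in bound *.
  set y := complex.Im w in y0 im0 bound; set x := complex.Re w in bound.
  have cy : c%:~R ^+ 2 * y <= 4 :> R.
    rewrite -(ler_pM2r y0); have := sqr_ge0 (c%:~R * x + d%:~R); nra.
  have c4 : c%:~R ^+ 2 <= 16 :> R by have := sqr_ge0 (c%:~R : R); nra.
  have c4' : c * c <= 16 by rewrite -(ler_int R) intrM -expr2.
  have cm : c \in [:: -4; -3; -2; -1; 0; 1; 2; 3; 4] by rewrite !inE; clear - c4'; nia.
  suff dm : d - D c \in [:: 0; 1; 2; 3; 4].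
    apply/allpairsP; exists (c, d - D c); split => //=.
    by rewrite /row -/c -/d [D c + _]addrC subrK.
  rewrite /D; have [c0|c0] := eqVneq c 0.
    have /SL2ZE := sh g gs; rewrite -/c -/d c0 mulr0 subr0 => ad.
    have : (d == 1) || (d == -1) by have := intUnitRing.unitzPl ad; rewrite qualifE.
    by rewrite !inE; move: (d); clear; lia.
  have c1 : 1 <= c%:~R ^+ 2 :> R.
    rewrite expr2 -intrM -[1]/(1%:~R) ler_int; clear -c0; nia.
  have : (c%:~R * x + d%:~R) ^+ 2 <= 2 ^+ 2.
    have := sqr_ge0 (y - 2); nra.
  rewrite -real_normK ?num_real// ler_sqr ?nnegrE// ler_norml.
  move=> /andP[b1 b2].
  have := Num.Theory.floor_le (- (c%:~R * x) - 2); have := lt_succ_floor (- (c%:~R * x) - 2).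
  rewrite intrD; set f := Num.floor _ => f1 f2.
  have g1 : f%:~R <= d%:~R :> R by lra.
  have g2 : d%:~R < (f + 5)%:~R :> R by rewrite intrD; lra.
  move: g1 g2; rewrite ler_int ltr_int !inE.
  by move: d f {bound b1 b2 f1 f2} => d f; clear; lia.
suff inj : {in s' &, injective row}.
  have -> : 45%N = size L by [].
  rewrite -(size_map row); apply: uniq_leq_size; first by rewrite map_inj_in_uniq.
  by move=> _ /mapP[g gs ->]; exact: rowL.
move=> g g' gs gs' [r0 r1].
have [l e] := SL2Z_same_row (sh g gs) (sh g' gs') r0 r1.
have [Gg /and3P[a1 a2 _]] := hs g gs; have [Gg' /and3P[b1 b2 _]] := hs g' gs'.
have gU := SL2Z_unit (gS _ Gg).
have e2 : t^-1 * g' = Um l * (t^-1 * g).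
  apply: (mulIr (x := g0^-1 * t)); first by rewrite unitrMr ?unitrV.
  by move: e; rewrite /h !mulrA.
have e3 : t * Um l * t^-1 = g' * g^-1.
  apply: (mulIr gU); rewrite divrK// -!mulrA -e2 mulrA mulrV// mul1r.
  by [].
have /wid /dvdzP[q lq] : G (t * Um l * t^-1) by rewrite e3; apply: (GM sG) => //; exact: (GV sG).
have : mobius (t^-1 * g') z = mobius (t^-1 * g) z + l%:~R.
  rewrite e2 mobiusM//; [by rewrite mobius_Um|exact: SL2Z_Um|by apply: SL2ZM => //; exact: gS].
move=> E; move: b1 b2; rewrite E ReD intrCE /= lq.
rewrite intrM => b1 b2.
have nR : 0 < n%:R :> R by rewrite ltr0n.
have q1 : q < 1.
  rewrite -(ltr_int R) -(ltr_pM2r nR); lra.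
have q2 : -1 < q.
  rewrite -(ltr_int R) -(ltr_pM2r nR) mulN1r; lra.
have q0 : q = 0 by move: q q1 q2 {lq b1 b2} => q; clear; lia.
move: e2; rewrite lq q0 mul0r Um0 mul1r => /(mulrI _) ->//.
by rewrite unitrV.
Qed.

End Count.

(** * The discrete Parseval identity and Bessel's inequality on horizontal lines *)

Section Conv.
Variable R : realType.
Local Notation C := R[i].

Lemma cvgC_eps (u : nat -> C) (l : C) : (u : nat -> C^o) @ \oo --> (l : C^o) <->
  forall e : R, 0 < e -> exists N, forall n, (N <= n)%N -> cabs (l - u n) <= e.
Proof.
split=> [/cvgrPdist_le h e e0|h].
  have e0' : 0 < e%:C by rewrite ltcR.
  have [N _ hN] := h _ e0'; exists N => n /hN.
  by rewrite /= normCE lecR.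
apply/cvgrPdist_le => e /gt0_complexE[-> e0].
by have [N hN] := h _ e0; exists N => // n /hN; rewrite /= normCE lecR.
Qed.

Lemma sum_unity (J m : nat) : (0 < m < J)%N ->
  \sum_(j < J) cexp (0 +i* (2 * pi * m%:R / J%:R)) ^+ j = 0 :> C.
Proof.
move=> /andP[m0 mJ]; set w := cexp _.
have J0 : 0 < J%:R :> R by rewrite ltr0n (leq_ltn_trans _ mJ).
have w1 : w != 1.
  have p2 : 0 < 2 * pi :> R by rewrite mulr_gt0// pi_gt0.
  have mR : 0 < m%:R :> R by rewrite ltr0n.
  apply: e_neq1; apply/andP; split; first by rewrite divr_gt0// mulr_gt0.
  rewrite ltr_pdivrMr//.
  by rewrite ltr_pM2l ?mulr_gt0 ?pi_gt0// ltr_nat.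
apply: (mulfI (x := w - 1)); first by rewrite subr_eq0.
rewrite -subrX1 mulr0 /w -e_X mulrC mulfVK ?gt_eqF// (@cexp_2pi_int R m) subrr//.
Qed.

Lemma parseval (J : nat) (b : nat -> C) :
  \sum_(j < J) cabs (\sum_(m < J) b m * cexp (0 +i* (2 * pi * m%:R / J%:R)) ^+ j) ^+ 2 =
  J%:R * \sum_(m < J) cabs (b m) ^+ 2.
Proof.
case: J => [|J']; first by rewrite !big_ord0 mul0r.
set J := J'.+1; have J0 : 0 < J%:R :> R by rewrite ltr0n.
pose w (m : nat) : C := cexp (0 +i* (2 * pi * m%:R / J%:R)).
have wc m j : conjc (w m ^+ j) = (w m ^+ j)^-1.
  apply: (mulfI (x := w m ^+ j)); first by rewrite expf_neq0// cexp_neq0.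
  by rewrite mul_conj cabsX cabs_e !expr1n divff// expf_neq0// cexp_neq0.
have key (m m' : 'I_J) : \sum_(j < J) w m ^+ j * conjc (w m' ^+ j) = (m == m')%:R * J%:R.
  have [->|mm'] := eqVneq m m'.
    rewrite (eq_bigr (fun=> 1)) => [|j _]; first by rewrite sumr_const card_ord mul1r.
    by rewrite wc divff// expf_neq0// cexp_neq0.
  have wlt (p q : nat) : (p < q)%N -> (q < J)%N ->
      w q = w p * cexp (0 +i* (2 * pi * (q - p)%:R / J%:R)).
    by move=> pq qJ; rewrite -e_D; congr cexp; congr (_ +i* _);
      rewrite natrB ?(ltnW pq)// -mulrDl -mulrDr addrCA subrr addr0.
  rewrite mul0r; have [lt|le] := ltnP m m'; last first.
    have lt : (m' < m)%N by rewrite ltn_neqAle le andbT eq_sym.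
    rewrite -[RHS](@sum_unity J (m - m')); last first.
      by rewrite subn_gt0 lt /= (leq_ltn_trans (leq_subr _ _)).
    apply: eq_bigr => j _; rewrite wc (wlt m' m)// exprMn mulrAC divff ?mul1r//.
    by rewrite expf_neq0// cexp_neq0.
  apply: (can_inj (@conjcK R)); rewrite rmorph0 rmorph_sum /=.
  rewrite -[RHS](@sum_unity J (m' - m)); last first.
    by rewrite subn_gt0 lt /= (leq_ltn_trans (leq_subr _ _)).
  apply: eq_bigr => j _; rewrite rmorphM /= conjcK wc (wlt m m')// exprMn mulrA mulVf ?mul1r//.
  by rewrite expf_neq0// cexp_neq0.
apply: (can_inj (f := fun x : R => x%:C) (g := @complex.Re R)) => //.
rewrite rmorphM !rmorph_sum /= rmorph_nat.
under eq_bigr do rewrite -mul_conj rmorph_sum mulr_suml /=.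
rewrite exchange_big /= mulr_sumr; apply: eq_bigr => m _.
under eq_bigr do rewrite mulr_sumr.
rewrite exchange_big /= (bigD1 m)//= [X in _ + X]big1 ?addr0 => [|m' mm'].
  under eq_bigr do rewrite rmorphM /= mulrACA.
  by rewrite -mulr_sumr key eqxx mul1r mulrC mul_conj.
under eq_bigr do rewrite rmorphM /= mulrACA.
by rewrite -mulr_sumr key eq_sym (negbTE mm') mul0r mulr0.
Qed.

End Conv.

Section Series.
Variable R : realType.
Local Notation C := R[i].
Local Notation H := (@upper_half R).
Variables (n : nat) (kappa : R) (a : nat -> C) (g : C -> C).
Hypotheses (n0 : (0 < n)%N) (k0 : 0 <= kappa).

(** [cusp_term] with the width and the cusp parameter as free variables. *)
Definition fterm (z : C) (m : nat) : C := if 0 < m%:R + kappa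
  then a m * cexp ((0 +i* (2 * pi * (m%:R + kappa) / n%:R)) * z) else 0.

Hypothesis gser : forall z, H z -> series (fterm z : nat -> C^o) @ \oo --> (g z : C^o).

Definition fcoef (m : nat) : R := if 0 < m%:R + kappa then cabs (a m) else 0.

Let nR : 0 < n%:R :> R. Proof. by rewrite ltr0n. Qed.

Lemma cabs_fterm z m : cabs (fterm z m) =
  fcoef m * expR (- (2 * pi * (m%:R + kappa) / n%:R) * complex.Im z).
Proof.
rewrite /fterm /fcoef; case: ifP => _; last by rewrite cabs0 mul0r.
by rewrite cabsM cabs_cexp ReM /= mul0r sub0r mulNr.
Qed.

Lemma ftermE z (x : R) m : fterm (z + x%:C) m =
  fterm z m * cexp (0 +i* (2 * pi * (m%:R + kappa) / n%:R * x)).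
Proof.
rewrite /fterm; case: ifP => _; last by rewrite mul0r.
rewrite -[RHS]mulrA -cexpD mulrDr; congr (_ * cexp (_ + _)).
by apply/eqP; rewrite eq_complex /= !mul0r mulr0 subr0 add0r !eqxx.
Qed.

Lemma parseval_line z J : (0 < J)%N ->
  \sum_(j < J) cabs (series (fterm (z + (j%:R * (n%:R / J%:R))%:C)) J) ^+ 2 =
  J%:R * \sum_(m < J) cabs (fterm z m) ^+ 2.
Proof.
move=> J0; have JR : 0 < J%:R :> R by rewrite ltr0n.
rewrite -parseval; apply: eq_bigr => j _; congr (_ ^+ 2).
(* A factor of modulus 1 absorbs the non-integral part kappa of the frequencies. *)
have U (x : C) : cabs x = cabs (cexp (0 +i* (2 * pi * kappa / J%:R * j%:R)) * x).
  by rewrite cabsM cabs_e mul1r.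
rewrite [RHS]U mulr_sumr /series /= big_mkord; congr cabs; apply: eq_bigr => m _.
rewrite ftermE [RHS]mulrCA -e_X -e_D; congr (_ * cexp (_ +i* _)).
by field; rewrite !gt_eqF.
Qed.

(** Convergence at height v / 2 bounds the terms there, and doubling the height gains the factor
    exp(-pi v / n) to the power m. *)
Lemma fterm_geom (v : R) : 0 < v -> exists B q : R, [/\ 0 <= B, 0 < q < 1 &
  forall z m, complex.Im z = v -> cabs (fterm z m) <= B * q ^+ m].
Proof.
move=> v0; have [B B0 hB] : exists2 B : R, 0 <= B &
    forall m, cabs (fterm (0 +i* (v / 2)) m) <= B.
  have Hv : H (0 +i* (v / 2)) by rewrite /upper_half /= divr_gt0.
  have [N hN] := (cvgC_eps _ _).1 (gser Hv) 1 ltr01.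
  set z := _ +i* _ in hN Hv *.
  exists (2 + \sum_(m < N) cabs (fterm z m)).
    by rewrite addr_ge0// sumr_ge0// => i _; exact: cabs_ge0.
  move=> m; have [mN|Nm] := ltnP m N.
    rewrite (bigD1 (Ordinal mN))//= addrCA lerDl addr_ge0// sumr_ge0// => i _.
    exact: cabs_ge0.
  apply: (@le_trans _ _ 2); last by rewrite lerDl sumr_ge0// => i _; exact: cabs_ge0.
  have := hN _ Nm; have := hN m.+1 (leqW Nm).
  rewrite seriesSr => h1 h2.
  have -> : fterm z m = (g z - series (fterm z) m) - (g z - (series (fterm z) m + fterm z m)).
    by ring.
  by apply: (le_trans (cabsB _ _)); lra.
exists B, (expR (- (pi * v / n%:R))); split=> //.
  by rewrite expR_gt0/= expR_lt1 oppr_lt0 divr_gt0// mulr_gt0// pi_gt0.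
move=> z m zv; have := hB m; rewrite !cabs_fterm /= zv => h.
rewrite -expRM_natl.
apply: le_trans (ler_pM _ _ h (lexx _)); rewrite ?expR_ge0//; last first.
  by rewrite mulr_ge0 ?expR_ge0// /fcoef; case: ifP => // _; exact: cabs_ge0.
rewrite -[leRHS]mulrA -expRD ler_wpM2l//; first by rewrite /fcoef; case: ifP => // _; exact: cabs_ge0.
rewrite ler_expR.
have -> : - (2 * pi * (m%:R + kappa) / n%:R) * (v / 2) + m%:R * - (pi * v / n%:R) =
  - (2 * pi * (m%:R + kappa) / n%:R) * v + pi * v * kappa / n%:R by field; rewrite gt_eqF.
by rewrite lerDl; apply: divr_ge0; [rewrite !mulr_ge0// ?pi_ge0// ltW|exact: ltW].
Qed.

Lemma series_uniform (v : R) : 0 < v -> exists K q : R, [/\ 0 <= K, 0 < q < 1 &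
  forall z M, complex.Im z = v -> cabs (series (fterm z) M) <= K /\
    cabs (g z - series (fterm z) M) <= K * q ^+ M].
Proof.
move=> v0; have [B [q [B0 /andP[q0 q1] hB]]] := fterm_geom v0.
have q1' : 0 < 1 - q by rewrite subr_gt0.
have K0 : 0 <= B / (1 - q) by rewrite divr_ge0// ltW.
have diff z (M L : nat) : complex.Im z = v ->
    cabs (series (fterm z) (M + L)%N - series (fterm z) M) <= B / (1 - q) * q ^+ M.
  move=> zv; apply: (@le_trans _ _ (B * q ^+ M * \sum_(l < L) q ^+ l)).
    elim: L => [|L ih]; first by rewrite addn0 subrr cabs0 big_ord0 mulr0.
    rewrite addnS seriesSr addrAC big_ord_recr /= mulrDr.
    apply: (le_trans (cabsD _ _)); rewrite lerD//.
    by rewrite -mulrA -exprD; exact: hB.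
  rewrite mulrAC ler_wpM2r ?exprn_ge0 ?(ltW q0)//.
  rewrite ler_wpM2l// -(ler_pM2l q1') divff ?gt_eqF// -opprB mulNr -subrX1 opprB.
  by rewrite gerBl exprn_ge0// ltW.
exists (B / (1 - q)), q; split=> //; first by rewrite q0.
move=> z M zv; split.
  have := diff z 0%N M zv; rewrite expr0 mulr1 add0n.
  have -> : series (fterm z) 0 = 0 by rewrite /series /= big_geq.
  by rewrite subr0.
apply/ler_addgt0Pr => e e0.
have Hz : H z by rewrite /upper_half /= zv.
have [N hN] := (cvgC_eps _ _).1 (gser Hz) e e0.
have h1 := hN (M + N)%N (leq_addl _ _).
have -> : g z - series (fterm z) M = (series (fterm z) (M + N)%N - series (fterm z) M) +
    (g z - series (fterm z) (M + N)%N) by ring.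
by apply: (le_trans (cabsD _ _)); rewrite lerD// diff.
Qed.

Lemma cabs_periodic z : H z -> cabs (g (z + n%:R%:C)) = cabs (g z).
Proof.
move=> Hz; have v0 : 0 < complex.Im z by exact: Hz.
have zn : complex.Im (z + n%:R%:C) = complex.Im z by rewrite ImD /= addr0.
have Hzn : H (z + n%:R%:C) by exact: upperDr.
pose u : C := cexp (0 +i* (2 * pi * kappa)).
suff -> : g (z + n%:R%:C) = u * g z by rewrite cabsM cabs_e mul1r.
apply/eqP; rewrite -subr_eq0 -cabs_eq0 eq_le cabs_ge0 andbT.
apply/ler_addgt0Pr => e e0; rewrite add0r.
have e20 : 0 < e / 2 by rewrite divr_gt0.
have [N1 h1] := (cvgC_eps _ _).1 (gser Hz) _ e20.
have [N2 h2] := (cvgC_eps _ _).1 (gser Hzn) _ e20.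
have g1 := h1 (N1 + N2)%N (leq_addr _ _); have g2 := h2 (N1 + N2)%N (leq_addl _ _).
have S : series (fterm (z + n%:R%:C)) (N1 + N2)%N = u * series (fterm z) (N1 + N2)%N.
  rewrite /series /= mulr_sumr; apply: eq_bigr => m _; rewrite ftermE mulrC; congr (_ * _).
  have -> : 2 * pi * (m%:R + kappa) / n%:R * n%:R = 2 * pi * kappa + m%:R * (2 * pi) :> R.
    by rewrite mulfVK ?gt_eqF//; ring.
  by rewrite e_D e_X [X in X ^+ _](_ : _ = 1) ?expr1n ?mulr1// -[2 * pi]mulr1 (@cexp_2pi_int R 1).
have -> : g (z + n%:R%:C) - u * g z = (g (z + n%:R%:C) - series (fterm (z + n%:R%:C)) (N1 + N2)%N) -
  u * (g z - series (fterm z) (N1 + N2)%N) by rewrite S; ring.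
apply: (le_trans (cabsB _ _)); rewrite cabsM cabs_e mul1r.
by rewrite [leRHS](splitr e) lerD.
Qed.

End Series.

Section Periodic.
Variable R : realType.
Local Notation mu := (@lebesgue_measure R).
Local Notation RM := (measurableTypeR R).

Definition ind (a b u : R) : \bar R := (\1_(`[a, b[%classic : set R) u)%:E.

Lemma indE a b u : ind a b u = ((a <= u) && (u < b))%:R%:E.
Proof.
rewrite /ind indicE; congr (_%:R%:E); congr nat_of_bool; apply/idP/idP.
  by move=> /set_mem /=; rewrite in_itv.
by move=> h; apply/mem_set; rewrite /= in_itv.
Qed.

Lemma ind_ge0 a b u : (0 <= ind a b u)%E.
Proof. by rewrite lee_fin. Qed.

Lemma measurable_ind a b : measurable_fun [set: RM] (ind a b).
Proof. by apply/measurable_EFinP; exact: measurable_indic. Qed.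

Lemma integral_ind a b : a <= b -> (\int[mu]_u ind a b u = (b - a)%:E)%E.
Proof.
move=> ab; rewrite integral_indic//= setIT lebesgue_measure_itv /= lte_fin.
case: ifP => //; move: ab; rewrite le_eqVlt => /orP[/eqP ->|->//].
by rewrite subrr.
Qed.

Variable psi : R -> \bar R.
Hypotheses (mpsi : measurable_fun [set: RM] psi) (psi0 : forall u, (0 <= psi u)%E).

Let mI a b : measurable_fun [set: RM] (fun u => ind a b u * psi u)%E.
Proof. by apply: emeasurable_funM => //; exact: measurable_ind. Qed.

Let I0 a b u : (0 <= ind a b u * psi u)%E.
Proof. by rewrite mule_ge0// ind_ge0. Qed.

Lemma integral_ind_shift a b c :
  (\int[mu]_u (ind a b u * psi (u + c)%R) = \int[mu]_u (ind (a + c) (b + c) u * psi u))%E.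
Proof.
have := integral_affine c (oner_neq0 R) (mI (a + c) (b + c)) (I0 _ _).
rewrite normr1 invr1 mul1e => <-; apply: eq_integral => u _.
by rewrite mul1r !indE lerD2r ltrD2r.
Qed.

Lemma integral_ind_split a b c : a <= b -> b <= c ->
  (\int[mu]_u (ind a c u * psi u) =
   \int[mu]_u (ind a b u * psi u) + \int[mu]_u (ind b c u * psi u))%E.
Proof.
move=> ab bc; rewrite -ge0_integralD//; apply: eq_integral => u _.
rewrite -ge0_muleDl ?ind_ge0//; congr (_ * _)%E; rewrite !indE -EFinD; congr (_%:E).
rewrite -natrD; congr (_%:R).
case: (lerP a u) => au; case: (ltrP u b) => ub /=; rewrite ?addn0 ?add0n.
- by rewrite (lt_le_trans ub bc).
- by [].
- by [].
- by move: (le_trans ab ub); rewrite leNgt au.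
Qed.

Lemma integral_periodic (n c : R) : (forall u, psi (u + n) = psi u) -> 0 <= c -> c <= n ->
  (\int[mu]_u (ind 0 n u * psi (u + c)%R) = \int[mu]_u (ind 0 n u * psi u))%E.
Proof.
move=> per c0 cn; rewrite integral_ind_shift add0r (@integral_ind_split c n)//; last by rewrite lerDl.
rewrite [RHS](@integral_ind_split 0 c n)// addeC; congr (_ + _)%E.
rewrite -{1}[n]add0r [n + c]addrC -integral_ind_shift.
by apply: eq_integral => u _; rewrite per.
Qed.

End Periodic.

Section Bessel.
Variable R : realType.
Local Notation C := R[i].
Local Notation H := (@upper_half R).
Local Notation mu := (@lebesgue_measure R).
Local Notation RM := (measurableTypeR R).

(** No limit is exchanged with the integral. The series is cut at M terms, as many as there are
    sample points, so that [parseval_line] applies; the geometric tail is absorbed in e. Integrating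
    over u, every sample point contributes the same integral by periodicity. *)
Lemma bessel (n : nat) (kappa : R) (a : nat -> C) (g : C -> C) (v : R) (N : nat) :
  (0 < n)%N -> 0 <= kappa -> 0 < v ->
  (forall z, H z -> series (fterm n kappa a z : nat -> C^o) @ \oo --> (g z : C^o)) ->
  measurable_fun [set: RM] (fun u => cabs (g (u +i* v))) ->
  ((n%:R * \sum_(m < N) cabs (fterm n kappa a (0 +i* v) m) ^+ 2)%:E <=
   \int[mu]_u (ind 0 n%:R u * (cabs (g (u +i* v)) ^+ 2)%:E))%E.
Proof.
move=> n0 k0 v0 gs mg; set T := \sum_(m < N) _; have nR : 0 < n%:R :> R by rewrite ltr0n.
pose psi (u : R) := (cabs (g (u +i* v)) ^+ 2)%:E.
have mpsi : measurable_fun [set: RM] psi by apply/measurable_EFinP; exact: measurable_funX.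
have psi0 u : (0 <= psi u)%E by rewrite lee_fin sqr_ge0.
have Huv u : H (u +i* v) by exact: v0.
have per u : psi (u + n%:R) = psi u.
  rewrite /psi -(cabs_periodic n0 gs (Huv u)); congr ((cabs (g _) ^+ 2)%:E).
  by apply/eqP; rewrite eq_complex /= addr0 !eqxx.
set L := (\int[mu]_u _)%E; have L0 : (0 <= L)%E.
  by apply: integral_ge0 => u _; exact: mule_ge0 (ind_ge0 _ _ _) (psi0 u).
have [K [q [K0 /andP[q0 q1] hK]]] := series_uniform n0 k0 gs v0.
apply/lee_addgt0Pr => e e0.
have en0 : 0 < e / n%:R by rewrite divr_gt0.
have [Te|Te] := lerP T (e / n%:R).
  apply: (@le_trans _ _ e%:E); last by rewrite leeDr.
  by rewrite lee_fin mulrC -ler_pdivlMr.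
have [M [M0 NM hM]] : exists M, [/\ (0 < M)%N, (N <= M)%N & 2 * K * (K * q ^+ M) <= e / n%:R].
  have : (fun m => q ^+ m : R^o) @ \oo --> (0 : R^o).
    by apply: cvg_expr; rewrite ger0_norm// ltW.
  have d0 : 0 < e / n%:R / (2 * K * K + 1).
    by rewrite divr_gt0// ltr_pwDr// !mulr_ge0.
  move=> /cvgrPdist_le /(_ _ d0)[M _ hM]; exists (M + N).+1; split => //.
    by rewrite leqW// leq_addl.
  have := hM (M + N).+1 (leqW (leq_addr _ _)).
  rewrite /= sub0r normrN ger0_norm; last by rewrite exprn_ge0// ltW.
  rewrite ler_pdivlMr ?ltr_pwDr ?mulr_ge0// => h; apply: le_trans h.
  have : 0 <= q ^+ (M + N).+1 by rewrite exprn_ge0// ltW.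
  nra.
have MR : 0 < M%:R :> R by rewrite ltr0n.
have pt u : M%:R * (T - e / n%:R) <= \sum_(j < M) cabs (g ((u + j%:R * (n%:R / M%:R)) +i* v)) ^+ 2.
  have := @parseval_line R n kappa a n0 (u +i* v) M M0.
  have -> : \sum_(m < M) cabs (fterm n kappa a (u +i* v) m) ^+ 2 =
      \sum_(m < M) cabs (fterm n kappa a (0 +i* v) m) ^+ 2.
    by apply: eq_bigr => m _; rewrite !cabs_fterm.
  have TM : T <= \sum_(m < M) cabs (fterm n kappa a (0 +i* v) m) ^+ 2.
    rewrite /T -!(big_mkord xpredT (fun m => cabs (fterm n kappa a (0 +i* v) m) ^+ 2)).
    rewrite [leRHS](@big_cat_nat _ _ _ N)//= lerDl; apply: sumr_ge0 => m _; exact: sqr_ge0.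
  move=> P; have {TM P}: M%:R * T <= \sum_(j < M)
      cabs (series (fterm n kappa a ((u +i* v) + (j%:R * (n%:R / M%:R))%:C)) M) ^+ 2.
    by rewrite P ler_pM2l.
  rewrite mulrBr lerBlDr => h; apply: (le_trans h).
  have -> : M%:R * (e / n%:R) = \sum_(j < M) (e / n%:R) by rewrite sumr_const card_ord mulr_natl.
  rewrite -big_split /=.
  apply: ler_sum => j _; set z := _ + _%:C.
  have -> : (u + j%:R * (n%:R / M%:R)) +i* v = z by apply/eqP; rewrite eq_complex /= addr0 !eqxx.
  have zv : complex.Im z = v by rewrite /z /= addr0.
  have [h1 h2] := hK z M zv.
  have h3 := cabs_lerB (series (fterm n kappa a z) M) (g z); rewrite cabsBC in h3.
  have g0 := cabs_ge0 (g z); have S0 := cabs_ge0 (series (fterm n kappa a z) M).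
  move: h1 h2 h3 g0 S0 hM; set S := cabs (series _ _); set gg := cabs (g z).
  set D := K * q ^+ M; move=> h1 h2 h3 g0 S0 hM.
  have SD : S - gg <= D by lra.
  have D0 : 0 <= D by rewrite mulr_ge0// exprn_ge0// ltW.
  have SK : S * D <= K * D by rewrite ler_wpM2r.
  have KD : 0 <= K * D by rewrite mulr_ge0.
  have hM' : 2 * (K * D) <= e / n%:R by rewrite mulrA.
  move: (e / n%:R) hM' => E hM'; have [Dl|Dl] := lerP S D.
    have : S * S <= S * D by rewrite ler_wpM2l.
    have := sqr_ge0 gg; rewrite -expr2; lra.
  have : (S - D) ^+ 2 <= gg ^+ 2 by rewrite ler_sqr ?nnegrE ?subr_ge0 ?(ltW Dl)//; lra.
  have := sqr_ge0 D; rewrite sqrrB -mulr_natl; lra.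
have ML : (M%:R%:E * L = \int[mu]_u (\sum_(j < M) ind 0 n%:R u * psi (u + j%:R * (n%:R / M%:R))%R))%E.
  rewrite ge0_integral_sum//; last 2 first.
  - move=> j; apply: emeasurable_funM; first exact: measurable_ind.
    by apply: (measurableT_comp mpsi); exact: measurable_funD.
  - by move=> j u _; rewrite mule_ge0 ?ind_ge0.
  rewrite (eq_bigr (fun=> L)) => [|j _].
    elim: (M) => [|M' ih]; first by rewrite big_ord0 mul0e.
    rewrite big_ord_recr /= -ih -[M'.+1%:R]natr1 EFinD ge0_muleDl ?lee_fin ?mul1e//.
  apply: (integral_periodic mpsi psi0 per).
    by rewrite mulr_ge0// divr_ge0// ltW.
  by rewrite mulrCA ler_piMr ?(ltW nR)// ler_pdivrMr// mul1r ler_nat ltnW.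
suff : ((M%:R * (n%:R * T - e))%:E <= M%:R%:E * L)%E.
  rewrite EFinM lee_pmul2l// ?lte_fin// => h.
  by rewrite -leeBlDr// -EFinB.
rewrite ML; apply: (@le_trans _ _ (\int[mu]_u ((M%:R * (T - e / n%:R))%:E * ind 0 n%:R u))%E).
  rewrite ge0_integralZl//; last 3 first.
  - exact: measurable_ind.
  - by move=> u _; exact: ind_ge0.
  - by rewrite lee_fin mulr_ge0// ltW// subr_gt0.
  rewrite (integral_ind (ltW nR)) subr0 -[leRHS]EFinM lee_fin le_eqVlt; apply/orP; left.
  by apply/eqP; field; rewrite gt_eqF.
apply: ge0_le_integral => //.
- by move=> u _; rewrite mule_ge0 ?ind_ge0// lee_fin mulr_ge0// ltW// subr_gt0.
- by apply: emeasurable_funM => //; exact: measurable_ind.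
- apply: emeasurable_sum => j; apply: emeasurable_funM; first exact: measurable_ind.
  by apply: (measurableT_comp mpsi); exact: measurable_funD.
move=> u _; rewrite muleC -ge0_sume_distrr; last by move=> j _; exact: psi0.
by rewrite lee_wpmul2l ?ind_ge0// sumEFin lee_fin.
Qed.

End Bessel.

(** * Measurability of cusp forms *)

Section Measurability.
Variable R : realType.
Local Notation C := R[i].
Local Notation H := (@upper_half R).
Local Notation RM := (measurableTypeR R).

Lemma pmeas_cexp f : @pmeas R f -> pmeas (fun p => cexp (f p)).
Proof.
move=> [f1 f2]; split; apply: measurable_funM.
- exact: (measurableT_comp (@measurable_expR R)).
- have mc : measurable_fun [set: RM] (cos : RM -> RM).
    by apply: continuous_measurable_fun; exact: continuous_cos.
  exact: (measurableT_comp mc).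
- exact: (measurableT_comp (@measurable_expR R)).
- have mc : measurable_fun [set: RM] (sin : RM -> RM).
    by apply: continuous_measurable_fun; exact: continuous_sin.
  exact: (measurableT_comp mc).
Qed.

Lemma pmeas_sum (I : Type) (s : seq I) (f : I -> RM * RM -> C) :
  (forall i, pmeas (f i)) -> pmeas (fun p => \sum_(i <- s) f i p).
Proof.
move=> mf; elim: s => [|i s ih].
  by under eq_fun do rewrite big_nil; exact: pmeas_cst.
by under eq_fun do rewrite big_cons; exact: pmeasD.
Qed.

Lemma measurable_upper : measurable_fun [set: (RM * RM)%type] (fun p : RM * RM => 0 < p.2).
Proof.
by apply: measurable_fun_ltr; [exact: measurable_cst|exact: measurable_snd].
Qed.

Lemma pmeas_upper f : @pmeas R f -> pmeas (fun p => if 0 < p.2 then f p else 0).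
Proof.
move=> [f1 f2]; split.
  have -> : (fun p : RM * RM => complex.Re (if 0 < p.2 then f p else 0)) =
      (fun p => if 0 < p.2 then complex.Re (f p) else 0).
    by apply/funext => p; case: ifP.
  by apply: measurable_fun_ifT => //; exact: measurable_upper.
have -> : (fun p : RM * RM => complex.Im (if 0 < p.2 then f p else 0)) =
    (fun p => if 0 < p.2 then complex.Im (f p) else 0).
  by apply/funext => p; case: ifP.
by apply: measurable_fun_ifT => //; exact: measurable_upper.
Qed.

Lemma pmeas_lim (u : nat -> RM * RM -> C) (f : RM * RM -> C) : (forall m, pmeas (u m)) ->
  (forall p (e : R), 0 < e -> exists N, forall n, (N <= n)%N -> cabs (f p - u n p) <= e) ->
  pmeas f.
Proof.
move=> mu cv; split.
  apply: (@measurable_fun_cvg _ _ _ _ (fun m p => complex.Re (u m p))).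
    by move=> m; have [] := mu m.
  move=> p _; apply/cvgrPdist_le => e e0; have [N hN] := cv p e e0.
  exists N => // m /hN; apply: le_trans.
  by rewrite -ReN -ReD; exact: Re_le_cabs.
apply: (@measurable_fun_cvg _ _ _ _ (fun m p => complex.Im (u m p))).
  by move=> m; have [] := mu m.
move=> p _; apply/cvgrPdist_le => e e0; have [N hN] := cv p e e0.
exists N => // m /hN; apply: le_trans.
by rewrite -ImN -ImD; exact: Im_le_cabs.
Qed.

(* Cusp forms are only controlled on H; extending them by 0 makes them measurable
   on the whole plane. *)
Definition hform (f : C -> C) (z : C) : C := if 0 < complex.Im z then f z else 0.

Lemma pmeas_series n kappa (a : nat -> C) (g : C -> C) :
  (forall z, H z -> series (fterm n kappa a z : nat -> C^o) @ \oo --> (g z : C^o)) ->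
  pmeas (fun p => hform g (p.1 +i* p.2)).
Proof.
move=> gs.
apply: (@pmeas_lim (fun M p => if 0 < p.2 then series (fterm n kappa a (p.1 +i* p.2)) M else 0)).
  move=> M; apply: pmeas_upper; apply: pmeas_sum => m; rewrite /fterm.
  case: (0 < m%:R + kappa); last exact: pmeas_cst.
  apply: pmeasM; first exact: pmeas_cst.
  by apply: pmeas_cexp; apply: pmeasM; [exact: pmeas_cst|exact: pmeas_id].
move=> p e e0; rewrite /hform /=; case: ifP => p0; last first.
  by exists 0%N => *; rewrite subrr cabs0 ltW.
by have [N hN] := (cvgC_eps _ _).1 (gs (p.1 +i* p.2) p0) e e0; exists N.
Qed.

Lemma slash1 k (f : C -> C) z : slash k f 1 z = f z.
Proof. by rewrite /slash jfac1 mobius1 cpow1 mul1r. Qed.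

Lemma cusp_form_series G (k : R) nu f t : cusp_form G k nu f -> SL2Z t ->
  exists a, forall z, H z ->
  series (fterm (cusp_width G t) (cusp_param G k nu t) a z : nat -> C^o) @ \oo
    --> (slash k f t z : C^o).
Proof. by move=> [_ _ ex] st; have [a ha] := ex t st; exists a. Qed.

Lemma pmeas_cusp_form G (k : R) nu f : cusp_form G k nu f ->
  pmeas (fun p => hform f (p.1 +i* p.2)).
Proof.
move=> cf; have [a ha] := cusp_form_series cf SL2Z1.
apply: (pmeas_series (a := a)) => z Hz; rewrite -[f z](slash1 k); exact: ha.
Qed.

End Measurability.

(** * Bounds for Fourier coefficients from a box around the peak *)

Section Weights.
Variable R : realType.

Lemma powR_expR_ln (x k : R) : 0 < x -> x `^ k = expR (k * ln x).
Proof. by move=> x0; rewrite /powR gt_eqF. Qed.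

Lemma expR_sub_sqr (x : R) : `|x| <= 1 / 2 -> expR (x - 2 * x ^+ 2) <= 1 + x.
Proof.
rewrite ler_norml => /andP[x1 x2].
have p : 0 < 1 - (x - 2 * x ^+ 2) by nra.
have := expR_ge1Dx (- (x - 2 * x ^+ 2)); rewrite expRN => h.
apply: (@le_trans _ _ (1 - (x - 2 * x ^+ 2))^-1).
  by rewrite -[leLHS]invrK lef_pV2// posrE invr_gt0 expR_gt0.
rewrite -[leLHS]mul1r ler_pdivrMr//.
have : 0 <= x ^+ 2 * (1 + 2 * x) by rewrite mulr_ge0 ?sqr_ge0//; lra.
rewrite !expr2; nra.
Qed.

Lemma expR_half_ge (x : R) : 0 <= x -> (1 + x ^+ 2) / 16 <= expR (x / 2).
Proof.
move=> x0; have -> : x / 2 = 2%:R * (x / 4) by field.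
rewrite expRM_natl; apply: (@le_trans _ _ ((1 + x / 4) ^+ 2)); first nra.
by rewrite ler_sqr ?nnegrE ?expR_ge0 ?expR_ge1Dx//; lra.
Qed.

Lemma expRN2_ge : 1 / 10 <= expR (- 2) :> R.
Proof.
have -> : (-2 : R) = 8%:R * (- (1 / 4)) by field.
rewrite expRM_natl; apply: (@le_trans _ _ ((1 + - (1 / 4)) ^+ 8)); first lra.
by rewrite lerXn2r ?nnegrE ?expR_ge0 ?expR_ge1Dx//; lra.
Qed.

(** Moving from y to v, the power gains at least exp(q s - 2 s^2) with q = sqrt k, and the
    exponential changes by exp(-q s - s A). The terms q s cancel, and what remains, exp(-s A) =
    exp(|s A|), is at least (1 + A^2) / 16 because v lies on the side of the peak and |s| >= 1 / 2.
    The constant is 1 / 360 = (4 / 9) (1 / 10) (1 / 16), with 4 / 9 from v^-2 and 1 / 10 from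
    exp(-2). *)
Lemma weight_ge (k y t s : R) : 4 <= k -> 0 < y -> `|s| <= 1 -> 1 / 2 <= `|s| ->
  let A := (t * y - k) / Num.sqrt k in let v := y * (1 + s / Num.sqrt k) in
  s * A <= 0 ->
  1 / 360 * (y `^ k / y ^+ 2 * expR (- t * y) * (1 + A ^+ 2)) <=
  v `^ k / v ^+ 2 * expR (- t * v).
Proof.
move=> k4 y0 s1 s2 A v sA; set q := Num.sqrt k.
have k0 : 0 < k by lra.
have q0 : 0 < q by rewrite sqrtr_gt0.
have qq : q ^+ 2 = k by rewrite sqr_sqrtr// ltW.
have q2 : 2 <= q by rewrite -ler_sqr ?nnegrE ?(ltW q0)// qq; lra.
pose x := s / q.
have x2 : `|x| <= 1 / 2.
  rewrite normrM normfV (gtr0_norm q0) ler_pdivrMr//.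
  by apply: (le_trans s1); lra.
have xk : q * x = s by rewrite mulrC mulfVK// gt_eqF.
have x1 : 0 < 1 + x by move: x2; rewrite ler_norml; lra.
have v0 : 0 < v by rewrite mulr_gt0.
have vk : y `^ k * expR (q * s - 2) <= v `^ k.
  rewrite powRM ?(ltW y0) ?(ltW x1)// ler_pM2l ?powR_gt0//.
  rewrite (powR_expR_ln _ x1) ler_expR.
  have l : x - 2 * x ^+ 2 <= ln (1 + x) by rewrite -[leLHS]expRK ler_ln ?posrE ?expR_gt0// expR_sub_sqr.
  apply: (@le_trans _ _ (k * (x - 2 * x ^+ 2))); last by rewrite ler_pM2l.
  have -> : k * (x - 2 * x ^+ 2) = q * s - 2 * s ^+ 2 by rewrite -xk -qq; ring.
  have : s ^+ 2 <= 1 by rewrite -real_normK ?num_real// expr_le1.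
  lra.
have v2 : 4 / 9 / y ^+ 2 <= (v ^+ 2)^-1.
  have -> : (v ^+ 2)^-1 = ((1 + x) ^+ 2)^-1 / y ^+ 2 by rewrite -invfM -exprMn mulrC.
  rewrite ler_pM2r ?invr_gt0 ?exprn_gt0// -[leLHS]invrK lef_pV2 ?posrE ?invr_gt0 ?exprn_gt0 ?divr_gt0//.
  have -> : (4 / 9 : R)^-1 = (3 / 2) ^+ 2 by field.
  by rewrite ler_sqr ?nnegrE ?(ltW x1)//; move: x2; rewrite ler_norml; lra.
have ev : expR (- t * v) = expR (- t * y) * expR (- (q * s)) * expR (- (s * A)).
  rewrite -!expRD; congr expR.
  have -> : - t * v = - t * y - (t * y) * x by rewrite /v -/q -/x; ring.
  have tyA : t * y = k + A * q by rewrite /A mulfVK ?gt_eqF//; ring.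
  have -> : t * y * x = q * s + s * A.
    have kx : k * x = q * s by rewrite -xk mulrA -expr2 qq.
    by rewrite tyA mulrDl kx -mulrA xk [s * A]mulrC.
  by ring.
have eA : (1 + A ^+ 2) / 16 <= expR (- (s * A)).
  have -> : A ^+ 2 = `|A| ^+ 2 by rewrite real_normK// num_real.
  apply: (le_trans (expR_half_ge (normr_ge0 A))); rewrite ler_expR.
  by rewrite -(ler0_norm sA) [leRHS]normrM [leRHS]mulrC ler_wpM2l//; lra.
rewrite ev.
have Y0 : 0 < y `^ k by rewrite powR_gt0.
have E0 : 0 < expR (- t * y) by rewrite expR_gt0.
have S1 : expR (q * s - 2) * expR (- (q * s)) = expR (-2) by rewrite -expRD; congr expR; ring.
apply: (@le_trans _ _ ((y `^ k * expR (q * s - 2)) * (4 / 9 / y ^+ 2) *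
   (expR (- t * y) * expR (- (q * s)) * ((1 + A ^+ 2) / 16)))).
  have -> : (y `^ k * expR (q * s - 2)) * (4 / 9 / y ^+ 2) *
   (expR (- t * y) * expR (- (q * s)) * ((1 + A ^+ 2) / 16)) =
   (4 / 9 / 16 * (expR (q * s - 2) * expR (- (q * s)))) *
   (y `^ k / y ^+ 2 * expR (- t * y) * (1 + A ^+ 2)) by ring.
  rewrite S1 ler_wpM2r//.
    rewrite !mulr_ge0 ?(ltW Y0) ?(ltW E0)//; first by rewrite invr_ge0 sqr_ge0.
    by have := sqr_ge0 A; lra.
  have := expRN2_ge; lra.
have i2 : 0 <= 4 / 9 / y ^+ 2 by rewrite divr_ge0 ?sqr_ge0//; lra.
have iA : 0 <= (1 + A ^+ 2) / 16 by rewrite divr_ge0//; have := sqr_ge0 A; lra.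
apply: ler_pM => //.
- by apply: mulr_ge0 => //; rewrite mulr_ge0 ?expR_ge0// ltW.
- by apply: mulr_ge0 => //; rewrite mulr_ge0 ?expR_ge0.
- by apply: ler_pM => //; rewrite mulr_ge0 ?expR_ge0// ltW.
- by rewrite ler_wpM2l// mulr_ge0 ?expR_ge0.
Qed.

Lemma cauchy_schwarz_sum (I : Type) (s : seq I) (p q : I -> R) :
  (\sum_(i <- s) p i * q i) ^+ 2 <= (\sum_(i <- s) p i ^+ 2) * (\sum_(i <- s) q i ^+ 2).
Proof.
elim: s => [|i s ih]; first by rewrite !big_nil expr0n mul0r.
rewrite !big_cons; move: ih.
have P0 : 0 <= \sum_(j <- s) p j ^+ 2 by apply: sumr_ge0 => *; exact: sqr_ge0.
have Q0 : 0 <= \sum_(j <- s) q j ^+ 2 by apply: sumr_ge0 => *; exact: sqr_ge0.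
move: P0 Q0; set P := \sum_(j <- s) p j ^+ 2; set Q := \sum_(j <- s) q j ^+ 2.
set X := \sum_(j <- s) _; move: (p i) (q i) => a b P0 Q0 ih.
have : 2 * (X * (a * b)) <= P * b ^+ 2 + Q * a ^+ 2.
  have r0 : 0 <= P * b ^+ 2 + Q * a ^+ 2 by apply: addr_ge0; apply: mulr_ge0 => //; exact: sqr_ge0.
  apply: (le_trans (ler_norm _)); rewrite -ler_sqr ?nnegrE// real_normK ?num_real//.
  have -> : (2 * (X * (a * b))) ^+ 2 = 4 * (X ^+ 2 * (a * b) ^+ 2) by ring.
  apply: (@le_trans _ _ (4 * (P * Q * (a * b) ^+ 2))).
    by rewrite ler_pM2l// ler_wpM2r// sqr_ge0.
  rewrite -subr_ge0.
  have -> : (P * b ^+ 2 + Q * a ^+ 2) ^+ 2 - 4 * (P * Q * (a * b) ^+ 2) =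
    (P * b ^+ 2 - Q * a ^+ 2) ^+ 2 by ring.
  exact: sqr_ge0.
move=> h; have -> : (a * b + X) ^+ 2 = (a * b) ^+ 2 + 2 * (X * (a * b)) + X ^+ 2 by ring.
have -> : (a ^+ 2 + P) * (b ^+ 2 + Q) = (a * b) ^+ 2 + (P * b ^+ 2 + Q * a ^+ 2) + P * Q by ring.
by rewrite !lerD.
Qed.

End Weights.

Section CoefBound.
Variable R : realType.
Local Notation C := R[i].
Local Notation H := (@upper_half R).
Local Notation mu := (@lebesgue_measure R).
Local Notation RM := (measurableTypeR R).

Definition absq (k : R) (f : C -> C) (z : C) : \bar R :=
  (cabs (hform f z) ^+ 2 * complex.Im z `^ k)%:E.

Lemma absq_ge0 k f z : (0 <= absq k f z)%E.
Proof. by rewrite lee_fin mulr_ge0 ?sqr_ge0// powR_ge0. Qed.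

Lemma hmeas_absq k f : pmeas (fun p => hform f (p.1 +i* p.2)) -> hmeas (absq k f).
Proof.
move=> mf; apply/measurable_EFinP; apply: measurable_funM.
  by apply: measurable_funX; exact: pmeas_cabs mf.
by apply: (measurableT_comp (@measurable_powR R k)); exact: measurable_snd.
Qed.

Definition boxf (n : nat) (k y : R) (z : C) : \bar R :=
  (ind 0 n%:R (complex.Re z) *
   ind (y * (1 - 1 / Num.sqrt k)) (y * (1 + 1 / Num.sqrt k)) (complex.Im z))%E.

Lemma boxf_ge0 n k y z : (0 <= boxf n k y z)%E.
Proof. by rewrite mule_ge0 ?ind_ge0. Qed.

Lemma hmeas_boxf n k y : hmeas (boxf n k y).
Proof.
apply: emeasurable_funM.
  by apply: (measurableT_comp (measurable_ind _ _)); exact: measurable_fst.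
by apply: (measurableT_comp (measurable_ind _ _)); exact: measurable_snd.
Qed.

(* On the upper (lower) half of the box only the terms with A_m <= 0 (A_m >= 0)
   are kept, so that [weight_ge] applies pointwise. *)
Lemma coef_bound (n : nat) (kappa : R) (a : nat -> C) (g : C -> C) (k y I : R) (N : nat) :
  (0 < n)%N -> 0 <= kappa -> 4 <= k -> 0 < y ->
  (forall z, H z -> series (fterm n kappa a z : nat -> C^o) @ \oo --> (g z : C^o)) ->
  (hyp (fun z => boxf n k y z * absq k g z) <= I%:E)%E ->
  y `^ k * (\sum_(m < N) fcoef kappa a m * expR (- (2 * pi * (m%:R + kappa) / n%:R) * y)) ^+ 2
    <= 720 * I * (4 * Num.sqrt k * y / n%:R + k).
Proof.
move=> n0 k0 k4 y0 gs hI; set q := Num.sqrt k; have nR : 0 < n%:R :> R by rewrite ltr0n.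
have kp : 0 < k by lra.
have q0 : 0 < q by rewrite sqrtr_gt0.
have qq : q ^+ 2 = k by rewrite sqr_sqrtr// ltW.
have q2 : 2 <= q by rewrite -ler_sqr ?nnegrE ?(ltW q0)// qq; lra.
pose t (m : nat) : R := 4 * pi * (m%:R + kappa) / n%:R.
pose A (m : nat) : R := (t m * y - k) / q.
pose c (m : nat) : R := fcoef kappa a m ^+ 2.
have c0 m : 0 <= c m by exact: sqr_ge0.
pose w (m : nat) : R := c m * (expR (- t m * y) * (1 + A m ^+ 2)).
have w0 m : 0 <= w m.
  apply: mulr_ge0 => //; apply: mulr_ge0; first exact: expR_ge0.
  by have := sqr_ge0 (A m); lra.
pose Sm : R := \sum_(m < N | A m <= 0) w m.
pose Sp : R := \sum_(m < N | ~~ (A m <= 0)) w m.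
pose W : R := n%:R * (1 / 360 * (y `^ k / y ^+ 2)).
have W0 : 0 <= W.
  apply: mulr_ge0; first exact: ltW.
  have Y2 : 0 <= y `^ k / y ^+ 2 by rewrite divr_ge0 ?powR_ge0 ?sqr_ge0.
  by apply: mulr_ge0; [lra|exact: Y2].
have Sm0 : 0 <= Sm by apply: sumr_ge0.
have Sp0 : 0 <= Sp by apply: sumr_ge0.
(* The heights with s between 1 / 2 and 1, and those with s between -1 and -1 / 2; in between,
   [weight_ge] does not apply. *)
pose p1 := y * (1 + 1 / (2 * q)); pose p2 := y * (1 + 1 / q).
pose m1 := y * (1 - 1 / q); pose m2 := y * (1 - 1 / (2 * q)).
have iq : 0 < 1 / q <= 1 / 2.
  by rewrite divr_gt0//= ler_pdivrMr//; lra.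
have iq2 : 1 / (2 * q) = (1 / q) / 2 by field; rewrite gt_eqF.
have m10 : 0 < m1 by rewrite mulr_gt0//; lra.
have m12 : m1 <= m2 by rewrite ler_pM2l// iq2; lra.
have m2p : m2 <= p1 by rewrite ler_pM2l// iq2; lra.
have p12 : p1 <= p2 by rewrite ler_pM2l// iq2; lra.
have len1 : p2 - p1 = y / (2 * q) by rewrite /p1 /p2; field; rewrite gt_eqF.
have len2 : m2 - m1 = y / (2 * q) by rewrite /m1 /m2; field; rewrite gt_eqF.
have mg := pmeas_series gs.
have mphi : hmeas (fun z => boxf n k y z * absq k g z)%E.
  by apply: hmeasM; [exact: hmeas_boxf|exact: hmeas_absq].
have phi0 z : (0 <= boxf n k y z * absq k g z)%E by rewrite mule_ge0 ?boxf_ge0 ?absq_ge0.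
have line v : 0 < v -> m1 <= v -> v < p2 ->
    ((v `^ k / v ^+ 2 * (n%:R * \sum_(m < N) c m * expR (- t m * v)))%:E <=
    \int[mu]_x ((boxf n k y (x +i* v) * absq k g (x +i* v)) * ((invpos v) ^+ 2)%:E))%E.
  move=> v0 mv vp.
  have m' : measurable_fun [set: RM] (fun u => cabs (g (u +i* v))).
    have m3 : measurable_fun [set: RM] (fun u : RM => (u, v : RM)) by exact: measurable_pair2.
    have := measurableT_comp (pmeas_cabs mg) m3; apply: eq_measurable_fun => u _ /=.
    by rewrite /hform /= v0.
  have B := @bessel _ n kappa a g v N n0 k0 v0 gs m'.
  have -> : \sum_(m < N) c m * expR (- t m * v) =
      \sum_(m < N) cabs (fterm n kappa a (0 +i* v) m) ^+ 2.
    apply: eq_bigr => m _; rewrite cabs_fterm exprMn; congr (_ * _).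
    rewrite -expRM_natl /=; congr expR; rewrite /t; field.
    by rewrite gt_eqF.
  have vk0 : 0 <= v `^ k / v ^+ 2 by rewrite mulr_ge0 ?powR_ge0// invr_ge0 sqr_ge0.
  rewrite EFinM; apply: le_trans (lee_wpmul2l _ B) _; first by rewrite lee_fin.
  rewrite -ge0_integralZl//; last 2 first.
  - apply: emeasurable_funM; first exact: measurable_ind.
    by apply/measurable_EFinP; exact: measurable_funX.
  - by move=> u _; rewrite mule_ge0 ?ind_ge0// lee_fin sqr_ge0.
  rewrite le_eqVlt; apply/orP; left; apply/eqP; apply: eq_integral => u _.
  rewrite /boxf /absq /hform /= v0 [X in (_ * X * _ * _)%E]indE mv vp mule1 /invpos v0.
  by rewrite /ind -!EFinM; congr (_%:E); rewrite exprVn; ring.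
have half s v : 1 / 2 <= `|s| <= 1 -> v = y * (1 + s / q) -> 0 < v ->
    (forall P : pred nat, (forall m, P m -> s * A m <= 0) ->
    W * \sum_(m < N | P m) w m <=
      v `^ k / v ^+ 2 * (n%:R * \sum_(m < N) c m * expR (- t m * v))).
  move=> /andP[s1 s2] vE v0 P hP.
  rewrite [leRHS]mulrCA /W -[leLHS]mulrA ler_pM2l//.
  apply: (@le_trans _ _ (v `^ k / v ^+ 2 * \sum_(m < N | P m) c m * expR (- t m * v))).
    rewrite !mulr_sumr; apply: ler_sum => m Pm.
    have := weight_ge k4 y0 s2 s1 (hP m Pm); rewrite -/q -vE => h.
    have := ler_wpM2l (c0 m) h.
    rewrite /w; set r1 := expR _; set r2 := expR _; move=> h'.
    have -> : v `^ k / v ^+ 2 * (c m * r2) = c m * (v `^ k / v ^+ 2 * r2) by ring.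
    by apply: le_trans h'; rewrite le_eqVlt /A; apply/orP; left; apply/eqP; ring.
  rewrite ler_wpM2l ?mulr_ge0 ?powR_ge0 ?invr_ge0 ?sqr_ge0//.
  rewrite [leLHS]big_mkcond /=; apply: ler_sum => m _; case: ifP => // _.
  by rewrite mulr_ge0 ?expR_ge0.
have tot : W * (Sm + Sp) * (y / (2 * q)) <= I.
  rewrite -lee_fin; apply: le_trans hI; rewrite (hyp_lines mphi phi0).
  apply: (@le_trans _ _ (\int[mu]_v ((W * Sm)%:E * ind p1 p2 v + (W * Sp)%:E * ind m1 m2 v))%E).
    rewrite ge0_integralD//; last 4 first.
    - by move=> v _; rewrite mule_ge0 ?ind_ge0// lee_fin mulr_ge0.
    - by apply: emeasurable_funM => //; exact: measurable_ind.
    - by move=> v _; rewrite mule_ge0 ?ind_ge0// lee_fin mulr_ge0.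
    - by apply: emeasurable_funM => //; exact: measurable_ind.
    rewrite !ge0_integralZl//; last 6 first.
    - exact: measurable_ind.
    - by move=> v _; exact: ind_ge0.
    - by rewrite lee_fin mulr_ge0.
    - exact: measurable_ind.
    - by move=> v _; exact: ind_ge0.
    - by rewrite lee_fin mulr_ge0.
    rewrite (integral_ind p12) (integral_ind m12) len1 len2 -!EFinM -EFinD lee_fin.
    by rewrite mulrDr mulrDl.
  have bm (a1 b1 : R) : measurable_fun [set: RM] (fun v => (a1%:E * ind b1 b1 v)%E).
    by apply: emeasurable_funM => //; exact: measurable_ind.
  apply: ge0_le_integral => //.
  - by move=> v _; rewrite adde_ge0// mule_ge0 ?ind_ge0// lee_fin mulr_ge0.
  - by apply: emeasurable_funD; apply: emeasurable_funM => //; exact: measurable_ind.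
  - have q0' p : (0 <= (boxf n k y (p.1 +i* p.2) * absq k g (p.1 +i* p.2)) * ((invpos p.2) ^+ 2)%:E)%E.
      by rewrite mule_ge0// lee_fin sqr_ge0.
    exact: (@measurable_fun_fubini_tonelli_G _ _ RM RM R mu _ (measurable_hyp mphi) q0').
  move=> v _; rewrite !indE.
  have [/andP[v1 v2]|nv] := boolP ((p1 <= v) && (v < p2)).
    have v0 : 0 < v by apply: lt_le_trans v1; apply: lt_le_trans m2p; apply: lt_le_trans m12.
    have -> : (v < m2) = false by apply/negbTE; rewrite -leNgt (le_trans m2p).
    rewrite andbF mule0 adde0 mule1.
    apply: le_trans (line v v0 _ v2); last by rewrite (le_trans m12)// (le_trans m2p).
    rewrite lee_fin; pose s := (v / y - 1) * q.
    have sE : v = y * (1 + s / q) by rewrite /s; field; rewrite !gt_eqF.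
    have s1 : 1 / 2 <= s.
      move: v1; rewrite /p1 sE ler_pM2l// lerD2l ler_pdivlMr// => h.
      by apply: le_trans h; rewrite le_eqVlt; apply/orP; left; apply/eqP; field; rewrite gt_eqF.
    have s2 : s <= 1 by move: v2; rewrite /p2 sE ltr_pM2l// ltrD2l ltr_pM2r ?invr_gt0// => /ltW.
    have s0 : 0 <= s by lra.
    have sr : 1 / 2 <= `|s| <= 1 by rewrite ger0_norm// s1.
    by apply: (half s v sr sE v0 (fun m => A m <= 0)) => m h; rewrite mulr_ge0_le0.
  have [/andP[v1 v2]|nv'] := boolP ((m1 <= v) && (v < m2)); last first.
    rewrite !mule0 adde0; apply: integral_ge0 => u _.
    by rewrite mule_ge0// lee_fin sqr_ge0.
  rewrite mule0 add0e mule1.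
  have v0 : 0 < v by apply: lt_le_trans v1.
  have vp : v < p2 by rewrite (lt_le_trans v2)// (le_trans m2p).
  apply: le_trans (line v v0 v1 vp).
  rewrite lee_fin; pose s := (v / y - 1) * q.
  have sE : v = y * (1 + s / q) by rewrite /s; field; rewrite !gt_eqF.
  have s1 : -1 <= s.
    by move: v1; rewrite /m1 sE ler_pM2l// lerD2l -mulNr ler_pM2r ?invr_gt0.
  have s2 : s <= - (1 / 2).
    move: v2; rewrite /m2 sE ltr_pM2l// ltrD2l ltr_pdivrMr// => /ltW h.
    by apply: (le_trans h); rewrite le_eqVlt; apply/orP; left; apply/eqP; field; rewrite gt_eqF.
  have s0 : s <= 0 by lra.
  have sr : 1 / 2 <= `|s| <= 1 by rewrite ler0_norm//; lra.
  apply: (half s v sr sE v0 (fun m => ~~ (A m <= 0))) => m h.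
  by rewrite mulr_le0_ge0// ltW// ltNge.
have SS : Sm + Sp = \sum_(m < N) w m.
  by rewrite [RHS](bigID (fun m : 'I_N => A m <= 0)).
rewrite SS in tot.
(* The A_m form an arithmetic progression of step h, so [sum_inv_sqr] bounds the sum of the inverse
   weights in the Cauchy-Schwarz inequality. *)
pose h := 4 * pi * y / (n%:R * q).
have h0 : 0 < h by rewrite divr_gt0 ?mulr_gt0 ?pi_gt0.
have AE m : A m = (4 * pi * kappa / n%:R * y - k) / q + h * m%:R.
  by rewrite /A /h /t; field; rewrite !gt_eqF.
have SA := sum_inv_sqr ((4 * pi * kappa / n%:R * y - k) / q) N h0.
have CS : (\sum_(m < N) fcoef kappa a m * expR (- (2 * pi * (m%:R + kappa) / n%:R) * y)) ^+ 2 <=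
    (\sum_(m < N) w m) * (2 + 4 / h).
  pose P (m : 'I_N) := fcoef kappa a m * (expR (- (2 * pi * (m%:R + kappa) / n%:R) * y) *
    Num.sqrt (1 + A m ^+ 2)).
  pose Q (m : 'I_N) := (Num.sqrt (1 + A m ^+ 2))^-1.
  have r0 m : 0 < 1 + A m ^+ 2 by have := sqr_ge0 (A m); lra.
  have -> : \sum_(m < N) fcoef kappa a m * expR (- (2 * pi * (m%:R + kappa) / n%:R) * y) =
      \sum_(m < N) P m * Q m.
    by apply: eq_bigr => m _; rewrite /P /Q mulrA mulfK// gt_eqF// sqrtr_gt0.
  apply: (le_trans (cauchy_schwarz_sum _ _ _)).
  have -> : \sum_(m < N) P m ^+ 2 = \sum_(m < N) w m.
    apply: eq_bigr => m _.
    have ee : expR (- (2 * pi * (m%:R + kappa) / n%:R) * y) ^+ 2 = expR (- t m * y).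
      by rewrite -expRM_natl; congr expR; rewrite /t; field; rewrite gt_eqF.
    by rewrite /P exprMn [in LHS]exprMn ee sqr_sqrtr ?(ltW (r0 m)).
  apply: ler_wpM2l; first by apply: sumr_ge0.
  apply: le_trans SA; apply: ler_sum => m _.
  by rewrite /Q exprVn sqr_sqrtr ?(ltW (r0 m))// AE.
have Y0 : 0 < y `^ k by rewrite powR_gt0.
apply: (@le_trans _ _ (y `^ k * ((\sum_(m < N) w m) * (2 + 4 / h)))).
  by rewrite ler_pM2l.
have w00 : 0 <= \sum_(m < N) w m by apply: sumr_ge0.
move: tot w00; set S := \sum_(m < N) w m; move=> tot w00.
(* 720 = 360 * 2: the constant of [weight_ge], and the length y / (2 sqrt k) of each half. *)
have E1 : y `^ k * (S * (2 + 4 / h)) = 720 * (W * S * (y / (2 * q))) * ((2 + 4 / h) * (q * y / n%:R)).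
  rewrite /W; move: (2 + 4 / h) => Z; have yn : y != 0 by rewrite gt_eqF.
  have qn : q != 0 by rewrite gt_eqF.
  have nn : n%:R != 0 :> R by rewrite gt_eqF.
  by field; rewrite yn qn nn.
have E2 : (2 + 4 / h) * (q * y / n%:R) = 2 * q * y / n%:R + k / pi.
  have pn : pi != 0 :> R by rewrite gt_eqF ?pi_gt0.
  have yn : y != 0 by rewrite gt_eqF.
  have qn : q != 0 by rewrite gt_eqF.
  have nn : n%:R != 0 :> R by rewrite gt_eqF.
  have -> : k / pi = q ^+ 2 / pi by rewrite qq.
  rewrite /h; move: (pi : R) pn; clear - yn qn nn => p pn.
  by field; rewrite pn yn qn nn.
have hh : 0 < 4 / h by rewrite divr_gt0.
rewrite E1; apply: ler_pM.
- apply: mulr_ge0; first exact: ler0n.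
  apply: mulr_ge0; first exact: mulr_ge0.
  by apply: divr_ge0; [exact: ltW|apply: mulr_ge0; [exact: ler0n|exact: ltW]].
- apply: mulr_ge0; first by apply: addr_ge0; [exact: ler0n|exact: ltW].
  by apply: divr_ge0; [apply: mulr_ge0; exact: ltW|exact: ltW].
- by apply: ler_wpM2l; [exact: ler0n|exact: tot].
rewrite E2; apply: lerD.
  rewrite ler_pM2r ?invr_gt0// ler_pM2r//; lra.
by rewrite ler_pdivrMr ?pi_gt0// ler_peMr ?(ltW kp)//; have := pi_ge2 R; lra.
Qed.

End CoefBound.

(** * The pointwise bound for cusp forms *)

Section Upper.
Variable R : realType.
Local Notation C := R[i].
Local Notation H := (@upper_half R).
Local Notation M2 := 'M[int]_2.

Lemma hform_upper (f : C -> C) z : H z -> hform f z = f z.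
Proof. by rewrite /hform => ->. Qed.

Lemma Im_mobius_powR (k : R) t w : SL2Z t -> H w ->
  complex.Im (mobius t w) `^ k * (cabs (jfac t w) `^ k) ^+ 2 = complex.Im w `^ k.
Proof.
move=> st Hw; have j0 := cabs_jfac_gt0 st Hw.
rewrite expr2 -!powRM ?mulr_ge0 ?cabs_ge0// -?expr2; last first.
  by rewrite ltW//; exact: mobius_upper.
by rewrite Im_mobius// divfK// expf_neq0// gt_eqF.
Qed.

Lemma absq_mobius (k : R) (f : C -> C) t w : SL2Z t -> H w ->
  absq k f (mobius t w) = absq k (slash k f t) w.
Proof.
move=> st Hw; have Htw := mobius_upper st Hw; have j0 := cabs_jfac_gt0 st Hw.
rewrite /absq !hform_upper// /slash cabsM cabs_cpow ?jfac_neq0//; congr (_%:E).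
rewrite -(Im_mobius_powR k st Hw) powRN; have p0 : cabs (jfac t w) `^ k != 0.
  by rewrite gt_eqF// powR_gt0.
by field.
Qed.

Lemma ys_k (n p eta k : R) : n != 0 -> p != 0 -> eta != 0 ->
  k / 2 = 2 * p * eta / n * (n * k / (4 * p * eta)).
Proof. by move=> nn pn en; field; rewrite nn pn en. Qed.

Lemma ys_q (n p eta k q : R) : n != 0 -> p != 0 -> eta != 0 ->
  4 * q * (n * k / (4 * p * eta)) / n = k * q / eta / p.
Proof. by move=> nn pn en; field; rewrite nn pn en. Qed.

Variables (G : set M2) (F : set C) (k : R) (nu : M2 -> C -> C).
Hypotheses (sG : is_subgroup G) (fG : finite_index G) (GN1 : G (-1)).
Hypotheses (anu : automorphy_factor G k nu) (fF : fundamental_domain G F).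

Lemma absq_G f g z : cusp_form G k nu f -> G g -> H z ->
  absq k f (mobius g z) = absq k f z.
Proof.
move=> [_ inv _] Gg Hz; have sg := G_SL2Z sG Gg; have Hgz := mobius_upper sg Hz.
rewrite /absq !hform_upper// inv// cabsM (cabs_nu anu)//; congr (_%:E).
rewrite -(Im_mobius_powR k sg Hz) exprMn; ring.
Qed.

(** Unfolding the box to F counts, for each z, the translates of z that fall into the box seen from
    the cusp t; by [count_box] there are at most 45. *)
Lemma hyp_box f t (y : R) : cusp_form G k nu f -> SL2Z t ->
  1 / 4 <= y * (1 - 1 / Num.sqrt k) ->
  (hyp (fun z => boxf (cusp_width G t) k y z * absq k (slash k f t) z) <=
   45%:R%:E * hyp (fun z => indF F z * absq k f z))%E.
Proof.
move=> cf st hy; have stV := SL2ZV st; have gS := G_SL2Z sG.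
have mf := hmeas_absq k (pmeas_cusp_form cf).
have count z (Hz : H z) s := @count_box R G sG fG GN1 t z s st Hz.
move: count; generalize (cusp_width G t) => n count.
have mb := @hmeas_boxf R n k y; have b0 := @boxf_ge0 R n k y; have f0 := absq_ge0 k f.
have mbt : hmeas (fun z => boxf n k y (mobius t^-1 z)) by exact: hmeas_mobius.
have -> : hyp (fun z => boxf n k y z * absq k (slash k f t) z)%E =
    hyp (fun z => boxf n k y (mobius t^-1 z) * absq k f z)%E.
  transitivity (hyp (fun z => boxf n k y z * absq k f (mobius t z)))%E.
    by apply: hyp_eq => w Hw; rewrite absq_mobius.
  exact: (hyp_swap st mb mf b0 f0).
have mu : hmeas (fun z => boxf n k y (mobius t^-1 z) * absq k f z)%E by exact: hmeasM.
have u0 z : (0 <= boxf n k y (mobius t^-1 z) * absq k f z)%E by rewrite mule_ge0.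
apply: le_trans (unfold_le sG fF mu u0) _.
have mI := hmeas_indF fF; have I0 := @indF_ge0 R F.
rewrite -hypZ//; last 2 first.
- exact: hmeasM.
- by move=> z; rewrite mule_ge0.
apply: le_hyp.
- apply: hmeasM => //; apply: hmeas_Gsum => [g Gg|g z]; last exact: u0.
  exact: (@hmeas_mobius R _ g^-1 mu).
- apply: hmeasM; first exact: measurable_cst.
  exact: hmeasM.
- by move=> z _; rewrite mule_ge0// Gsum_ge0.
move=> z Hz; rewrite muleCA lee_wpmul2l//.
rewrite (@eq_Gsum _ _ _ (fun g => absq k f z * boxf n k y (mobius t^-1 (mobius g^-1 z))))%E; last first.
  move=> g Gg; rewrite muleC; congr (_ * _)%E.
  by rewrite absq_G//; exact: (GV sG).
rewrite -GsumZ// muleC lee_wpmul2r//.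
apply: le_trans (@Gsum_count R G (fun g => in_box n (mobius (t^-1 * g^-1) z)) 45 _).
  apply: le_Gsum => // g Gg; rewrite -mobiusM//; last by apply: SL2ZV; exact: gS.
  rewrite /boxf !indE -EFinM lee_fin -natrM ler_nat mulnb leq_eqVlt; apply/orP.
  set w := mobius _ z; case: (boolP (in_box n w)) => [_|nb].
    by case: (_ && _); [left|right].
  left; apply/eqP; case: (boolP (_ && _)) => // /andP[/andP[a1 a2] /andP[a3 a4]].
  by case/negP: nb; rewrite /in_box a1 a2 (le_trans hy).
move=> s us hs; rewrite -(size_map (fun g : M2 => g^-1)).
apply: (count z Hz); first by rewrite map_inj_uniq//; exact: invr_inj.
by move=> _ /mapP[g /hs[Gg Qg] ->]; split; first exact: (GV sG).
Qed.

(** The function y^k' exp(-t y) decreases beyond its peak k' / t, which is at most y0. *)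
Lemma expR_powR_mono (t k' y0 y : R) : 0 < y0 -> y0 <= y -> 0 <= k' -> k' <= t * y0 ->
  y `^ k' * expR (- t * y) <= y0 `^ k' * expR (- t * y0).
Proof.
move=> p0 le k0 kt; have p : 0 < y by exact: lt_le_trans le.
rewrite !powR_expR_ln// -!expRD ler_expR.
have l : ln y <= ln y0 + (y / y0 - 1).
  have q0 : 0 < y / y0 by rewrite divr_gt0.
  have yE : y = y0 * (y / y0) by rewrite mulrCA divff ?gt_eqF// mulr1.
  rewrite {1}yE lnM ?posrE// lerD2l -[leRHS]expRK ler_ln ?posrE ?expR_gt0//.
  by have := expR_ge1Dx (y / y0 - 1); rewrite addrCA subrr addr0.
have h : k' * ln y <= k' * ln y0 + k' * (y / y0 - 1) by rewrite -mulrDr ler_wpM2l.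
have h2 : k' * (y / y0 - 1) <= t * y0 * (y / y0 - 1).
  by rewrite ler_wpM2r// subr_ge0 ler_pdivlMr// mul1r.
have h3 : t * y0 * (y / y0 - 1) = t * (y - y0) by field; rewrite gt_eqF.
move: h3 h2 h; rewrite mulrBr; lra.
Qed.

(** By [reduction], z is seen from a cusp t at height at least 1 / 2. Up to the height ys,
    [coef_bound] suffices; beyond it every term decreases, so the bound at ys persists. The constant
    is 720 * 45 * 2: from [coef_bound], from [hyp_box], and from bounding each of the two summands
    of [coef_bound] by k^(3/2) / eta. *)
Lemma upper_bound f z (eta K : R) : 720 * 90 <= K -> cusp_form G k nu f -> 8 <= k -> H z ->
  0 < eta -> (forall t, SL2Z t -> eta <= eta_cusp G k nu t) ->
  ((cabs (f z) ^+ 2 * complex.Im z `^ k)%:E <=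
   (K * k `^ (3 / 2) / eta)%:E * hyp (fun z => indF F z * absq k f z))%E.
Proof.
move=> hK cf k8 Hz eta0 heta; have k0 : 0 < k by lra.
have K0 : 0 < K by lra.
have K1 : 0 <= 720 :> R by lra.
move: (720 : R) (@coef_bound R) hK K1 => c0 cbound hK c00.
have [t [w [st w12 zw]]] := reduction Hz.
set y := complex.Im w in w12; have y0 : 0 < y by lra.
have Hw : H w by exact: y0.
have -> : (cabs (f z) ^+ 2 * complex.Im z `^ k)%:E = (cabs (slash k f t w) ^+ 2 * y `^ k)%:E.
  have := absq_mobius k f st Hw; rewrite /absq -zw !hform_upper//.
have [a ha] := cusp_form_series cf st.
pose J := hyp (fun z => indF F z * absq k f z)%E; rewrite -/J.
have hb y1 : 1 / 4 <= y1 * (1 - 1 / Num.sqrt k) ->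
    (hyp (fun z => boxf (cusp_width G t) k y1 z * absq k (slash k f t) z) <= 45%:R%:E * J)%E.
  exact: hyp_box.
have I00 : (0 <= J)%E.
  apply: integral_ge0 => p _; apply: mule_ge0; last by rewrite lee_fin sqr_ge0.
  by apply: mule_ge0; [exact: indF_ge0|exact: absq_ge0].
clearbody J.
have n0 := cusp_width_gt0 sG fG GN1 st.
have [/andP[kap0 kap1] _] := cusp_paramP sG fG GN1 anu st.
have et := heta t st; have /andP[_ et1] := eta_cusp_gt0 sG fG GN1 anu st.
have etm m : 0 < m%:R + cusp_param G k nu t -> eta <= m%:R + cusp_param G k nu t.
  move=> pm; apply: (le_trans et); rewrite /eta_cusp; case: eqP pm => [->|_ _].
    by rewrite addr0 ltr0n => m0; rewrite ler1n.
  by rewrite lerDr.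
have eta1 : eta <= 1 by exact: le_trans et1.
clear et et1; move: ha hb n0 kap0 kap1 etm.
generalize (cusp_width G t) (cusp_param G k nu t) => n kap ha hb n0 kap0 kap1 etm.
have nR : 0 < n%:R :> R by rewrite ltr0n.
have n1 : 1 <= n%:R :> R by rewrite ler1n.
case: J I00 hb => [I|_ _|//]; last first.
  by rewrite gt0_muley ?leey// lte_fin divr_gt0// mulr_gt0 ?powR_gt0//; lra.
rewrite lee_fin => I0 hb; rewrite -EFinM lee_fin.
set q := Num.sqrt k in hb.
have qq : q ^+ 2 = k by rewrite sqr_sqrtr// ltW.
have q0 : 0 < q by rewrite sqrtr_gt0.
have q2 : 2 <= q by rewrite -ler_sqr ?nnegrE ?(ltW q0)// qq; lra.
have k32 : k `^ (3 / 2) = k * q.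
  have -> : 3 / 2 = 1 + 2^-1 :> R by field.
  by rewrite powRD ?(gt_eqF k0)// ?implybT// powRr1 ?(ltW k0)// powR12_sqrt// ltW.
pose M N y1 := \sum_(m < N) fcoef kap a m * expR (- (2 * pi * (m%:R + kap) / n%:R) * y1).
(* The peak of y^k exp(-4 pi eta y / n), for eta a lower bound of all frequencies m + kappa > 0. *)
pose ys := n%:R * k / (4 * pi * eta).
have pi3 : pi < 4 :> R by have := pihalf_lt2 R; lra.
have pi1 : 1 < pi :> R by have := pi_ge2 R; lra.
have ys0 : 1 / 2 <= ys.
  rewrite /ys ler_pdivlMr ?mulr_gt0 ?pi_gt0//.
  apply: (@le_trans _ _ k); last by rewrite ler_peMl// ltW.
  have : pi * eta <= pi * 1 by rewrite ler_pM2l ?pi_gt0.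
  lra.
have main y1 N : 1 / 2 <= y1 -> y1 <= ys -> y1 `^ k * M N y1 ^+ 2 <= K * k `^ (3 / 2) / eta * I.
  move=> h1 h2; have y10 : 0 < y1 by lra.
  have hy : 1 / 4 <= y1 * (1 - 1 / q).
    have : 1 / q <= 1 / 2 by rewrite ler_pdivrMr//; lra.
    nra.
  have := hb _ hy; rewrite -EFinM => {}hb.
  have k4 : 4 <= k by lra.
  apply: (le_trans (@cbound n kap a _ k y1 _ N n0 kap0 k4 y10 ha hb)).
  rewrite -/q k32.
  have E1 : 4 * q * y1 / n%:R <= k * q / eta.
    apply: (@le_trans _ _ (4 * q * ys / n%:R)).
      by rewrite ler_pM2r ?invr_gt0// ler_pM2l// mulr_gt0.
    have -> : 4 * q * ys / n%:R = k * q / eta / pi.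
      by apply: ys_q; rewrite gt_eqF ?pi_gt0.
    rewrite ler_pdivrMr ?pi_gt0// ler_peMr//; last exact: ltW.
    by rewrite divr_ge0// ?mulr_ge0 ?ltW.
  have E2 : k <= k * q / eta.
    by rewrite -mulrA ler_peMr ?(ltW k0)// ler_pdivlMr// mul1r; lra.
  have E3 : 4 * q * y1 / n%:R + k <= 2 * (k * q / eta) by lra.
  apply: (@le_trans _ _ (c0 * (45 * I) * (2 * (k * q / eta)))).
    by apply: ler_wpM2l; [apply: mulr_ge0; [exact: c00|lra]|exact: E3].
  have -> : c0 * (45 * I) * (2 * (k * q / eta)) = (c0 * 90) * (k * q / eta * I) by ring.
  have -> : K * (k * q) / eta * I = K * (k * q / eta * I) by ring.
  by rewrite ler_wpM2r// mulr_ge0// divr_ge0 ?mulr_ge0// ltW.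
have all N : y `^ k * M N y ^+ 2 <= K * k `^ (3 / 2) / eta * I.
  have [le|/ltW lt] := lerP y ys; first exact: main.
  apply: le_trans (main ys N ys0 (lexx _)).
  have ysp : 0 < ys by lra.
  (* Square roots are taken so that the comparison is termwise: y^(k/2) exp(-2 pi (m + kappa) y / n)
     is past its peak, as k / 2 = 2 pi eta ys / n. *)
  have half (x : R) : 0 < x -> x `^ k = (x `^ (k / 2)) ^+ 2.
    by move=> x0; rewrite -powR_mulrn ?powR_ge0// -powRrM; congr (_ `^ _); field.
  rewrite !half// -!exprMn ler_sqr ?nnegrE; last 2 first.
  - rewrite mulr_ge0 ?powR_ge0//; apply: sumr_ge0 => m _; rewrite mulr_ge0 ?expR_ge0//.
    by rewrite /fcoef; case: ifP => // _; exact: cabs_ge0.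
  - rewrite mulr_ge0 ?powR_ge0//; apply: sumr_ge0 => m _; rewrite mulr_ge0 ?expR_ge0//.
    by rewrite /fcoef; case: ifP => // _; exact: cabs_ge0.
  rewrite /M !mulr_sumr; apply: ler_sum => m _; rewrite /fcoef; case: ifP => [pm|_]; last by rewrite !mul0r !mulr0.
  rewrite ![_ `^ _ * (cabs _ * _)]mulrCA ler_wpM2l ?cabs_ge0//.
  apply: expR_powR_mono => //; first by rewrite divr_ge0// ltW.
  have mk := etm m pm; have -> : k / 2 = 2 * pi * eta / n%:R * ys.
    by apply: ys_k; rewrite gt_eqF ?pi_gt0.
  by rewrite ler_pM2r// ler_pM2r ?invr_gt0// ler_pM2l// mulr_gt0// pi_gt0.
have B0 : 0 <= K * k `^ (3 / 2) / eta * I.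
  apply: mulr_ge0 => //; apply: divr_ge0; last exact: ltW.
  by apply: mulr_ge0; [lra|exact: powR_ge0].
rewrite mulrC; pose S := Num.sqrt (K * k `^ (3 / 2) / eta * I / y `^ k).
have yk0 : 0 < y `^ k by rewrite powR_gt0.
have allS N : M N y <= S.
  have M0 : 0 <= M N y.
    apply: sumr_ge0 => m _; rewrite mulr_ge0 ?expR_ge0//.
    by rewrite /fcoef; case: ifP => // _; exact: cabs_ge0.
  by rewrite -(ger0_norm M0) -sqrtr_sqr ler_wsqrtr// ler_pdivlMr// mulrC.
have gS : cabs (slash k f t w) <= S.
  apply/ler_addgt0Pr => e e0; have [N hN] := (cvgC_eps _ _).1 (ha w Hw) e e0.
  have := hN N (leqnn N); set s := series _ N => h.
  have -> : slash k f t w = s + (slash k f t w - s) by rewrite addrCA subrr addr0.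
  apply: (le_trans (cabsD _ _)); apply: lerD => //; apply: le_trans (allS N).
  rewrite /s /series /= big_mkord; apply: (le_trans (cabs_sum _ _ _)).
  by apply: ler_sum => m _; rewrite cabs_fterm.
rewrite mulrC -ler_pdivlMr//.
apply: (@le_trans _ _ (S ^+ 2)); last by rewrite sqr_sqrtr// divr_ge0// ltW.
by rewrite ler_sqr ?nnegrE ?cabs_ge0 ?sqrtr_ge0.
Qed.

End Upper.

(** * Poincare series *)

Section Unordered.
Variable R : realType.
Local Notation C := R[i].

Lemma ler_sum_sub (I : eqType) (s t : seq I) (g : I -> R) : (forall i, 0 <= g i) ->
  uniq s -> {subset s <= t} -> \sum_(i <- s) g i <= \sum_(i <- t) g i.
Proof.
move=> g0 us st; have P : perm_eq s [seq i <- undup t | i \in s].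
  apply: uniq_perm => //; first by rewrite filter_uniq// undup_uniq.
  by move=> i; rewrite mem_filter mem_undup; case: (boolP (i \in s)) => // /st ->.
rewrite (perm_big _ P) big_filter big_mkcond /=.
apply: (@le_trans _ _ (\sum_(i <- undup t) g i)).
  by apply: ler_sum => i _; case: ifP.
elim: t {st P} => [|i t ih]; first by rewrite !big_nil.
by rewrite /=; case: ifP => _; rewrite !big_cons ?lerD2l// (le_trans ih)// lerDr.
Qed.

Lemma half_pow_small (e : R) : 0 < e ->
  exists m, forall n, (m <= n)%N -> (2^-1 : R) ^+ n <= e.
Proof.
move=> e0; exists (Num.bound e^-1) => n mn.
have b : e^-1 < (Num.bound e^-1)%:R by rewrite archi_boundP// invr_ge0 ltW.
have c : (Num.bound e^-1)%:R <= 2 ^+ n :> R.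
  by rewrite -natrX ler_nat (leq_trans mn)// ltnW// ltn_expl.
by rewrite exprVn -[leRHS]invrK lef_pV2 ?posrE ?invr_gt0 ?exprn_gt0// ltW// (lt_le_trans b).
Qed.

Variable I : choiceType.
Implicit Types (f : I -> C) (g : I -> R).

(** Convergence along finite sets. It is invariant under permutations of the index set, which is how
    the action of G on rows gives automorphy. *)
Definition has_sum f (S : C) := forall e : R, 0 < e -> exists s0 : seq I,
  forall s, uniq s -> {subset s0 <= s} -> cabs (S - \sum_(i <- s) f i) <= e.

Definition summable_by g (B : R) := forall s, uniq s -> \sum_(i <- s) g i <= B.

Lemma has_sum_le f S (B : R) : has_sum f S ->
  (forall s, uniq s -> cabs (\sum_(i <- s) f i) <= B) -> cabs S <= B.
Proof.
move=> hS hB; apply/ler_addgt0Pr => e e0; have [s0 h] := hS e e0.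
have us := undup_uniq s0.
have := h _ us; have sub : {subset s0 <= undup s0} by move=> i; rewrite mem_undup.
move=> /(_ sub) h1; have -> : S = \sum_(i <- undup s0) f i + (S - \sum_(i <- undup s0) f i).
  by rewrite addrCA subrr addr0.
by apply: (le_trans (cabsD _ _)); apply: lerD => //; exact: hB.
Qed.

Lemma has_sumD f1 f2 S1 S2 : has_sum f1 S1 -> has_sum f2 S2 ->
  has_sum (fun i => f1 i + f2 i) (S1 + S2).
Proof.
move=> h1 h2 e e0; have e2 : 0 < e / 2 by rewrite divr_gt0.
have [s1 k1] := h1 _ e2; have [s2 k2] := h2 _ e2; exists (s1 ++ s2) => s us sub.
rewrite big_split /= opprD addrACA; apply: (le_trans (cabsD _ _)).
rewrite [leRHS](splitr e); apply: lerD.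
  by apply: k1 => // i is1; apply: sub; rewrite mem_cat is1.
by apply: k2 => // i is1; apply: sub; rewrite mem_cat is1 orbT.
Qed.

Lemma has_sumZ f S (a : C) : has_sum f S -> has_sum (fun i => a * f i) (a * S).
Proof.
move=> h e e0; have a1 : 0 < cabs a + 1 by rewrite ltr_wpDl ?cabs_ge0.
have [s0 k] := h (e / (cabs a + 1)) (divr_gt0 e0 a1); exists s0 => s us sub.
rewrite -mulr_sumr -mulrBr cabsM; have := k s us sub; rewrite ler_pdivlMr//.
apply: le_trans; rewrite mulrC ler_wpM2l ?cabs_ge0// lerDl//.
Qed.

Lemma has_sum_reindex f S (p q : I -> I) : cancel p q -> cancel q p ->
  has_sum f S -> has_sum (fun i => f (p i)) S.
Proof.
move=> pq qp h e e0; have [s0 k] := h e e0; exists (map q s0) => s us sub.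
rewrite -(big_map p xpredT f); apply: k.
  by rewrite map_inj_uniq//; exact: can_inj pq.
by move=> i i0; rewrite -(qp i); apply: map_f; apply: sub; apply: map_f.
Qed.

Lemma eq_has_sum f1 f2 S : (forall i, f1 i = f2 i) -> has_sum f1 S -> has_sum f2 S.
Proof.
move=> e h d d0; have [s0 k] := h d d0; exists s0 => s us sub.
by have := k s us sub; rewrite (eq_bigr f2).
Qed.

Lemma has_sum_unique f S1 S2 : has_sum f S1 -> has_sum f S2 -> S1 = S2.
Proof.
move=> h1 h2; apply/eqP; rewrite -subr_eq0 -cabs_eq0 eq_le cabs_ge0 andbT.
have h3 : has_sum (fun i => f i + -1 * f i) (S1 + -1 * S2).
  by apply: has_sumD => //; exact: has_sumZ.
rewrite mulN1r in h3; apply: (has_sum_le h3) => s us.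
by rewrite big1 ?cabs0// => i _; rewrite mulN1r subrr.
Qed.

Lemma has_sum_finite f (s : seq I) : uniq s -> (forall i, i \notin s -> f i = 0) ->
  has_sum f (\sum_(i <- s) f i).
Proof.
move=> us f0 e e0; exists s => t ut sub.
have P : perm_eq s [seq i <- t | i \in s].
  apply: uniq_perm => //; first by rewrite filter_uniq.
  by move=> i; rewrite mem_filter; case: (boolP (i \in s)) => // /sub ->.
rewrite (perm_big _ P) big_filter big_mkcond /= -sumrB big1 ?cabs0 ?ltW// => i _.
by case: ifPn => [_|/f0 ->]; rewrite subrr.
Qed.

Lemma summable_tail g (B : R) : (forall i, 0 <= g i) -> summable_by g B ->
  forall e : R, 0 < e -> exists s0, uniq s0 /\
  forall s, uniq s -> (forall i, i \in s -> i \notin s0) -> \sum_(i <- s) g i <= e.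
Proof.
move=> g0 hB e e0; pose E : set R := [set x | exists2 s, uniq s & x = \sum_(i <- s) g i].
have supE : has_sup E.
  split; first by exists (\sum_(i <- [::]) g i); exists [::].
  by exists B => _ [s us ->]; exact: hB.
have [_ [s0 us0 ->] lt] := sup_adherent e0 supE; exists s0; split => // s us dis.
have u2 : uniq (s0 ++ s).
  rewrite cat_uniq us0 us andbT; apply/hasPn => i /dis; exact.
have := ub_le_sup supE.2 (ex_intro2 _ _ (s0 ++ s) u2 (erefl _) : E _).
rewrite big_cat /=; move: lt; lra.
Qed.

(** The lists u m increase and leave tails of size at most 2^-m. The sums over them are therefore
    Cauchy, and any finite set containing u m has a sum within 2^-m of that over u m. *)
Lemma summable_has_sum f g (B : R) : (forall i, 0 <= g i) -> summable_by g B ->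
  (forall i, cabs (f i) <= g i) -> exists S, has_sum f S.
Proof.
move=> g0 hB fg.
have /choice [s hs] : forall m : nat, exists s0 : seq I, uniq s0 /\
    forall s, uniq s -> (forall i, i \in s -> i \notin s0) -> \sum_(i <- s) g i <= (2^-1) ^+ m.
  by move=> m; apply: (summable_tail g0 hB); rewrite exprn_gt0.
pose u := fix u m := if m is m'.+1 then undup (u m' ++ s m) else s 0%N.
have uu m : uniq (u m) by case: m => [|m]; [have [] := hs 0%N|exact: undup_uniq].
have su m : {subset s m <= u m}.
  by case: m => [//|m] i im; rewrite /= mem_undup mem_cat im orbT.
have uS m : {subset u m <= u m.+1} by move=> i im; rewrite /= mem_undup mem_cat im.
have near_ m t : uniq t -> {subset u m <= t} ->
    cabs (\sum_(i <- t) f i - \sum_(i <- u m) f i) <= (2^-1) ^+ m.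
  move=> ut sub; have P : perm_eq t (u m ++ [seq i <- t | i \notin u m]).
    apply: uniq_perm => //.
      rewrite cat_uniq uu filter_uniq// andbT; apply/hasPn => i.
      by rewrite mem_filter => /andP[].
    move=> i; rewrite mem_cat mem_filter.
    by case: (boolP (i \in u m)) => [/sub ->|].
  rewrite (perm_big _ P) big_cat /= addrAC subrr add0r.
  apply: (le_trans (cabs_sum _ _ _)).
  apply: (@le_trans _ _ (\sum_(i <- [seq i <- t | i \notin u m]) g i)).
    by apply: ler_sum => i _; exact: fg.
  have [_] := hs m; apply; first by rewrite filter_uniq.
  move=> i; rewrite mem_filter => /andP[iu _].
  by apply: contra iu; exact: su.
have step m : (0 <= m)%N -> cabs (\sum_(i <- u m.+1) f i - \sum_(i <- u m) f i) <= 1 / 2 ^+ m.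
  move=> _; rewrite div1r -exprVn; apply: near_; first exact: uu.
  exact: uS.
have [S hS] := geometric_cauchy ler01 step.
exists S => e e0; have e2 : 0 < e / 2 by rewrite divr_gt0.
have [m1 k1] := hS _ e2; have [m2 k2] := half_pow_small e2.
exists (u (m1 + m2)%N) => t ut sub; set m := (m1 + m2)%N in sub *.
have -> : S - \sum_(i <- t) f i = - (\sum_(i <- u m) f i - S) -
    (\sum_(i <- t) f i - \sum_(i <- u m) f i) by ring.
apply: (le_trans (cabsB _ _)); rewrite cabsN.
have := k1 m (leq_addr _ _); have := k2 m (leq_addl _ _); have := near_ m t ut sub; lra.
Qed.

End Unordered.

(** * Sums of powers of |c z + d| over bottom rows *)

Section RowSum.
Variable R : realType.
Local Notation C := R[i].
Local Notation H := (@upper_half R).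

Lemma sum_inv_sqr_le2 (N : nat) : \sum_(a < N) (a.+1%:R ^+ 2)^-1 <= 2 :> R.
Proof.
case: N => [|N]; first by rewrite big_ord0.
apply: (@le_trans _ _ (2 - N.+1%:R^-1)); last by rewrite gerBl invr_ge0.
elim: N => [|N ih]; first by rewrite big_ord1 expr1n invr1; lra.
rewrite big_ord_recr /=; apply: (le_trans (lerD ih (lexx _))).
have n1 : 0 < N.+1%:R :> R by [].
have -> : N.+2%:R = N.+1%:R + 1 :> R by rewrite natr1.
move: (N.+1%:R : R) n1 => x x0.
have x1 : 0 < x + 1 by lra.
have : ((x + 1) ^+ 2)^-1 <= x^-1 - (x + 1)^-1.
  have -> : x^-1 - (x + 1)^-1 = (x * (x + 1))^-1 by field; rewrite !gt_eqF.
  by rewrite lef_pV2 ?posrE ?mulr_gt0 ?exprn_gt0// expr2 ler_wpM2r ?(ltW x1)//; lra.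
lra.
Qed.

Lemma sum_ints (g : int -> R) (N : nat) (S : seq int) : (forall i, 0 <= g i) -> uniq S ->
  (forall i, i \in S -> (`|i| < N)%N) ->
  \sum_(i <- S) g i <= \sum_(b < N) g b%:Z + \sum_(b < N) g (- b%:Z).
Proof.
move=> g0 us hN.
have E (h : nat -> int) : \sum_(b < N) g (h b) = \sum_(i <- [seq h b | b <- iota 0 N]) g i.
  by rewrite big_map -[in RHS](subn0 N) -/(index_iota 0 N) big_mkord.
rewrite (E (fun b => b%:Z)) (E (fun b => - b%:Z)) -big_cat.
apply: ler_sum_sub => // i /hN; rewrite mem_cat => iN; apply/orP.
case: i iN => [b|b] bN; [left|right]; apply/mapP; [exists b|exists b.+1] => //;
  by rewrite mem_iota add0n.
Qed.

Definition rowfac (r : int * int) (z : C) : C := r.1%:~R * z + r.2%:~R.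

(** With Y = |c| Im z, |c z + d|^2 = Y^2 (1 + ((c x + d) / Y)^2), and the inner quotient runs
    through a progression of step 1 / Y. The factor 4 + 8 Y is twice the bound 2 + 4 Y of
    [sum_inv_sqr], once for d >= 0 and once for d <= 0. *)
Lemma inner_sum (c : int) (z : C) (s : R) (S : seq int) : c != 0 -> H z -> 2 <= s -> uniq S ->
  \sum_(d <- S) cabs (rowfac (c, d) z) `^ (- s) <=
  4 * (`|c|%:R * complex.Im z) `^ (- s) + 8 * (`|c|%:R * complex.Im z) `^ (1 - s).
Proof.
move=> c0 Hz s2 us; have y0 : 0 < complex.Im z by exact: Hz.
set Y := `|c|%:R * complex.Im z; have cp : 1 <= `|c|%:R :> R by rewrite ler1n absz_gt0.
have Y0 : 0 < Y by rewrite mulr_gt0//; lra.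
pose X : R := c%:~R * complex.Re z; pose h := Y^-1.
have h0 : 0 < h by rewrite invr_gt0.
have term (d : int) : cabs (rowfac (c, d) z) `^ (- s) <=
    Y `^ (- s) * (1 + (X * h + h * d%:~R) ^+ 2)^-1.
  have cc : cabs (rowfac (c, d) z) ^+ 2 = Y ^+ 2 * (1 + (X * h + h * d%:~R) ^+ 2).
    rewrite cabs_sqr /rowfac ReD ImD !intrCE ReM ImM /= !mul0r subr0 !addr0.
    have Yc : Y ^+ 2 = (c%:~R * complex.Im z) ^+ 2.
      by rewrite /Y !exprMn natr_absz intr_norm real_normK// num_real.
    rewrite -Yc /X /h; field; rewrite gt_eqF//.
  have q1 : 1 <= 1 + (X * h + h * d%:~R) ^+ 2 by rewrite lerDl sqr_ge0.
  have -> : cabs (rowfac (c, d) z) = Y * Num.sqrt (1 + (X * h + h * d%:~R) ^+ 2).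
    rewrite -[LHS]ger0_norm ?cabs_ge0// -sqrtr_sqr cc sqrtrM ?sqr_ge0//.
    by rewrite sqrtr_sqr ger0_norm// ltW.
  move: (1 + _) q1 => q q1; rewrite powRM ?(ltW Y0) ?sqrtr_ge0//.
  rewrite ler_pM2l ?powR_gt0//.
  have q0 : 0 < q by lra.
  rewrite -powR12_sqrt ?(ltW q0)// -powRrM -[leRHS]powR_inv1 ?(ltW q0)//.
  by apply: ler_powR => //; lra.
apply: (le_trans (ler_sum _ (fun d _ => term d))); rewrite -mulr_sumr.
have [N hN] : exists N, forall i, i \in S -> (`|i| < N)%N.
  exists (\max_(i <- S) `|i|%N).+1 => i iS; rewrite ltnS (bigD1_seq i)//= leq_maxl//.
have := @sum_ints (fun d => (1 + (X * h + h * d%:~R) ^+ 2)^-1) N S _ us hN.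
have p i : 0 <= (1 + (X * h + h * i%:~R) ^+ 2)^-1.
  by rewrite invr_ge0; have := sqr_ge0 (X * h + h * i%:~R); lra.
move=> /(_ p) le1.
have le2 := sum_inv_sqr (X * h) N h0.
have le3 := sum_inv_sqr (- (X * h)) N h0.
have eq3 : \sum_(b < N) (1 + (X * h + h * (- b%:Z)%:~R) ^+ 2)^-1 =
    \sum_(m < N) (1 + (- (X * h) + h * m%:R) ^+ 2)^-1.
  apply: eq_bigr => b _; congr (_ + _)^-1; rewrite rmorphN /= -[in RHS]sqrrN opprD opprK mulrN.
  by [].
rewrite eq3 in le1.
have -> : 4 * Y `^ (- s) + 8 * Y `^ (1 - s) = Y `^ (- s) * (4 + 8 * Y).
  rewrite powRD; last by rewrite (gt_eqF Y0) implybT.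
  by rewrite powRr1 ?(ltW Y0)//; ring.
rewrite ler_pM2l ?powR_gt0//; apply: (le_trans le1).
have -> : 4 + 8 * Y = (2 + 4 / h) + (2 + 4 / h) by rewrite /h invrK; ring.
exact: lerD.
Qed.

(** For s >= 3 both powers of |c| in [inner_sum] are at most c^-2, whose sum over c >= 1 is at most
    2. The two signs of c give another factor 2, whence 16 = 4 * 4 and 32 = 8 * 4. *)
Lemma row_sum (z : C) (s : R) (S : seq (int * int)) : H z -> 3 <= s -> uniq S ->
  (forall r, r \in S -> r.1 != 0) ->
  \sum_(r <- S) cabs (rowfac r z) `^ (- s) <=
  16 * complex.Im z `^ (- s) + 32 * complex.Im z `^ (1 - s).
Proof.
move=> Hz s3 us S0; have y0 : 0 < complex.Im z by exact: Hz.
have [N hN] : exists N, forall i, i \in S -> (`|i.1| <= N)%N.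
  by exists (\max_(i <- S) `|i.1|%N) => i iS; rewrite (bigD1_seq i)//= leq_maxl.
pose D := undup [seq r.2 | r <- S].
pose Lc := [seq (a.+1)%:Z | a <- iota 0 N] ++ [seq - (a.+1)%:Z | a <- iota 0 N].
pose T := [seq (c, d) | c <- Lc, d <- D].
have sT : {subset S <= T}.
  move=> [c d] rS; apply/allpairsP; exists (c, d); split => //=; last first.
    by rewrite mem_undup; apply/mapP; exists (c, d).
  have := hN _ rS; have := S0 _ rS; rewrite /= mem_cat => c0 cN; apply/orP.
  case: c c0 cN {rS} => [[//|a]|a] _ aN; [left|right; rewrite NegzE];
    by apply: map_f; rewrite mem_iota.
apply: (@le_trans _ _ (\sum_(r <- T) cabs (rowfac r z) `^ (- s))).
  by apply: ler_sum_sub => // r; exact: powR_ge0.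
rewrite /T big_allpairs_dep /=.
set y := complex.Im z in y0 *.
have cterm (c : int) (a : nat) : `|c|%N = a.+1 ->
    \sum_(d <- D) cabs (rowfac (c, d) z) `^ (- s) <=
    (4 * y `^ (- s) + 8 * y `^ (1 - s)) * (a.+1%:R ^+ 2)^-1.
  move=> ca; have c0 : c != 0 by rewrite -absz_eq0 ca.
  have s2 : 2 <= s by lra.
  apply: (le_trans (inner_sum c0 Hz s2 (undup_uniq _))); rewrite ca -/y.
  have a1 : 1 <= a.+1%:R :> R by rewrite ler1n.
  have a0 : 0 < a.+1%:R :> R by lra.
  have pw (u : R) : u <= -2 -> (a.+1%:R * y) `^ u <= y `^ u * (a.+1%:R ^+ 2)^-1.
    move=> u2; rewrite powRM ?(ltW a0) ?(ltW y0)// mulrC ler_pM2l ?powR_gt0//.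
    rewrite -powR_mulrn ?(ltW a0)// -powRN; exact: ler_powR.
  rewrite [leRHS]mulrDl -(mulrA 4) -(mulrA 8); apply: lerD; rewrite ler_pM2l//; apply: pw; lra.
have K0 : 0 <= 4 * y `^ (- s) + 8 * y `^ (1 - s) by rewrite addr_ge0// mulr_ge0// powR_ge0.
have half (e : nat -> int) : (forall a, `|e a|%N = a.+1) ->
    \sum_(c <- [seq e a | a <- iota 0 N]) \sum_(d <- D) cabs (rowfac (c, d) z) `^ (- s) <=
    (4 * y `^ (- s) + 8 * y `^ (1 - s)) * 2.
  move=> he; rewrite big_map; apply: le_trans (ler_wpM2l K0 (sum_inv_sqr_le2 N)).
  rewrite mulr_sumr -[iota 0 N]/(iota 0 N) -[in leLHS](subn0 N) -/(index_iota 0 N) big_mkord.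
  by apply: ler_sum => a _; exact: cterm.
rewrite big_cat /=.
have h1 := half (fun a => (a.+1)%:Z) (fun a => erefl).
have h2 := half (fun a => - (a.+1)%:Z) (fun a => abszN _).
apply: (le_trans (lerD h1 h2)); lra.
Qed.

End RowSum.

Section Bounds.
Variable R : realType.

Lemma ge3_facts (k : R) : 3 <= k ->
  [/\ - k <= 0, 1 - k <= 0, - k <= -1 & 1 - k <= -1].
Proof. by move=> k3; split; lra. Qed.

Lemma bound_small (a k e : R) : 0 < a -> 3 <= k -> 0 < e -> exists Y : R, 1 <= Y /\
  forall y, Y <= y -> 2 * expR (- a * y) + (16 * y `^ (- k) + 32 * y `^ (1 - k)) <= e.
Proof.
move=> a0 k3 e0; pose b := 2 / a + 48; have [_ _ k1 k2] := ge3_facts k3.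
exists (Num.max 1 (b / e)); split=> [|y]; first by rewrite le_max lexx.
rewrite ge_max => /andP[y1 yY]; have y0 : 0 < y by exact: lt_le_trans y1.
apply: (@le_trans _ _ (b / y)); last first.
  by move: yY; rewrite !ler_pdivrMr// [y * e]mulrC.
have pw (p : R) : p <= -1 -> y `^ p <= y^-1.
  by move=> p1; rewrite -[leRHS]powR_inv1 ?(ltW y0)//; apply: ler_powR.
have e1 : expR (- a * y) <= (a * y)^-1.
  rewrite mulNr expRN lef_pV2 ?posrE ?expR_gt0 ?mulr_gt0//.
  by have := expR_ge1Dx (a * y); lra.
have -> : b / y = 2 * (a * y)^-1 + (16 * y^-1 + 32 * y^-1).
  by rewrite /b; field; rewrite !gt_eqF.
by apply: lerD; [|apply: lerD]; rewrite ler_pM2l//; exact: pw.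
Qed.

Lemma powR_le0_mono (p y1 y2 : R) : 0 < y1 -> y1 <= y2 -> p <= 0 -> y2 `^ p <= y1 `^ p.
Proof.
move=> y0 le p0; have y20 : 0 < y2 by exact: lt_le_trans le.
rewrite -(opprK p) !(powRN _ (- p)) lef_pV2 ?posrE ?powR_gt0//.
by rewrite ge0_ler_powR ?nnegrE ?oppr_ge0// ltW.
Qed.

End Bounds.

(** * The Poincare series at a cusp and its expansions *)

Section Poincare.
Variable R : realType.
Local Notation C := R[i].
Local Notation H := (@upper_half R).
Local Notation M2 := 'M[int]_2.
Local Notation Row := (int * int)%type.

Definition rowof (m : M2) : Row := (m 1 0, m 1 1).
Definition rmul (r : Row) (h : M2) : Row :=
  (r.1 * h 0 0 + r.2 * h 1 0, r.1 * h 0 1 + r.2 * h 1 1).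

Lemma rowofM g h : rowof (g * h) = rmul (rowof g) h.
Proof. by rewrite /rowof !mul2E. Qed.

Lemma rmulM r g h : rmul r (g * h) = rmul (rmul r g) h.
Proof. by rewrite /rmul !mul2E /=; congr (_, _); ring. Qed.

Lemma rmul1 r : rmul r 1 = r.
Proof. by case: r => c d; rewrite /rmul !mxE /= !mulr1 !mulr0 addr0 add0r. Qed.

Lemma rmulK h : SL2Z h -> cancel (rmul^~ h) (rmul^~ h^-1).
Proof. by move=> sh r; rewrite -rmulM mulrV ?rmul1// SL2Z_unit. Qed.

Lemma rmulVK h : SL2Z h -> cancel (rmul^~ h^-1) (rmul^~ h).
Proof. by move=> sh r; rewrite -rmulM mulVr ?rmul1// SL2Z_unit. Qed.

Lemma jfac_row (g : M2) (z : C) : jfac g z = rowfac (rowof g) z.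
Proof. by []. Qed.

Variables (G : set M2) (k : R) (nu : M2 -> C -> C).
Hypotheses (sG : is_subgroup G) (fG : finite_index G) (GN1 : G (-1)).
Hypotheses (anu : automorphy_factor G k nu) (k3 : 3 <= k).
Variables (t : M2) (n : nat) (eta : R).
Hypotheses (st : SL2Z t) (n0 : (0 < n)%N) (eta0 : 0 < eta).
Hypothesis hw : forall l : int, G (t * Um l * t^-1) <-> (n %| l)%Z.
Hypothesis hconj : forall z, H z ->
  conj_factor k nu t (Um n) z = cexp (0 +i* (2 * pi * eta)).

Let gS := G_SL2Z sG.
Let stV := SL2ZV st.
Let tU := SL2Z_unit st.

Definition cuspA : R := 2 * pi * eta / n%:R.
Local Notation A := cuspA.

Lemma cuspA_gt0 : 0 < A.
Proof. by rewrite divr_gt0 ?ltr0n// !mulr_gt0 ?pi_gt0. Qed.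

Definition phi (w : C) : C := cexp ((0 +i* A) * w).
(** [phi] carried from infinity to the cusp t oo; with this factor, slashing by t returns [phi]
    exactly, with no phase from the branch of the power. *)
Definition psi (w : C) : C := cpow (jfac t (mobius t^-1 w)) k * phi (mobius t^-1 w).
Definition tm (g : M2) (z : C) : C := (nu g z)^-1 * psi (mobius g z).

Lemma phiDn z : phi (z + n%:R%:C) = phi z * cexp (0 +i* (2 * pi * eta)).
Proof.
rewrite /phi mulrDr cexpD; congr (_ * cexp _); rewrite /A.
apply/eqP; rewrite eq_complex /= !mul0r mulr0 subr0 add0r eqxx /=.
by rewrite mulfVK// pnatr_eq0 -lt0n.
Qed.

(** The matrices under which [psi] transforms by nu form a group, so t U^l t^-1 with n | l is
    reached by induction from the generator, for which the property is [hconj] moved to the cusp. *)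
Definition stab (d : M2) := G d /\ forall w, H w -> psi (mobius d w) = nu d w * psi w.

Lemma stab_base : stab (t * Um n * t^-1).
Proof.
have Gd : G (t * Um n * t^-1) by apply/hw; exact: dvdzz.
split=> // w Hw; have Hz : H (mobius t^-1 w) by exact: mobius_upper.
have sU := SL2Z_Um n; set d := t * Um n * t^-1.
have sd : SL2Z d by exact: gS.
have E : mobius t^-1 (mobius d w) = mobius (Um n) (mobius t^-1 w).
  rewrite -!mobiusM// /d.
  by rewrite !mulrA mulVr// mul1r.
have := hconj Hz; rewrite /conj_factor mobiusVK// -/d => /(canRL (mulfVK (cpow_neq0 _ _))) h.
rewrite /psi E mulrA h mobius_Um; have -> : (n%:Z)%:~R = n%:R%:C :> C by rewrite -pmulrn natrCE.
by rewrite phiDn mulrA mulrC mulrA.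
Qed.

Lemma stabM d1 d2 : stab d1 -> stab d2 -> stab (d1 * d2).
Proof.
move=> [G1' h1] [G2' h2]; split=> [|w Hw]; first exact: (GM sG).
have H2 : H (mobius d2 w) by apply: mobius_upper => //; exact: gS.
by rewrite mobiusM ?h1// ?(nuM anu)//; [rewrite h2// mulrA|exact: gS|exact: gS].
Qed.

Lemma stabV d : stab d -> stab d^-1.
Proof.
move=> [Gd h]; have sd := gS Gd; have GV' := GV sG Gd; split=> // w Hw.
have H2 : H (mobius d^-1 w) by apply: mobius_upper => //; exact: gS.
have := h _ H2; rewrite mobiusVK// => ->.
rewrite mulrA [X in X * _]mulrC -(nuM anu)// mulrV ?SL2Z_unit//.
by rewrite (nu1 sG anu)// mul1r.
Qed.

Lemma stab_Um l : (n %| l)%Z -> stab (t * Um l * t^-1).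
Proof.
have pos (q : nat) : stab (t * Um (q%:Z * n%:Z) * t^-1).
  elim: q => [|q ih].
    rewrite mul0r Um0 mulr1 divrr//; split=> [|w Hw]; first exact: (G1 sG).
    by rewrite mobius1 (nu1 sG anu)// mul1r.
  have -> : t * Um (q.+1%:Z * n%:Z) * t^-1 = (t * Um n * t^-1) * (t * Um (q%:Z * n%:Z) * t^-1).
    have -> : q.+1%:Z * n%:Z = n%:Z + q%:Z * n%:Z by rewrite -addn1 PoszD mulrDl mul1r addrC.
    by rewrite UmD !mulrA mulrVK.
  exact: stabM stab_base ih.
move=> /dvdzP[[q|q] ->]; first exact: pos.
rewrite NegzE mulNr UmN; have := stabV (pos q.+1).
rewrite invrM ?unitrV// ?unitrMl// ?SL2Z_unit ?invrK//; last exact: SL2Z_Um.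
rewrite invrM// ?SL2Z_unit//; last exact: SL2Z_Um.
by rewrite mulrA.
Qed.

(** The two matrices differ on the left by some t U^l t^-1 in G. Then n | l, so this matrix is in
    [stab] and its factor nu cancels. *)
Lemma tm_row g h z : G g -> G h -> rowof (t^-1 * g) = rowof (t^-1 * h) -> H z -> tm g z = tm h z.
Proof.
move=> Gg Gh [r0 r1] Hz; have sg := gS Gg; have sh := gS Gh.
have [l e] := SL2Z_same_row (SL2ZM stV sh) (SL2ZM stV sg) (esym r0) (esym r1).
have e2 : g = (t * Um l * t^-1) * h.
  by rewrite -[LHS](mulVKr tU) e !mulrA.
have Gd : G (t * Um l * t^-1).
  have -> : t * Um l * t^-1 = g * h^-1 by rewrite e2 mulrK ?SL2Z_unit.
  by apply: (GM sG) => //; exact: (GV sG).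
have [_ hd] := stab_Um ((hw l).1 Gd).
have Hhz : H (mobius h z) by exact: mobius_upper.
have sd := gS Gd.
rewrite e2 /tm mobiusM// hd// (nuM anu)// invfM mulrA; congr (_ * _).
by rewrite mulrAC mulVf ?mul1r//; exact: (nu_neq0 sG anu).
Qed.

Lemma tmM g h z : G g -> G h -> H z -> tm g (mobius h z) = nu h z * tm (g * h) z.
Proof.
move=> Gg Gh Hz; have sg := gS Gg; have sh := gS Gh.
have n1 := nu_neq0 sG anu Gh Hz; have n2 := nu_neq0 sG anu Gg (mobius_upper sh Hz).
by rewrite /tm (nuM anu)// mobiusM//; field; rewrite n1 n2.
Qed.

(* [tm g] depends only on the bottom row of t^-1 g, so the Poincare series is an
   unordered sum over these rows; [ft r] is its term at r, and 0 if no g has row r. *)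
Definition isrow r := exists g, G g /\ rowof (t^-1 * g) = r.
Definition rep r : M2 := xget 1 [set g | G g /\ rowof (t^-1 * g) = r].
Definition ft r z : C := if `[< isrow r >] then tm (rep r) z else 0.

Lemma repP r : isrow r -> G (rep r) /\ rowof (t^-1 * rep r) = r.
Proof. by move=> [g hg]; exact: (@xgetPex _ 1 [set g | G g /\ rowof (t^-1 * g) = r] (ex_intro _ g hg)). Qed.

Lemma ftE g z : G g -> H z -> ft (rowof (t^-1 * g)) z = tm g z.
Proof.
move=> Gg Hz; have ir : isrow (rowof (t^-1 * g)) by exists g.
rewrite /ft asboolT//; have [Gr er] := repP ir.
exact: tm_row.
Qed.

Lemma isrow_mul r h : G h -> isrow r -> isrow (rmul r h).
Proof.
move=> Gh [g [Gg <-]]; exists (g * h); split; first exact: (GM sG).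
by rewrite mulrA rowofM.
Qed.

Lemma ft_mobius r h z : G h -> H z -> ft r (mobius h z) = nu h z * ft (rmul r h) z.
Proof.
move=> Gh Hz; have sh := gS Gh; have Hhz := mobius_upper sh Hz.
have [ir|nir] := pselect (isrow r).
  have [g [Gg er]] := ir.
  rewrite -er ftE// -rowofM -mulrA ftE//; last exact: (GM sG).
  exact: tmM.
rewrite /ft !asboolF ?mulr0// => ir; apply: nir.
by rewrite -(rmulK sh r); apply: isrow_mul => //; exact: (GV sG).
Qed.

(** All factors nu and all complex powers but that of [pterm] are collected in f, which is
    holomorphic of modulus 1, hence a constant u. *)
Lemma slash_tm tau g : SL2Z tau -> G g -> exists u : C, cabs u = 1 /\
  forall z, H z -> slash k (tm g) tau z = u * pterm (- k) A (t^-1 * g * tau) z.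
Proof.
move=> sta Gg; have sg := gS Gg; set s := t^-1 * g * tau.
have ss : SL2Z s by apply: SL2ZM => //; exact: SL2ZM.
pose f z := cpow (jfac tau z) (- k) * (nu g (mobius tau z))^-1 *
  cpow (jfac t (mobius s z)) k * cpow (jfac s z) k.
have hf : holo f.
  apply: holoM; last exact: holo_cpow_jfac.
  apply: holoM; last first.
    by apply: (@holo_comp _ (fun z => cpow (jfac t z) k)) => //; exact: holo_cpow_jfac.
  apply: holoM; first exact: holo_cpow_jfac.
  apply: holoV; first exact: (holo_nu_mobius anu).
  by move=> z Hz; apply: (nu_neq0 sG anu) => //; exact: mobius_upper.
have f1 z : H z -> cabs (f z) = 1.
  move=> Hz; have Htz := mobius_upper sta Hz; have Hsz := mobius_upper ss Hz.
  have j1 := cabs_jfac_gt0 sta Hz; have j2 := cabs_jfac_gt0 sg Htz.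
  have j3 := cabs_jfac_gt0 st Hsz; have j4 := cabs_jfac_gt0 ss Hz.
  rewrite /f !cabsM cabsV (cabs_nu anu)// !cabs_cpow ?jfac_neq0//.
  have E : cabs (jfac t (mobius s z)) * cabs (jfac s z) =
      cabs (jfac g (mobius tau z)) * cabs (jfac tau z).
    rewrite -!cabsM -!jfacM//.
    by rewrite /s !mulrA mulrV// mul1r.
  rewrite -mulrA -powRM ?cabs_ge0// E powRM ?cabs_ge0// powRN.
  have p1 : cabs (jfac tau z) `^ k != 0 by rewrite gt_eqF// powR_gt0.
  have p2 : cabs (jfac g (mobius tau z)) `^ k != 0 by rewrite gt_eqF// powR_gt0.
  by field; rewrite p1 p2.
have Hi : H 'i by rewrite /upper_half /= ltr01.
exists (f 'i); split; first exact: f1.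
move=> z Hz; have Htz := mobius_upper sta Hz; have Hgtz := mobius_upper sg Htz.
rewrite (holo_unimodular_cst hf f1 Hi Hz) /f /slash /tm /psi /pterm.
have -> : mobius t^-1 (mobius g (mobius tau z)) = mobius s z.
  by rewrite -(mobiusM sg sta Hz) -(mobiusM stV (SL2ZM sg sta) Hz) /s !mulrA.
rewrite cpowN (cpowN (jfac s z)) /phi -!mulrA; congr (_ * (_ * (_ * _))).
by rewrite mulrA mulfV ?mul1r// cpow_neq0.
Qed.

Lemma slash_ft tau : SL2Z tau -> exists (u : Row -> C) (s : Row -> M2), forall r, isrow r ->
  [/\ cabs (u r) = 1, SL2Z (s r), rowof (s r) = rmul r tau &
    forall z, H z -> slash k (ft r) tau z = u r * pterm (- k) A (s r) z].
Proof.
move=> sta; have /choice [u hu] : forall r, exists u : C, isrow r -> cabs u = 1 /\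
    forall z, H z -> slash k (ft r) tau z = u * pterm (- k) A (t^-1 * rep r * tau) z.
  move=> r; have [ir|nir] := pselect (isrow r); last by exists 0.
  have [Gr er] := repP ir; have [u [u1 hu]] := slash_tm sta Gr; exists u => _; split=> // z Hz.
  by rewrite -hu// /slash /ft asboolT.
exists u, (fun r => t^-1 * rep r * tau) => r ir; have [u1 h] := hu r ir.
have [Gr er] := repP ir; split => //; last by rewrite rowofM er.
by apply: SL2ZM => //; apply: SL2ZM => //; exact: gS.
Qed.

Lemma slash_ft0 tau r z : ~ isrow r -> slash k (ft r) tau z = 0.
Proof. by move=> nir; rewrite /slash /ft asboolF// mulr0. Qed.

Lemma cabs_pterm (p : R) (s : M2) z : SL2Z s -> H z ->
  cabs (pterm p A s z) = cabs (rowfac (rowof s) z) `^ p *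
    expR (- A * complex.Im z / cabs (rowfac (rowof s) z) ^+ 2).
Proof.
move=> ss Hz; rewrite /pterm cabsM cabs_cpow ?jfac_neq0// cabs_cexp ReM /= mul0r sub0r.
by rewrite Im_mobius// jfac_row; congr (_ * expR _); ring.
Qed.

Lemma cabs_slash_ft tau r z : SL2Z tau -> H z -> isrow r ->
  cabs (slash k (ft r) tau z) = cabs (rowfac (rmul r tau) z) `^ (- k) *
    expR (- A * complex.Im z / cabs (rowfac (rmul r tau) z) ^+ 2).
Proof.
move=> sta Hz ir; have [u [s /(_ r ir) [u1 ss rs ->//]]] := slash_ft sta.
by rewrite cabsM u1 mul1r cabs_pterm// rs.
Qed.

Lemma row0 tau r : SL2Z tau -> isrow r -> (rmul r tau).1 = 0 ->
  (rmul r tau == (0, 1)) || (rmul r tau == (0, -1)).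
Proof.
move=> sta [g [Gg er]]; rewrite -er -rowofM /= => c0.
have ss : SL2Z (t^-1 * g * tau) by apply: SL2ZM => //; apply: SL2ZM => //; exact: gS.
move: ss => /SL2ZE; rewrite c0 mulr0 subr0 => ad.
have := intUnitRing.unitzPl ad; rewrite qualifE /rowof c0 !xpair_eqE eqxx /=.
by [].
Qed.

(** The exponent p is free: p = k gives convergence, while p = k - 4 serves after four powers have
    been traded for the decay of the exponential in [poinc_le]. *)
Lemma sum_offcusp tau (s : seq Row) z (p c : R) : SL2Z tau -> H z -> 3 <= p -> 0 <= c -> uniq s ->
  (forall r, isrow r -> (rmul r tau).1 != 0 ->
    cabs (slash k (ft r) tau z) <= c * cabs (rowfac (rmul r tau) z) `^ (- p)) ->
  \sum_(r <- s | (rmul r tau).1 != 0) cabs (slash k (ft r) tau z) <=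
  c * (16 * complex.Im z `^ (- p) + 32 * complex.Im z `^ (1 - p)).
Proof.
move=> sta Hz p3 c0 us hb.
pose s' := [seq rmul r tau | r <- s & (rmul r tau).1 != 0].
have us' : uniq s' by rewrite map_inj_uniq ?filter_uniq//; exact: can_inj (rmulK sta).
have := row_sum Hz p3 us' => /(_ _); rewrite big_map big_filter => h.
apply: (@le_trans _ _ (\sum_(r <- s | (rmul r tau).1 != 0) c * cabs (rowfac (rmul r tau) z) `^ (- p))).
  apply: ler_sum => r r0; have [ir|nir] := pselect (isrow r); first exact: hb.
  by rewrite slash_ft0// cabs0 mulr_ge0// powR_ge0.
rewrite -mulr_sumr ler_wpM2l//; apply: h => r /mapP[r' ]; rewrite mem_filter.
by move=> /andP[r0 _] ->.
Qed.

Lemma sum_oncusp tau (s : seq Row) z : SL2Z tau -> H z -> uniq s ->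
  \sum_(r <- s | (rmul r tau).1 == 0) cabs (slash k (ft r) tau z) <=
  2 * expR (- A * complex.Im z).
Proof.
move=> sta Hz us; set e := expR _; have e0 : 0 <= e by rewrite expR_ge0.
have fb r : (rmul r tau).1 == 0 -> cabs (slash k (ft r) tau z) <=
    (if rmul r tau \in [:: (0, 1); (0, -1)] then e else 0).
  move=> /eqP r0; have [ir|nir] := pselect (isrow r); last first.
    by rewrite slash_ft0// cabs0; case: ifP.
  have := row0 sta ir r0; rewrite !inE => ->; rewrite cabs_slash_ft//.
  have -> : cabs (rowfac (rmul r tau) z) = 1.
    have := row0 sta ir r0; rewrite /rowfac => /orP[] /eqP ->; rewrite /= mul0r add0r ?cabs1//.
    by rewrite mulrN1z cabsN cabs1.
  by rewrite powR1 mul1r expr1n divr1.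
apply: (le_trans (ler_sum _ fb)).
apply: (@le_trans _ _ (\sum_(r <- s) (if rmul r tau \in [:: (0, 1); (0, -1)] then e else 0))).
  rewrite big_mkcond /=; apply: ler_sum => r _; case: ifP => // _; by case: ifP.
rewrite -big_mkcond /= -(big_map (rmul^~ tau) (mem [:: (0, 1); (0, -1)]) (fun=> e)).
rewrite -big_filter big_const_seq count_predT iter_addr_0 -[leLHS]mulr_natl ler_wpM2r// ler_nat.
have u' : uniq [seq i <- [seq rmul r tau | r <- s] | i \in [:: (0, 1); (0, -1)]].
  by rewrite filter_uniq// map_inj_uniq//; exact: can_inj (rmulK sta).
apply: (@uniq_leq_size _ _ [:: (0, 1); (0, -1)] u') => i.
by rewrite mem_filter => /andP[].
Qed.

(** The first summand bounds the at most two terms with c = 0, the others come from [row_sum]. It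
    depends on Im z alone, so the same bound serves at every cusp. *)
Definition fbound (y : R) : R :=
  2 * expR (- A * y) + (16 * y `^ (- k) + 32 * y `^ (1 - k)).

Lemma sum_bound tau (s : seq Row) z : SL2Z tau -> H z -> uniq s ->
  \sum_(r <- s) cabs (slash k (ft r) tau z) <= fbound (complex.Im z).
Proof.
move=> sta Hz us; rewrite (bigID (fun r => (rmul r tau).1 == 0)) /=; apply: lerD.
  exact: sum_oncusp.
rewrite -[leRHS]mul1r; apply: sum_offcusp => // r ir _.
rewrite mul1r cabs_slash_ft// ler_piMr ?powR_ge0// -expR0 ler_expR.
have y0 : 0 < complex.Im z by exact: Hz.
by rewrite !mulNr oppr_le0 divr_ge0 ?sqr_ge0// mulr_ge0// ?ltW// cuspA_gt0.
Qed.

Lemma fbound_mono y1 y2 : 0 < y1 -> y1 <= y2 -> fbound y2 <= fbound y1.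
Proof.
move=> y0 le; have y20 : 0 < y2 by exact: lt_le_trans le.
have [k1 k2 _ _] := ge3_facts k3.
have h1 := powR_le0_mono y0 le k1; have h2 := powR_le0_mono y0 le k2.
have h3 : expR (- A * y2) <= expR (- A * y1).
  by rewrite ler_expR !mulNr lerN2 ler_pM2l// cuspA_gt0.
by rewrite /fbound !lerD// ler_pM2l.
Qed.

Definition poinc (z : C) : C := xget 0 [set S | has_sum (fun r => ft r z) S].

Lemma poincP z : H z -> has_sum (fun r => ft r z) (poinc z).
Proof.
move=> Hz; suff [S hS] : exists S, has_sum (fun r => ft r z) S by exact: (@xgetPex _ 0 [set S | has_sum (fun r => ft r z) S] (ex_intro _ S hS)).
apply: (@summable_has_sum _ _ _ (fun r => cabs (ft r z)) (fbound (complex.Im z))) => //.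
  by move=> r; exact: cabs_ge0.
move=> s us; have := sum_bound SL2Z1 Hz us.
by under eq_bigr do rewrite slash1.
Qed.

Lemma slash_poinc tau z : SL2Z tau -> H z ->
  has_sum (fun r => slash k (ft r) tau z) (slash k poinc tau z).
Proof. by move=> sta Hz; apply: has_sumZ; apply: poincP; exact: mobius_upper. Qed.

Lemma poinc_mobius h z : G h -> H z -> poinc (mobius h z) = nu h z * poinc z.
Proof.
move=> Gh Hz; have sh := gS Gh.
have h1 := poincP (mobius_upper sh Hz).
apply: (has_sum_unique h1).
apply: (@eq_has_sum _ _ (fun r => nu h z * ft (rmul r h) z)) => [r|].
  by rewrite ft_mobius.
apply: has_sumZ; apply: (@has_sum_reindex _ _ (fun r => ft r z) _ (rmul^~ h) (rmul^~ h^-1)).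
- exact: rmulK.
- exact: rmulVK.
- exact: poincP.
Qed.

Lemma cabs_slash_poinc tau z : SL2Z tau -> H z ->
  cabs (slash k poinc tau z) <= fbound (complex.Im z).
Proof.
move=> sta Hz; apply: (has_sum_le (slash_poinc sta Hz)) => s us.
by apply: (le_trans (cabs_sum _ _ _)); exact: sum_bound.
Qed.

Lemma fbound_ge0 y : 0 <= fbound y.
Proof. by rewrite !addr_ge0// mulr_ge0// ?expR_ge0 ?powR_ge0. Qed.

(** The errors of [pterm_taylor] are multiples of the terms with common constants, so they add up to
    a multiple of the sum of the moduli, which [fbound] controls. The derivative is the sum of the
    termwise derivatives. *)
Lemma poinc_taylor tau (Y : R) : SL2Z tau -> 0 < Y -> exists K d : R, exists D : C -> C,
  [/\ 0 <= K, 0 < d, d <= 1 & forall z, Y <= complex.Im z ->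
   [/\ cabs (slash k poinc tau z) <= K, cabs (D z) <= K &
     forall h, cabs h <= d -> cabs (slash k poinc tau (z + h) - slash k poinc tau z - D z * h)
       <= K * cabs h ^+ 2]].
Proof.
(* [pterm_taylor] asks for a height at most 1. *)
move=> sta Y0; pose Z := Num.min Y 1.
have Z0 : 0 < Z by rewrite lt_min Y0 ltr01.
have Z1 : 0 < Z <= 1 by rewrite Z0 ge_min lexx orbT.
have ZY : Z <= Y by rewrite ge_min lexx.
have [K [d [K0 d0 hK]]] := pterm_taylor (- k) A Z1.
have [u [s hs]] := slash_ft sta.
have /choice [D hD] : forall r, exists D : C -> C, isrow r -> forall z, Z <= complex.Im z ->
    cabs (D z) <= K /\ forall h, cabs h <= d ->
    cabs (pterm (- k) A (s r) (z + h) - pterm (- k) A (s r) z - pterm (- k) A (s r) z * D z * h)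
      <= K * cabs (pterm (- k) A (s r) z) * cabs h ^+ 2.
  move=> r; have [ir|nir] := pselect (isrow r); last by exists (fun=> 0).
  by have [_ ss _ _] := hs r ir; have [D hD] := hK _ ss; exists D.
pose Dt r z : C := if `[< isrow r >] then slash k (ft r) tau z * D r z else 0.
have Dtb r z : Z <= complex.Im z -> cabs (Dt r z) <= K * cabs (slash k (ft r) tau z).
  move=> Zz; rewrite /Dt; case: asboolP => ir; last by rewrite cabs0 mulr_ge0 ?cabs_ge0.
  have [dK _] := hD r ir z Zz; rewrite cabsM mulrC.
  by rewrite ler_wpM2r// cabs_ge0.
have HZ z : Z <= complex.Im z -> H z by move=> Zz; exact: lt_le_trans Zz.
pose B := fbound Z.
have bB z s' : Z <= complex.Im z -> uniq s' ->
    \sum_(r <- s') cabs (slash k (ft r) tau z) <= B.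
  move=> Zz us; apply: (le_trans (sum_bound sta (HZ _ Zz) us)); exact: fbound_mono.
pose DD z : C := xget 0 [set S | has_sum (fun r => Dt r z) S].
have DDP z : Z <= complex.Im z -> has_sum (fun r => Dt r z) (DD z).
  move=> Zz; suff [S hS] : exists S, has_sum (fun r => Dt r z) S by exact: (@xgetPex _ 0 [set S | has_sum (fun r => Dt r z) S] (ex_intro _ S hS)).
  apply: (@summable_has_sum _ _ _ (fun r => K * cabs (slash k (ft r) tau z)) (K * B)).
  - by move=> r; rewrite mulr_ge0 ?cabs_ge0.
  - by move=> s' us; rewrite -mulr_sumr ler_wpM2l// bB.
  - by move=> r; exact: Dtb.
have B0 : 0 <= B by exact: fbound_ge0.
exists (K * B + B), (Num.min d (Num.min 1 (Y / 2))), DD; split.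
- by rewrite addr_ge0// mulr_ge0.
- by rewrite !lt_min d0 ltr01 divr_gt0.
- by rewrite !ge_min lexx orbT.
move=> z Yz; have Zz : Z <= complex.Im z by exact: le_trans Yz.
split.
- apply: (@le_trans _ _ B); last by rewrite lerDr mulr_ge0.
  apply: (has_sum_le (slash_poinc sta (HZ _ Zz))) => s' us.
  by apply: (le_trans (cabs_sum _ _ _)); exact: bB.
- apply: (@le_trans _ _ (K * B)); last by rewrite lerDl.
  apply: (has_sum_le (DDP _ Zz)) => s' us.
  apply: (le_trans (cabs_sum _ _ _)).
  apply: (@le_trans _ _ (\sum_(r <- s') K * cabs (slash k (ft r) tau z))).
    by apply: ler_sum => r _; exact: Dtb.
  by rewrite -mulr_sumr ler_wpM2l// bB.
move=> h; rewrite !le_min => /and3P[hd h1 hY].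
have Hzh : H (z + h).
  have : 0 < complex.Im z + complex.Im h.
    by have := le_trans (Im_le_cabs h) hY; rewrite ler_norml => /andP[]; lra.
  by rewrite -ImD.
have S := has_sumD (has_sumD (slash_poinc sta Hzh) (has_sumZ (-1) (slash_poinc sta (HZ _ Zz))))
  (has_sumZ (- h) (DDP _ Zz)).
have -> : slash k poinc tau (z + h) - slash k poinc tau z - DD z * h =
  slash k poinc tau (z + h) + -1 * slash k poinc tau z + - h * DD z by ring.
apply: (has_sum_le S) => s' us; apply: (le_trans (cabs_sum _ _ _)).
apply: (@le_trans _ _ (\sum_(r <- s') (K * cabs h ^+ 2) * cabs (slash k (ft r) tau z))).
  apply: ler_sum => r _; have [ir|nir] := pselect (isrow r); last first.
    by rewrite !slash_ft0// /Dt asboolF// !mulr0 !addr0 !cabs0 mulr0.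
  have [_ /(_ _ hd) hT] := hD r ir z Zz; have [u1 ss _ E] := hs r ir.
  rewrite /Dt asboolT// !E//; last exact: HZ.
  have -> : u r * pterm (- k) A (s r) (z + h) + -1 * (u r * pterm (- k) A (s r) z) +
      - h * (u r * pterm (- k) A (s r) z * D r z) = u r * (pterm (- k) A (s r) (z + h) -
      pterm (- k) A (s r) z - pterm (- k) A (s r) z * D r z * h) by ring.
  rewrite [leLHS]cabsM [cabs (u r * pterm _ _ _ _)]cabsM u1 !mul1r; apply: (le_trans hT).
  by rewrite [leLHS]mulrAC.
rewrite -mulr_sumr mulrAC; apply: ler_wpM2r; first exact: sqr_ge0.
apply: (@le_trans _ _ (K * B)); last by rewrite lerDl.
by rewrite ler_wpM2l// bB.
Qed.

Lemma poinc_decay tau (e : R) : SL2Z tau -> 0 < e -> exists Y : R, forall z, Y <= complex.Im z ->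
  cabs (slash k poinc tau z) <= e.
Proof.
move=> sta e0; have [Y [Y1 hY]] := bound_small cuspA_gt0 k3 e0.
exists Y => z Yz; have y0 : 0 < complex.Im z by lra.
exact: le_trans (cabs_slash_poinc sta (y0 : H z)) (hY _ Yz).
Qed.

Lemma poinc_cusp_form : cusp_form G k nu poinc.
Proof.
split.
- move=> z Hz; have [K [d [D [K0 d0 d1 /(_ z (lexx _)) [_ _ h]]]]] := poinc_taylor SL2Z1 Hz.
  apply: (@taylor_derivable _ _ _ (D z) K d) => // w hw'; have := h w hw'.
  by rewrite !slash1.
- by move=> g z Gg Hz; exact: poinc_mobius.
move=> tau sta; have nt0 := cusp_width_gt0 sG fG GN1 sta.
have [kap01 hk] := cusp_paramP sG fG GN1 anu sta.
have Gd := width_conj sG fG GN1 sta.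
(* The translation by the width is conjugated by tau into G; automorphy gives quasi-periodicity,
   with the constant that defines the cusp parameter. *)
have per z : H z -> slash k poinc tau (z + (cusp_width G tau)%:R%:C) =
    cexp (0 +i* (2 * pi * cusp_param G k nu tau)) * slash k poinc tau z.
  move=> Hz; rewrite (hk z Hz) UmxE.
  move: Gd; generalize (cusp_width G tau) => m Gd; have sU := SL2Z_Um m.
  have Htz := mobius_upper sta Hz.
  have E : mobius (Um m) z = z + m%:R%:C by rewrite mobius_Um -pmulrn natrCE.
  have E2 : mobius tau (z + m%:R%:C) = mobius (tau * Um m * tau^-1) (mobius tau z).
    rewrite -E -!mobiusM//; last exact: gS.
    by rewrite mulrVK// SL2Z_unit.
  rewrite /slash E2 poinc_mobius// /conj_factor E !cpowN.
  set x := cpow _ _; set y := cpow (jfac tau z) k; set N := nu _ _.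
  have y0 : y != 0 by exact: cpow_neq0.
  rewrite -!mulrA [y * _]mulrCA [y * _]mulrA mulfV// mul1r.
  by rewrite mulrCA.
have tay Y1 Y2 : 0 < Y1 -> Y1 <= Y2 -> taylor_on Y1 Y2 (slash k poinc tau).
  move=> Y10 _; have [K [d [D [K0 d0 d1 h]]]] := poinc_taylor sta Y10.
  by exists K, d, D; split => // z /andP[z1 _]; exact: h.
have [a ha] := fourier_expansion nt0 kap01 per tay (fun e => poinc_decay sta).
by exists a => z Hz; exact: ha.
Qed.

End Poincare.

(** * The norm of the Poincare series *)

Section Integrals.
Variable R : realType.
Local Notation mu := (@lebesgue_measure R).
Local Notation RM := (measurableTypeR R).

Lemma measurable_bump (a c : R) :
  measurable_fun [set: RM] (fun x : R => ((1 + (c * x + a) ^+ 2)^-1)%:E).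
Proof.
apply/measurable_EFinP; apply: (measurableT_comp (@measurable_invR R)).
apply: measurable_funD => //; apply: measurable_funX.
by apply: measurable_funD => //; exact: mulrl_measurable.
Qed.

Lemma bump_ge0 (x : R) : 0 <= (1 + x ^+ 2)^-1.
Proof. by rewrite invr_ge0 addr_ge0 ?sqr_ge0. Qed.

Lemma integral_oneDsqr : (\int[mu]_x ((1 + x ^+ 2)^-1)%:E <= 4%:R%:E)%E.
Proof.
pose h (x : R) : \bar R := (if 0 <= x then (1 + x ^+ 2)^-1 else 0)%:E.
have mh : measurable_fun [set: RM] h.
  apply/measurable_EFinP; apply: measurable_fun_ifT => //.
    exact: measurable_fun_ler.
  by have := measurable_bump 0 1 => /measurable_EFinP; under eq_fun do rewrite mul1r addr0.
have h0 x : (0 <= h x)%E by rewrite lee_fin; case: ifP => // _; exact: bump_ge0.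
have Ih : (\int[mu]_x h x = (pi / 2)%:E)%E.
  rewrite -integral0y_oneDsqr [RHS]integral_mkcond; apply: eq_integral => x _.
  rewrite patchE /h; case: ifPn => [x0|x0].
    by rewrite mem_set//= in_itv /= andbT.
  by rewrite memNset//= in_itv /= andbT; exact/negP.
have N1 : -1 != 0 :> R by rewrite oppr_eq0 oner_eq0.
have := integral_affine 0 N1 mh h0; rewrite normrN1 invr1 mul1e => In.
apply: (@le_trans _ _ (\int[mu]_x (h x + h (-1 * x + 0)%R))%E).
  apply: ge0_le_integral => //.
  - by move=> x _; rewrite lee_fin bump_ge0.
  - by have := measurable_bump 0 1; under eq_fun do rewrite mul1r addr0.
  - apply: emeasurable_funD => //; apply: (measurableT_comp mh).
    by apply: measurable_funD => //; exact: mulrl_measurable.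
  move=> x _; rewrite addr0 mulN1r /h -EFinD lee_fin sqrrN.
  have := bump_ge0 x; rewrite oppr_ge0; case: (leP 0 x) => x0 b0.
    by rewrite lerDl; case: ifP.
  by rewrite (ltW x0) add0r.
rewrite ge0_integralD//; last first.
  apply: (measurableT_comp mh); apply: measurable_funD => //; exact: mulrl_measurable.
rewrite In Ih -EFinD lee_fin; have := pihalf_lt2 R; lra.
Qed.

Lemma integral_bump (a c : R) : 0 < c ->
  (\int[mu]_x ((1 + (c * x + a) ^+ 2)^-1)%:E <= (4 / c)%:E)%E.
Proof.
move=> c0; pose f (x : R) : \bar R := ((1 + x ^+ 2)^-1)%:E.
have mf : measurable_fun [set: RM] f.
  by have := measurable_bump 0 1; under eq_fun do rewrite mul1r addr0.
have f0 x : (0 <= f x)%E by rewrite lee_fin bump_ge0.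
have -> : (\int[mu]_x ((1 + (c * x + a) ^+ 2)^-1)%:E = \int[mu]_x f (c * x + a)%R)%E by [].
rewrite (integral_affine a (lt0r_neq0 c0) mf f0) gtr0_norm// mulrC EFinM.
by apply: lee_wpmul2l; [rewrite lee_fin invr_ge0 ltW|exact: integral_oneDsqr].
Qed.

Lemma le_integral_bump (f : R -> R) (a c K : R) : 0 < c -> 0 <= K ->
  measurable_fun [set: RM] f -> (forall x, 0 <= f x) ->
  (forall x, f x <= K * (1 + (c * x + a) ^+ 2)^-1) ->
  (\int[mu]_x (f x)%:E <= (K * (4 / c))%:E)%E.
Proof.
move=> c0 K0 mf f0 fle.
apply: (@le_trans _ _ (\int[mu]_x (K%:E * ((1 + (c * x + a) ^+ 2)^-1)%:E))%E).
  apply: ge0_le_integral => //.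
  - by move=> x _; rewrite lee_fin.
  - exact/measurable_EFinP.
  - by apply: emeasurable_funM => //; exact: measurable_bump.
  - by move=> x _; rewrite -EFinM lee_fin.
rewrite ge0_integralZl//; last 2 first.
- exact: measurable_bump.
- by move=> x _; rewrite lee_fin bump_ge0.
by rewrite EFinM; apply: lee_wpmul2l; [rewrite lee_fin|exact: integral_bump].
Qed.

(** From ln x <= x - 1, used at (1 + p u) / (1 + u) and, multiplied by p - 1, at 1 / (1 + u): the
    rational parts cancel. *)
Lemma bernoulli (u p : R) : 0 <= u -> 1 <= p -> 1 + p * u <= (1 + u) `^ p.
Proof.
move=> u0 p1; have p0 : 0 < p by lra.
have m0 : 0 < 1 + u by lra.
have y0 : 0 < 1 + p * u by have := mulr_ge0 (ltW p0) u0; lra.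
rewrite powR_expR_ln// -[leLHS]lnK ?posrE// ler_expR.
have lnle (x : R) : 0 < x -> ln x <= x - 1.
  move=> x0; rewrite -[leRHS]expRK ler_ln ?posrE ?expR_gt0//.
  by have := expR_ge1Dx (x - 1); rewrite addrCA subrr addr0.
have l1 : ln (1 + p * u) <= ln (1 + u) + ((1 + p * u) / (1 + u) - 1).
  rewrite -lerBlDl -ln_div ?posrE//; apply: lnle; exact: divr_gt0.
have l2 : 0 <= ln (1 + u) + ((1 + u)^-1 - 1).
  have := lnle (1 + u)^-1; rewrite invr_gt0 m0 => /(_ isT); rewrite lnV ?posrE//; lra.
have e : (1 + p * u) / (1 + u) - 1 + (p - 1) * ((1 + u)^-1 - 1) = 0.
  by field; rewrite gt_eqF.
have := mulr_ge0 (_ : 0 <= p - 1) l2; rewrite subr_ge0 => /(_ p1); rewrite mulrDr.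
move: l1 e; set a := _ / _ - 1; set b := (p - 1) * (_ - 1); set L := ln (1 + u).
rewrite mulrBl mul1r; lra.
Qed.

(** The fraction is u = (3 + q^4) / (4 q) - 1, factored to show its double zero at q = 1. In the
    expansion of the fourth power, 4 p u suffices for q <= 2 and 4 (p u)^3 for q > 2; in the second
    range q^9 / 1024 must exceed q^8 / 512, which fixes the constant 512. *)
Lemma bump_poly (q p : R) : 0 < q -> 1 <= p ->
  1 + p * (q ^+ 4 - 1) ^+ 2 / 512 <= (1 + p * ((q - 1) ^+ 2 * (q ^+ 2 + 2 * q + 3) / (4 * q))) ^+ 4.
Proof.
move=> q0 p1; have p0 : 0 < p by lra.
set u := (q - 1) ^+ 2 * _ / _.
have n0 : 0 <= (q - 1) ^+ 2 * (q ^+ 2 + 2 * q + 3).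
  by rewrite mulr_ge0 ?sqr_ge0// !addr_ge0 ?sqr_ge0// mulr_ge0// ltW.
have u0 : 0 <= u by rewrite divr_ge0// mulr_ge0// ltW.
have pu0 : 0 <= p * u by rewrite mulr_ge0// ltW.
have ex : 1 + 4 * (p * u) + 4 * (p * u) ^+ 3 <= (1 + p * u) ^+ 4.
  have -> : (1 + p * u) ^+ 4 = 1 + 4 * (p * u) + 4 * (p * u) ^+ 3 +
    (6 * (p * u) ^+ 2 + (p * u) ^+ 4) by ring.
  by rewrite lerDl addr_ge0 ?exprn_ge0// mulr_ge0// exprn_ge0.
apply: le_trans ex; have pu3 : 0 <= 4 * (p * u) ^+ 3 by rewrite mulr_ge0// exprn_ge0.
rewrite -addrA lerD2l; have [q2|q2] := lerP q 2.
  apply: (@le_trans _ _ (4 * (p * u))); last by rewrite lerDl.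
  have f : (q ^+ 4 - 1) ^+ 2 = (q - 1) ^+ 2 * ((q + 1) ^+ 2 * (q ^+ 2 + 1) ^+ 2) by ring.
  have b1 : (q + 1) ^+ 2 * (q ^+ 2 + 1) ^+ 2 <= 9 * 25.
    apply: ler_pM; rewrite ?sqr_ge0//.
      have -> : 9 = 3 ^+ 2 :> R by ring.
      by rewrite ler_sqr ?nnegrE; lra.
    have -> : 25 = 5 ^+ 2 :> R by ring.
    by rewrite ler_sqr ?nnegrE; nra.
  have b2 : q <= q ^+ 2 + 2 * q + 3 by have := sqr_ge0 q; lra.
  have uE : (q - 1) ^+ 2 <= 4 * u.
    have -> : 4 * u = (q - 1) ^+ 2 * ((q ^+ 2 + 2 * q + 3) / q) by rewrite /u; field; rewrite gt_eqF.
    by rewrite ler_peMr ?sqr_ge0// ler_pdivlMr// mul1r.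
  rewrite f -mulrA [leRHS]mulrCA ler_pM2l//.
  have := ler_wpM2l (sqr_ge0 (q - 1)) b1; lra.
apply: (@le_trans _ _ (4 * (p * u) ^+ 3)); last by rewrite lerDr mulr_ge0.
have uq : q ^+ 3 / 16 <= u.
  have h1 : q ^+ 2 / 4 <= (q - 1) ^+ 2.
    have -> : q ^+ 2 / 4 = (q / 2) ^+ 2 by field.
    by rewrite ler_sqr ?nnegrE; lra.
  have h2 : q ^+ 2 <= q ^+ 2 + 2 * q + 3 by lra.
  have q20 : 0 <= q ^+ 2 by exact: sqr_ge0.
  rewrite /u ler_pdivlMr ?mulr_gt0//.
  have -> : q ^+ 3 / 16 * (4 * q) = (q ^+ 2 / 4) * q ^+ 2 by field.
  by apply: ler_pM => //; rewrite divr_ge0.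
have q30 : 0 <= q ^+ 3 / 16 by rewrite divr_ge0// exprn_ge0// ltW.
have u3 : (q ^+ 3 / 16) ^+ 3 <= u ^+ 3 by rewrite lerXn2r ?nnegrE.
have p3 : p <= p ^+ 3 by rewrite -[leLHS]expr1 ler_weXn2l.
have a1 : 1 <= q ^+ 4 by rewrite exprn_ege1//; lra.
have a2 : (q ^+ 4 - 1) ^+ 2 <= q ^+ 8.
  have -> : q ^+ 8 = (q ^+ 4) ^+ 2 by ring.
  by rewrite ler_sqr ?nnegrE; lra.
have a3 : 2 * q ^+ 8 <= 16 ^+ 3 * (q ^+ 3 / 16) ^+ 3.
  have -> : 16 ^+ 3 * (q ^+ 3 / 16) ^+ 3 = q * q ^+ 8 by field.
  by rewrite ler_wpM2r ?exprn_ge0//; lra.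
apply: (@le_trans _ _ (p * (4 * (q ^+ 3 / 16) ^+ 3))).
  rewrite -mulrA ler_pM2l//; lra.
rewrite [leRHS](_ : _ = p ^+ 3 * (4 * u ^+ 3)); last by rewrite exprMn; ring.
by apply: ler_pM; [exact: ltW|rewrite mulr_ge0// exprn_ge0|exact: p3|rewrite ler_pM2l].
Qed.

End Integrals.

(** * Laplace's method and numerical estimates *)

Section Stirling.
Variable R : realType.
Local Notation mu := (@lebesgue_measure R).
Local Notation RM := (measurableTypeR R).

(** The constant 1 / 512 of [bump_poly], kept abstract. *)
Variable w : R.
Hypotheses (w0 : 0 < w) (wE : w = 512^-1).

Lemma powR_expn (q p : R) (m : nat) : 0 <= q -> (q `^ p) ^+ m = (q ^+ m) `^ p.
Proof.
move=> q0; elim: m => [|m ih]; first by rewrite !expr0 powR1.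
by rewrite !exprS powRM ?exprn_ge0// ih.
Qed.

(* With s = q^4: e^((s-1)/4) >= (3+s)/4 = q (1+u), so s e^(1-s) <= (1+u)^-4. *)
Lemma powexp_bump (p s : R) : 1 <= p -> 0 < s ->
  s `^ p * (1 + p * (s - 1) ^+ 2 * w) <= expR (p * (s - 1)).
Proof.
move=> p1 s0; pose q := Num.sqrt (Num.sqrt s).
have q0 : 0 < q by rewrite !sqrtr_gt0.
have qs : q ^+ 4 = s.
  have -> : q ^+ 4 = (q ^+ 2) ^+ 2 by ring.
  by rewrite !sqr_sqrtr ?sqrtr_ge0// ltW.
pose u := (q - 1) ^+ 2 * (q ^+ 2 + 2 * q + 3) / (4 * q).
have u0 : 0 <= u.
  apply: divr_ge0; last by rewrite mulr_ge0// ltW.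
  apply: mulr_ge0; first exact: sqr_ge0.
  by rewrite !addr_ge0 ?sqr_ge0// mulr_ge0// ltW.
have e1 : q * (1 + u) <= expR ((s - 1) / 4).
  have -> : q * (1 + u) = 1 + (s - 1) / 4 by rewrite -qs /u; field; rewrite gt_eqF.
  exact: expR_ge1Dx.
have -> : expR (p * (s - 1)) = (expR ((s - 1) / 4) `^ p) ^+ 4.
  by rewrite -expRM -expRM_natl; congr expR; field.
have qu0 : 0 <= q * (1 + u) by rewrite mulr_ge0 ?(ltW q0)//; lra.
apply: (@le_trans _ _ (((q * (1 + u)) `^ p) ^+ 4)); last first.
  rewrite lerXn2r ?nnegrE ?powR_ge0//.
  by rewrite ge0_ler_powR ?nnegrE ?expR_ge0//; lra.
rewrite powRM ?(ltW q0) ?addr_ge0// exprMn powR_expn ?(ltW q0)// qs.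
rewrite ler_pM2l ?powR_gt0//; have := bump_poly q0 p1; rewrite -/u qs -wE => h.
apply: (le_trans h); rewrite lerXn2r ?nnegrE ?powR_ge0//.
  by apply: addr_ge0 => //; apply: mulr_ge0 => //; lra.
exact: bernoulli.
Qed.

Definition onpos (f : R -> R) (v : R) : R := if 0 < v then f v else 0.

Lemma measurable_onpos f : measurable_fun [set: RM] f -> measurable_fun [set: RM] (onpos f).
Proof. by move=> mf; apply: measurable_fun_ifT => //; exact: measurable_fun_ltr. Qed.

Lemma measurable_expRM (b : R) : measurable_fun [set: RM] (fun v : R => expR (b * v)).
Proof. by apply: (measurableT_comp (@measurable_expR R)); exact: mulrl_measurable. Qed.

(** An upper bound of Stirling type for Gamma(p + 1) / B^(p + 1). The integrand is at most its
    maximum, at y = p / B, times a Cauchy density profile of relative width of order 1 / sqrt p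
    around y. *)
Lemma integral_powexp (p B : R) : 1 <= p -> 0 < B ->
  (\int[mu]_v (onpos (fun v => v `^ p * expR (- B * v)) v)%:E <=
   ((p / B) `^ p * expR (- p) * (4 / (Num.sqrt (p * w) / (p / B))))%:E)%E.
Proof.
move=> p1 B0; have p0 : 0 < p by lra.
set y := p / B; set c := Num.sqrt (p * w); have y0 : 0 < y by rewrite divr_gt0.
have c0 : 0 < c by rewrite sqrtr_gt0 mulr_gt0.
apply: (@le_integral_bump _ _ (- c) (c / y)).
- exact: divr_gt0.
- by rewrite mulr_ge0 ?powR_ge0 ?expR_ge0.
- apply: measurable_onpos; apply: measurable_funM; last exact: measurable_expRM.
  exact: measurable_powR.
- by move=> v; rewrite /onpos; case: ifP => // _; rewrite mulr_ge0 ?powR_ge0 ?expR_ge0.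
move=> v; rewrite /onpos; case: ifP => v0; last first.
  by rewrite mulr_ge0 ?mulr_ge0 ?powR_ge0 ?expR_ge0// bump_ge0.
pose s := v / y; have s0 : 0 < s by rewrite divr_gt0.
have vE : v = y * s by rewrite /s mulrCA divff ?mulr1// gt_eqF.
have -> : (c / y * v - c) ^+ 2 = p * (s - 1) ^+ 2 * w.
  have -> : c / y * v - c = c * (s - 1) by rewrite /s; ring.
  rewrite exprMn sqr_sqrtr; last by apply: mulr_ge0; exact: ltW.
  by ring.
have q0 : 0 < 1 + p * (s - 1) ^+ 2 * w.
  rewrite ltr_pwDl//; apply: mulr_ge0; last exact: ltW.
  by apply: mulr_ge0; [exact: ltW|exact: sqr_ge0].
rewrite ler_pdivlMr// vE powRM ?(ltW y0) ?(ltW s0)//.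
have -> : - B * (y * s) = - p + - (p * (s - 1)) by rewrite /y; field; rewrite gt_eqF.
rewrite expRD [expR (- (p * _))]expRN.
have h := powexp_bump p1 s0; set E := expR (p * (s - 1)) in h *.
have E0 : 0 < E by rewrite expR_gt0.
have -> : y `^ p * s `^ p * (expR (- p) / E) * (1 + p * (s - 1) ^+ 2 * w) =
  y `^ p * expR (- p) * (s `^ p * (1 + p * (s - 1) ^+ 2 * w) / E) by ring.
rewrite ler_piMr ?mulr_ge0 ?powR_ge0 ?expR_ge0//.
by rewrite ler_pdivrMr// mul1r.
Qed.

Lemma integral_exp_lin (A : R) : 0 < A ->
  (\int[mu]_v (onpos (fun v => (16 + 32 * v) * expR (- A * v)) v)%:E <=
   ((32 + 224 / A) * (4 / A))%:E)%E.
Proof.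
move=> A0; have c0 : 0 <= 32 + 224 / A.
  by have := divr_gt0 (ltr01 : 0 < 1 :> R) A0; rewrite mul1r; lra.
apply: (@le_integral_bump _ _ 0 A) => //.
- apply: measurable_onpos; apply: measurable_funM; last exact: measurable_expRM.
  by apply: measurable_funD => //; exact: mulrl_measurable.
- move=> v; rewrite /onpos; case: ifP => // v0.
  by rewrite mulr_ge0 ?expR_ge0// addr_ge0// mulr_ge0// ltW.
move=> v; rewrite /onpos addr0; case: ifP => v0; last first.
  by apply: mulr_ge0; [exact: c0|exact: bump_ge0].
pose x := A * v; have x0 : 0 < x by rewrite mulr_gt0.
have vE : v = x / A by rewrite /x mulrC mulKf// gt_eqF.
rewrite -/x mulNr -/x expRN ler_pdivrMr ?expR_gt0//.
have q0 : 0 < 1 + x ^+ 2 by have := sqr_ge0 x; lra.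
rewrite mulrAC ler_pdivlMr//.
have e1 := expR_ge1Dx x.
have := @expR_ge1Dxn R x 1 (ltW x0); have := @expR_ge1Dxn R x 2 (ltW x0).
rewrite [2`!%:R](_ : _ = 2)// [3`!%:R](_ : _ = 6)// => e3 e2.
have {}e2 : 1 + x ^+ 2 <= 2 * expR x.
  lra.
have {}e3 : x * (1 + x ^+ 2) <= 7 * expR x.
  have -> : x * (1 + x ^+ 2) = x + x ^+ 3 by ring.
  lra.
have -> : (16 + 32 * v) * (1 + x ^+ 2) = 16 * (1 + x ^+ 2) + 32 / A * (x * (1 + x ^+ 2)).
  by rewrite {1}vE; field; rewrite gt_eqF.
have -> : (32 + 224 / A) * expR x = 16 * (2 * expR x) + 32 / A * (7 * expR x).
  by field; rewrite gt_eqF.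
by apply: lerD; rewrite ler_pM2l// divr_gt0.
Qed.

Lemma expR4_ge5 : 5 <= expR 4 :> R.
Proof. by have := expR_ge1Dx (4 : R); lra. Qed.

Lemma powR_ge_expR4 (y m : R) : expR 4 <= y -> 0 <= m -> expR (4 * m) <= y `^ m.
Proof.
move=> h m0; rewrite expRM ge0_ler_powR ?nnegrE ?expR_ge0//.
by apply: le_trans h; exact: expR_ge0.
Qed.

(** The rows with c <> 0 are compared with the main term, which is exp(-k / 2) at the height where A
    y = k / 2; for y >= exp 4 their powers of y are smaller. *)
Lemma poinc_lower (k y : R) : 80 <= k -> expR 4 <= y ->
  16 * y `^ (- k) + 32 * y `^ (1 - k) <= expR (- k / 2).
Proof.
move=> k80 hy; have e5 := expR4_ge5; have y0 : 0 < y by lra.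
have y1 : 1 <= y by lra.
apply: (@le_trans _ _ (48 * y `^ (1 - k))).
  have : y `^ (- k) <= y `^ (1 - k) by apply: ler_powR => //; lra.
  lra.
have -> : 1 - k = - (k - 1) by ring.
rewrite powRN; have h : expR (4 * (k - 1)) <= y `^ (k - 1) by apply: powR_ge_expR4 => //; lra.
apply: (@le_trans _ _ (48 * expR (- (4 * (k - 1))))).
  by rewrite ler_pM2l// expRN lef_pV2 ?posrE ?expR_gt0 ?powR_gt0.
have -> : - (4 * (k - 1)) = - k / 2 + - (7 / 2 * k - 4) by field.
rewrite expRD [leRHS](_ : _ = 1 * expR (- k / 2)) ?mul1r// mulrCA.
rewrite ler_piMr ?expR_ge0// expRN ler_pdivrMr ?expR_gt0// mul1r.
by have := expR_ge1Dx (7 / 2 * k - 4); lra.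
Qed.

(** The first summand has the order y^(k-1) exp(-k) / sqrt k by Laplace's method. The second grows
    only like y^4 and is dominated because y >= exp 4. The constant 60 * 60 exceeds 2 * 1280 + 1. *)
Lemma poinc_norm_numeric (k y A : R) : 80 <= k -> 0 < A -> expR 4 <= y -> A = k / (2 * y) ->
  2 * (((k - 2) / (2 * A)) `^ (k - 2) * expR (- (k - 2)) *
       (4 / (Num.sqrt ((k - 2) * w) / ((k - 2) / (2 * A))))) +
  A ^- 2 * ((32 + 224 / A) * (4 / A)) <=
  60 * 60 * (y `^ (k - 1) * expR (- k) / Num.sqrt k).
Proof.
move=> k80 A0 hy AE; have e5 := expR4_ge5; have y0 : 0 < y by lra.
have k0 : 0 < k by lra.
pose p := k - 2; have p0 : 0 < p by rewrite /p; lra.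
pose q := Num.sqrt k; have q0 : 0 < q by rewrite sqrtr_gt0.
pose y1 := p / (2 * A); have y10 : 0 < y1 by rewrite divr_gt0// mulr_gt0.
have yy : y1 <= y.
  have -> : y = k / (2 * A) by rewrite AE; field; rewrite !gt_eqF.
  by rewrite /y1 ler_pM2r ?invr_gt0 ?mulr_gt0// /p; lra.
pose T := y `^ (k - 1) * expR (- k) / q.
have T0 : 0 <= T by rewrite !mulr_ge0 ?powR_ge0 ?expR_ge0// invr_ge0 ltW.
have main : y1 `^ p * expR (- p) * (4 / (Num.sqrt (p * w) / y1)) <= 1280 * T.
  pose c := Num.sqrt (p * w); have c0 : 0 < c by rewrite sqrtr_gt0 mulr_gt0.
  have cq : q / 32 <= c.
    have k1 : (q / 32) ^+ 2 <= p * w.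
      rewrite exprMn sqr_sqrtr ?(ltW k0)// wE exprVn /p.
      rewrite ler_pdivlMr; last lra.
      rewrite mulrAC ler_pdivrMr; last lra.
      lra.
    rewrite /c -[leLHS]ger0_norm; last by apply: divr_ge0; [exact: ltW|lra].
    by rewrite -sqrtr_sqr ler_wsqrtr.
  have -> : y1 `^ p * expR (- p) * (4 / (c / y1)) = (y1 `^ p * y1) * expR (- p) * (4 / c).
    by field; rewrite !gt_eqF.
  have yp : y1 `^ p * y1 <= y `^ (k - 1).
    have -> : k - 1 = p + 1 by rewrite /p; ring.
    rewrite -[X in _ * X](powRr1 (ltW y10)) -powRD ?(gt_eqF y10) ?implybT//.
    by rewrite ge0_ler_powR ?nnegrE ?(ltW y10) ?(ltW y0)//; lra.
  have ep : expR (- p) <= 10 * expR (- k).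
    have -> : - p = 2 - k by rewrite /p; ring.
    rewrite expRD ler_pM2r ?expR_gt0//.
    have := expRN2_ge R; rewrite expRN -[leLHS]invrK lef_pV2 ?posrE ?invr_gt0 ?expR_gt0//.
    by rewrite div1r invrK.
  have cp : 4 / c <= 128 / q.
    rewrite ler_pdivrMr// mulrAC ler_pdivlMr//; lra.
  have -> : 1280 * T = y `^ (k - 1) * (10 * expR (- k)) * (128 / q) by rewrite /T; ring.
  have y1p : 0 <= y1 `^ p * y1 by apply: mulr_ge0; [exact: powR_ge0|exact: ltW].
  apply: ler_pM => //; first by apply: mulr_ge0 => //; exact: expR_ge0.
    by rewrite divr_ge0// ltW.
  by apply: ler_pM => //; exact: expR_ge0.
have cross : A ^- 2 * ((32 + 224 / A) * (4 / A)) <= T.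
  apply: (@le_trans _ _ (y ^+ 4)).
    have -> : A ^- 2 * ((32 + 224 / A) * (4 / A)) =
        (1024 / k ^+ 3) * y ^+ 3 + (14336 / k ^+ 4) * y ^+ 4.
      by rewrite AE; field; rewrite !gt_eqF.
    have k2 : 80 * k <= k ^+ 2 by rewrite expr2 ler_wpM2r// ltW.
    have k3 : 80 * k ^+ 2 <= k ^+ 3 by rewrite [k ^+ 3]exprS ler_wpM2r ?sqr_ge0.
    have k4 : 80 * k ^+ 3 <= k ^+ 4 by rewrite [k ^+ 4]exprS ler_wpM2r// exprn_ge0// ltW.
    have a1 : 1024 / k ^+ 3 <= 1 / 2 by rewrite ler_pdivrMr ?exprn_gt0//; lra.
    have a2 : 14336 / k ^+ 4 <= 1 / 2 by rewrite ler_pdivrMr ?exprn_gt0//; lra.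
    have y3 : 0 <= y ^+ 3 by rewrite exprn_ge0// ltW.
    have y4 : 0 <= y ^+ 4 by rewrite exprn_ge0// ltW.
    have y34 : y ^+ 3 <= y ^+ 4.
      rewrite [y ^+ 4]exprS; apply: ler_peMl => //.
      by apply: (le_trans _ hy); apply: (le_trans _ e5); rewrite ler1n.
    apply: (le_trans (lerD (ler_wpM2r y3 a1) (ler_wpM2r y4 a2))).
    move: y34 y4 y3; move: (y ^+ 3) (y ^+ 4) => c3 c4; clear; lra.
  have ypos : y `^ (k - 1) = y `^ (k - 5) * y ^+ 4.
    rewrite -powR_mulrn ?(ltW y0)// -powRD ?(gt_eqF y0) ?implybT//.
    by congr (_ `^ _); ring.
  have e1 : expR (4 * (k - 5)) <= y `^ (k - 5) by apply: powR_ge_expR4 => //; lra.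
  have qk : q <= expR k.
    apply: (@le_trans _ _ (1 + k)); last exact: expR_ge1Dx.
    have qq : q ^+ 2 = k by rewrite sqr_sqrtr// ltW.
    have := sqr_ge0 (q - 1); rewrite sqrrB qq -mulr_natl; lra.
  rewrite /T ypos ler_pdivlMr// [leRHS](_ : _ = y ^+ 4 * (y `^ (k - 5) * expR (- k))); last by ring.
  rewrite ler_wpM2l ?exprn_ge0 ?(ltW y0)//.
  apply: (le_trans qk); apply: (@le_trans _ _ (expR (4 * (k - 5)) * expR (- k))).
    by rewrite -expRD ler_expR; lra.
  by rewrite ler_wpM2r// expR_ge0.
rewrite -/p -/y1 -/q -/T.
apply: (@le_trans _ _ (2 * (1280 * T) + T)); last by move: T0; clear; lra.
by apply: lerD; [apply: ler_wpM2l; [lra|exact: main]|exact: cross].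
Qed.

End Stirling.

Lemma sqr_le_expR (R : realType) (x : R) : 0 <= x -> x ^+ 2 <= expR x.
Proof.
move=> x0; have h : x <= (1 + x / 4) ^+ 2 by have := sqr_ge0 (1 - x / 4); lra.
have e4 : expR x = expR (x / 4) ^+ 4.
  by rewrite -expRM_natl; congr expR; field.
rewrite e4 -[4%N]/(2 * 2)%N exprM; apply: lerXn2r; rewrite ?nnegrE ?sqr_ge0//.
apply: (le_trans h); apply: lerXn2r; rewrite ?nnegrE ?expR_ge0 ?expR_ge1Dx//.
by rewrite addr_ge0// divr_ge0.
Qed.

Lemma rowof_Um l (h : 'M[int]_2) : rowof (Um l * h) = rowof h.
Proof. by rewrite rowofM /rmul /rowof !mxE /=; congr (_, _); ring. Qed.

(** * Size of the Poincare series near its cusp, and unfolding of its norm *)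

Section PoincareNorm.
Variable R : realType.
Local Notation C := R[i].
Local Notation H := (@upper_half R).
Local Notation M2 := 'M[int]_2.
Local Notation mu := (@lebesgue_measure R).
Local Notation RM := (measurableTypeR R).
Local Notation Row := (int * int)%type.

Variables (G : set M2) (F : set C) (k : R) (nu : M2 -> C -> C).
Hypotheses (sG : is_subgroup G) (fG : finite_index G) (GN1 : G (-1)).
Hypotheses (anu : automorphy_factor G k nu) (fF : fundamental_domain G F) (k7 : 7 <= k).
Variables (t : M2) (n : nat) (eta : R).
Hypotheses (st : SL2Z t) (n0 : (0 < n)%N) (eta0 : 0 < eta).
Hypothesis hw : forall l : int, G (t * Um l * t^-1) <-> (n %| l)%Z.
Hypothesis hconj : forall z, H z ->
  conj_factor k nu t (Um n) z = cexp (0 +i* (2 * pi * eta)).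

Let gS := G_SL2Z sG.
Let stV := SL2ZV st.
Let tU := SL2Z_unit st.
Let k3 : 3 <= k. Proof. by apply: le_trans k7; rewrite ler_nat. Qed.
Local Notation A := (cuspA n eta).
Local Notation P := (poinc G k nu t n eta).
Local Notation ft := (ft G k nu t n eta).
Let A0 : 0 < A := cuspA_gt0 n0 eta0.

Lemma mobiusN1 z : mobius (-1) z = z :> C.
Proof. by rewrite /mobius /jfac !mxE /= !oppr0 addr0 mul0r add0r mulN1r invrN1 mulrN1 opprK. Qed.

Lemma slash_ft_pm1 d z : d = 1 \/ d = -1 -> H z -> slash k (ft (rowof (t^-1 * d))) t z = phi n eta z.
Proof.
move=> hd Hz; have Htz := mobius_upper st Hz.
have [Gd [m1 nu1']] : G d /\ mobius d (mobius t z) = mobius t z /\ nu d (mobius t z) = 1.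
  have n1 := nu1 sG anu Htz.
  case: hd => ->; first by rewrite mobius1; split=> //; exact: (G1 sG).
  rewrite mobiusN1; split=> //; split=> //; rewrite -[RHS]n1.
  by have [_ _ _ /(_ 1 _ (G1 sG) Htz)] := anu.
rewrite /slash (ftE sG anu st n0 hw hconj)// /tm m1 nu1' invr1 mul1r /psi mobiusK//.
by rewrite mulrA cpowN mulVf ?mul1r// cpow_neq0.
Qed.

Lemma rowofN (m : M2) : rowof (- m) = (- (rowof m).1, - (rowof m).2).
Proof. by rewrite /rowof !mxE. Qed.

(** The rows of t^-1 and -t^-1 are the only ones that become (0, 1) or (0, -1) under t; each
    contributes exactly [phi], whence the factor 2. *)
Lemma poinc_main (p c : R) z : H z -> 3 <= p -> 0 <= c ->
  (forall r, isrow G t r -> (rmul r t).1 != 0 ->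
    cabs (slash k (ft r) t z) <= c * cabs (rowfac (rmul r t) z) `^ (- p)) ->
  cabs (slash k P t z - 2 * phi n eta z) <=
    c * (16 * complex.Im z `^ (- p) + 32 * complex.Im z `^ (1 - p)).
Proof.
move=> Hz p3 c0 hb; pose r1 := rowof (t^-1 * 1); pose r2 := rowof (t^-1 * -1).
have rm d : rmul (rowof (t^-1 * d)) t = rowof (t^-1 * d * t) by rewrite -rowofM.
have e1 : rmul r1 t = (0, 1) by rewrite /r1 rm mulr1 mulVr// /rowof !mxE.
have e2 : rmul r2 t = (0, -1).
  by rewrite /r2 rm mulrN1 mulNr mulVr// rowofN /rowof !mxE /= oppr0.
have r12 : r1 != r2 by apply/eqP => e; move: e2; rewrite -e e1 => -[].
pose g r : C := if r \in [:: r1; r2] then phi n eta z else 0.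
have hg : has_sum g (2 * phi n eta z).
  have -> : 2 * phi n eta z = \sum_(r <- [:: r1; r2]) g r.
    by rewrite !big_cons big_nil /g !inE !eqxx orbT /= addr0; ring.
  apply: has_sum_finite; first by rewrite /= inE r12.
  by move=> r; rewrite /g => /negbTE ->.
have := has_sumD (slash_poinc sG anu k3 st n0 eta0 st Hz) (has_sumZ (-1) hg).
rewrite mulN1r => hS; apply: (has_sum_le hS) => s us.
apply: (le_trans (cabs_sum _ _ _)).
apply: le_trans (sum_offcusp (nu := nu) (eta := eta) (n := n) st Hz p3 c0 us hb).
rewrite [leRHS]big_mkcond /=; apply: ler_sum => r _.
have [ir|nir] := pselect (isrow G t r); last first.
  rewrite slash_ft0// cabs0 if_same add0r.
  have rn : r \notin [:: r1; r2].
    apply/negP; rewrite !inE => /orP[] /eqP e; apply: nir; rewrite e.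
      by exists 1; split=> //; exact: (G1 sG).
    by exists (-1).
  by rewrite /g (negbTE rn) mulr0 cabs0.
rewrite /g; case: ifPn => rin.
  rewrite (_ : slash _ _ _ _ = phi n eta z) ?mulN1r ?subrr ?cabs0; last first.
    by move: rin; rewrite !inE => /orP[] /eqP ->; apply: slash_ft_pm1 => //; [left|right].
  by case: ifP => // _; exact: cabs_ge0.
rewrite mulr0 addr0; case: ifPn => //; rewrite negbK => /eqP z0.
have := row0 sG st st ir z0; rewrite -{1}e1 -e2 !(can_eq (rmulK st)) => h.
by move: rin; rewrite !inE h.
Qed.

Lemma cabs_phi z : cabs (phi n eta z) = expR (- A * complex.Im z).
Proof. by rewrite /phi cabs_cexp ReM /= mul0r sub0r mulNr. Qed.

Let cft tau r z : SL2Z tau -> H z -> isrow G t r ->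
  cabs (slash k (ft r) tau z) = cabs (rowfac (rmul r tau) z) `^ (- k) *
    expR (- A * complex.Im z / cabs (rowfac (rmul r tau) z) ^+ 2).
Proof. by move=> *; apply: cabs_slash_ft. Qed.

Lemma poinc_ge z : H z -> 2 * expR (- A * complex.Im z) -
  (16 * complex.Im z `^ (- k) + 32 * complex.Im z `^ (1 - k)) <= cabs (slash k P t z).
Proof.
move=> Hz; have := @poinc_main k 1 z Hz k3 ler01; rewrite mul1r => h.
have {}h : cabs (slash k P t z - 2 * phi n eta z) <=
    16 * complex.Im z `^ (- k) + 32 * complex.Im z `^ (1 - k).
  apply: h => r ir _; rewrite mul1r cft// ler_piMr ?powR_ge0// -expR0 ler_expR.
  have y0 : 0 < complex.Im z by exact: Hz.
  by rewrite !mulNr oppr_le0 divr_ge0 ?sqr_ge0// mulr_ge0// ltW.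
have c2 : cabs (2 * phi n eta z) = 2 * expR (- A * complex.Im z).
  by rewrite cabsM cabs_phi (cabs_nat R 2).
rewrite -c2 lerBlDr; apply: (@le_trans _ _ (cabs (slash k P t z) + cabs (2 * phi n eta z - slash k P t z))).
  by apply: le_trans (cabsD _ _); rewrite addrC subrK.
by rewrite lerD2l -cabsN opprB.
Qed.

(** With x = A y / |c z + d|^2, the bound exp(-x) <= x^-2 trades the exponential for four powers of
    |c z + d|. Without it the rows with c <> 0 would leave y^-2 in the norm integral, which diverges
    at y = 0; with it the integrand there is a linear function times exp(-A y). The exponent k - 4
    >= 3 accounts for k >= 7. *)
Lemma poinc_le z : H z -> cabs (slash k P t z) <= 2 * expR (- A * complex.Im z) +
  A ^- 2 * complex.Im z ^- 2 * (16 * complex.Im z `^ (4 - k) + 32 * complex.Im z `^ (5 - k)).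
Proof.
move=> Hz; have y0 : 0 < complex.Im z by exact: Hz.
have c0 : 0 <= A ^- 2 * complex.Im z ^- 2.
  by rewrite mulr_ge0// invr_ge0 sqr_ge0.
have p3 : 3 <= k - 4 by rewrite lerBrDr; apply: le_trans k7; rewrite -natrD ler_nat.
have := @poinc_main (k - 4) _ z Hz p3 c0.
have -> : 1 - (k - 4) = 5 - k by ring.
have -> : - (k - 4) = 4 - k by ring.
move=> h; rewrite -[leLHS](subrK (cabs (2 * phi n eta z))) addrC.
rewrite cabsM cabs_phi (cabs_nat R 2) lerD2l; apply: le_trans (h _).
  rewrite lerBlDr -(cabs_nat R 2) -cabs_phi -cabsM.
  by apply: le_trans (cabsD _ _); rewrite subrK.
move=> r ir r0; rewrite cft//; set q := cabs _.
have q0 : 0 < q.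
  have [g [Gg er]] := ir.
  rewrite /q -er -rowofM -jfac_row; apply: cabs_jfac_gt0 => //.
  by apply: SL2ZM => //; apply: SL2ZM => //; exact: gS.
have -> : q `^ (4 - k) = q `^ (- k) * q ^+ 4.
  by rewrite addrC powRD ?(gt_eqF q0) ?implybT// powR_mulrn// ltW.
rewrite mulrCA ler_wpM2l ?powR_ge0//.
pose x := A * complex.Im z / q ^+ 2; have x0 : 0 < x by rewrite divr_gt0 ?exprn_gt0// mulr_gt0.
have -> : - A * complex.Im z / q ^+ 2 = - x by rewrite /x; ring.
have -> : A ^- 2 / complex.Im z ^+ 2 * q ^+ 4 = x ^- 2.
  by rewrite /x; field; rewrite !gt_eqF.
rewrite expRN lef_pV2 ?posrE ?exprn_gt0 ?expR_gt0//; exact: sqr_le_expR (ltW x0).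
Qed.

(** The invariant size |phi| y^(k/2), cut to one period of the translation by n. *)
Definition strip (w : C) : \bar R :=
  (ind 0 n%:R (complex.Re w) * (expR (- A * complex.Im w) * complex.Im w `^ (k / 2))%:E)%E.

Lemma strip_ge0 w : (0 <= strip w)%E.
Proof. by rewrite mule_ge0 ?ind_ge0// lee_fin mulr_ge0 ?expR_ge0 ?powR_ge0. Qed.

Lemma hmeas_strip : hmeas strip.
Proof.
apply: emeasurable_funM.
  by apply: (measurableT_comp (measurable_ind _ _)); exact: measurable_fst.
apply/measurable_EFinP; apply: measurable_funM.
  have := measurable_expRM (- A); move: (- A) => a ma; exact: (measurableT_comp ma measurable_snd).
by apply: (measurableT_comp (@measurable_powR R (k / 2))); exact: measurable_snd.
Qed.

(** The matrices of G with a given row differ by translations by multiples of n seen from the cusp,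
    so one of them brings z into the strip. *)
Lemma ft_strip r z : H z -> isrow G t r -> exists g, [/\ G g, rowof (t^-1 * g) = r &
  ((cabs (ft r z) * complex.Im z `^ (k / 2))%:E = strip (mobius t^-1 (mobius g z)))%E].
Proof.
move=> Hz ir; have [g [Gg er]] := ir; have sg := gS Gg.
pose u := mobius (t^-1 * g) z; pose q := - Num.floor (complex.Re u / n%:R).
pose l := q * n%:Z; have Gd : G (t * Um l * t^-1) by apply/hw; exact: dvdz_mull.
have sd := gS Gd; have su : SL2Z (t^-1 * g) by exact: SL2ZM.
have e : t^-1 * (t * Um l * t^-1 * g) = Um l * (t^-1 * g).
  by rewrite !mulrA mulVr// mul1r.
exists (t * Um l * t^-1 * g); split; first exact: (GM sG).
  by rewrite e -er rowof_Um.
have Hu : H u by exact: mobius_upper.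
have sU := SL2Z_Um l.
rewrite -(mobiusM stV _ Hz); last exact: SL2ZM.
rewrite e mobiusM// -/u mobius_Um /strip.
have n0' : 0 < n%:R :> R by rewrite ltr0n.
have lC : l%:~R = (l%:~R : R)%:C :> C by rewrite rmorph_int.
have -> : complex.Im (u + l%:~R) = complex.Im u by rewrite ImD lC addr0.
have -> : ind 0 n%:R (complex.Re (u + l%:~R)) = 1%E.
  rewrite indE ReD lC /= /l intrM -pmulrn.
  have /andP[f1 f2] := Num.Theory.floor_itv (complex.Re u / n%:R : R).
  move: f1 f2; rewrite ler_pdivlMr// ltr_pdivrMr// /q intrD mulr1z mulrDl mul1r => f1 f2.
  by rewrite intrN mulNr subr_ge0 f1 /= ltrBlDl f2.
rewrite mul1e; congr (_%:E).
have := cft SL2Z1 Hz ir; rewrite slash1 rmul1 => ->.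
have j0 := cabs_jfac_gt0 su Hz; rewrite -er -jfac_row.
have p0 : cabs (jfac (t^-1 * g) z) `^ k != 0 by rewrite gt_eqF// powR_gt0.
have := Im_mobius_powR (k / 2) su Hz; rewrite -/u => <-.
have Eu : - A * complex.Im z / cabs (jfac (t^-1 * g) z) ^+ 2 = - A * complex.Im u.
  by rewrite /u Im_mobius// mulrA.
rewrite Eu expr2 -powRD ?(gt_eqF j0) ?implybT//.
have -> : k / 2 + k / 2 = k by field.
by rewrite powRN; field.
Qed.

(** Distinct rows choose distinct matrices, so any finite sum of moduli of terms is part of the sum
    over G. The inverse matches the form of [unfold_ge]. *)
Lemma poinc_le_Gsum z : H z -> ((cabs (P z) * complex.Im z `^ (k / 2))%:E <=
  Gsum G (fun g => strip (mobius t^-1 (mobius g^-1 z))))%E.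
Proof.
move=> Hz; have y0 : 0 < complex.Im z `^ (k / 2) by rewrite powR_gt0.
set u := fun g : M2 => _; have u0 g : (0 <= u g)%E by exact: strip_ge0.
have /choice [gg hg] : forall r, exists g : M2, isrow G t r -> [/\ G g, rowof (t^-1 * g) = r &
    (cabs (ft r z) * complex.Im z `^ (k / 2))%:E = u g^-1].
  move=> r; have [ir|nir] := pselect (isrow G t r); last by exists 1.
  have [g [Gg er e]] := ft_strip Hz ir; exists g => _; split=> //.
  by rewrite e /u invrK.
have key s : uniq s ->
    (((\sum_(r <- s) cabs (ft r z)) * complex.Im z `^ (k / 2))%:E <= Gsum G u)%E.
  move=> us; pose p r := `[< isrow G t r >].
  pose s' := [seq (gg r)^-1 | r <- [seq r <- s | p r]].
  have us' : uniq s'.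
    rewrite map_inj_in_uniq ?filter_uniq// => r1 r2.
    rewrite !mem_filter => /andP[/asboolP /hg[_ e1 _] _] /andP[/asboolP /hg[_ e2 _] _] /invr_inj e.
    by rewrite -e1 -e2 e.
  have := @Gsum_ge_seq R G u s' u0 us'; rewrite big_map big_filter => h.
  apply: (le_trans _ (h _)); last first.
    move=> g /mapP[r]; rewrite mem_filter => /andP[/asboolP /hg[Gg _ _] _] ->.
    exact: (GV sG).
  rewrite (eq_bigr (fun r => (cabs (ft r z) * complex.Im z `^ (k / 2))%:E)); last first.
    by move=> r /asboolP /hg[].
  rewrite sumEFin lee_fin mulr_suml [leRHS]big_mkcond /=; apply: ler_sum => r _.
  rewrite /p; case: asboolP => // nir.
  by have := slash_ft0 k nu n eta 1 z nir; rewrite slash1 => ->; rewrite cabs0 mul0r.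
have S0 : (0 <= Gsum G u)%E by exact: Gsum_ge0.
move: key S0; case: (Gsum G u) => [b| |] key S0 //; last by rewrite leey.
rewrite lee_fin -ler_pdivlMr//; apply: (has_sum_le (poincP sG anu k3 st n0 eta0 Hz)) => s us.
apply: (le_trans (cabs_sum _ _ _)); rewrite ler_pdivlMr// -lee_fin.
exact: key.
Qed.

Let cfP : cusp_form G k nu P := poinc_cusp_form sG fG GN1 anu k3 st n0 eta0 hw hconj.

Definition amp (f : C -> C) z : R := cabs (hform f z) * complex.Im z `^ (k / 2).

Lemma amp_ge0 f z : 0 <= amp f z.
Proof. by rewrite mulr_ge0 ?cabs_ge0 ?powR_ge0. Qed.

Lemma absq_amp f z : absq k f z = ((amp f z)%:E * (amp f z)%:E)%E.
Proof.
have e : complex.Im z `^ k = complex.Im z `^ (k / 2) ^+ 2.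
  by rewrite -powR_mulrn ?powR_ge0// -powRrM divfK// pnatr_eq0.
by rewrite /absq /amp -EFinM e; congr (_%:E); ring.
Qed.

Lemma amp_mobius f g z : SL2Z g -> H z -> amp f (mobius g z) = amp (slash k f g) z.
Proof.
move=> sg Hz; apply/eqP; rewrite -(eqrXn2 (n := 2))// ?amp_ge0// -eqe !expr2 !EFinM -!absq_amp.
by rewrite absq_mobius.
Qed.

Lemma amp_G f g z : cusp_form G k nu f -> G g -> H z -> amp f (mobius g z) = amp f z.
Proof.
move=> cf Gg Hz; apply/eqP; rewrite -(eqrXn2 (n := 2))// ?amp_ge0// -eqe !expr2 !EFinM -!absq_amp.
by rewrite (absq_G sG anu cf).
Qed.

Lemma hmeas_amp f : cusp_form G k nu f -> hmeas (fun z => (amp f z)%:E).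
Proof.
move=> cf; apply/measurable_EFinP; apply: measurable_funM.
  exact: pmeas_cabs (pmeas_cusp_form cf).
by apply: (measurableT_comp (@measurable_powR R (k / 2))); exact: measurable_snd.
Qed.

(* |P|^2 is unfolded by bounding one factor by the sum of the moduli of its terms. *)
Lemma poinc_unfold : (hyp (fun z => indF F z * absq k P z) <=
  2%:R%:E * hyp (fun z => (amp P (mobius t z))%:E * strip z))%E.
Proof.
pose Psi z := ((amp P z)%:E * strip (mobius t^-1 z))%E.
have mst : hmeas (fun z => strip (mobius t^-1 z)) by apply: hmeas_mobius; exact: hmeas_strip.
have mPsi : hmeas Psi by apply: hmeasM => //; exact: hmeas_amp.
have Psi0 z : (0 <= Psi z)%E by rewrite mule_ge0 ?strip_ge0// lee_fin amp_ge0.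
have -> : hyp (fun z => (amp P (mobius t z))%:E * strip z)%E = hyp Psi.
  rewrite -(hyp_mobius st mPsi Psi0); apply: hyp_eq => z Hz.
  by rewrite /Psi mobiusK.
apply: le_trans (unfold_ge sG fF mPsi Psi0); apply: le_hyp.
- apply: hmeasM; [exact: hmeas_indF fF|apply: hmeas_absq; exact: pmeas_cusp_form cfP].
- apply: hmeasM; first exact: hmeas_indF fF.
  by apply: hmeas_Gsum; [move=> g Gg; exact: hmeas_mobius|move=> g z; exact: Psi0].
- by move=> z _; rewrite mule_ge0 ?indF_ge0 ?absq_ge0.
move=> z Hz; apply: lee_wpmul2l; first exact: indF_ge0.
rewrite (eq_Gsum (v := fun g => ((amp P z)%:E * strip (mobius t^-1 (mobius g^-1 z)))%E)); last first.
  by move=> g Gg; rewrite /Psi amp_G//; exact: (GV sG).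
rewrite -GsumZ ?lee_fin ?amp_ge0//; last by move=> g; exact: strip_ge0.
rewrite absq_amp; apply: lee_wpmul2l; first by rewrite lee_fin amp_ge0.
by rewrite /amp hform_upper//; exact: poinc_le_Gsum.
Qed.

(** Integration in x over the strip gives n. In the height, W1 is the square of the main term and W2
    the product of the main term with the rows c <> 0, in the form prepared by [poinc_le]. *)
Lemma poinc_norm (w : R) : 0 < w -> w = 512^-1 ->
  (hyp (fun z => (amp P (mobius t z))%:E * strip z) <=
   (n%:R * (2 * (((k - 2) / (2 * A)) `^ (k - 2) * expR (- (k - 2)) *
       (4 / (Num.sqrt ((k - 2) * w) / ((k - 2) / (2 * A))))) +
   A ^- 2 * ((32 + 224 / A) * (4 / A))))%:E)%E.
Proof.
move=> w0 wE.
pose W1 (v : R) : R := onpos (fun v => v `^ (k - 2) * expR (- (2 * A) * v)) v.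
pose W2 (v : R) : R := onpos (fun v => (16 + 32 * v) * expR (- A * v)) v.
pose W v := 2 * W1 v + A ^- 2 * W2 v.
have p1 : 1 <= k - 2 by rewrite lerBrDr; apply: le_trans k3; rewrite -(natrD R 1 2) ler_nat.
have A20 : 0 < 2 * A by rewrite mulr_gt0.
have I1 := integral_powexp w0 wE p1 A20.
have I2 := @integral_exp_lin R A A0.
have W10 v : 0 <= W1 v by rewrite /W1 /onpos; case: ifP => // _; rewrite mulr_ge0 ?powR_ge0 ?expR_ge0.
have W20 v : 0 <= W2 v.
  by rewrite /W2 /onpos; case: ifP => // v0; rewrite mulr_ge0 ?expR_ge0// addr_ge0// mulr_ge0// ltW.
have W0 v : 0 <= W v by rewrite addr_ge0// mulr_ge0// invr_ge0 sqr_ge0.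
have mW1 : measurable_fun [set: RM] W1.
  apply: measurable_onpos; apply: measurable_funM; [exact: measurable_powR|exact: measurable_expRM].
have mW2 : measurable_fun [set: RM] W2.
  apply: measurable_onpos; apply: measurable_funM; last exact: measurable_expRM.
  by apply: measurable_funD => //; exact: mulrl_measurable.
have mW : measurable_fun [set: RM] W.
  apply: measurable_funD; apply: measurable_funM => //.
pose maj z := (ind 0 n%:R (complex.Re z) * (W (complex.Im z) * complex.Im z ^+ 2)%:E)%E.
have mm : hmeas maj.
  apply: emeasurable_funM.
    by apply: (measurableT_comp (measurable_ind _ _)); exact: measurable_fst.
  apply/measurable_EFinP; apply: measurable_funM.
    exact: (measurableT_comp mW measurable_snd).
  by apply: measurable_funX; exact: measurable_snd.
have maj0 z : (0 <= maj z)%E.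
  by rewrite mule_ge0 ?ind_ge0// lee_fin mulr_ge0 ?sqr_ge0.
apply: (@le_trans _ _ (hyp maj)).
  apply: le_hyp => //.
  - apply: hmeasM; last exact: hmeas_strip.
    apply: (@hmeas_mobius _ (fun z => (amp P z)%:E)); exact: hmeas_amp.
  - by move=> z _; rewrite mule_ge0 ?strip_ge0// lee_fin amp_ge0.
  move=> z Hz; have y0 : 0 < complex.Im z by exact: Hz.
  rewrite muleCA; apply: lee_wpmul2l; first exact: ind_ge0.
  rewrite amp_mobius// -EFinM lee_fin /W /W1 /W2 /onpos y0 /amp hform_upper//.
  move: (poinc_le Hz); set a := cabs _; set y := complex.Im z in y0 *.
  set e := expR (- A * y) => h.
  have ee : expR (- (2 * A) * y) = e * e by rewrite /e -expRD; congr expR; ring.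
  have kk : y `^ (k / 2) * y `^ (k / 2) = y `^ (k - 2) * y ^+ 2.
    rewrite -powR_mulrn ?(ltW y0)// -!powRD ?(gt_eqF y0) ?implybT//.
    by congr (_ `^ _); field.
  have k4 : y `^ (4 - k) * y `^ (k - 2) = y ^+ 2.
    rewrite -powR_mulrn ?(ltW y0)// -!powRD ?(gt_eqF y0) ?implybT//.
    by congr (_ `^ _); ring.
  have k5 : y `^ (5 - k) * y `^ (k - 2) = y ^+ 3.
    rewrite -powR_mulrn ?(ltW y0)// -!powRD ?(gt_eqF y0) ?implybT//.
    by congr (_ `^ _); ring.
  have e0 : 0 <= e by exact: expR_ge0.
  have -> : a * y `^ (k / 2) * (e * y `^ (k / 2)) = a * (e * (y `^ (k / 2) * y `^ (k / 2))) by ring.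
  rewrite kk; apply: (le_trans (ler_wpM2r _ h)).
    by rewrite mulr_ge0// mulr_ge0 ?powR_ge0 ?sqr_ge0.
  rewrite ee le_eqVlt; apply/orP; left; apply/eqP.
  have y2 : y ^- 2 * y ^+ 2 = 1 by rewrite mulVf// expf_neq0// gt_eqF.
  transitivity (2 * (y `^ (k - 2) * (e * e)) * y ^+ 2 + A ^- 2 * (y ^- 2 * y ^+ 2) * e *
    (16 * (y `^ (4 - k) * y `^ (k - 2)) + 32 * (y `^ (5 - k) * y `^ (k - 2)))); first by ring.
  by rewrite y2 k4 k5; ring.
rewrite hyp_lines//.
have -> : (\int[mu]_y \int[mu]_x (maj (x +i* y) * (invpos y ^+ 2)%:E) =
    \int[mu]_y (n%:R%:E * (W y)%:E))%E.
  apply: eq_integral => y _.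
  rewrite (_ : (fun x => _) = (fun x => (W y)%:E * ind 0 n%:R x)%E); last first.
    apply/funext => x; rewrite /maj /= [RHS]muleC -muleA -EFinM.
    suff -> : W y * y ^+ 2 * invpos y ^+ 2 = W y by [].
    rewrite /W /W1 /W2 /onpos /invpos; case: ifP => y0; last by rewrite !mulr0 addr0 !mul0r.
    by rewrite -mulrA -exprMn mulfV ?expr1n ?mulr1// gt_eqF.
  rewrite ge0_integralZl//; last by rewrite lee_fin.
    by rewrite integral_ind ?ler0n// subr0 muleC.
  - exact: measurable_ind.
  - by move=> x _; exact: ind_ge0.
rewrite ge0_integralZl//; [|exact/measurable_EFinP|by move=> y _; rewrite lee_fin].
rewrite [in leRHS]EFinM; apply: lee_wpmul2l; first by rewrite lee_fin.
have -> : (\int[mu]_y (W y)%:E = 2%:E * \int[mu]_y (W1 y)%:E + (A ^- 2)%:E * \int[mu]_y (W2 y)%:E)%E.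
  rewrite -!ge0_integralZl//.
  - rewrite -ge0_integralD//.
    + by move=> y _; rewrite mule_ge0 ?lee_fin.
    + by apply: emeasurable_funM => //; exact/measurable_EFinP.
    + by move=> y _; rewrite mule_ge0 ?lee_fin// invr_ge0 sqr_ge0.
    + by apply: emeasurable_funM => //; exact/measurable_EFinP.
  - exact/measurable_EFinP.
  - by move=> y _; rewrite lee_fin.
  - by rewrite lee_fin invr_ge0 sqr_ge0.
  - exact/measurable_EFinP.
  - by move=> y _; rewrite lee_fin.
rewrite [leRHS]EFinD EFinM [X in (_ <= _ + X)%E]EFinM.
apply: leeD; apply: lee_wpmul2l => //.
by rewrite lee_fin invr_ge0 sqr_ge0.
Qed.
End PoincareNorm.

Section PoincareRatio.
Variable R : realType.
Local Notation C := R[i].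
Local Notation H := (@upper_half R).
Local Notation M2 := 'M[int]_2.

(** The ratio is taken at height y = k / (2 A) = n k / (4 pi eta). As A = 2 pi eta / n <= 8, the
    hypothesis on k makes y >= exp 4. In the condition on c, 2 comes from [poinc_unfold], 60 * 60
    from [poinc_norm_numeric] and 4 pi from y. *)
Lemma poinc_ratio (G : set M2) (F : set C) (k : R) (nu : M2 -> C -> C) (t : M2) (n : nat) (eta c : R) :
  is_subgroup G -> finite_index G -> G (-1) -> automorphy_factor G k nu ->
  fundamental_domain G F -> 16 * expR 4 <= k -> SL2Z t -> (0 < n)%N -> 0 < eta -> eta <= 1 ->
  (forall l : int, G (t * Um l * t^-1) <-> (n %| l)%Z) ->
  (forall z, H z -> conj_factor k nu t (Um n) z = cexp (0 +i* (2 * pi * eta))) ->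
  0 <= c -> c * (2 * (60 * 60) * (4 * pi)) <= 1 ->
  exists z, [/\ H z, (0 < absq k (poinc G k nu t n eta) z)%E &
    ((c * k `^ (3 / 2) / eta)%:E * hyp (fun z => indF F z * absq k (poinc G k nu t n eta) z) <=
     absq k (poinc G k nu t n eta) z)%E].
Proof.
move=> sG fG GN1 anu fF kb st n0 eta0 eta1 hw hconj c0 hc.
have k80 : 80 <= k.
  apply: le_trans kb; have -> : 80 = 16 * 5 :> R by rewrite -natrM.
  by rewrite ler_pM2l// expR4_ge5.
have k7 : 7 <= k by apply: le_trans k80; rewrite ler_nat.
have k0 : 0 < k by apply: lt_le_trans k7; rewrite ltr0n.
pose A := cuspA n eta; have A0 : 0 < A by exact: cuspA_gt0.
have n1 : 1 <= n%:R :> R by rewrite ler1n.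
have n0' : 0 < n%:R :> R by rewrite ltr0n.
have p0 : 0 < pi :> R := pi_gt0 R.
have A8 : A <= 8.
  rewrite /A /cuspA ler_pdivrMr//; have p4 : pi <= 4 :> R by have := @pihalf_lt2 R; rewrite ltr_pdivrMr// -natrM => /ltW.
  apply: (@le_trans _ _ (2 * 4 * 1)).
    by apply: ler_pM => //; [rewrite mulr_ge0// ltW|exact: ltW|rewrite ler_pM2l].
  by rewrite -natrM ler_pM2l// ltr0n.
pose y := k / (2 * A).
have hy : expR 4 <= y.
  have A20 : 0 < 2 * A by rewrite mulr_gt0.
  rewrite /y ler_pdivlMr//; apply: (@le_trans _ _ (16 * expR 4)); last exact: kb.
  rewrite [leRHS]mulrC ler_pM2l ?expR_gt0//.
  have -> : 16 = 2 * 8 :> R by rewrite -natrM.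
  by rewrite ler_pM2l.
have y0 : 0 < y by rewrite divr_gt0// mulr_gt0.
have AE : A = k / (2 * y) by rewrite /y; field; rewrite !gt_eqF.
have w0 : 0 < (512^-1 : R) by rewrite invr_gt0 ltr0n.
have nrm := poinc_norm sG fG GN1 anu k7 st n0 eta0 hw hconj w0 erefl.
have num := poinc_norm_numeric w0 erefl k80 A0 hy AE.
have unf := poinc_unfold sG fG GN1 anu fF k7 st n0 eta0 hw hconj.
pose P := poinc G k nu t n eta; rewrite -/P in nrm unf *.
pose q := Num.sqrt k; have q0 : 0 < q by rewrite sqrtr_gt0.
pose T := y `^ (k - 1) * expR (- k) / q.
have T0 : 0 < T by rewrite !mulr_gt0 ?powR_gt0 ?expR_gt0 ?invr_gt0.
have up : (hyp (fun z => indF F z * absq k P z) <= (2 * (n%:R * (60 * 60 * T)))%:E)%E.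
  apply: (le_trans unf); rewrite [leRHS]EFinM; apply: lee_wpmul2l; first by rewrite lee_fin.
  apply: (le_trans nrm); rewrite lee_fin; apply: ler_wpM2l; first exact: ltW.
  exact: num.
pose z : C := 0 +i* y; have Hz : H z by exact: y0.
have Htz := mobius_upper st Hz.
have low : ((y `^ k * expR (- k))%:E <= absq k P (mobius t z))%E.
  rewrite absq_mobius// /absq hform_upper// lee_fin mulrC ler_wpM2r ?powR_ge0//.
  have -> : - k = - k / 2 + - k / 2 by field.
  rewrite expRD expr2; have e0 := expR_ge0 (- k / 2).
  suff h : expR (- k / 2) <= cabs (slash k P t z) by apply: ler_pM.
  have := poinc_ge sG GN1 anu k7 st n0 eta0 hw hconj Hz; apply: le_trans.
  have := poinc_lower k80 hy; rewrite /=.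
  have -> : - cuspA n eta * y = - k / 2.
    by rewrite -/A AE; field; rewrite gt_eqF.
  lra.
have yk : y `^ k * expR (- k) = y * q * T.
  have -> : y `^ k = y `^ (k - 1) * y.
    rewrite -[X in _ * X](powRr1 (ltW y0)) -powRD ?(gt_eqF y0) ?implybT//.
    by rewrite subrK.
  by rewrite /T; field; rewrite gt_eqF.
exists (mobius t z); split => //.
  by apply: lt_le_trans low; rewrite lte_fin mulr_gt0 ?powR_gt0 ?expR_gt0.
apply: le_trans low; rewrite yk.
have c1 : 0 <= c * k `^ (3 / 2) / eta.
  by apply: divr_ge0; [apply: mulr_ge0 => //; exact: powR_ge0|exact: ltW].
apply: (le_trans (lee_wpmul2l _ up)); first by rewrite lee_fin.
rewrite -EFinM lee_fin.
have kq : k `^ (3 / 2) = k * q.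
  have -> : 3 / 2 = 1 + 1 / 2 :> R by field.
  by rewrite powRD ?(gt_eqF k0) ?implybT// powRr1 ?(ltW k0)// div1r powR12_sqrt// ltW.
have -> : c * k `^ (3 / 2) / eta * (2 * (n%:R * (60 * 60 * T))) =
    (c * (2 * (60 * 60) * (4 * pi))) * (k * q * n%:R * T / (4 * pi * eta)).
  rewrite kq; have := p0; generalize (pi : R) => p p0'; field.
  by rewrite !gt_eqF.
have -> : y * q * T = 1 * (k * q * n%:R * T / (4 * pi * eta)).
  rewrite /y /A /cuspA; have := p0; generalize (pi : R) => p p0'; field.
  by rewrite !gt_eqF.
have t1 : 0 < k * q * n%:R * T by apply: mulr_gt0 => //; apply: mulr_gt0 => //; exact: mulr_gt0.
have t2 : 0 < 4 * pi * eta by apply: mulr_gt0 => //; exact: mulr_gt0.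
by apply: ler_wpM2r => //; apply: ltW; exact: divr_gt0.
Qed.
End PoincareRatio.

(** * Orthonormal bases *)

Section Inner.
Variable R : realType.
Local Notation C := R[i].
Local Notation H := (@upper_half R).
Local Notation M2 := 'M[int]_2.
Local Notation RM := (measurableTypeR R).
Local Notation area := (@area R).

Variables (G : set M2) (F : set C) (k : R) (nu : M2 -> C -> C).
Hypotheses (fF : fundamental_domain G F).
Let D := plane F.
Let mD : measurable D. Proof. by have [] := fF. Qed.
Let FH p : D p -> 0 < p.2. Proof. by move=> Dp; have [h _ _ _] := fF; exact: (h _ Dp). Qed.

Definition wt (p : RM * RM) : R := p.2 `^ k * invpos p.2 ^+ 2.

(** The Petersson integrand extended by 0 off H, so that it is measurable on the whole plane. *)
Definition hh (f g : C -> C) (p : RM * RM) : C :=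
  hform f (p.1 +i* p.2) * conjc (hform g (p.1 +i* p.2)) * (wt p)%:C.

Lemma wt_ge0 p : 0 <= wt p.
Proof. by rewrite mulr_ge0 ?powR_ge0 ?sqr_ge0. Qed.

Lemma hhE f g p : D p -> f (p.1 +i* p.2) * conjc (g (p.1 +i* p.2)) *
  (complex.Im (p.1 +i* p.2) `^ k / complex.Im (p.1 +i* p.2) ^+ 2)%:C = hh f g p.
Proof.
move=> Dp; have y0 := FH Dp; rewrite /hh /hform /wt /invpos /= y0.
by rewrite exprVn.
Qed.

Lemma petersson_hh f g : petersson G F k f g = (SL2Z_index G)%:R^-1 *
  (fine (\int[area]_(p in D) (complex.Re (hh f g p))%:E) +i*
   fine (\int[area]_(p in D) (complex.Im (hh f g p))%:E)).
Proof.
rewrite /petersson /plane_integral /Rintegral; congr (_ * (fine _ +i* fine _)).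
  by apply: eq_integral => p /set_mem Dp; rewrite -hhE.
by apply: eq_integral => p /set_mem Dp; rewrite -hhE.
Qed.

Lemma Re_hh f p : complex.Re (hh f f p) = cabs (hform f (p.1 +i* p.2)) ^+ 2 * wt p.
Proof. by rewrite /hh mul_conj -[X in complex.Re X]/(_ * _) ReZ. Qed.

Lemma hyp_hh f : hyp (fun z => indF F z * absq k f z)%E =
  (\int[area]_(p in D) (complex.Re (hh f f p))%:E)%E.
Proof.
rewrite [RHS]integral_mkcond; apply: eq_integral => p _.
rewrite patchE /indF indicE; have -> : (p.1 +i* p.2 \in F) = (p \in D).
  by apply/idP/idP => /set_mem h; apply/mem_set.
case: ifP => _; last by rewrite !mul0e.
by rewrite mul1e Re_hh /absq /wt -EFinM mulrA.
Qed.

Lemma pmeas_hh f g : pmeas (fun p => hform f (p.1 +i* p.2)) ->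
  pmeas (fun p => hform g (p.1 +i* p.2)) -> pmeas (hh f g).
Proof.
move=> mf [g1 g2]; apply: pmeasM; last first.
  split; last exact: measurable_cst.
  apply: measurable_funM.
    exact: (measurableT_comp (@measurable_powR R k) measurable_snd).
  by apply: measurable_funX; exact: (measurableT_comp (@measurable_invpos R) measurable_snd).
apply: pmeasM => //; split.
  rewrite [X in measurable_fun _ X](_ : _ = (fun p => complex.Re (hform g (p.1 +i* p.2))))//.
  by apply/funext => p; case: (hform g _).
rewrite [X in measurable_fun _ X](_ : _ = (fun p => - complex.Im (hform g (p.1 +i* p.2)))).
  exact: measurableT_comp g2.
by apply/funext => p; case: (hform g _).
Qed.

Lemma cabs_hh f g p : cabs (hh f g p) <= complex.Re (hh f f p) + complex.Re (hh g g p).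
Proof.
rewrite !Re_hh /hh !cabsM cabs_conj cabs_real ger0_norm ?wt_ge0// -mulrDl.
apply: ler_wpM2r; first exact: wt_ge0.
move: (cabs _) (cabs _) (cabs_ge0 (hform f (p.1 +i* p.2))) (cabs_ge0 (hform g (p.1 +i* p.2))) => a b a0 b0.
by have := sqr_ge0 (a - b); have := mulr_ge0 a0 b0; lra.
Qed.

Variables (d : nat) (f : 'I_d -> C -> C).
Hypotheses (onb : orthonormal_basis G F k nu f).
Let mf i : pmeas (fun p => hform (f i) (p.1 +i* p.2)).
Proof. by have [cf _ _] := onb; exact: pmeas_cusp_form (cf i). Qed.
Local Notation m := ((SL2Z_index G)%:R : R).

Let fE i j : m != 0 ->
  fine (\int[area]_(p in D) (complex.Re (hh (f i) (f j) p))%:E) = m * (i == j)%:R /\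
  fine (\int[area]_(p in D) (complex.Im (hh (f i) (f j) p))%:E) = 0.
Proof.
move=> m0; have [_ /(_ i j) e _] := onb; move: e; rewrite petersson_hh.
set x := fine _; set y := fine _ => /(congr1 (fun z => m%:C * z)).
have -> : (SL2Z_index G)%:R = m%:C :> C by rewrite natrCE.
rewrite mulrA mulfV ?mul1r; last by rewrite eq_complex /= eqxx andbT.
move=> e; have ex := congr1 (@complex.Re R) e; have ey := congr1 (@complex.Im R) e.
move: ex ey; rewrite ReZ ImZ /=.
by case: (i == j) => /= -> ->; rewrite ?mulr0.
Qed.

(** With the inverse of 0 being 0, index 0 would make every [petersson] product 0, against norm
    1. *)
Lemma index_neq0 (i : 'I_d) : m != 0.
Proof.
have [_ /(_ i i) e _] := onb; apply/eqP => m0; move: e.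
rewrite /petersson eqxx; have -> : (SL2Z_index G)%:R = 0 :> C.
  by move: m0 => /eqP; rewrite pnatr_eq0 => /eqP ->.
by rewrite invr0 mul0r => /eqP; rewrite eq_sym oner_eq0.
Qed.

(** Square integrability is part of orthonormality: [fine] sends +oo to 0, while the integral has
    the nonzero value m. *)
Let intq i : area.-integrable D (fun p => (complex.Re (hh (f i) (f i) p))%:E).
Proof.
have m0 := index_neq0 i; have [e _] := fE i i m0; rewrite eqxx mulr1 in e.
apply/integrableP; split.
  apply: measurable_funTS; apply/measurable_EFinP; exact: (pmeas_hh (mf i) (mf i)).1.
have q0 p : 0 <= complex.Re (hh (f i) (f i) p) by rewrite Re_hh mulr_ge0 ?sqr_ge0 ?wt_ge0.
under eq_integral do rewrite gee0_abs ?lee_fin ?q0//.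
have : (0 <= \int[area]_(p in D) (complex.Re (hh (f i) (f i) p))%:E)%E.
  by apply: integral_ge0 => p _; rewrite lee_fin.
move: e; case: (\int[area]_(p in D) _)%E => [r| |] //= e _; first by rewrite ltry.
by move: m0; rewrite -e eqxx.
Qed.

Let intX i j (h : C -> R) : (forall z, `|h z| <= cabs z) ->
  measurable_fun [set: RM * RM] (fun p => h (hh (f i) (f j) p)) ->
  area.-integrable D (fun p => (h (hh (f i) (f j) p))%:E).
Proof.
move=> hb mh; apply: (@le_integrable _ _ _ area D mD _
  (fun p => (complex.Re (hh (f i) (f i) p))%:E + (complex.Re (hh (f j) (f j) p))%:E)%E).
- by apply: measurable_funTS; apply/measurable_EFinP.
- move=> p _; rewrite -EFinD !abse_EFin lee_fin.
  by apply: le_trans (ler_norm _); apply: le_trans (hb _) _; exact: cabs_hh.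
- exact: integrableD.
Qed.

(** Parseval's identity, with the factor m because [petersson] divides by the index. The square is
    expanded into finitely many real integrals, each integrable by [cabs_hh]. *)
Lemma hyp_sum (b : 'I_d -> C) g : (forall z, H z -> g z = \sum_(j < d) b j * f j z) ->
  hyp (fun z => indF F z * absq k g z)%E = (m * \sum_(j < d) cabs (b j) ^+ 2)%:E.
Proof.
move=> gE; rewrite hyp_hh.
(* For d = 0 no basis element is at hand to show m <> 0; both sides are then 0. *)
have [d0|[i0]] : d = 0%N \/ inhabited 'I_d.
  by case: (posnP d) => [->|d0]; [left|right; exact: inhabits (Ordinal d0)].
  rewrite integral0_eq.
    by rewrite big1 ?mulr0// => i; move: (ltn_ord i); rewrite {2}d0.
  move=> p Dp; rewrite Re_hh /hform FH// gE; last exact: (FH Dp).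
  by rewrite big1 ?cabs0 ?expr0n ?mul0r// => i; move: (ltn_ord i); rewrite {2}d0.
have m0 := index_neq0 i0.
pose c (ij : 'I_d * 'I_d) := b ij.1 * conjc (b ij.2).
pose X (ij : 'I_d * 'I_d) p := complex.Re (hh (f ij.1) (f ij.2) p).
pose Y (ij : 'I_d * 'I_d) p := complex.Im (hh (f ij.1) (f ij.2) p).
pose u (ij : 'I_d * 'I_d) p :=
  ((complex.Re (c ij))%:E * (X ij p)%:E + (- complex.Im (c ij))%:E * (Y ij p)%:E)%E.
have iX ij : area.-integrable D (fun p => (X ij p)%:E).
  exact: (@intX ij.1 ij.2 (@complex.Re R) (@Re_le_cabs R) (pmeas_hh (mf _) (mf _)).1).
have iY ij : area.-integrable D (fun p => (Y ij p)%:E).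
  exact: (@intX ij.1 ij.2 (@complex.Im R) (@Im_le_cabs R) (pmeas_hh (mf _) (mf _)).2).
have iu ij : area.-integrable D (u ij).
  by apply: integrableD => //; apply: integrableZl.
have -> : (\int[area]_(p in D) (complex.Re (hh g g p))%:E = \int[area]_(p in D) (\sum_ij u ij p))%E.
  apply: eq_integral => p /set_mem Dp; have y0 := FH Dp.
  rewrite /u; under eq_bigr do rewrite -!EFinM -EFinD.
  rewrite sumEFin; congr (_%:E).
  rewrite (eq_bigr (fun ij => complex.Re (c ij * hh (f ij.1) (f ij.2) p))); last first.
    by move=> ij _; rewrite ReM mulNr.
  rewrite -Re_sum; congr (complex.Re _).
  rewrite -(pair_bigA _ (fun i j => b i * conjc (b j) * hh (f i) (f j) p)) /=.
  rewrite /hh /hform /= y0 gE; last exact: y0.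
  rewrite rmorph_sum big_distrlr /= mulr_suml; apply: eq_bigr => i _.
  rewrite mulr_suml; apply: eq_bigr => j _.
  by rewrite rmorphM; ring.
rewrite integral_sum//.
have Iu ij : (\int[area]_(p in D) u ij p = (complex.Re (c ij) * (m * (ij.1 == ij.2)%:R))%:E)%E.
  have [e1 e2] := fE ij.1 ij.2 m0.
  rewrite integralD//; [|exact: integrableZl|exact: integrableZl].
  rewrite !integralZl//.
  rewrite -(fineK (integrable_fin_num mD (iX ij))) -(fineK (integrable_fin_num mD (iY ij))).
  by rewrite e1 e2 mule0 adde0 EFinM.
under eq_bigr do rewrite Iu.
rewrite sumEFin; congr (_%:E).
rewrite -(pair_bigA _ (fun i j => complex.Re (b i * conjc (b j)) * (m * (i == j)%:R))) /=.
rewrite mulr_sumr; apply: eq_bigr => i _.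
rewrite (bigD1 i)//= eqxx big1 ?addr0 => [|j /negbTE]; last by rewrite eq_sym => ->; rewrite !mulr0.
by rewrite mul_conj mulr1 mulrC.
Qed.

End Inner.

(** * Linear combinations of cusp forms *)

Section CuspFormLinear.
Variable R : realType.
Local Notation C := R[i].
Local Notation H := (@upper_half R).
Local Notation M2 := 'M[int]_2.
Variables (G : set M2) (k : R) (nu : M2 -> C -> C).

Lemma cvgC_linear (a : C) (u v : nat -> C) (l m : C) :
  (u : nat -> C^o) @ \oo --> (l : C^o) -> (v : nat -> C^o) @ \oo --> (m : C^o) ->
  ((fun n => a * u n + v n) : nat -> C^o) @ \oo --> (a * l + m : C^o).
Proof.
move=> /cvgC_eps hu /cvgC_eps hv; apply/cvgC_eps => e e0.
have a0 : 0 < cabs a + 1 by rewrite ltr_wpDl// cabs_ge0.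
have e2 : 0 < e / 2 by rewrite divr_gt0.
have [N1 h1] := hu _ (divr_gt0 e2 a0); have [N2 h2] := hv _ e2.
exists (maxn N1 N2) => n; rewrite geq_max => /andP[n1 n2].
have -> : a * l + m - (a * u n + v n) = a * (l - u n) + (m - v n) by ring.
apply: (le_trans (cabsD _ _)); rewrite [e](splitr e); apply: lerD; last exact: h2.
rewrite cabsM; apply: (@le_trans _ _ ((cabs a + 1) * (e / 2 / (cabs a + 1)))).
  by apply: ler_pM; rewrite ?cabs_ge0 ?h1// lerDl.
by rewrite mulrC divfK// gt_eqF.
Qed.

Lemma cusp_formZD (a : C) f g : cusp_form G k nu f -> cusp_form G k nu g ->
  cusp_form G k nu (fun z => a * f z + g z).
Proof.
move=> [hf af ef] [hg ag eg]; split.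
- exact: (holoD (holoM (@holo_cst R a) hf) hg).
- by move=> h z Gh Hz; rewrite af// ag//; ring.
move=> t st; have [b hb] := ef t st; have [c hc] := eg t st.
exists (fun m => a * b m + c m) => z Hz.
have -> : slash k (fun z => a * f z + g z) t z = a * slash k f t z + slash k g t z.
  by rewrite /slash; ring.
have -> : series (cusp_term G k nu t (fun m => a * b m + c m) z : nat -> C^o) =
    (fun n => a * series (cusp_term G k nu t b z : nat -> C^o) n +
      series (cusp_term G k nu t c z : nat -> C^o) n).
  apply/funext => n; rewrite /series /= mulr_sumr -big_split /=; apply: eq_bigr => m _.
  rewrite /cusp_term; case: ifP => _; last by rewrite mulr0 addr0.
  by rewrite mulrDl mulrA.
exact: cvgC_linear (hb z Hz) (hc z Hz).
Qed.

Lemma cusp_form0 : cusp_form G k nu (fun=> 0).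
Proof.
split; first exact: holo_cst; first by move=> *; rewrite mulr0.
move=> t st; exists (fun=> 0) => z Hz; rewrite /slash mulr0.
have -> : series (cusp_term G k nu t (fun=> 0) z : nat -> C^o) = fun=> 0.
  by apply/funext => n; rewrite /series /= big1// => m _; rewrite /cusp_term mul0r if_same.
exact: cvg_cst.
Qed.

Lemma cusp_form_sum (I : Type) (s : seq I) (b : I -> C) (f : I -> C -> C) :
  (forall i, cusp_form G k nu (f i)) -> cusp_form G k nu (fun z => \sum_(i <- s) b i * f i z).
Proof.
move=> cf; elim: s => [|i s ih].
  rewrite [X in cusp_form _ _ _ X](_ : _ = fun=> 0); first exact: cusp_form0.
  by apply/funext => z; rewrite big_nil.
rewrite [X in cusp_form _ _ _ X](_ : _ = fun z => b i * f i z + \sum_(j <- s) b j * f j z).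
  exact: (cusp_formZD (b i) (cf i) ih).
by apply/funext => z; rewrite big_cons.
Qed.

(** Replacing kappa = 0 by eta = 1 does not change the phase, so exp(2 pi i eta z / n) transforms
    correctly and yet vanishes at the cusp. *)
Lemma cexp_eta_cusp t : cexp (0 +i* (2 * pi * eta_cusp G k nu t)) =
  cexp (0 +i* (2 * pi * cusp_param G k nu t)) :> C.
Proof.
rewrite /eta_cusp; move: (cusp_param G k nu t) => kap; case: eqP => [->|//].
exact: (etrans (cexp_2pi_int R 1) (esym (cexp_2pi_int R 0))).
Qed.

Lemma ler_sup_norm (d : nat) (f : 'I_d -> C -> C) z : H z ->
  ((\sum_(j < d) complex.Im z `^ k * cabs (f j z) ^+ 2)%:E <= sup_norm k f)%E.
Proof. by move=> Hz; apply: ereal_sup_ubound; exists z. Qed.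

Lemma cauchy_schwarz_C (d : nat) (a b : 'I_d -> C) :
  cabs (\sum_(j < d) a j * b j) ^+ 2 <= (\sum_(j < d) cabs (a j) ^+ 2) * (\sum_(j < d) cabs (b j) ^+ 2).
Proof.
apply: le_trans (cauchy_schwarz_sum _ (fun j => cabs (a j)) (fun j => cabs (b j))).
rewrite ler_sqr ?nnegrE ?cabs_ge0//; last by apply: sumr_ge0 => j _; rewrite mulr_ge0 ?cabs_ge0.
by apply: (le_trans (cabs_sum _ _ _)); apply: ler_sum => j _; rewrite cabsM.
Qed.

End CuspFormLinear.

(** * The two bounds for the supremum *)

Section Bounds.
Variable R : realType.
Local Notation C := R[i].
Local Notation H := (@upper_half R).
Local Notation M2 := 'M[int]_2.
Variables (G : set M2) (F : set C) (k : R) (nu : M2 -> C -> C) (d : nat) (f : 'I_d -> C -> C).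
Hypotheses (sG : is_subgroup G) (fG : finite_index G) (GN1 : G (-1)).
Hypotheses (anu : automorphy_factor G k nu) (fF : fundamental_domain G F).
Hypotheses (onb : orthonormal_basis G F k nu f).
Local Notation m := ((SL2Z_index G)%:R : R).

(* Apply [upper_bound] at z to the reproducing form w |-> sum_j conj(f_j(z)) f_j(w). *)
Lemma sup_norm_le (eta K : R) : 720 * 90 <= K -> 8 <= k -> 0 < eta ->
  (forall t, SL2Z t -> eta <= eta_cusp G k nu t) ->
  (sup_norm k f <= (K * (m * k `^ (3 / 2) / eta))%:E)%E.
Proof.
move=> hK k8 eta0 heta; apply: ge_ereal_sup => _ [z Hz <-].
have [cf _ _] := onb; rewrite lee_fin -mulr_sumr.
set B := \sum_j _.
pose b j := conjc (f j z); pose g w : C := \sum_(j < d) b j * f j w.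
have cg : cusp_form G k nu g by exact: cusp_form_sum.
have gz : g z = B%:C.
  rewrite /g /B rmorph_sum; apply: eq_bigr => j _.
  by rewrite mulrC mul_conj.
have B0 : 0 <= B by apply: sumr_ge0 => j _; exact: sqr_ge0.
have := upper_bound sG fG GN1 anu fF hK cg k8 Hz eta0 heta.
rewrite (hyp_sum fF onb (b := b))// -EFinM lee_fin gz cabs_real ger0_norm//.
have -> : \sum_(j < d) cabs (b j) ^+ 2 = B by apply: eq_bigr => j _; rewrite cabs_conj.
have -> : K * k `^ (3 / 2) / eta * (m * B) = K * (m * k `^ (3 / 2) / eta) * B by ring.
have X0 : 0 <= K * (m * k `^ (3 / 2) / eta).
  have K0 : 0 <= K by lra.
  apply: mulr_ge0 => //; apply: divr_ge0; last exact: ltW.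
  by rewrite mulr_ge0 ?powR_ge0.
move: (K * (m * _ / _)) X0 => X; move: B0; rewrite le_eqVlt => /orP[/eqP <- X0 _|B0 X0 h].
  by rewrite mulr0.
rewrite -(ler_pM2r B0); apply: le_trans h.
by rewrite le_eqVlt; apply/orP; left; apply/eqP; ring.
Qed.

(** In P = sum_j a_j f_j the sum S of the |a_j|^2 enters on both sides: m S is the integral in
    [poinc_ratio] by [hyp_sum], which is how the index appears, and S is a factor in the
    Cauchy-Schwarz inequality. It is positive since P does not vanish at z, so it cancels. *)
Lemma sup_norm_ge (c : R) t : 16 * expR 4 <= k -> 0 <= c -> c * (2 * (60 * 60) * (4 * pi)) <= 1 ->
  SL2Z t -> ((c * (m * k `^ (3 / 2) / eta_cusp G k nu t))%:E <= sup_norm k f)%E.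
Proof.
move=> kb c0 hc st; have [n0 hw] := cusp_widthP sG fG GN1 st.
have /andP[eta0 eta1] := eta_cusp_gt0 sG fG GN1 anu st.
have [_ hk] := cusp_paramP sG fG GN1 anu st.
have hconj z : H z -> conj_factor k nu t (Um (cusp_width G t)) z =
    cexp (0 +i* (2 * pi * eta_cusp G k nu t)).
  by move=> Hz; rewrite cexp_eta_cusp (hk z Hz) UmxE.
move: hconj eta0 eta1 n0 hw {hk}; move: (eta_cusp G k nu t) (cusp_width G t) => eta n.
move=> hconj eta0 eta1 n0 hw.
have [z [Hz P0 hP]] := poinc_ratio sG fG GN1 anu fF kb st n0 eta0 eta1 hw hconj c0 hc.
apply: le_trans (ler_sup_norm k f Hz); move: P0 hP.
have k3 : 3 <= k.
  apply: le_trans kb; have := expR4_ge5 R; lra.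
have cP := poinc_cusp_form sG fG GN1 anu k3 st n0 eta0 hw hconj.
move: (poinc _ _ _ _ _ _) cP => P cP.
have [_ _ /(_ P cP) [a hPa]] := onb.
rewrite (hyp_sum fF onb hPa) /absq hform_upper// -EFinM !lee_fin lte_fin hPa// => P0 hP.
set S := \sum_j _ in hP; set Y := complex.Im z `^ k in P0 hP *.
have Y0 : 0 <= Y by exact: powR_ge0.
have cs := cauchy_schwarz_C a (fun j => f j z); rewrite -/S in cs.
set V := \sum_j _ ^+ 2 in cs.
rewrite -mulr_sumr -/V.
have S0 : 0 < S.
  have S0' : 0 <= S by apply: sumr_ge0 => j _; exact: sqr_ge0.
  rewrite lt_neqAle S0' andbT eq_sym; apply/eqP => S0; move: cs P0; rewrite S0 mul0r => cs.
  by move=> P0; have := lt_le_trans P0 (mulr_le0_ge0 cs Y0); rewrite ltxx.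
rewrite -(ler_pM2l S0); apply: (@le_trans _ _ (cabs (\sum_(j < d) a j * f j z) ^+ 2 * Y)).
  by apply: le_trans hP; rewrite le_eqVlt; apply/orP; left; apply/eqP; ring.
by rewrite [Y * V]mulrC mulrA; apply: ler_wpM2r.
Qed.

End Bounds.

Theorem theorem1p3 (R : realType) :
  exists k0 : R, forall delta C : R, 0 < delta -> 0 < C ->
  exists c1 c2 : R, 0 < c1 /\ 0 < c2 /\
  forall (G : set 'M[int]_2) (k : R) (nu : 'M[int]_2 -> R[i] -> R[i]),
    is_subgroup G -> finite_index G -> G (- 1) ->
    k0 <= k ->
    automorphy_factor G k nu ->
    (SL2Z_index G)%:R <= C * k `^ (1 - delta) ->
  forall (F : set R[i]) (d : nat) (f : 'I_d -> R[i] -> R[i]),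
    fundamental_domain G F ->
    orthonormal_basis G F k nu f ->
  exists tau0 : 'M[int]_2,
    SL2Z tau0 /\
    (forall tau, SL2Z tau -> eta_cusp G k nu tau0 <= eta_cusp G k nu tau) /\
    let X := (SL2Z_index G)%:R * k `^ (3 / 2) / eta_cusp G k nu tau0 in
    ((c1 * X)%:E <= sup_norm k f)%E /\ (sup_norm k f <= (c2 * X)%:E)%E.
Proof.
(* The threshold of [poinc_ratio]. It exceeds the 8 that [upper_bound] asks for; c1 is the largest
   constant that [sup_norm_ge] admits. *)
exists (16 * expR 4) => delta C _ _; pose c1 : R := (2 * (60 * 60) * (4 * pi))^-1.
have p0 : 0 < 2 * (60 * 60) * (4 * pi) :> R by rewrite !mulr_gt0// pi_gt0.
have K0 : 0 < 720 * 90 :> R by lra.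
exists c1, (720 * 90); split; first by rewrite invr_gt0.
split=> // G k nu sG fG GN1 kb anu _ F d f fF onb.
have [t0 st0 tmin] := eta_cusp_min sG fG GN1 anu.
have /andP[eta0 _] := eta_cusp_gt0 sG fG GN1 anu st0.
exists t0; split=> //; split=> //=; split.
  apply: (sup_norm_ge sG fG GN1 anu fF onb kb _ _ st0); first by rewrite invr_ge0 ltW.
  by rewrite mulVf// gt_eqF.
apply: (sup_norm_le sG fG GN1 anu fF onb (lexx _) _ eta0 tmin).
by apply: le_trans kb; have := expR4_ge5 R; lra.
Qed.
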